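(* A $6$-dimensional nilmanifold, with associated nilpotent Lie algebra $\mathfrak{g}$, does not admit left-invariant generalized complex structures of type $2$ if and only if one of the following holds: (a) it has maximal nilpotency index (i.e. $\dim V_1=2$ and $\dim V_i/V_{i-1}=1$ for $1<i\le \mathrm{nil}(\mathfrak{g})$; so $\mathrm{nil}(\mathfrak{g})=5$); (b) $\mathfrak{g}$ is of the form $(0,0,0,12,14,-)$ (the last entry being arbitrary) and has nilpotency index $4$; (c) $\mathfrak{g}$ is isomorphic to $(0,0,0,12,14,13-24)$ or $(0,0,0,12,14,23+24)$; (d) $\mathfrak{g}$ is isomorphic to $(0,0,12,13,23,14)$ or $(0,0,12,13,23,14-25)$.
   Context: A nilmanifold is a quotient $M=\Gamma\backslash G$ of a connected, simply-connected nilpotent real Lie group $G$ (Lie algebra $\mathfrak{g}$) by a maximal lattice (discrete cocompact subgroup). With $\mathfrak{g}^0=\mathfrak{g}$, $\mathfrak{g}^k=[\mathfrak{g}^{k-1},\mathfrak{g}]$, the nilpotency index $\mathrm{nil}(\mathfrak{g})$ is the smallest $s$ with $\mathfrak{g}^s=0$, and $V_i\subset\mathfrak{g}^*$ is the annihilator of $\mathfrak{g}^i$. Notation: a $6$-tuple such as $(0,0,0,12,13,14+35)$ denotes the Lie algebra whose dual has a basis $e_1,\dots,e_6$ with Chevalley–Eilenberg differential $de_1=de_2=de_3=0$, $de_4=e_1\wedge e_2$, $de_5=e_1\wedge e_3$, $de_6=e_1\wedge e_4+e_3\wedge e_5$ (so $ij$ stands for $e_i\wedge e_j$). A generalized complex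 structure on $M^{2n}$ is an endomorphism $\mathcal{J}$ of $TM\oplus T^*M$, orthogonal for $\langle X+\xi,Y+\eta\rangle=\frac12(\xi(Y)+\eta(X))$, with $\mathcal{J}^2=-\mathrm{Id}$ and $+i$-eigenbundle $L$ closed under the Courant bracket $[X+\xi,Y+\eta]=[X,Y]+X\lfloor d\eta-Y\lfloor d\xi+\frac12d(X\lfloor\eta-Y\lfloor\xi)$. Forms annihilated pointwise by $L$ (under $(X+\xi)\cdot\rho=X\lfloor\rho+\xi\wedge\rho$) form a complex line generated by some $e^{B+i\omega}\Omega$, with $B,\omega$ real $2$-forms and $\Omega$ decomposable complex; the degree of $\Omega$ is the type. A structure on $\Gamma\backslash G$ is left-invariant if it descends from a left-invariant structure on $G$. *)

(* Defs.v *)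
From HB Require Import structures.
From mathcomp Require Import all_boot all_order all_algebra.
From mathcomp Require Import complex.
From mathcomp Require Import all_classical all_reals all_analysis.

Set Implicit Arguments.
Unset Strict Implicit.
Unset Printing Implicit Defensive.

Import Order.TTheory GRing.Theory Num.Theory.
Import numFieldNormedType.Exports.

Local Open Scope ring_scope.

(** Elements of the exterior algebra of the dual of K^n are given by their
    coordinates on the monomials e^{i_1} /\ .. /\ e^{i_k}, i_1 < .. < i_k,
    indexed by the sets {i_1, .., i_k}.  Vectors and covectors are row
    vectors, in dual bases. *)

Definition form (K : comNzRingType) (n : nat) := {ffun {set 'I_n} -> K^o}.

Section Exterior.
Variable n : nat.

Section Ring.
Variable K : comNzRingType.
Implicit Types (a b : form K n) (v : 'rV[K]_n).

Definition monomial (S : {set 'I_n}) : form K n := [ffun T => (T == S)%:R].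

(* e^S /\ e^T = shuffle_sign S T *: e^(S :|: T) for disjoint S and T *)
Definition shuffle_sign (S T : {set 'I_n}) : K :=
  (-1) ^+ #|[set p : 'I_n * 'I_n | [&& p.1 \in S, p.2 \in T & (p.2 < p.1)%N]]%SET|.

Definition wedge a b : form K n :=
  [ffun U : {set 'I_n} => \sum_(S : {set 'I_n} | S \subset U)
     shuffle_sign S (U :\: S)%SET * (a S * b (U :\: S)%SET)].

Definition oneform v : form K n := \sum_(k < n) v 0 k *: monomial [set k]%SET.

Definition twoform (F : 'I_n -> 'I_n -> K) : form K n :=
  \sum_(j < n) \sum_(k < n | (j < k)%N) F j k *: monomial [set j; k]%SET.

Definition contract v a : form K n :=
  [ffun S : {set 'I_n} => \sum_(k | k \notin S)
     v 0 k * (shuffle_sign [set k]%SET S * a (k |: S)%SET)].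

Definition homogeneous (d : nat) a := forall S : {set 'I_n}, #|S| != d -> a S = 0.

Definition dot (u v : 'rV[K]_n) : K := (u *m v^T) 0 0.

(* Clifford action of X + xi, encoded as row_mx X xi *)
Definition clifford (v : 'rV[K]_(n + n)) a : form K n :=
  contract (lsubmx v) a + wedge (oneform (rsubmx v)) a.

End Ring.

(* Powers of exponent > n vanish for forms of positive degree. *)
Definition form_exp (K : fieldType) (a : form K n) : form K n :=
  \sum_(j < n.+1) (j`!%:R)^-1 *: iter j (wedge a) (monomial K finset.set0).

Definition pairing (K : fieldType) (u v : 'rV[K]_(n + n)) : K :=
  2^-1 * (dot (rsubmx u) (lsubmx v) + dot (rsubmx v) (lsubmx u)).

End Exterior.

Section LieAlgebra.
Variables (R : realType) (n : nat).
Local Notation V := 'rV[R]_n.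

Record lie_algebra := LieAlgebra {
  bracket :> V -> V -> V;
  bracket_linearl : forall a x y z,
    bracket (a *: x + y) z = a *: bracket x z + bracket y z;
  bracket_linearr : forall a x y z,
    bracket z (a *: x + y) = a *: bracket z x + bracket z y;
  bracket_alt : forall x, bracket x x = 0;
  bracket_jacobi : forall x y z,
    bracket x (bracket y z) + bracket y (bracket z x)
    + bracket z (bracket x y) = 0 }.

Variable g : lie_algebra.

Definition basis_vec (k : 'I_n) : V := delta_mx 0 k.

Fixpoint lower_central (k : nat) : {vspace V} :=
  if k is k'.+1 then
    <<[seq g x y | x <- vbasis (lower_central k'), y <- vbasis fullv]>>%VS
  else fullv.

Definition nilpotent_lie := exists s, lower_central s == 0%VS.

Definition nil_index (gnil : nilpotent_lie) : nat := ex_minn gnil.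

(* V_i, as a space of covectors: eta *m x^T is the value of eta at x. *)
Definition ann_lower_central (i : nat) : {vspace V} :=
  (\bigcap_(x <- vbasis (lower_central i)) lker (linfun (mulmxr x^T)))%VS.

Definition maximal_nilpotency (gnil : nilpotent_lie) :=
  \dim (ann_lower_central 1) = 2%N /\
  forall i, (1 < i <= nil_index gnil)%N ->
    \dim (ann_lower_central i) = (\dim (ann_lower_central i.-1)).+1.

(* d eta (x, y) = - eta [x, y] *)
Definition chevalley_d (eta : V) : form R n :=
  twoform (fun j k => - dot eta (g (basis_vec j) (basis_vec k))).

(* An integer with decimal digits ij stands for e_i /\ e_j (indices starting
   from 1), and its opposite for - e_i /\ e_j. *)
Definition ij_form (e : seq V) (z : int) : form R n :=
  (sgz z)%:~R *: wedge (oneform e`_((`|z| %/ 10)%N.-1))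
                       (oneform e`_((`|z| %% 10)%N.-1)).

(* (0,0,0,12,14,13-24) is written
   [:: [::]; [::]; [::]; [:: 12]; [:: 14]; [:: 13; -24]].
   If the list has fewer than n entries, the missing ones are arbitrary. *)
Definition of_the_form (l : seq (seq int)) :=
  exists2 e : n.-tuple V, basis_of fullv e &
    forall k, (k < size l)%N ->
      chevalley_d e`_k = \sum_(z <- nth [::] l k) ij_form e z.

(** The simply connected group of a nilpotent Lie algebra is the space V
    with the Baker-Campbell-Hausdorff product, the exponential map being the
    identity.  The unit is 0, the inverse of x
    is - x. *)

(* [x_1, [x_2, .. [x_{m-1}, x_m] ..]] *)
Fixpoint iterated_bracket (x : V) (w : seq V) : V :=
  if w is y :: w' then g x (iterated_bracket y w') else x.

Definition word_bracket (w : seq V) : V :=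
  if w is x :: w' then iterated_bracket x w' else 0.

(* x^{r_1} y^{s_1} .. x^{r_k} y^{s_k}, with f i = (r_i, s_i) *)
Definition dynkin_word (x y : V) k (f : 'I_k -> 'I_n.+1 * 'I_n.+1) : seq V :=
  flatten [seq nseq (f i).1 x ++ nseq (f i).2 y | i <- enum 'I_k].

(* Dynkin's formula for log (exp x exp y).  When g is nilpotent, brackets of
   words of length > n vanish, so that the sum may be restricted to k <= n
   and r_i, s_i <= n; here k is written k.+1. *)
Definition bch (x y : V) : V :=
  \sum_(k < n)
    ((-1) ^+ k / k.+1%:R) *:
    \sum_(f : {ffun 'I_k.+1 -> 'I_n.+1 * 'I_n.+1}
            | [forall i, 0 < (f i).1 + (f i).2]%N)
      ((size (dynkin_word x y f))%:R
        * \prod_i (((f i).1)`!%:R * ((f i).2)`!%:R))^-1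
      *: word_bracket (dynkin_word x y f).

Definition lattice (Gamma : set V) :=
  [/\ Gamma 0,
      forall x y, Gamma x -> Gamma y -> Gamma (bch x y),
      forall x, Gamma x -> Gamma (- x),
      forall x, Gamma x -> \forall y \near x, Gamma y -> y = x &
      exists2 K : set V, compact K &
        forall x, exists c y, [/\ Gamma c, K y & x = bch c y]].

End LieAlgebra.

Record nilmanifold (R : realType) (n : nat) := Nilmanifold {
  nil_algebra :> lie_algebra R n;
  nil_algebraP : nilpotent_lie nil_algebra;
  nil_lattice : set 'rV[R]_n;
  nil_latticeP : lattice nil_algebra nil_lattice }.

(** The tangent bundle of the group G is trivialized by the left-invariant
    vector fields x_1, .., x_n extending the standard basis, and the cotangent
    bundle by the dual coframe; left translations act trivially on the fibres.
    Objects on the quotient of G by Gamma are those on G which are invariant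
    under left translation by elements of Gamma. *)

Section Calculus.
Variables (R : realType) (n : nat) (g : lie_algebra R n).
Local Notation V := 'rV[R]_n.
Local Notation C := R[i].
Local Notation toC := (map_mx (real_complex R)).

(* The curve t |-> p (t x_k) is the integral curve of x_k through p. *)
Definition left_derive (k : 'I_n) (f : V -> R) (p : V) : R :=
  derive1 (fun t : R => f (bch g p (t *: basis_vec R k))) 0.

(* Differentiability along the frame x_1, .., x_n, which is equivalent to
   differentiability in the coordinates. *)
Fixpoint Ck (m : nat) (f : V -> R) : Prop :=
  continuous f /\
  if m is m'.+1 then
    forall k,
      (forall p, derivable (fun t : R => f (bch g p (t *: basis_vec R k))) 0 1)
      /\ Ck m' (left_derive k f)
  else True.

Definition smooth (f : V -> R) := forall m, Ck m f.

Definition smoothC (f : V -> C) :=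
  smooth (fun p => complex.Re (f p)) /\ smooth (fun p => complex.Im (f p)).

Definition left_deriveC (k : 'I_n) (f : V -> C) (p : V) : C :=
  Complex (left_derive k (fun q => complex.Re (f q)) p)
          (left_derive k (fun q => complex.Im (f q)) p).

Definition bracketC (u v : 'rV[C]_n) : 'rV[C]_n :=
  \sum_j \sum_k
    (u 0 j * v 0 k) *: toC (g (basis_vec R j) (basis_vec R k)).

Definition differential (f : V -> C) (p : V) : 'rV[C]_n :=
  \row_k left_deriveC k f p.

(* d eta (x_j, x_k) = x_j (eta x_k) - x_k (eta x_j) - eta [x_j, x_k] *)
Definition exterior_d (eta : V -> 'rV[C]_n) (p : V) : form C n :=
  twoform (fun j k =>
    left_deriveC j (fun q => eta q 0 k) p
    - left_deriveC k (fun q => eta q 0 j) p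
    - dot (eta p) (toC (g (basis_vec R j) (basis_vec R k)))).

Definition vf_bracket (X Y : V -> 'rV[C]_n) (p : V) : 'rV[C]_n :=
  (\row_k \sum_j (X p 0 j * left_deriveC j (fun q => Y q 0 k) p
                  - Y p 0 j * left_deriveC j (fun q => X q 0 k) p))
  + bracketC (X p) (Y p).

Definition covector (a : form C n) : 'rV[C]_n := \row_k a [set k]%SET.

Definition courant (s t : V -> 'rV[C]_(n + n)) (p : V) : 'rV[C]_(n + n) :=
  let X q := lsubmx (s q) in let xi q := rsubmx (s q) in
  let Y q := lsubmx (t q) in let eta q := rsubmx (t q) in
  row_mx
    (vf_bracket X Y p)
    (covector (contract (X p) (exterior_d eta p))
     - covector (contract (Y p) (exterior_d xi p))
     + 2^-1 *: differential (fun q => dot (eta q) (X q) - dot (xi q) (Y q)) p).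

(* Endomorphisms act on row vectors on the right. *)
Definition plus_i_eigenspace (J : 'M[R]_(n + n)) (v : 'rV[C]_(n + n)) : Prop :=
  v *m toC J = 'i%C *: v.

Definition complexify (a : form R n) : form C n := [ffun S => (a S)%:C%C].

Definition has_type (L : 'rV[C]_(n + n) -> Prop) (k : nat) : Prop :=
  exists (B w : form R n) (theta : 'I_k -> 'rV[C]_n),
    let Omega := \big[@wedge n C/monomial C finset.set0]_i oneform (theta i) in
    let rho :=
      wedge (form_exp (complexify B + 'i%C *: complexify w)) Omega in
    [/\ homogeneous 2 B, homogeneous 2 w, Omega != 0 &
        forall phi : form C n,
          (forall v, L v -> clifford v phi = 0) <-> exists c : C, phi = c *: rho].

End Calculus.

Section GeneralizedComplex.
Variables (R : realType) (n : nat) (M : nilmanifold R n).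
Local Notation V := 'rV[R]_n.
Local Notation C := R[i].
Local Notation G := (nil_algebra M).

Definition descends (T : Type) (f : V -> T) :=
  forall c x, nil_lattice M c -> f (bch G c x) = f x.

Definition smooth_section (s : V -> 'rV[C]_(n + n)) :=
  descends s /\ forall k, smoothC G (fun p => s p 0 k).

Definition section_of_L (J : V -> 'M[R]_(n + n)) (s : V -> 'rV[C]_(n + n)) :=
  smooth_section s /\ forall p, plus_i_eigenspace (J p) (s p).

Record generalized_complex (J : V -> 'M[R]_(n + n)) : Prop := {
  gc_descends : descends J;
  gc_smooth : forall j k, smooth G (fun p => J p j k);
  gc_orthogonal : forall p u v, pairing (u *m J p) (v *m J p) = pairing u v;
  gc_square : forall p, J p *m J p = - 1%:M;
  gc_integrable : forall s t, section_of_L J s -> section_of_L J t ->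
    forall p, plus_i_eigenspace (J p) (courant G s t p) }.

Definition left_invariant (J : V -> 'M[R]_(n + n)) :=
  forall x y, J (bch G x y) = J y.

Definition of_type (J : V -> 'M[R]_(n + n)) (k : nat) :=
  forall p, has_type (plus_i_eigenspace (J p)) k.

End GeneralizedComplex.

(* Main.v *)
From mathcomp Require Import all_classical all_reals all_analysis.
From mathcomp Require Import all_boot all_order all_algebra.
From mathcomp Require Import complex ring lra zify.
Require Import Defs.

(** Let J be a left-invariant structure of type 2, considered as an endomorphism
    of the sum of the Lie algebra g and of its dual, and exp F /\ t1 /\ t2 its
    spinor, F = B + i w.

    Integrability becomes algebraic.  The Courant bracket of two sections of the
    +i-eigenspace L is the bracket of their values up to derivatives of the
    sections, which stay in L, and pairings, which vanish since L is isotropic;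
    so that L has to be closed under the bracket of constant sections
    ([generalized_complex_cst], [left_invariant_generalized_complex]).  Let a be
    the subspace of complexified g annihilated by t1 and t2.  The elements of L
    are the X + xi with X in a and xi equal to - F (X, -) on a
    ([pure_spinor_line], [isotropic_of_plus_i]), and L is closed under brackets if
    and only if a is a subalgebra on which F is closed ([isotropic_courant],
    [courant_isotropic]).  Moreover L does not meet its conjugate: t1, t2 and
    their conjugates are independent, and F is nondegenerate on the real plane
    annihilated by t1 and t2 ([type2_necessary]).  Conversely it is enough for
    existence to find a real coframe f for which these conditions hold for the
    spinor exp (i f5 /\ f6) /\ (f1 + i f2) /\ (f3 + i f4), called split here
    ([split_type2_exists]).

    Existence.  By Engel's theorem g has a coframe e such that d e_k is a 2-form
    in e_1, .., e_(k-1) ([triangular_coframe]).  Changes of coframe simplify these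
    2-forms, which are subject to d d = 0, until either a split structure can be
    written down or one of six normal forms is reached ([split_or_exceptional]).
    The first two of these have maximal nilpotency and nilpotency index 4, by
    computation of their lower central series ([exceptional_maximal],
    [exceptional_nil_index]), and the four others are those of the theorem.

    Nonexistence.  Nilpotency allows to choose t1 and t2 such that d t1 = 0 and
    t1 /\ d t2 = 0 ([adapted_pair]).  In a coframe e adapted to the lower central
    series these two equations leave few coefficients to t1 and t2.  If g has
    maximal nilpotency then both covectors are combinations of three real ones, and
    cannot be independent of their conjugates.  In the other cases the real plane
    annihilated by t1 and t2 contains the central vector dual to e_6, and the
    closedness of F on a implies that F vanishes on this plane
    ([central_pairing_14], [central_pairing_23]). *)

Set Implicit Arguments.
Unset Strict Implicit.
Unset Printing Implicit Defensive.
Import Order.TTheory GRing.Theory Num.Theory.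
Import numFieldNormedType.Exports.
Local Open Scope ring_scope.


(** * The exterior algebra *)

Section ExteriorAlgebra.
Variables (n : nat) (K : comNzRingType).
Implicit Types (a b c : form K n) (v : 'rV[K]_n) (S T U : {set 'I_n}).

Local Notation one := (monomial K (@finset.set0 'I_n)).
Local Notation mono1 k := (monomial K [set k]%SET).
Local Notation sgn k S := (shuffle_sign K [set k]%SET S).

Let fD a b S : (a + b) S = (a S : K) + (b S : K) :> K.
Proof. by rewrite ffunE. Qed.

Let fZ x a S : (x *: a) S = x * (a S : K) :> K.
Proof. by rewrite ffunE. Qed.

Let wE a b U : wedge a b U = \sum_(S : {set 'I_n} | S \subset U)
  shuffle_sign K S (U :\: S)%SET * ((a S : K) * (b (U :\: S)%SET : K)) :> K.
Proof. by rewrite ffunE. Qed.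

Let cE v a S : contract v a S = \sum_(k | k \notin S)
  v 0 k * (shuffle_sign K [set k]%SET S * (a (k |: S)%SET : K)) :> K.
Proof. by rewrite ffunE. Qed.

Let mE S T : monomial K S T = (if T == S then 1 else 0) :> K.
Proof. by rewrite ffunE; case: eqP. Qed.

Lemma wedgeDl a b c : wedge (a + b) c = wedge a c + wedge b c.
Proof.
apply/ffunP => U; rewrite fD !wE -big_split; apply: eq_bigr => S _.
by rewrite fD /=; ring.
Qed.

Lemma wedgeZl x a b : wedge (x *: a) b = x *: wedge a b.
Proof.
apply/ffunP => U; rewrite fZ !wE mulr_sumr; apply: eq_bigr => S _.
by rewrite fZ; ring.
Qed.

Lemma wedgeDr a b c : wedge c (a + b) = wedge c a + wedge c b.
Proof.
apply/ffunP => U; rewrite fD !wE -big_split; apply: eq_bigr => S _.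
by rewrite fD /=; ring.
Qed.

Lemma wedgeZr x a b : wedge b (x *: a) = x *: wedge b a.
Proof.
apply/ffunP => U; rewrite fZ !wE mulr_sumr; apply: eq_bigr => S _.
by rewrite fZ; ring.
Qed.

Lemma wedge0l a : wedge 0 a = 0.
Proof. by have := wedgeZl 0 0 a; rewrite !scale0r. Qed.

Lemma wedge0r a : wedge a 0 = 0.
Proof. by have := wedgeZr 0 0 a; rewrite !scale0r. Qed.

Lemma wedge_suml I (r : seq I) (P : pred I) (F : I -> form K n) a :
  wedge (\sum_(i <- r | P i) F i) a = \sum_(i <- r | P i) wedge (F i) a.
Proof.
by elim/big_rec2: _ => [|i x y _ <-]; rewrite ?wedge0l ?wedgeDl.
Qed.

Lemma wedge_sumr I (r : seq I) (P : pred I) (F : I -> form K n) a :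
  wedge a (\sum_(i <- r | P i) F i) = \sum_(i <- r | P i) wedge a (F i).
Proof.
by elim/big_rec2: _ => [|i x y _ <-]; rewrite ?wedge0r ?wedgeDr.
Qed.

Lemma contractDr v a b : contract v (a + b) = contract v a + contract v b.
Proof.
apply/ffunP => U; rewrite fD !cE -big_split; apply: eq_bigr => S _.
by rewrite fD /=; ring.
Qed.

Lemma contractZr v x a : contract v (x *: a) = x *: contract v a.
Proof.
apply/ffunP => U; rewrite fZ !cE mulr_sumr; apply: eq_bigr => S _.
by rewrite ?fZ ?mxE; ring.
Qed.

Lemma contract0r v : contract v 0 = 0.
Proof. by have := contractZr v 0 0; rewrite !scale0r. Qed.

Lemma wedgeNl a b : wedge (- a) b = - wedge a b.
Proof. by rewrite -scaleN1r wedgeZl scaleN1r. Qed.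

Lemma contractNr v a : contract v (- a) = - contract v a.
Proof. by rewrite -scaleN1r contractZr scaleN1r. Qed.

Lemma contract_sumr v I (r : seq I) (P : pred I) (F : I -> form K n) :
  contract v (\sum_(i <- r | P i) F i) = \sum_(i <- r | P i) contract v (F i).
Proof.
by elim/big_rec2: _ => [|i x y _ <-]; rewrite ?contract0r ?contractDr.
Qed.

Lemma contractDl u v a : contract (u + v) a = contract u a + contract v a.
Proof.
apply/ffunP => U; rewrite fD !cE -big_split; apply: eq_bigr => S _.
by rewrite !mxE /=; ring.
Qed.

Lemma contractZl x v a : contract (x *: v) a = x *: contract v a.
Proof.
apply/ffunP => U; rewrite fZ !cE mulr_sumr; apply: eq_bigr => S _.
by rewrite !mxE; ring.
Qed.

Lemma contract0l a : contract 0 a = 0.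
Proof. by have := contractZl 0 0 a; rewrite !scale0r. Qed.

Lemma contract_suml I (r : seq I) (P : pred I) (F : I -> 'rV[K]_n) a :
  contract (\sum_(i <- r | P i) F i) a = \sum_(i <- r | P i) contract (F i) a.
Proof.
by elim/big_rec2: _ => [|i x y _ <-]; rewrite ?contract0l ?contractDl.
Qed.

Lemma oneformD u v : oneform (u + v) = oneform u + oneform v :> form K n.
Proof. by rewrite /oneform -big_split; apply: eq_bigr => k _; rewrite mxE scalerDl. Qed.

Lemma oneformZ x v : oneform (x *: v) = x *: oneform v :> form K n.
Proof. by rewrite /oneform scaler_sumr; apply: eq_bigr => k _; rewrite mxE scalerA. Qed.

Lemma oneform0 : oneform (0 : 'rV[K]_n) = 0.
Proof. by have := oneformZ 0 0; rewrite !scale0r. Qed.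

Lemma oneformN v : oneform (- v) = - oneform v :> form K n.
Proof. by rewrite -scaleN1r oneformZ scaleN1r. Qed.

Lemma oneform_delta k : oneform (delta_mx 0 k : 'rV[K]_n) = mono1 k.
Proof.
rewrite /oneform (bigD1 k) //= big1 ?addr0 ?mxE ?eqxx ?scale1r // => j jk.
by rewrite mxE eqxx (negPf jk) scale0r.
Qed.

Lemma shuffle_sign_sq S T : shuffle_sign K S T * shuffle_sign K S T = 1.
Proof. by rewrite /shuffle_sign -expr2 sqrr_sign. Qed.

Lemma shuffle_signUl S T U : [disjoint S & T] ->
  shuffle_sign K (S :|: T)%SET U = shuffle_sign K S U * shuffle_sign K T U.
Proof.
move=> dST; rewrite /shuffle_sign -exprD; congr (_ ^+ _).
rewrite -cardsUI [X in (_ + X)%N](_ : _ = 0%N) ?addn0; last first.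
  apply/eqP; rewrite cards_eq0; apply/eqP/setP => -[i j]; rewrite !inE /=.
  by case: (boolP (i \in S)) => //= iS; rewrite (disjointFr dST iS) /= andbF.
by apply: eq_card => -[i j]; rewrite !inE /=; case: (i \in _); case: (j \in _); case: (_ < _)%N; rewrite ?andbT ?andbF ?orbF.
Qed.

Lemma shuffle_signUr S T U : [disjoint T & U] ->
  shuffle_sign K S (T :|: U)%SET = shuffle_sign K S T * shuffle_sign K S U.
Proof.
move=> dST; rewrite /shuffle_sign -exprD; congr (_ ^+ _).
rewrite -cardsUI [X in (_ + X)%N](_ : _ = 0%N) ?addn0; last first.
  apply/eqP; rewrite cards_eq0; apply/eqP/setP => -[i j]; rewrite !inE /=.
  by case: (boolP (j \in T)) => //= iS; rewrite ?(disjointFr dST iS) /= ?andbF.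
by apply: eq_card => -[i j]; rewrite !inE /=; case: (i \in _); case: (j \in _); case: (_ < _)%N; rewrite ?andbT ?andbF ?orbF.
Qed.

Lemma shuffle_sign11 (j k : 'I_n) : shuffle_sign K [set j]%SET [set k]%SET = (-1) ^+ (k < j)%N.
Proof.
rewrite /shuffle_sign; congr (_ ^+ _); case: ltnP => kj.
  transitivity #|[set (j, k)]%SET|; last by rewrite cards1.
  apply: eq_card => -[p q]; rewrite !inE /= xpair_eqE.
  by case: eqP => [->|] //; case: eqP => [->|] //=.
apply/eqP; rewrite cards_eq0; apply/eqP/setP => -[p q]; rewrite !inE /=.
by case: eqP => [->|] //; case: eqP => [->|] //=; rewrite ltnNge kj.
Qed.

Lemma shuffle_sign_swap (j k : 'I_n) : j != k -> sgn j [set k]%SET * sgn k [set j]%SET = -1 :> K.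
Proof.
by rewrite !shuffle_sign11 neq_ltn => /orP[] jk; rewrite jk (ltnNge _) ltnW //= ?mulr1 ?mul1r.
Qed.

Lemma shuffle_sign0l S : shuffle_sign K finset.set0 S = 1.
Proof.
rewrite /shuffle_sign [X in _ ^+ X](_ : _ = 0%N) //; apply/eqP.
by rewrite cards_eq0; apply/eqP/setP => -[p q]; rewrite !inE.
Qed.

Lemma shuffle_sign0r S : shuffle_sign K S finset.set0 = 1.
Proof.
rewrite /shuffle_sign [X in _ ^+ X](_ : _ = 0%N) //; apply/eqP.
by rewrite cards_eq0; apply/eqP/setP => -[p q]; rewrite !inE andbF.
Qed.

Lemma wedge_mono1E k a U :
  wedge (mono1 k) a U = if k \in U then sgn k (U :\ k)%SET * a (U :\ k)%SET else 0.
Proof.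
rewrite wE; case: ifPn => kU.
  rewrite (bigD1 [set k]%SET) /=; last by rewrite finset.sub1set.
  rewrite big1 ?addr0 ?mE ?eqxx ?mul1r // => S /andP[_ nS].
  by rewrite mE (negPf nS); ring.
rewrite big1 // => S SU; rewrite mE; case: eqP => [eS|]; last by move=> _; ring.
by move: SU; rewrite eS finset.sub1set (negPf kU).
Qed.

Lemma contract_deltaE k a S :
  contract (delta_mx 0 k : 'rV[K]_n) a S =
    if k \in S then 0 else sgn k S * a (k |: S)%SET.
Proof.
rewrite cE; case: ifPn => kS.
  apply: big1 => j jS; rewrite mxE /=; case: (j =P k) => [ejk|] /=; last by rewrite mul0r.
  by move: jS; rewrite ejk kS.
rewrite (bigD1 k) //= big1 ?addr0 ?mxE ?eqxx ?mul1r // => j /andP[_ jk].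
by rewrite mxE (negPf jk) andbF mul0r.
Qed.

Lemma wedge1l a : wedge one a = a.
Proof.
apply/ffunP => U; rewrite wE (bigD1 finset.set0) ?finset.sub0set //= big1.
  by rewrite mE eqxx shuffle_sign0l setD0; ring.
by move=> S /andP[_ nS]; rewrite mE (negPf nS); ring.
Qed.

Lemma wedge1r a : wedge a one = a.
Proof.
apply/ffunP => U; rewrite wE (bigD1 U) //= big1.
  by rewrite mE finset.setDv eqxx shuffle_sign0r; ring.
move=> S /andP[SU nS]; rewrite mE; case: eqP => [/eqP|]; last by move=> _; ring.
by rewrite finset.setD_eq0 => US; rewrite finset.eqEsubset SU US in nS.
Qed.

Lemma form_decomp a : a = \sum_S a S *: monomial K S.
Proof.
apply/ffunP => U; rewrite sum_ffunE (bigD1 U) //= big1 ?addr0.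
  by rewrite !ffunE eqxx /GRing.scale /= mulr1.
by move=> S nS; rewrite !ffunE eq_sym (negPf nS) /GRing.scale /= mulr0.
Qed.

Lemma monomial_rec k S : k \in S ->
  monomial K S = sgn k (S :\ k)%SET *: wedge (mono1 k) (monomial K (S :\ k)%SET).
Proof.
move=> kS; apply/ffunP => U; rewrite [RHS]ffunE wedge_mono1E !ffunE.
rewrite /GRing.scale /=; case: ifPn => kU; last first.
  by rewrite mulr0; case: eqP => // eU; move: kU; rewrite eU kS.
have -> : ((U :\ k)%SET == (S :\ k)%SET) = (U == S).
  apply/eqP/eqP => [e|-> //]; by rewrite -(setD1K kU) e setD1K.
by case: eqP => [->|_]; rewrite ?mulr0 ?mulr1 ?shuffle_sign_sq.
Qed.

(** The exterior algebra is generated by 1-forms: identities that are linear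
    in a form need only be propagated through left multiplication by one. *)
Lemma form_ind (P : form K n -> Prop) :
  P 0 -> (forall a b, P a -> P b -> P (a + b)) -> (forall x a, P a -> P (x *: a)) ->
  P one -> (forall k a, P a -> P (wedge (mono1 k) a)) -> forall a, P a.
Proof.
move=> P0 PD PZ P1 Pw a.
have Pm S : P (monomial K S).
  move: {2}#|S| (erefl #|S|) => m; elim: m S => [|m IH] S.
    by move/eqP; rewrite cards_eq0 => /eqP ->.
  move=> cS; have /card_gt0P[k kS] : (0 < #|S|)%N by rewrite cS.
  rewrite (monomial_rec kS); apply/PZ/Pw/IH.
  by apply: succn_inj; rewrite -cS (cardsD1 k S) kS.
rewrite (form_decomp a); elim/big_rec: _ => // S x _ Px.
by apply: PD => //; apply: PZ.
Qed.

Lemma wedge_mono1A k a b : wedge (wedge (mono1 k) a) b = wedge (mono1 k) (wedge a b).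
Proof.
apply/ffunP => U; rewrite wedge_mono1E [LHS]wE.
case: ifPn => kU; last first.
  apply: big1 => S SU; rewrite wedge_mono1E; case: ifPn => kS; last by ring.
  by rewrite (subsetP SU) // in kU.
rewrite (bigID (fun S : {set 'I_n} => k \in S)) /= [X in _ + X]big1 ?addr0; last first.
  by move=> S /andP[_ kS]; rewrite wedge_mono1E (negPf kS); ring.
rewrite (reindex_onto (fun S => (k |: S)%SET) (fun S => (S :\ k)%SET)) /=; last first.
  by move=> S /andP[_ kS]; rewrite setD1K.
rewrite wE big_distrr /=; apply: eq_big => [S|S].
  rewrite setU11 andbT; apply/andP/idP => [[SU /eqP <-]|SU].
    by apply/finset.setSD.
  have kS : k \notin S by apply/negP => /(subsetP SU); rewrite !inE eqxx.
  rewrite setU1K // eqxx; split=> //; apply/subsetP => j; rewrite !inE.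
  by case/orP=> [/eqP -> //|/(subsetP SU)]; rewrite !inE => /andP[].
case/andP=> /andP[SU _] /eqP eS.
have kS : k \notin S by rewrite -eS !inE eqxx.
rewrite wedge_mono1E setU11 eS.
have -> : (U :\: (k |: S) = (U :\ k) :\: S)%SET by rewrite finset.setDDl.
set T := (_ :\: S)%SET.
have kT : k \notin T by rewrite !inE eqxx /= andbF.
have dST : [disjoint S & T] by rewrite finset.disjoints_subset /T finset.setCD finset.subsetUr.
have -> : (U :\ k = S :|: T)%SET.
  apply/setP => j; rewrite !inE; case: (boolP (j \in S)) => //= jS.
  have : j \in (k |: S)%SET by rewrite !inE jS orbT.
  move=> /(subsetP SU) ->; rewrite andbT; apply/negP => /eqP ejk.
  by rewrite ejk (negPf kS) in jS.
rewrite shuffle_signUl ?shuffle_signUr //; first by ring.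
by rewrite finset.disjoints1 //.
Qed.

Lemma wedgeA a b c : wedge (wedge a b) c = wedge a (wedge b c).
Proof.
elim/form_ind: a => [|a a' IHa IHa'|x a IHa||k a IHa].
- by rewrite !wedge0l.
- by rewrite !wedgeDl IHa IHa'.
- by rewrite !wedgeZl IHa.
- by rewrite !wedge1l.
- by rewrite !wedge_mono1A IHa.
Qed.

Lemma contract_wedge_mono1 j k a :
  contract (delta_mx 0 j : 'rV[K]_n) (wedge (mono1 k) a) =
  (if j == k then a else 0) - wedge (mono1 k) (contract (delta_mx 0 j : 'rV[K]_n) a).
Proof.
apply/ffunP => S; apply: (can_inj (addrK (wedge (mono1 k) (contract (delta_mx 0 j : 'rV[K]_n) a) S))).
rewrite contract_deltaE !wedge_mono1E [in RHS]ffunE [X in _ = _ + X + _]ffunE.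
rewrite wedge_mono1E !contract_deltaE subrK.
case: (j =P k) => [->|/eqP jk].
  rewrite setU11; case: (boolP (k \in S)) => kS /=.
    by rewrite !inE eqxx /= setD1K // mulrA shuffle_sign_sq mul1r add0r.
  by rewrite setU1K // mulrA shuffle_sign_sq mul1r addr0.
rewrite !inE (negPf jk) (eq_sym k j) (negPf jk) /= ffunE.
case: (boolP (j \in S)) => jS; case: (boolP (k \in S)) => kS; rewrite ?addr0 ?add0r ?mulr0 //.
have jk' : k != j by rewrite eq_sym.
have -> : ((j |: S) :\ k = j |: (S :\ k))%SET.
  by apply/setP => i; rewrite !inE; case: (i =P k) => [->|] //=; rewrite (negPf jk').
have -> : sgn j S = sgn j [set k]%SET * sgn j (S :\ k)%SET.
  by rewrite -shuffle_signUr ?setD1K // finset.disjoints1 !inE eqxx.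
have -> : sgn k (j |: S :\ k)%SET = sgn k [set j]%SET * sgn k (S :\ k)%SET.
  by rewrite -shuffle_signUr // finset.disjoints1 !inE (negPf jS) andbF.
set x := (a _ : K).
have -> : sgn j [set k]%SET * sgn j (S :\ k)%SET * (sgn k [set j]%SET * sgn k (S :\ k)%SET * x)
  = (sgn j [set k]%SET * sgn k [set j]%SET) * (sgn j (S :\ k)%SET * sgn k (S :\ k)%SET * x) by ring.
by rewrite shuffle_sign_swap //; ring.
Qed.

Lemma row_decomp v : v = \sum_k v 0 k *: delta_mx 0 k.
Proof. exact: row_sum_delta. Qed.

(** With [contract_anticomm] and the anticommutation of 1-forms, these are the
    Clifford relations. *)
Lemma contract_wedge1 v (xi : 'rV[K]_n) a :
  contract v (wedge (oneform xi) a) = dot xi v *: a - wedge (oneform xi) (contract v a).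
Proof.
have mono1P k : contract v (wedge (mono1 k) a) = v 0 k *: a - wedge (mono1 k) (contract v a).
  rewrite {1 3}(row_decomp v) !contract_suml wedge_sumr.
  have -> : v 0 k *: a = \sum_j v 0 j *: (if j == k then a else 0).
    by rewrite (bigD1 k) //= eqxx big1 ?addr0 // => j /negPf ->; rewrite scaler0.
  rewrite -sumrB; apply: eq_bigr => j _.
  by rewrite !contractZl contract_wedge_mono1 wedgeZr scalerBr.
rewrite /oneform wedge_suml contract_sumr wedge_suml.
have -> : dot xi v *: a = \sum_k xi 0 k *: (v 0 k *: a).
  by rewrite /dot mxE scaler_suml; apply: eq_bigr => k _; rewrite mxE scalerA.
rewrite -sumrB; apply: eq_bigr => k _.
by rewrite !wedgeZl contractZr mono1P scalerBr.
Qed.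

Lemma contract1 v : contract v one = 0.
Proof.
apply/ffunP => S; rewrite cE !ffunE big1 // => k kS; rewrite mE ifF ?mulr0 //.
by apply/negP => /eqP/setP/(_ k); rewrite !inE eqxx.
Qed.

Lemma contract_oneform v (xi : 'rV[K]_n) : contract v (oneform xi) = dot xi v *: one.
Proof. by rewrite -{1}(wedge1r (oneform xi)) contract_wedge1 contract1 wedge0r subr0. Qed.

Lemma contract_anticomm u v a : contract u (contract v a) = - contract v (contract u a).
Proof.
elim/form_ind: a => [|a b IHa IHb|x a IHa||k a IHa].
- by rewrite !contract0r oppr0.
- by rewrite !contractDr IHa IHb opprD.
- by rewrite !contractZr IHa scalerN.
- by rewrite !contract1 !contract0r oppr0.
rewrite -oneform_delta !contract_wedge1 -!scaleN1r !contractDr !contractZr !contract_wedge1 IHa.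
rewrite -!scaleN1r !wedgeZr !scalerDr !scalerA.
move: (wedge _ _) => z; apply/ffunP => S; rewrite !ffunE /GRing.scale /=.
by set p := (contract u a S : K); set q := (contract v a S : K); set r := (z S : K); ring.
Qed.

Lemma wedge_mono11 (j k : 'I_n) : wedge (mono1 j) (mono1 k) =
  if j == k then 0 else (-1) ^+ (k < j)%N *: monomial K [set j; k]%SET.
Proof.
case: (j =P k) => [->|/eqP jk].
  apply/ffunP => U; rewrite wedge_mono1E [RHS]ffunE; case: ifPn => // kU.
  rewrite mE ifF ?mulr0 //; apply/negP => /eqP/setP/(_ k).
  by rewrite !inE eqxx.
have jI : j \in [set j; k]%SET by rewrite !inE eqxx.
rewrite (monomial_rec jI).
have -> : ([set j; k] :\ j = [set k])%SET.
  by apply/setP => i; rewrite !inE; case: (i =P j) => [->|//]; rewrite (negPf jk).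
by rewrite scalerA -shuffle_sign11 shuffle_sign_sq scale1r.
Qed.

Lemma homog1_oneform a : homogeneous 1 a -> a = oneform (\row_k (a [set k]%SET : K)).
Proof.
move=> ha; apply/ffunP => S; rewrite sum_ffunE.
case: (boolP (#|S| == 1%N)) => [/cards1P[k ->]|nS].
  rewrite (bigD1 k) //= big1 ?addr0; first by rewrite fZ mE eqxx mulr1 mxE.
  by move=> j jk; rewrite fZ mE ifF ?mulr0 //; apply/negP => /eqP/finset.set1_inj/esym/eqP; apply/negP.
rewrite ha // big1 // => j _; rewrite fZ mE ifF ?mulr0 //.
by apply/negP => /eqP eS; rewrite eS cards1 in nS.
Qed.

Lemma homogeneous_wedge p q a b :
  homogeneous p a -> homogeneous q b -> homogeneous (p + q) (wedge a b).
Proof.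
move=> ha hb U nU; rewrite wE big1 // => S SU.
case: (boolP (#|S| == p)) => [/eqP eS|/ha -> /=]; last by rewrite mul0r mulr0.
case: (boolP (#|U :\: S|%SET == q)) => [/eqP eT|/hb -> /=]; last by rewrite !mulr0.
by case/eqP: nU; rewrite -eS -eT -(cardsID S U) (setIidPr SU).
Qed.

Lemma homogeneous_contract p v a : homogeneous p.+1 a -> homogeneous p (contract v a).
Proof.
move=> ha S nS; rewrite cE big1 // => k kS; rewrite ha ?mulr0 //.
by rewrite cardsU1 kS.
Qed.

Lemma homogeneous_oneform v : homogeneous 1 (oneform v : form K n).
Proof.
move=> S nS; rewrite sum_ffunE big1 // => j _; rewrite fZ mE ifF ?mulr0 //.
by apply/negP => /eqP eS; rewrite eS cards1 in nS.
Qed.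

Lemma homogeneous_one : homogeneous 0 one.
Proof. by move=> S nS; rewrite mE ifF //; apply/negP => /eqP eS; rewrite eS cards0 in nS. Qed.

Lemma homogeneousD p a b : homogeneous p a -> homogeneous p b -> homogeneous p (a + b).
Proof. by move=> ha hb S nS; rewrite fD ha ?hb ?addr0. Qed.

Lemma homogeneousZ p x a : homogeneous p a -> homogeneous p (x *: a).
Proof. by move=> ha S nS; rewrite fZ ha ?mulr0. Qed.

Lemma homogeneous_big p a : (n < p)%N -> homogeneous p a -> a = 0.
Proof.
move=> np ha; apply/ffunP => S; rewrite ha ?ffunE //.
by rewrite neq_ltn (leq_ltn_trans (max_card _)) // card_ord.
Qed.

(** 2-forms are central in the exterior algebra; this is propagated from the
    products of two basic 1-forms. *)
Lemma homog2_ind (P : form K n -> Prop) :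
  P 0 -> (forall a b, P a -> P b -> P (a + b)) -> (forall x a, P a -> P (x *: a)) ->
  (forall j k, P (wedge (mono1 j) (mono1 k))) -> forall a, homogeneous 2 a -> P a.
Proof.
move=> P0 PD PZ Pm a ha; rewrite (form_decomp a); elim/big_rec: _ => // S x _ Px.
apply: PD; last exact: Px.
case: (boolP (#|S| == 2%N)) => [|/ha ->]; last by rewrite scale0r; exact: P0.
case/cards2P => j [k [jk ->]].
have := Pm j k; rewrite wedge_mono11 (negPf jk) => /(PZ ((-1) ^+ (k < j)%N)).
by rewrite scalerA -expr2 sqrr_sign scale1r; apply: PZ.
Qed.

Lemma wedge_oneC (xi eta : 'rV[K]_n) :
  wedge (oneform xi) (oneform eta) = - wedge (oneform eta) (oneform xi).
Proof.
rewrite /oneform !wedge_suml.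
under eq_bigr do rewrite wedgeZl wedge_sumr scaler_sumr.
under [X in - X]eq_bigr do rewrite wedgeZl wedge_sumr scaler_sumr.
rewrite exchange_big -sumrN; apply: eq_bigr => j _; rewrite -sumrN; apply: eq_bigr => k _.
rewrite !wedgeZr !scalerA (mulrC (xi 0 k)) -scalerN; congr (_ *: _).
rewrite !wedge_mono11 (eq_sym j k); case: (k =P j) => [|/eqP kj]; first by rewrite oppr0.
rewrite finset.setUC -scaleNr; congr (_ *: _).
by move: kj; rewrite neq_ltn => /orP[] jk; rewrite jk (ltnNge _) ltnW //= ?opprK.
Qed.

Lemma wedge_oneCA (xi eta : 'rV[K]_n) a :
  wedge (oneform xi) (wedge (oneform eta) a) = - wedge (oneform eta) (wedge (oneform xi) a).
Proof. by rewrite -!wedgeA wedge_oneC -scaleN1r wedgeZl scaleN1r. Qed.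

Lemma wedge_one_two xi b a : homogeneous 2 b ->
  wedge (oneform xi) (wedge b a) = wedge b (wedge (oneform xi) a).
Proof.
move=> hb; elim/homog2_ind: hb => [|c c' IH IH'|x c IH|j k].
- by rewrite !wedge0l wedge0r.
- by rewrite !wedgeDl wedgeDr IH IH'.
- by rewrite !wedgeZl wedgeZr IH.
by rewrite -!oneform_delta !wedgeA wedge_oneCA (wedge_oneCA xi) -!scaleN1r wedgeZr scalerA mulrNN mulr1 scale1r.
Qed.

Lemma contract_two v b a : homogeneous 2 b ->
  contract v (wedge b a) = wedge (contract v b) a + wedge b (contract v a).
Proof.
move=> hb; elim/homog2_ind: hb => [|c c' IH IH'|x c IH|j k].
- by rewrite contract0r !wedge0l contract0r addr0.
- by rewrite contractDr !wedgeDl contractDr IH IH' addrACA.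
- by rewrite contractZr !wedgeZl contractZr IH scalerDr.
rewrite -!oneform_delta !wedgeA !contract_wedge1 contract_oneform.
have wB c x y : wedge c (x - y) = wedge c x - wedge c y.
  by rewrite -scaleN1r wedgeDr wedgeZr scaleN1r.
have wBl c x y : wedge (x - y) c = wedge x c - wedge y c.
  by rewrite -scaleN1r wedgeDl wedgeZl scaleN1r.
by rewrite wB wBl !wedgeZr wedge1r !wedgeZl opprB addrA addrAC.
Qed.

End ExteriorAlgebra.

Section Exponential.
Variables (n : nat) (K : numFieldType).
Implicit Types (a b F : form K n) (v : 'rV[K]_n).

Local Notation one := (monomial K (@finset.set0 'I_n)).
Let wE a b U : wedge a b U = \sum_(S : {set 'I_n} | S \subset U)
  shuffle_sign K S (U :\: S)%SET * ((a S : K) * (b (U :\: S)%SET : K)) :> K.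
Proof. by rewrite ffunE. Qed.

Local Notation pw F j := (iter j (wedge F) one).

Lemma wedge_oneform_sq (xi : 'rV[K]_n) a :
  wedge (oneform xi) (wedge (oneform xi) a) = 0.
Proof.
have /eqP := wedge_oneCA xi xi a; rewrite -addr_eq0 -mulr2n -scaler_nat.
by rewrite scaler_eq0 pnatr_eq0 /= => /eqP.
Qed.

Lemma contract_sq v a : contract v (contract v a) = 0.
Proof.
have /eqP := contract_anticomm v v a; rewrite -addr_eq0 -mulr2n -scaler_nat.
by rewrite scaler_eq0 pnatr_eq0 /= => /eqP.
Qed.

Lemma homogeneous_pw F j : homogeneous 2 F -> homogeneous (2 * j) (pw F j).
Proof.
move=> hF; elim: j => [|j IH]; first exact: homogeneous_one.
by rewrite mulnS; apply: homogeneous_wedge.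
Qed.

Lemma homog2_contract v F : homogeneous 2 F ->
  contract v F = oneform (\row_k (contract v F [set k]%SET : K)).
Proof. by move=> hF; apply/homog1_oneform/homogeneous_contract. Qed.

Lemma wedge_one_pw xi F j a : homogeneous 2 F ->
  wedge (oneform xi) (wedge (pw F j) a) = wedge (pw F j) (wedge (oneform xi) a).
Proof.
move=> hF; elim: j a => [|j IH] a /=; first by rewrite !wedge1l.
by rewrite !wedgeA wedge_one_two // IH.
Qed.

Lemma contract_pw v F j : homogeneous 2 F ->
  contract v (pw F j.+1) = j.+1%:R *: wedge (contract v F) (pw F j).
Proof.
move=> hF; elim: j => [|j IH]; first by rewrite /= !wedge1r scale1r.
rewrite [pw F j.+2]iterS contract_two // IH wedgeZr homog2_contract // -wedge_one_two //.
by rewrite -[in RHS]natr1 scalerDl scale1r addrC.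
Qed.

Lemma contract_pw_wedge v F j a : homogeneous 2 F ->
  contract v (wedge (pw F j) a) = wedge (contract v (pw F j)) a + wedge (pw F j) (contract v a).
Proof.
move=> hF; elim: j a => [|j IH] a /=.
  by rewrite contract1 wedge0l add0r !wedge1l.
by rewrite !wedgeA (contract_two _ _ hF) IH (contract_two _ _ hF) wedgeDl wedgeDr !wedgeA addrA.
Qed.

(** The chain rule for exp; the truncation of the series is harmless. *)
Lemma contract_exp v F : (0 < n)%N -> homogeneous 2 F ->
  contract v (form_exp F) = wedge (contract v F) (form_exp F).
Proof.
move=> n0 hF; rewrite /form_exp contract_sumr wedge_sumr big_ord_recl [RHS]big_ord_recr /=.
rewrite contractZr contract1 scaler0 add0r wedgeZr.
(* F^n has degree 2 n > n *)
have -> : pw F n = 0.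
  apply: (homogeneous_big _ (homogeneous_pw (j := n) hF)).
  by rewrite mul2n -addnn -{1}[n]addn0 ltn_add2l.
rewrite wedge0r scaler0 addr0; apply: eq_bigr => j _.
rewrite /= contractZr contract_pw // wedgeZr scalerA; congr (_ *: _).
rewrite /bump /= add1n factS natrM invfM mulrAC mulVf ?mul1r //.
Qed.

Lemma wedge_expE F a :
  wedge (form_exp F) a = \sum_(j < n.+1) (j`!%:R)^-1 *: wedge (pw F j) a.
Proof. by rewrite /form_exp wedge_suml; apply: eq_bigr => j _; rewrite wedgeZl. Qed.

Lemma wedge_one_exp xi F a : homogeneous 2 F ->
  wedge (oneform xi) (wedge (form_exp F) a) = wedge (form_exp F) (wedge (oneform xi) a).
Proof.
move=> hF; rewrite !wedge_expE wedge_sumr; apply: eq_bigr => j _.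
by rewrite wedgeZr wedge_one_pw.
Qed.

Lemma contract_exp_wedge v F a : (0 < n)%N -> homogeneous 2 F ->
  contract v (wedge (form_exp F) a) = wedge (form_exp F) (wedge (contract v F) a + contract v a).
Proof.
move=> n0 hF.
have -> : contract v (wedge (form_exp F) a) =
    wedge (contract v (form_exp F)) a + wedge (form_exp F) (contract v a).
  rewrite !wedge_expE /form_exp !contract_sumr wedge_suml -big_split; apply: eq_bigr => j _ /=.
  by rewrite !contractZr wedgeZl contract_pw_wedge // scalerDr.
by rewrite contract_exp // wedgeDr homog2_contract // wedgeA wedge_one_exp.
Qed.

Lemma contract_eq0 a : (forall v, contract v a = 0) -> a = (a finset.set0 : K) *: one.
Proof.
move=> ha; apply/ffunP => S; rewrite [RHS]ffunE [X in _ *: X]ffunE.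
case: eqP => [->|/eqP/set0Pn[k kS]]; first by rewrite /GRing.scale /= mulr1.
rewrite /GRing.scale /= mulr0.
have /ffunP/(_ (S :\ k)%SET) := ha (delta_mx 0 k).
rewrite contract_deltaE !inE eqxx /= setD1K // ffunE => e.
by rewrite -[a S]mul1r -(shuffle_sign_sq K [set k]%SET (S :\ k)%SET) -mulrA e mulr0.
Qed.

Lemma form_exp0 F : homogeneous 2 F -> form_exp F finset.set0 = 1.
Proof.
move=> hF; rewrite /form_exp sum_ffunE big_ord_recl /= big1 ?addr0.
  by rewrite !ffunE eqxx fact0 /GRing.scale /= invr1 mulr1.
move=> j _; rewrite [LHS]ffunE -[wedge F _]/(pw F j.+1) (homogeneous_pw (j := j.+1) hF) ?scaler0 //.
by rewrite cards0 eq_sym muln_eq0.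
Qed.

(** All interior products of exp F /\ exp (- F) vanish by [contract_exp_wedge], so
    that it equals its component of degree 0. *)
Lemma wedge_expN F : (0 < n)%N -> homogeneous 2 F ->
  wedge (form_exp F) (form_exp (- F)) = one.
Proof.
move=> n0 hF; have hNF : homogeneous 2 (- F) by rewrite -scaleN1r; apply: homogeneousZ.
rewrite (@contract_eq0 (wedge _ _)); last first.
  move=> v; rewrite contract_exp_wedge // contract_exp // -wedgeDl -contractDr subrr.
  by rewrite contract0r wedge0l wedge0r.
rewrite wE (bigD1 finset.set0) ?finset.sub0set //= big1 ?addr0; last first.
  by move=> S /andP[]; rewrite finset.subset0 => ->.
by rewrite finset.setDv shuffle_sign0l !form_exp0 // !mul1r scale1r.
Qed.

(** As th1 /\ a = 0, a is the product of th1 and its interior product by X1, and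
    likewise for th2.  Hence a is a multiple of th1 /\ th2 by psi, the interior
    product of a by X1 and X2; all interior products of psi vanish, so that psi
    is a scalar. *)
Lemma annihilated_form (th1 th2 X1 X2 : 'rV[K]_n) a :
  dot th1 X1 = 1 -> dot th2 X2 = 1 -> dot th1 X2 = 0 -> dot th2 X1 = 0 ->
  wedge (oneform th1) a = 0 -> wedge (oneform th2) a = 0 ->
  (forall X, dot th1 X = 0 -> dot th2 X = 0 -> contract X a = 0) ->
  exists c, a = c *: wedge (oneform th1) (oneform th2).
Proof.
move=> t11 t22 t12 t21 w1 w2 kX.
have a1 : a = wedge (oneform th1) (contract X1 a).
  have := contract_wedge1 X1 th1 a; rewrite w1 contract0r t11 scale1r => /eqP.
  by rewrite eq_sym subr_eq0 => /eqP.
have a2 : a = wedge (oneform th2) (contract X2 a).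
  have := contract_wedge1 X2 th2 a; rewrite w2 contract0r t22 scale1r => /eqP.
  by rewrite eq_sym subr_eq0 => /eqP.
pose psi := contract X1 (contract X2 a).
have kpsi v : contract v psi = 0.
  have dotB (t u w : 'rV[K]_n) : dot t (u - w) = dot t u - dot t w.
    by rewrite /dot linearB /= mulmxBr !mxE.
  have dotZ c (t u : 'rV[K]_n) : dot t (c *: u) = c * dot t u.
    by rewrite /dot linearZ /= -scalemxAr !mxE.
  pose w := v - dot th1 v *: X1 - dot th2 v *: X2.
  have kw (u : 'rV[K]_n) : contract u (contract w a) = 0.
    rewrite kX ?contract0r // !dotB !dotZ ?t11 ?t12 ?t21 ?t22 ?mulr0 ?mulr1.
      by rewrite subrr subr0.
    by rewrite subr0 subrr.
  have -> : v = dot th1 v *: X1 + (dot th2 v *: X2 + w).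
    by rewrite [dot th2 v *: X2 + _]addrC subrK [RHS]addrC subrK.
  have k1 : contract X1 psi = 0 by rewrite /psi contract_sq.
  have k2 : contract X2 psi = 0.
    by rewrite /psi (contract_anticomm X2 X1) contract_sq contract0r oppr0.
  have k3 : contract w psi = 0.
    by rewrite /psi contract_anticomm (contract_anticomm w X2) kw oppr0 contract0r oppr0.
  rewrite (contractDl (dot th1 v *: X1)) (contractDl (dot th2 v *: X2)) !contractZl.
  by rewrite k1 k2 k3 !scaler0 !addr0.
have epsi := contract_eq0 kpsi.
exists (- psi finset.set0); move: (psi finset.set0 : K) epsi => c epsi.
rewrite {1}a1 {1}a2 contract_wedge1 t21 scale0r sub0r -/psi epsi.
by rewrite wedgeZr wedge1r -scaleNr wedgeZr.
Qed.
End Exponential.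

(** * Covectors, 2-forms and dual frames *)

Lemma mulf_cancel0 (K : idomainType) (a b : K) : a != 0 -> a * b = 0 -> b = 0.
Proof. by move=> a0 /eqP; rewrite mulf_eq0 (negPf a0) => /eqP. Qed.

Section Bilinear.
Variables (n : nat) (K : comNzRingType).
Implicit Types (a b u v x y : 'rV[K]_n) (A B : 'M[K]_n) (c : K).

Lemma dotDl a b x : dot (a + b) x = dot a x + dot b x.
Proof. by rewrite /dot mulmxDl mxE. Qed.
Lemma dotDr a x y : dot a (x + y) = dot a x + dot a y.
Proof. by rewrite /dot linearD /= mulmxDr mxE. Qed.
Lemma dotZl c a x : dot (c *: a) x = c * dot a x.
Proof. by rewrite /dot -scalemxAl mxE. Qed.
Lemma dotZr c a x : dot a (c *: x) = c * dot a x.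
Proof. by rewrite /dot linearZ /= -scalemxAr mxE. Qed.
Lemma dotNl a x : dot (- a) x = - dot a x.
Proof. by rewrite -scaleN1r dotZl mulN1r. Qed.
Lemma dotNr a x : dot a (- x) = - dot a x.
Proof. by rewrite -scaleN1r dotZr mulN1r. Qed.
Lemma dotC a x : dot a x = dot x a.
Proof. by rewrite /dot !mxE; apply: eq_bigr => k _; rewrite !mxE mulrC. Qed.
Lemma dot0l x : dot 0 x = 0.
Proof. by rewrite /dot mul0mx mxE. Qed.
Lemma dot0r x : dot x 0 = 0.
Proof. by rewrite dotC dot0l. Qed.
Lemma dot_delta a k : dot a (delta_mx 0 k) = a 0 k.
Proof.
rewrite /dot mxE (bigD1 k) //= big1 ?addr0 ?mxE ?eqxx ?mulr1 // => j jk.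
by rewrite !mxE (negPf jk) andbF mulr0.
Qed.

Definition dotE := (dotDl, dotDr, dotZl, dotZr, dotNl, dotNr, dot0l, dot0r).

Lemma dot_sumr I (r : seq I) (P : pred I) (F : I -> 'rV[K]_n) a :
  dot a (\sum_(i <- r | P i) F i) = \sum_(i <- r | P i) dot a (F i).
Proof. by elim/big_rec2: _ => [|i x y _ <-]; rewrite ?dot0r ?dotDr. Qed.

Lemma dot_eq a b : (forall x, dot a x = dot b x) -> a = b.
Proof. by move=> h; apply/rowP => k; rewrite -!dot_delta. Qed.

(** The algebra of the reduction to normal forms only involves 2-forms, which are
    represented there by alternating matrices; [wd a b] is the exterior product of
    two covectors. *)
Definition ev2 A x y : K := (x *m A *m y^T) 0 0.
Definition wd a b : 'M[K]_n := a^T *m b - b^T *m a.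

Lemma ev2_wd a b x y : ev2 (wd a b) x y = dot a x * dot b y - dot b x * dot a y.
Proof.
have h (u v : 'rV[K]_n) : (x *m (u^T *m v) *m y^T) 0 0 = dot x u * dot v y.
  by rewrite mulmxA -mulmxA mxE big_ord1.
have hB (A B : 'M[K]_1) : (A - B) 0 0 = A 0 0 - B 0 0 by rewrite !mxE.
by rewrite /ev2 /wd mulmxBr mulmxBl hB !h !(dotC x).
Qed.

Lemma ev2D A B x y : ev2 (A + B) x y = ev2 A x y + ev2 B x y.
Proof. by rewrite /ev2 mulmxDr mulmxDl mxE. Qed.
Lemma ev2Z c A x y : ev2 (c *: A) x y = c * ev2 A x y.
Proof. by rewrite /ev2 -scalemxAr -scalemxAl mxE. Qed.
Lemma ev2N A x y : ev2 (- A) x y = - ev2 A x y.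
Proof. by rewrite -scaleN1r ev2Z mulN1r. Qed.
Lemma ev20 x y : ev2 0 x y = 0.
Proof. by rewrite -(scale0r 0) ev2Z mul0r. Qed.

Lemma ev2Dl A x y z : ev2 A (x + y) z = ev2 A x z + ev2 A y z.
Proof. by rewrite /ev2 !mulmxDl mxE. Qed.
Lemma ev2Zl A c x z : ev2 A (c *: x) z = c * ev2 A x z.
Proof. by rewrite /ev2 -!scalemxAl mxE. Qed.
Lemma ev2Dr A x y z : ev2 A z (x + y) = ev2 A z x + ev2 A z y.
Proof. by rewrite /ev2 linearD mulmxDr mxE. Qed.
Lemma ev2Zr A c x z : ev2 A z (c *: x) = c * ev2 A z x.
Proof. by rewrite /ev2 linearZ /= -scalemxAr mxE. Qed.
Lemma ev2Nl A x z : ev2 A (- x) z = - ev2 A x z.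
Proof. by rewrite -scaleN1r ev2Zl mulN1r. Qed.
Lemma ev2Nr A x z : ev2 A z (- x) = - ev2 A z x.
Proof. by rewrite -scaleN1r ev2Zr mulN1r. Qed.

Lemma ev2_delta A j k : ev2 A (delta_mx 0 j) (delta_mx 0 k) = A j k.
Proof. by rewrite /ev2 -rowE -[row _ _ *m _]/(_) -/(dot _ _) dot_delta mxE. Qed.

Lemma ev2_ext A B : (forall x y, ev2 A x y = ev2 B x y) -> A = B.
Proof. by move=> h; apply/matrixP => j k; rewrite -!ev2_delta. Qed.

Lemma ev2_sum A x y : ev2 A x y = \sum_j \sum_k x 0 j * y 0 k * A j k.
Proof.
rewrite /ev2 -mulmxA mxE; apply: eq_bigr => j _; rewrite mxE mulr_sumr.
by apply: eq_bigr => k _; rewrite mxE; ring.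
Qed.
End Bilinear.

Section DualFrames.
Variable K : fieldType.
Implicit Types (f x X xi : 'rV[K]_6).

(** A basis of the space of covectors, in the form in which it is used and
    checked: the covectors have no common zero. *)
Definition coframe f1 f2 f3 f4 f5 f6 := forall X,
  dot f1 X = 0 -> dot f2 X = 0 -> dot f3 X = 0 -> dot f4 X = 0 -> dot f5 X = 0 ->
  dot f6 X = 0 -> X = 0.

Definition mx6 (s : seq 'rV[K]_6) : 'M[K]_6 := \matrix_(i < 6) s`_i.

Lemma mx6_mul (s t : seq 'rV[K]_6) i j : (mx6 s *m (mx6 t)^T) i j = dot s`_i t`_j.
Proof. by rewrite /dot !mxE; apply: eq_bigr => k _; rewrite !mxE. Qed.

(** The frame x is dual to the coframe f.  The duality relations are stated on
    linear combinations so as to serve as rewriting rules. *)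
Record dual f1 f2 f3 f4 f5 f6 x1 x2 x3 x4 x5 x6 : Prop := {
  dual1 : forall c1 c2 c3 c4 c5 c6, dot f1 (c1 *: x1 + c2 *: x2 + c3 *: x3 + c4 *: x4 + c5 *: x5 + c6 *: x6) = c1;
  dual2 : forall c1 c2 c3 c4 c5 c6, dot f2 (c1 *: x1 + c2 *: x2 + c3 *: x3 + c4 *: x4 + c5 *: x5 + c6 *: x6) = c2;
  dual3 : forall c1 c2 c3 c4 c5 c6, dot f3 (c1 *: x1 + c2 *: x2 + c3 *: x3 + c4 *: x4 + c5 *: x5 + c6 *: x6) = c3;
  dual4 : forall c1 c2 c3 c4 c5 c6, dot f4 (c1 *: x1 + c2 *: x2 + c3 *: x3 + c4 *: x4 + c5 *: x5 + c6 *: x6) = c4;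
  dual5 : forall c1 c2 c3 c4 c5 c6, dot f5 (c1 *: x1 + c2 *: x2 + c3 *: x3 + c4 *: x4 + c5 *: x5 + c6 *: x6) = c5;
  dual6 : forall c1 c2 c3 c4 c5 c6, dot f6 (c1 *: x1 + c2 *: x2 + c3 *: x3 + c4 *: x4 + c5 *: x5 + c6 *: x6) = c6;
  dual_vec : forall X, X = dot f1 X *: x1 + dot f2 X *: x2 + dot f3 X *: x3 + dot f4 X *: x4 + dot f5 X *: x5 + dot f6 X *: x6 }.

Lemma mx6_dual f1 f2 f3 f4 f5 f6 x1 x2 x3 x4 x5 x6 :
  mx6 [:: f1; f2; f3; f4; f5; f6] *m (mx6 [:: x1; x2; x3; x4; x5; x6])^T = 1%:M ->
  dual f1 f2 f3 f4 f5 f6 x1 x2 x3 x4 x5 x6.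
Proof.
set s := [:: f1; _; _; _; _; _]; set t := [:: x1; _; _; _; _; _] => e.
have d i j : (i < 6)%N -> (j < 6)%N -> dot s`_i t`_j = (i == j)%:R.
  move=> hi hj; have := mx6_mul s t (Ordinal hi) (Ordinal hj).
  by rewrite e mxE => <-.
split=> [c1 c2 c3 c4 c5 c6|c1 c2 c3 c4 c5 c6|c1 c2 c3 c4 c5 c6|c1 c2 c3 c4 c5 c6|c1 c2 c3 c4 c5 c6|c1 c2 c3 c4 c5 c6|X].
- rewrite !dotE (d 0 0) // (d 0 1) // (d 0 2) // (d 0 3) // (d 0 4) // (d 0 5) //=; ring.
- rewrite !dotE (d 1 0) // (d 1 1) // (d 1 2) // (d 1 3) // (d 1 4) // (d 1 5) //=; ring.
- rewrite !dotE (d 2 0) // (d 2 1) // (d 2 2) // (d 2 3) // (d 2 4) // (d 2 5) //=; ring.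
- rewrite !dotE (d 3 0) // (d 3 1) // (d 3 2) // (d 3 3) // (d 3 4) // (d 3 5) //=; ring.
- rewrite !dotE (d 4 0) // (d 4 1) // (d 4 2) // (d 4 3) // (d 4 4) // (d 4 5) //=; ring.
- rewrite !dotE (d 5 0) // (d 5 1) // (d 5 2) // (d 5 3) // (d 5 4) // (d 5 5) //=; ring.
have {}e : (mx6 s)^T *m mx6 t = 1%:M.
  by rewrite -[mx6 t]trmxK -trmx_mul (mulmx1C e) trmx1.
rewrite -{1}[X]mulmx1 -e mulmxA mulmx_sum_row.
have c k : (k < 6)%N -> forall i : 'I_6, i = k :> nat ->
    (X *m (mx6 s)^T) 0 i *: row i (mx6 t) = dot s`_k X *: t`_k.
  move=> _ i <-; rewrite rowK; congr (_ *: _); rewrite dotC /dot !mxE.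
  by apply: eq_bigr => j _; rewrite !mxE.
rewrite 6!big_ord_recr big_ord0.
by rewrite /= add0r (c 0) // (c 1) // (c 2) // (c 3) // (c 4) // (c 5).
Qed.

Lemma dual_ev (e1 e2 e3 e4 e5 e6 x1 x2 x3 x4 x5 x6 : 'rV[K]_6) :
  dual e1 e2 e3 e4 e5 e6 x1 x2 x3 x4 x5 x6 ->
  ((dot e1 x1 = 1) * (dot e2 x1 = 0) * (dot e3 x1 = 0) * (dot e4 x1 = 0) * (dot e5 x1 = 0) * (dot e6 x1 = 0)) *
  ((dot e1 x2 = 0) * (dot e2 x2 = 1) * (dot e3 x2 = 0) * (dot e4 x2 = 0) * (dot e5 x2 = 0) * (dot e6 x2 = 0)) *
  ((dot e1 x3 = 0) * (dot e2 x3 = 0) * (dot e3 x3 = 1) * (dot e4 x3 = 0) * (dot e5 x3 = 0) * (dot e6 x3 = 0)) *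
  ((dot e1 x4 = 0) * (dot e2 x4 = 0) * (dot e3 x4 = 0) * (dot e4 x4 = 1) * (dot e5 x4 = 0) * (dot e6 x4 = 0)) *
  ((dot e1 x5 = 0) * (dot e2 x5 = 0) * (dot e3 x5 = 0) * (dot e4 x5 = 0) * (dot e5 x5 = 1) * (dot e6 x5 = 0)) *
  ((dot e1 x6 = 0) * (dot e2 x6 = 0) * (dot e3 x6 = 0) * (dot e4 x6 = 0) * (dot e5 x6 = 0) * (dot e6 x6 = 1)).
Proof.
move=> d.
have := (dual1 d 1 0 0 0 0 0, dual2 d 1 0 0 0 0 0, dual3 d 1 0 0 0 0 0, dual4 d 1 0 0 0 0 0, dual5 d 1 0 0 0 0 0, dual6 d 1 0 0 0 0 0).
rewrite scale1r !scale0r ?addr0 ?add0r => h1.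
have := (dual1 d 0 1 0 0 0 0, dual2 d 0 1 0 0 0 0, dual3 d 0 1 0 0 0 0, dual4 d 0 1 0 0 0 0, dual5 d 0 1 0 0 0 0, dual6 d 0 1 0 0 0 0).
rewrite scale1r !scale0r ?addr0 ?add0r => h2.
have := (dual1 d 0 0 1 0 0 0, dual2 d 0 0 1 0 0 0, dual3 d 0 0 1 0 0 0, dual4 d 0 0 1 0 0 0, dual5 d 0 0 1 0 0 0, dual6 d 0 0 1 0 0 0).
rewrite scale1r !scale0r ?addr0 ?add0r => h3.
have := (dual1 d 0 0 0 1 0 0, dual2 d 0 0 0 1 0 0, dual3 d 0 0 0 1 0 0, dual4 d 0 0 0 1 0 0, dual5 d 0 0 0 1 0 0, dual6 d 0 0 0 1 0 0).
rewrite scale1r !scale0r ?addr0 ?add0r => h4.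
have := (dual1 d 0 0 0 0 1 0, dual2 d 0 0 0 0 1 0, dual3 d 0 0 0 0 1 0, dual4 d 0 0 0 0 1 0, dual5 d 0 0 0 0 1 0, dual6 d 0 0 0 0 1 0).
rewrite scale1r !scale0r ?addr0 ?add0r => h5.
have := (dual1 d 0 0 0 0 0 1, dual2 d 0 0 0 0 0 1, dual3 d 0 0 0 0 0 1, dual4 d 0 0 0 0 0 1, dual5 d 0 0 0 0 0 1, dual6 d 0 0 0 0 0 1).
rewrite scale1r !scale0r ?addr0 ?add0r => h6.
by rewrite !h1 !h2 !h3 !h4 !h5 !h6.
Qed.

Lemma coframe_mx6 f1 f2 f3 f4 f5 f6 : coframe f1 f2 f3 f4 f5 f6 ->
  mx6 [:: f1; f2; f3; f4; f5; f6] \in unitmx.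
Proof.
move=> h; rewrite -unitmx_tr -row_free_unit; apply/row_freeP.
suff /row_freeP[B hB] : row_free (mx6 [:: f1; f2; f3; f4; f5; f6])^T by exists B.
rewrite -kermx_eq0; apply/eqP/row_matrixP => i; rewrite row0.
have := sub_kermxP (row_sub i (kermx (mx6 [:: f1; f2; f3; f4; f5; f6])^T)).
move: (row i _) => X e.
have z k : (k < 6)%N -> dot [:: f1; f2; f3; f4; f5; f6]`_k X = 0.
  move=> hk; have /matrixP/(_ 0 (Ordinal hk)) := e; rewrite mxE [RHS]mxE => <-.
  by rewrite dotC /dot mxE; apply: eq_bigr => j _; rewrite !mxE.
by apply: h; [apply: (z 0)|apply: (z 1)|apply: (z 2)|apply: (z 3)|apply: (z 4)|apply: (z 5)].
Qed.

Lemma coframe_dual f1 f2 f3 f4 f5 f6 : coframe f1 f2 f3 f4 f5 f6 ->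
  exists x1 x2 x3 x4 x5 x6,
  mx6 [:: f1; f2; f3; f4; f5; f6] *m (mx6 [:: x1; x2; x3; x4; x5; x6])^T = 1%:M.
Proof.
move=> /coframe_mx6 u; set P := mx6 _ in u *.
pose x k := row (inord k) (invmx P)^T.
exists (x 0%N), (x 1%N), (x 2), (x 3), (x 4), (x 5).
rewrite (_ : (mx6 _)^T = invmx P) ?mulmxV //; apply/trmx_inj; rewrite trmxK.
apply/row_matrixP => i; rewrite rowK /x.
by case: i => [[|[|[|[|[|[|i]]]]]] hi] //=; congr (row _ _); apply/val_inj; rewrite /= inordK.
Qed.

End DualFrames.

(** * Brackets, differentials and complexification *)

Section Complexification.
Variables (R : realType) (n : nat).
Local Notation C := R[i].
Local Notation V := 'rV[R]_n.
Local Notation toC := (map_mx (real_complex R)).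
Variable g : lie_algebra R n.
Implicit Types (eta a b x y z : V) (X Y Z : 'rV[C]_n) (c : R).

Lemma toC_D m p (A B : 'M[R]_(m, p)) : toC (A + B) = toC A + toC B :> 'M[C]_(m, p).
Proof. exact: map_mxD. Qed.
Lemma toC_Z m p c (A : 'M[R]_(m, p)) : toC (c *: A) = c%:C%C *: toC A :> 'M[C]_(m, p).
Proof. exact: map_mxZ. Qed.
Lemma toC_N m p (A : 'M[R]_(m, p)) : toC (- A) = - toC A :> 'M[C]_(m, p).
Proof. exact: map_mxN. Qed.
Lemma toC_0 m p : toC 0 = 0 :> 'M[C]_(m, p).
Proof. exact: map_mx0. Qed.
Lemma toC_wd a b : toC (wd a b) = wd (toC a) (toC b) :> 'M[C]_n.
Proof. by rewrite /wd map_mxB !map_mxM !map_trmx. Qed.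
Lemma toC_sum I (r : seq I) (P : pred I) (F : I -> V) :
  toC (\sum_(i <- r | P i) F i) = \sum_(i <- r | P i) toC (F i).
Proof. by elim/big_rec2: _ => [|i x y _ <-]; rewrite ?toC_0 ?toC_D. Qed.
Definition toCE := (toC_D, toC_Z, toC_N, toC_0, toC_wd).

Lemma real_imaginary X :
  X = toC (map_mx (@complex.Re R) X) + 'i%C *: toC (map_mx (@complex.Im R) X).
Proof.
apply/rowP => k; rewrite !mxE; case: (X 0 k) => a b.
by apply/eqP; rewrite eq_complex /= !(mul0r, mulr0, mul1r, add0r, addr0, subr0) !eqxx.
Qed.

Lemma dot_toC a x : dot (toC a) (toC x) = (dot a x)%:C%C.
Proof. by rewrite /dot map_trmx -map_mxM mxE. Qed.

Lemma ev2_toC A x y : ev2 (toC A) (toC x) (toC y) = (ev2 A x y)%:C%C.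
Proof. by rewrite /ev2 map_trmx -!map_mxM mxE. Qed.

(** The matrix of the 2-form [d eta]. *)
Definition dmx eta : 'M[R]_n :=
  \matrix_(j, k) - dot eta (g (basis_vec R j) (basis_vec R k)).

Lemma brDl x y z : g (x + y) z = g x z + g y z.
Proof. by have := bracket_linearl g 1 x y z; rewrite !scale1r. Qed.
Lemma brDr x y z : g z (x + y) = g z x + g z y.
Proof. by have := bracket_linearr g 1 x y z; rewrite !scale1r. Qed.
Lemma br0l z : g 0 z = 0.
Proof. by have /eqP := brDl 0 0 z; rewrite addr0 -subr_eq0 opprD addNKr oppr_eq0 => /eqP. Qed.
Lemma br0r z : g z 0 = 0.
Proof. by have /eqP := brDr 0 0 z; rewrite addr0 -subr_eq0 opprD addNKr oppr_eq0 => /eqP. Qed.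
Lemma brZl c x z : g (c *: x) z = c *: g x z.
Proof. by have := bracket_linearl g c x 0 z; rewrite br0l !addr0. Qed.
Lemma brZr c x z : g z (c *: x) = c *: g z x.
Proof. by have := bracket_linearr g c x 0 z; rewrite br0r !addr0. Qed.
Lemma br_anti x y : g y x = - g x y.
Proof.
have := bracket_alt g (x + y); rewrite brDl !brDr !bracket_alt addr0 add0r => /eqP.
by rewrite addrC addr_eq0 => /eqP.
Qed.

Lemma br_suml I (r : seq I) (P : pred I) (F : I -> V) z :
  g (\sum_(i <- r | P i) F i) z = \sum_(i <- r | P i) g (F i) z.
Proof. by elim/big_rec2: _ => [|i x y _ <-]; rewrite ?br0l ?brDl. Qed.
Lemma br_sumr I (r : seq I) (P : pred I) (F : I -> V) z :
  g z (\sum_(i <- r | P i) F i) = \sum_(i <- r | P i) g z (F i).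
Proof. by elim/big_rec2: _ => [|i x y _ <-]; rewrite ?br0r ?brDr. Qed.

Lemma ev2_dmx eta x y : ev2 (dmx eta) x y = - dot eta (g x y).
Proof.
rewrite ev2_sum {2}(row_decomp x) br_suml dot_sumr -sumrN; apply: eq_bigr => j _.
rewrite {2}(row_decomp y) br_sumr dot_sumr -sumrN; apply: eq_bigr => k _.
by rewrite brZl brZr !dotZr mxE; ring.
Qed.

Lemma dot_br eta x y : dot eta (g x y) = - ev2 (dmx eta) x y.
Proof. by rewrite ev2_dmx opprK. Qed.

Lemma dot_brC eta X Y : dot (toC eta) (bracketC g X Y) = - ev2 (toC (dmx eta)) X Y.
Proof.
rewrite ev2_sum /bracketC dot_sumr -sumrN; apply: eq_bigr => j _.
rewrite dot_sumr -sumrN; apply: eq_bigr => k _.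
by rewrite dotZr dot_toC !mxE rmorphN /=; ring.
Qed.

Lemma dmxD eta eta' : dmx (eta + eta') = dmx eta + dmx eta'.
Proof. by apply/matrixP => j k; rewrite !mxE dotDl opprD. Qed.
Lemma dmxZ c eta : dmx (c *: eta) = c *: dmx eta.
Proof. by apply/matrixP => j k; rewrite !mxE dotZl mulrN. Qed.
Lemma dmxN eta : dmx (- eta) = - dmx eta.
Proof. by rewrite -scaleN1r dmxZ scaleN1r. Qed.
Definition dmxE := (dmxD, dmxZ, dmxN).

Lemma bracketC_toC x y : bracketC g (toC x) (toC y) = toC (g x y).
Proof.
rewrite [in RHS](row_decomp x) br_suml toC_sum; apply: eq_bigr => j _.
rewrite [in RHS](row_decomp y) br_sumr toC_sum; apply: eq_bigr => k _.
by rewrite brZl brZr !toC_Z scalerA !mxE.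
Qed.

(** Jacobi, that is d d eta = 0. *)
Lemma dd0 eta x y z :
  ev2 (dmx eta) x (g y z) + ev2 (dmx eta) y (g z x) + ev2 (dmx eta) z (g x y) = 0.
Proof.
rewrite !ev2_dmx -!opprD -!dotDr bracket_jacobi.
by rewrite dot0r oppr0.
Qed.

Lemma bracketC_anti X Y : bracketC g Y X = - bracketC g X Y.
Proof.
rewrite /bracketC exchange_big -sumrN; apply: eq_bigr => j _; rewrite -sumrN; apply: eq_bigr => k _.
by rewrite br_anti toC_N scalerN mulrC.
Qed.

End Complexification.
Arguments dmxE {R n g}.
Arguments toCE {R n}.

(** * Pure spinors *)

Section TwoForms.
Variables (n : nat) (K : comNzRingType).
Local Notation mono1 k := (monomial K [set k]%SET).

Lemma twoformE (F : 'I_n -> 'I_n -> K) : twoform F =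
  \sum_(j < n) \sum_(k < n | (j < k)%N) F j k *: wedge (mono1 j) (mono1 k).
Proof.
apply: eq_bigr => j _; apply: eq_bigr => k jk; rewrite wedge_mono11.
case: (j =P k) => [e|_]; first by rewrite e ltnn in jk.
by rewrite ltnNge (ltnW jk) /= scale1r.
Qed.

Lemma homogeneous_twoform (F : 'I_n -> 'I_n -> K) : homogeneous 2 (twoform F).
Proof.
move=> S nS; rewrite sum_ffunE big1 // => j _; rewrite sum_ffunE big1 // => k jk.
rewrite !ffunE; case: eqP => [e|]; last by rewrite scaler0.
by move: nS; rewrite e cards2; case: (j =P k) jk => [->|//]; rewrite ltnn.
Qed.

Lemma contract_twoform (v : 'rV[K]_n) (F : 'I_n -> 'I_n -> K) :
  (forall j k, F k j = - F j k) -> (forall j, F j j = 0) ->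
  contract v (twoform F) = oneform (v *m \matrix_(j, k) F j k).
Proof.
move=> Fa F0; rewrite twoformE contract_sumr.
under eq_bigr => j _.
  rewrite contract_sumr; under eq_bigr => k _.
    rewrite contractZr -!oneform_delta contract_wedge1 contract_oneform wedgeZr wedge1r.
    rewrite !oneform_delta !(dotC _ v) !dot_delta scalerBr !scalerA; over.
  rewrite sumrB; over.
rewrite sumrB /oneform.
under [RHS]eq_bigr => k _ do rewrite mxE scaler_suml.
rewrite [RHS]exchange_big [X in _ - X](exchange_big_dep xpredT) //= -sumrB.
apply: eq_bigr => j _.
rewrite [RHS](bigID (fun k : 'I_n => (j < k)%N)) /=; congr (_ + _).
  by apply: eq_bigr => k _; rewrite mxE mulrC.
rewrite -sumrN [RHS](bigD1 j) ?ltnn //= mxE F0 mulr0 scale0r add0r.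
apply: eq_big => [k|k _]; first by rewrite -leqNgt ltn_neqAle andbC.
by rewrite mxE (Fa j k) mulNr scaleNr opprK mulrC.
Qed.

End TwoForms.

Section SpinorLine.
Variables (n : nat) (K : numFieldType).
Implicit Types (t xi X Z : 'rV[K]_n) (v : 'rV[K]_(n + n)) (F phi : form K n).

Definition ann2 t1 t2 X := dot t1 X = 0 /\ dot t2 X = 0.

Definition contract_row X F : 'rV[K]_n := \row_k (contract X F [set k]%SET : K).

Lemma homog2_eq0 F : homogeneous 2 F -> (forall X, contract X F = 0) -> F = 0.
Proof. by move=> hF /contract_eq0 ->; rewrite hF ?cards0 // scale0r. Qed.

Lemma wedge_oneform (a b : 'rV[K]_n) :
  wedge (oneform a) (oneform b) = twoform (wd a b).
Proof.
have hd : homogeneous 2 (wedge (oneform a) (oneform b) + (-1) *: twoform (wd a b)).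
  apply: homogeneousD; first by apply: (@homogeneous_wedge _ _ 1 1); apply: homogeneous_oneform.
  exact/homogeneousZ/homogeneous_twoform.
suff /eqP : wedge (oneform a) (oneform b) + (-1) *: twoform (wd a b) = 0.
  by rewrite scaleN1r subr_eq0 => /eqP.
apply: homog2_eq0 => // v; rewrite contractDr contractZr contract_twoform; first last.
- by move=> j; rewrite !mxE !big_ord1 !mxE mulrC subrr.
- by move=> j k; rewrite !mxE !big_ord1 !mxE; ring.
rewrite contract_wedge1 contract_oneform wedgeZr wedge1r scaleN1r.
rewrite -!oneformZ -!oneformN -!oneformD (_ : _ - _ = 0) ?oneform0 //.
apply: dot_eq => x; rewrite !dotE; apply/eqP; rewrite subr_eq0 eq_sym; apply/eqP.
have -> : \matrix_(j, k) wd a b j k = wd a b by apply/matrixP => j k; rewrite mxE.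
have -> : dot (v *m wd a b) x = ev2 (wd a b) v x by [].
by rewrite ev2_wd; ring.
Qed.

(** The maximal isotropic subspace of all X + xi with X annihilated by t1 and t2,
    and xi equal to minus the interior product of F by X on the annihilator of t1
    and t2. *)
Definition isotropic_of t1 t2 F v := ann2 t1 t2 (lsubmx v) /\
  forall Z, ann2 t1 t2 Z -> dot (rsubmx v) Z + dot (contract_row (lsubmx v) F) Z = 0.

Lemma ann2_span t1 t2 X1 X2 xi :
  dot t1 X1 = 1 -> dot t2 X2 = 1 -> dot t1 X2 = 0 -> dot t2 X1 = 0 ->
  (forall Z, ann2 t1 t2 Z -> dot xi Z = 0) -> xi = dot xi X1 *: t1 + dot xi X2 *: t2.
Proof.
move=> t11 t22 t12 t21 h; apply: dot_eq => Z.
have := h (Z - dot t1 Z *: X1 - dot t2 Z *: X2).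
rewrite /ann2 !dotE t11 t22 t12 t21 => e.
have /eqP : dot xi Z - dot t1 Z * dot xi X1 - dot t2 Z * dot xi X2 = 0.
  by apply: e; split; ring.
by rewrite -addrA -opprD subr_eq0 => /eqP ->; ring.
Qed.

(** Conjugation by exp F in the Clifford algebra is a shear. *)
Lemma clifford_exp F v phi : (0 < n)%N -> homogeneous 2 F ->
  clifford v (wedge (form_exp F) phi) = wedge (form_exp F)
    (contract (lsubmx v) phi + wedge (oneform (rsubmx v + contract_row (lsubmx v) F)) phi).
Proof.
move=> n0 hF; rewrite /clifford contract_exp_wedge // wedge_one_exp // -wedgeDr.
rewrite oneformD wedgeDl -homog2_contract //; congr wedge.
by rewrite [RHS]addrCA [RHS]addrC [contract _ _ + _]addrC.
Qed.

Lemma wedge_exp_eq0 F phi : (0 < n)%N -> homogeneous 2 F ->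
  wedge (form_exp F) phi = 0 -> phi = 0.
Proof.
move=> n0 hF /(congr1 (wedge (form_exp (- F)))).
have hNF : homogeneous 2 (- F) by rewrite -scaleN1r; apply: homogeneousZ.
by rewrite wedge0r -wedgeA -{2}[F]opprK wedge_expN // wedge1l.
Qed.

(** Multiplication by exp (- F) reduces this to [annihilated_form]. *)
Lemma pure_spinor_line t1 t2 X1 X2 F : (0 < n)%N -> homogeneous 2 F ->
  dot t1 X1 = 1 -> dot t2 X2 = 1 -> dot t1 X2 = 0 -> dot t2 X1 = 0 ->
  forall phi, (forall v, isotropic_of t1 t2 F v -> clifford v phi = 0) <->
    exists c, phi = c *: wedge (form_exp F) (wedge (oneform t1) (oneform t2)).
Proof.
move=> n0 hF t11 t22 t12 t21 phi.
have hNF : homogeneous 2 (- F) by rewrite -scaleN1r; apply: homogeneousZ.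
split=> [kphi|[c ->] v [[e1 e2] hv]]; last first.
  rewrite -wedgeZr clifford_exp // [rsubmx v + _](ann2_span t11 t22 t12 t21); last first.
    by move=> Z aZ; rewrite dotDl hv.
  rewrite contractZr contract_wedge1 contract_oneform e1 e2 !scale0r wedge0r subr0 scaler0 add0r.
  rewrite wedgeZr oneformD !oneformZ wedgeDl !wedgeZl wedge_oneform_sq scaler0 add0r.
  have -> : wedge (oneform t2) (wedge (oneform t1) (oneform t2)) = 0.
    by rewrite (wedge_oneC t1) -scaleN1r wedgeZr wedge_oneform_sq scaler0.
  by rewrite !scaler0 wedge0r.
have w0 t : (forall Z, ann2 t1 t2 Z -> dot t Z = 0) -> wedge (oneform t) phi = 0.
  move=> h; have := kphi (row_mx 0 t); rewrite /isotropic_of /clifford row_mxKl row_mxKr.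
  rewrite contract0l add0r; apply; split; first by rewrite /ann2 !dot0r.
  move=> Z aZ; rewrite h // add0r; rewrite (_ : contract_row 0 F = 0) ?dot0l //.
  by apply/rowP => k; rewrite !mxE contract0l ffunE.
have [||X [aX1 aX2]|c hc] := @annihilated_form n K t1 t2 X1 X2 (wedge (form_exp (- F)) phi) t11 t22 t12 t21.
- by rewrite wedge_one_exp // w0 ?wedge0r // => Z [].
- by rewrite wedge_one_exp // w0 ?wedge0r // => Z [].
- rewrite contract_exp_wedge // (_ : _ + _ = 0) ?wedge0r //.
  have := kphi (row_mx X (- contract_row X F)).
  rewrite /isotropic_of /clifford row_mxKl row_mxKr => <-; last first.
    by split=> // Z _; rewrite dotNl addNr.
  rewrite addrC oneformN -homog2_contract //; congr (_ + _).
  by rewrite contractNr wedgeNl.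
exists c; rewrite -wedgeZr -hc -wedgeA wedge_expN // wedge1l //.
Qed.

End SpinorLine.

(** * Left-invariant calculus and the Courant bracket *)

Section LeftInvariant.
Variables (R : realType) (n : nat) (g : lie_algebra R n.+1).
Local Notation V := 'rV[R]_n.+1.

Lemma iterated_bracket_pow (x a : V) w : a = x \/ a = 0 -> (forall b, b \in w -> b = x \/ b = 0) ->
  (0 < size w)%N -> iterated_bracket g a w = 0.
Proof.
elim: w a => // b w IH a ha hw _ /=.
case: w IH hw => [|c w] IH hw.
  have hb : b = x \/ b = 0 by apply: hw; rewrite inE eqxx.
  by case: ha hb => -> [] -> /=; rewrite ?bracket_alt ?br0l ?br0r.
rewrite IH ?br0r //; first by apply: hw; rewrite inE eqxx.
by move=> d dw; apply: hw; rewrite inE dw orbT.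
Qed.

Lemma dynkin_word_mem (x y : V) k (f : 'I_k -> 'I_n.+2 * 'I_n.+2) b :
  b \in dynkin_word x y f -> b = x \/ b = y.
Proof.
case/flattenP => s /mapP[i _ ->]; rewrite mem_cat !mem_nseq.
by case/orP=> /andP[_ /eqP ->]; [left|right].
Qed.

Lemma size_dynkin_word (x y : V) k (f : 'I_k -> 'I_n.+2 * 'I_n.+2) :
  size (dynkin_word x y f) = (\sum_i ((f i).1 + (f i).2))%N.
Proof.
rewrite size_flatten /shape -map_comp sumnE big_map big_enum /=.
by apply: eq_bigr => i _; rewrite size_cat !size_nseq.
Qed.

(** The innermost bracket of a longer word in x and 0 is a bracket of two of x, 0. *)
Lemma word_bracket_x0 (x : V) k (f : 'I_k.+1 -> 'I_n.+2 * 'I_n.+2) :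
  [forall i, 0 < (f i).1 + (f i).2]%N ->
  ~ (k = 0%N /\ f ord0 = (inord 1, inord 0)) ->
  word_bracket g (dynkin_word x 0 f) = 0.
Proof.
move=> /forallP fpos nf.
have := dynkin_word_mem (f := f) (x := x) (y := 0).
case e: (dynkin_word x 0 f) => [|a w] //= hw.
have ha : a = x \/ a = 0 by apply: hw; rewrite inE eqxx.
have hw' b : b \in w -> b = x \/ b = 0 by move=> bw; apply: hw; rewrite inE bw orbT.
case: w e hw' {hw} => [|b w] e hw'; last exact: (iterated_bracket_pow ha hw').
have := size_dynkin_word x 0 f; rewrite e /=.
case: k f fpos nf e => [|k] f fpos nf e.
  rewrite big_ord_recl big_ord0 addn0.
  case ef : (f ord0) => [[r hr] [s hs]] /= ers.
  case: r hr ef ers => [|r] hr ef ers.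
    case: ha => // ax; move: e; rewrite /dynkin_word enum_ordSl enum_ord0 /= ef /= cats0.
    by case: s hs ef ers => [|s] //= hs ef _ [<-].
  case: nf; split=> //; rewrite ef; congr (_, _); apply/val_inj; rewrite /= inordK //; lia.
rewrite !big_ord_recl => e2; have := fpos ord0; have := fpos (lift ord0 ord0); lia.
Qed.

(** The unit law; it makes the curves along which the derivatives are taken start at
    the right point, and left-invariant objects constant. *)
Lemma bch_x0 (x : V) : bch g x 0 = x.
Proof.
rewrite /bch big_ord_recl [X in _ + X]big1 ?addr0; last first.
  move=> i _; rewrite big1 ?scaler0 // => f hf.
  by rewrite word_bracket_x0 ?scaler0 // => -[].
rewrite expr0 divr1 scale1r (bigD1 [ffun=> (inord 1, inord 0)]) /=; last first.
  by apply/forallP => i; rewrite ffunE /= !inordK.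
rewrite [X in _ + X]big1 ?addr0; last first.
  move=> f /andP[hf nf]; rewrite word_bracket_x0 ?scaler0 // => -[_ ef].
  by case/eqP: nf; apply/ffunP => i; rewrite ffunE (ord1 i).
set f0 := [ffun=> _].
have ef : f0 ord0 = (inord 1, inord 0) by rewrite ffunE.
have -> : dynkin_word x 0 f0 = [:: x].
  by rewrite /dynkin_word enum_ordSl enum_ord0 /= ef /= !inordK.
by rewrite big_ord1 ef /= !inordK //= !mulr1 invr1 scale1r.
Qed.

Lemma left_derive_cst k c p : left_derive g k (fun=> c) p = 0.
Proof. by rewrite /left_derive derive1_cst. Qed.

Lemma smooth_cst c : smooth g (fun=> c).
Proof.
move=> m; elim: m c => [|m IH] c /=; first by split=> //; apply: cst_continuous.
split; first exact: cst_continuous.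
move=> k; split=> [p|]; first exact: derivable_cst.
rewrite (_ : left_derive g k _ = fun=> 0) //.
by apply: boolp.funext => p; rewrite left_derive_cst.
Qed.

Lemma smoothC_cst (c : R[i]) : smoothC g (fun=> c).
Proof. by split; apply: smooth_cst. Qed.

Lemma left_deriveC_cst k (c : R[i]) p : left_deriveC g k (fun=> c) p = 0.
Proof. by rewrite /left_deriveC !left_derive_cst. Qed.

End LeftInvariant.

Section ComplexDerivative.
Variable R : realType.
Local Notation C := R[i].
Implicit Types (F G : R -> C).

Definition derivableC F := derivable (fun t => complex.Re (F t)) 0 1 /\
  derivable (fun t => complex.Im (F t)) 0 1.
Definition deriveC F : C := Complex (derive1 (fun t => complex.Re (F t)) 0)
  (derive1 (fun t => complex.Im (F t)) 0).

Lemma deriveC_cst c : deriveC (fun=> c) = 0.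
Proof. by rewrite /deriveC !derive1_cst. Qed.

Lemma derivableC_cst c : derivableC (fun=> c).
Proof. by split; apply: derivable_cst. Qed.

Let derive1D (u v : R -> R) : derivable u 0 1 -> derivable v 0 1 ->
  derivable (fun t => u t + v t) 0 1 /\
  derive1 (fun t => u t + v t) 0 = derive1 u 0 + derive1 v 0.
Proof.
move=> du dv; split; first exact: derivableD.
rewrite !derive1E; exact: (deriveD du dv).
Qed.

Let derive1B (u v : R -> R) : derivable u 0 1 -> derivable v 0 1 ->
  derivable (fun t => u t - v t) 0 1 /\
  derive1 (fun t => u t - v t) 0 = derive1 u 0 - derive1 v 0.
Proof.
move=> du dv; split; first exact: derivableB.
rewrite !derive1E; exact: (deriveB du dv).
Qed.

Let derive1M (u v : R -> R) : derivable u 0 1 -> derivable v 0 1 ->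
  derivable (fun t => u t * v t) 0 1 /\
  derive1 (fun t => u t * v t) 0 = u 0 * derive1 v 0 + v 0 * derive1 u 0.
Proof.
move=> du dv; split; first exact: (derivableM du dv).
rewrite !derive1E; exact: (deriveM du dv).
Qed.

Lemma deriveCD F G : derivableC F -> derivableC G ->
  derivableC (fun t => F t + G t) /\ deriveC (fun t => F t + G t) = deriveC F + deriveC G.
Proof.
move=> [F1 F2] [G1 G2]; rewrite /derivableC /deriveC.
have -> : (fun t => complex.Re (F t + G t)) = (fun t => complex.Re (F t) + complex.Re (G t)).
  by apply: boolp.funext => t /=; rewrite raddfD.
have -> : (fun t => complex.Im (F t + G t)) = (fun t => complex.Im (F t) + complex.Im (G t)).
  by apply: boolp.funext => t /=; rewrite raddfD.
have [d1 ->] := derive1D F1 G1; have [d2 ->] := derive1D F2 G2.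
by split.
Qed.

Lemma deriveCB F G : derivableC F -> derivableC G ->
  deriveC (fun t => F t - G t) = deriveC F - deriveC G.
Proof.
move=> [F1 F2] [G1 G2]; rewrite /deriveC.
have -> : (fun t => complex.Re (F t - G t)) = (fun t => complex.Re (F t) - complex.Re (G t)).
  by apply: boolp.funext => t /=; rewrite raddfB.
have -> : (fun t => complex.Im (F t - G t)) = (fun t => complex.Im (F t) - complex.Im (G t)).
  by apply: boolp.funext => t /=; rewrite raddfB.
by have [_ ->] := derive1B F1 G1; have [_ ->] := derive1B F2 G2.
Qed.

Lemma deriveCM F G : derivableC F -> derivableC G ->
  derivableC (fun t => F t * G t) /\
  deriveC (fun t => F t * G t) = deriveC F * G 0 + F 0 * deriveC G.
Proof.
move=> [F1 F2] [G1 G2]; rewrite /derivableC /deriveC.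
have -> : (fun t => complex.Re (F t * G t)) =
  (fun t => complex.Re (F t) * complex.Re (G t) - complex.Im (F t) * complex.Im (G t)).
  by apply: boolp.funext => t; case: (F t) => a b; case: (G t).
have -> : (fun t => complex.Im (F t * G t)) =
  (fun t => complex.Re (F t) * complex.Im (G t) + complex.Im (F t) * complex.Re (G t)).
  by apply: boolp.funext => t; case: (F t) => a b; case: (G t).
have [d1 e1] := derive1M F1 G1; have [d2 e2] := derive1M F2 G2.
have [d3 e3] := derive1M F1 G2; have [d4 e4] := derive1M F2 G1.
have [d5 ->] := derive1B d1 d2; have [d6 ->] := derive1D d3 d4.
rewrite e1 e2 e3 e4; split=> //.
move: (derive1 _ _) (derive1 _ _) (derive1 _ _) (derive1 _ _) => p q r s.
case: (F 0) => a b; case: (G 0) => c d /=.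
by apply/eqP; rewrite eq_complex /=; apply/andP; split; apply/eqP; ring.
Qed.

Lemma deriveC_sum (I : Type) (r : seq I) (P : pred I) (F : I -> R -> C) :
  (forall i, derivableC (F i)) ->
  derivableC (fun t => \sum_(i <- r | P i) F i t) /\
  deriveC (fun t => \sum_(i <- r | P i) F i t) = \sum_(i <- r | P i) deriveC (F i).
Proof.
move=> dF; elim: r => [|i r [IH1 IH2]].
  rewrite big_nil (_ : (fun t => _) = fun=> 0); last by apply: boolp.funext => t; rewrite big_nil.
  by split; [apply: derivableC_cst|rewrite deriveC_cst].
rewrite big_cons; case: (boolP (P i)) => Pi; last first.
  by rewrite (_ : (fun t => _) = (fun t => \sum_(j <- r | P j) F j t)); last
    by apply: boolp.funext => t; rewrite big_cons (negPf Pi).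
rewrite (_ : (fun t => _) = (fun t => F i t + \sum_(j <- r | P j) F j t)); last first.
  by apply: boolp.funext => t; rewrite big_cons Pi.
by rewrite -IH2; exact: (deriveCD (dF i) IH1).
Qed.

End ComplexDerivative.

Section Courant.
Variables (R : realType) (n : nat) (g : lie_algebra R n.+1).
Local Notation C := R[i].
Local Notation V := 'rV[R]_n.+1.
Local Notation toC := (map_mx (real_complex R)).
Implicit Types (X Y Z xi eta : 'rV[C]_n.+1) (u v w : 'rV[C]_(n.+1 + n.+1)) (p : V).

(** The matrix of [d eta] for a complex left-invariant 1-form [eta]. *)
Definition dmxC eta : 'M[C]_n.+1 :=
  \matrix_(j, k) - dot eta (toC (g (basis_vec R j) (basis_vec R k))).

Lemma ev2_dmxC eta X Y : ev2 (dmxC eta) X Y = - dot eta (bracketC g X Y).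
Proof.
rewrite ev2_sum /bracketC dot_sumr -sumrN; apply: eq_bigr => j _.
rewrite dot_sumr -sumrN; apply: eq_bigr => k _.
by rewrite dotZr !mxE; ring.
Qed.

Lemma dot_mulmx X (A : 'M[C]_n.+1) Z : dot (X *m A) Z = ev2 A X Z.
Proof. by []. Qed.

Lemma dot_dmxC X Y xi eta Z : dot (X *m dmxC eta - Y *m dmxC xi) Z =
  dot xi (bracketC g Y Z) - dot eta (bracketC g X Z).
Proof.
by rewrite dotDl dotNl (dot_mulmx X) (dot_mulmx Y) !ev2_dmxC opprK addrC.
Qed.

(** The Courant bracket of left-invariant sections. *)
Definition courant_alg u v : 'rV[C]_(n.+1 + n.+1) :=
  row_mx (bracketC g (lsubmx u) (lsubmx v))
    (lsubmx u *m dmxC (rsubmx v) - lsubmx v *m dmxC (rsubmx u)).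

Lemma courant_alg_row X xi Y eta : courant_alg (row_mx X xi) (row_mx Y eta) =
  row_mx (bracketC g X Y) (X *m dmxC eta - Y *m dmxC xi).
Proof. by rewrite /courant_alg !row_mxKl !row_mxKr. Qed.

Definition section_derive (s : V -> 'rV[C]_(n.+1 + n.+1)) p j :=
  \row_l left_deriveC g j (fun q => s q 0 l) p.

Lemma left_deriveCE k (f : V -> C) p :
  left_deriveC g k f p = deriveC (fun t => f (bch g p (t *: basis_vec R k))).
Proof. by []. Qed.

Lemma smoothC_derivable k (f : V -> C) p : smoothC g f ->
  derivableC (fun t => f (bch g p (t *: basis_vec R k))).
Proof. by move=> [/(_ 1)[_ /(_ k)[r _]] /(_ 1)[_ /(_ k)[i _]]]; split. Qed.

Lemma dot_mxE (K : comNzRingType) m (a b : 'rV[K]_m) : dot a b = \sum_k a 0 k * b 0 k.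
Proof. by rewrite /dot mxE; apply: eq_bigr => k _; rewrite mxE. Qed.

Lemma left_deriveC_dot k m (s t : V -> 'rV[C]_m) p :
  (forall l, smoothC g (fun q => s q 0 l)) -> (forall l, smoothC g (fun q => t q 0 l)) ->
  derivableC (fun r => dot (s (bch g p (r *: basis_vec R k))) (t (bch g p (r *: basis_vec R k)))) /\
  left_deriveC g k (fun q => dot (s q) (t q)) p =
  dot (\row_l left_deriveC g k (fun q => s q 0 l) p) (t p) +
  dot (s p) (\row_l left_deriveC g k (fun q => t q 0 l) p).
Proof.
move=> hs ht; rewrite left_deriveCE.
rewrite (_ : (fun r => dot _ _) = (fun r => \sum_l s (bch g p (r *: basis_vec R k)) 0 l *
  t (bch g p (r *: basis_vec R k)) 0 l)); last by apply: boolp.funext => r; rewrite dot_mxE.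
have dst l := deriveCM (smoothC_derivable k p (hs l)) (smoothC_derivable k p (ht l)).
have [dS ->] := deriveC_sum (index_enum _) xpredT (fun l => (dst l).1).
split=> //; rewrite !dot_mxE -big_split; apply: eq_bigr => l _.
by rewrite (dst l).2 !scale0r !bch_x0 !mxE.
Qed.

Lemma left_deriveCB_dot k m (s t s' t' : V -> 'rV[C]_m) p :
  (forall l, smoothC g (fun q => s q 0 l)) -> (forall l, smoothC g (fun q => t q 0 l)) ->
  (forall l, smoothC g (fun q => s' q 0 l)) -> (forall l, smoothC g (fun q => t' q 0 l)) ->
  left_deriveC g k (fun q => dot (s q) (t q) - dot (s' q) (t' q)) p =
  (dot (\row_l left_deriveC g k (fun q => s q 0 l) p) (t p) +
   dot (s p) (\row_l left_deriveC g k (fun q => t q 0 l) p)) -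
  (dot (\row_l left_deriveC g k (fun q => s' q 0 l) p) (t' p) +
   dot (s' p) (\row_l left_deriveC g k (fun q => t' q 0 l) p)).
Proof.
move=> hs ht hs' ht'.
rewrite -(left_deriveC_dot k p hs ht).2 -(left_deriveC_dot k p hs' ht').2 !left_deriveCE.
by rewrite (deriveCB (left_deriveC_dot k p hs ht).1 (left_deriveC_dot k p hs' ht').1).
Qed.

(** Differentiating a linear equation satisfied by a section: the derivatives of
    the sections of a left-invariant bundle are sections of it. *)
Lemma left_deriveC_ann k m (s : V -> 'rV[C]_m) (c : 'rV[C]_m) p :
  (forall l, smoothC g (fun q => s q 0 l)) -> (forall q, dot (s q) c = 0) ->
  dot (\row_l left_deriveC g k (fun q => s q 0 l) p) c = 0.
Proof.
move=> hs sc.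
have [_] := left_deriveC_dot k p hs (t := fun=> c) (fun l => smoothC_cst _ _).
rewrite (_ : (fun q => _) = fun=> 0); last by apply: boolp.funext => q; rewrite sc.
rewrite left_deriveC_cst [X in dot (s p) X](_ : _ = 0) ?dot0r ?addr0 //.
by apply/rowP => l; rewrite !mxE left_deriveC_cst.
Qed.

Lemma covector_contract X (F : 'I_n.+1 -> 'I_n.+1 -> C) :
  (forall j k, F k j = - F j k) -> (forall j, F j j = 0) ->
  covector (contract X (twoform F)) = X *m \matrix_(j, k) F j k.
Proof.
move=> Fa F0; rewrite contract_twoform //; apply/rowP => k; rewrite mxE sum_ffunE.
rewrite (bigD1 k) //= big1 ?addr0; first by rewrite !ffunE eqxx /GRing.scale /= mulr1.
move=> j jk; rewrite !ffunE; case: eqP => [/finset.set1_inj e|_]; last by rewrite scaler0.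
by rewrite e eqxx in jk.
Qed.

Lemma exterior_d_contract X (eta : V -> 'rV[C]_n.+1) p :
  covector (contract X (exterior_d g eta p)) = X *m dmxC (eta p) +
  \row_k \sum_j X 0 j * (left_deriveC g j (fun q => eta q 0 k) p - left_deriveC g k (fun q => eta q 0 j) p).
Proof.
rewrite /exterior_d covector_contract; first last.
- by move=> j; rewrite subrr sub0r bracket_alt toC_0 dot0r oppr0.
- by move=> j k; rewrite (br_anti g (basis_vec R j)) toC_N dotNr; ring.
apply/rowP => k; rewrite !mxE -big_split; apply: eq_bigr => j _.
by rewrite !mxE /=; ring.
Qed.

Lemma courant_cst u v p : courant g (fun=> u) (fun=> v) p = courant_alg u v.
Proof.
have d0 m (w : 'rV[C]_m) j k : left_deriveC g j (fun=> w 0 k) p = 0 by rewrite left_deriveC_cst.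
rewrite /courant /courant_alg /vf_bracket; congr row_mx.
  rewrite (_ : \row_k _ = 0) ?add0r //; apply/rowP => k; rewrite !mxE big1 // => j _.
  by rewrite !d0 !mulr0 subrr.
have e0 X eta : covector (contract X (exterior_d g (fun=> eta) p)) = X *m dmxC eta.
  rewrite exterior_d_contract (_ : \row_k _ = 0) ?addr0 //.
  by apply/rowP => k; rewrite !mxE big1 // => j _; rewrite !d0 subrr mulr0.
have d1 (c : C) : 2^-1 *: differential g (fun=> c) p = 0.
  by apply/rowP => k; rewrite !mxE left_deriveC_cst mulr0.
by rewrite -[RHS]addr0 -(d1 (dot (rsubmx v) (lsubmx u) - dot (rsubmx u) (lsubmx v))) -!e0.
Qed.

(** The bracket of two sections is the bracket of their values up to derivatives of
    the sections and pairings of these with the sections: on an isotropic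
    left-invariant bundle the former stay in the bundle and the latter vanish. *)
Lemma courant_expand (s t : V -> 'rV[C]_(n.+1 + n.+1)) p :
  (forall l, smoothC g (fun q => s q 0 l)) -> (forall l, smoothC g (fun q => t q 0 l)) ->
  courant g s t p = courant_alg (s p) (t p)
   + \sum_j s p 0 (lshift n.+1 j) *: section_derive t p j
   - \sum_j t p 0 (lshift n.+1 j) *: section_derive s p j
   + row_mx 0 (\row_k (pairing (section_derive s p k) (t p) - pairing (s p) (section_derive t p k))).
Proof.
move=> hs ht.
have sumE (a : V -> 'rV[C]_(n.+1 + n.+1)) (c : 'I_n.+1 -> C) l :
  (\sum_j c j *: section_derive a p j) 0 l = \sum_j c j * left_deriveC g j (fun q => a q 0 l) p.
  by rewrite summxE; apply: eq_bigr => j _; rewrite !mxE.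
have lE (a : V -> 'rV[C]_(n.+1 + n.+1)) k :
  (fun q => lsubmx (a q) 0 k) = (fun q => a q 0 (lshift n.+1 k)).
  by apply: boolp.funext => q; rewrite mxE.
have rE (a : V -> 'rV[C]_(n.+1 + n.+1)) k :
  (fun q => rsubmx (a q) 0 k) = (fun q => a q 0 (rshift n.+1 k)).
  by apply: boolp.funext => q; rewrite mxE.
have aE m (A B : 'rV[C]_m) l : (A + B) 0 l = A 0 l + B 0 l by rewrite mxE.
have nE m (A : 'rV[C]_m) l : (- A) 0 l = - A 0 l by rewrite mxE.
have zE m c (A : 'rV[C]_m) l : (c *: A) 0 l = c * A 0 l by rewrite mxE.
have diffE f k : differential g f p 0 k = left_deriveC g k f p by rewrite mxE.
have rowE (f : 'I_n.+1 -> C) k : (\row_j f j) 0 k = f k by rewrite mxE.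
apply/rowP => l; rewrite !aE nE !sumE.
case: (split_ordP l) => k ->.
  rewrite /courant /courant_alg !row_mxEl /vf_bracket aE [X in X + _]mxE [X in _ = _ + X]mxE addr0.
  rewrite sumrB !lE addrC -addrA; congr (_ + (_ - _)).
    by apply: eq_bigr => j _; rewrite [in LHS]mxE.
  by apply: eq_bigr => j _; rewrite [in LHS]mxE.
have sl a : (forall l, smoothC g (fun q => (a : V -> 'rV[C]_(n.+1 + n.+1)) q 0 l)) ->
  forall l, smoothC g (fun q => lsubmx (a q) 0 l) by move=> h j; rewrite lE.
have sr a : (forall l, smoothC g (fun q => (a : V -> 'rV[C]_(n.+1 + n.+1)) q 0 l)) ->
  forall l, smoothC g (fun q => rsubmx (a q) 0 l) by move=> h j; rewrite rE.
have dl a : \row_j left_deriveC g k (fun q => lsubmx ((a : V -> 'rV[C]_(n.+1 + n.+1)) q) 0 j) p =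
  lsubmx (section_derive a p k) by apply/rowP => j; rewrite !mxE lE.
have dr a : \row_j left_deriveC g k (fun q => rsubmx ((a : V -> 'rV[C]_(n.+1 + n.+1)) q) 0 j) p =
  rsubmx (section_derive a p k) by apply/rowP => j; rewrite !mxE rE.
rewrite /courant /courant_alg !row_mxEr !aE !nE zE diffE.
rewrite left_deriveCB_dot; [|by auto..].
rewrite (dl s) (dl t) (dr s) (dr t).
have e1 := exterior_d_contract (lsubmx (s p)) (fun q => rsubmx (t q)) p.
have e2 := exterior_d_contract (lsubmx (t p)) (fun q => rsubmx (s q)) p.
have step (A B A' B' : 'rV[C]_n.+1) (r rhs : C) :
  A = A' -> B = B' -> A' 0 k - B' 0 k + r = rhs -> A 0 k - B 0 k + r = rhs by move=> -> ->.
apply: (step _ _ _ _ _ _ e1 e2) => {step e1 e2}.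
rewrite !aE (rowE (fun k => pairing _ _ - _)).
have eX (X : 'rV[C]_n.+1) (a : V -> 'rV[C]_(n.+1 + n.+1)) :
  \sum_j X 0 j * (left_deriveC g j (fun q => rsubmx (a q) 0 k) p - left_deriveC g k (fun q => rsubmx (a q) 0 j) p) =
  \sum_j X 0 j * left_deriveC g j (fun q => a q 0 (rshift n.+1 k)) p - dot (rsubmx (section_derive a p k)) X.
  rewrite dot_mxE -sumrB; apply: eq_bigr => j _; rewrite rE -dr [X in _ = _ - X * _]mxE mulrBr.
  by congr (_ - _); rewrite mulrC.
rewrite [(\row_k _) 0 k]mxE [(\row_k (\sum_j lsubmx (t p) 0 j * _)) 0 k]mxE (eX _ s) (eX _ t) /pairing.
have eS (a b : V -> 'rV[C]_(n.+1 + n.+1)) :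
  \sum_j a p 0 (lshift n.+1 j) * left_deriveC g j (fun q => b q 0 (rshift n.+1 k)) p =
  \sum_j lsubmx (a p) 0 j * left_deriveC g j (fun q => b q 0 (rshift n.+1 k)) p.
  by apply: eq_bigr => j _; rewrite [in RHS]mxE.
rewrite (eS s t) (eS t s).
have alg (S1 S2 M1 M2 a b c d : C) : M1 + (S1 - a) - (M2 + (S2 - b)) +
  2^-1 * (a + c - (b + d)) = M1 - M2 + S1 - S2 + (2^-1 * (b + c) - 2^-1 * (d + a)) by field.
exact: alg.
Qed.

End Courant.

Section ConstantStructure.
Variables (R : realType) (n : nat) (M : nilmanifold R n.+1).
Local Notation C := R[i].
Local Notation V := 'rV[R]_n.+1.
Local Notation toC := (map_mx (real_complex R)).
Local Notation g := (nil_algebra M).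

Lemma left_invariant_cst (J : V -> 'M[R]_(n.+1 + n.+1)) x :
  left_invariant M J -> J x = J 0.
Proof. by move=> h; rewrite -{1}(bch_x0 g x) h. Qed.

Definition orthogonal (J : 'M[R]_(n.+1 + n.+1)) :=
  forall u v, pairing (u *m J) (v *m J) = pairing u v.

Definition pairing_mx (K : fieldType) : 'M[K]_(n.+1 + n.+1) :=
  2^-1 *: block_mx 0 1%:M 1%:M 0.

Lemma pairingE (K : fieldType) (u v : 'rV[K]_(n.+1 + n.+1)) :
  pairing u v = ev2 (pairing_mx K) u v.
Proof.
rewrite /pairing_mx ev2Z /pairing; congr (_ * _).
rewrite /ev2 -{3}(hsubmxK u) -{3}(hsubmxK v) mul_row_block tr_row_mx mul_row_col.
by rewrite !mulmx0 !mulmx1 addr0 add0r [X in _ + X]dotC /dot [RHS]mxE.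
Qed.

Lemma toC_pairing_mx : toC (pairing_mx R) = pairing_mx C.
Proof.
rewrite /pairing_mx map_mxZ map_block_mx map_mx0 map_mx1; congr (_ *: _).
by rewrite fmorphV rmorph_nat.
Qed.

Lemma orthogonalC J (u v : 'rV[C]_(n.+1 + n.+1)) : orthogonal J ->
  pairing (u *m toC J) (v *m toC J) = pairing u v.
Proof.
move=> oJ; have e : J *m pairing_mx R *m J^T = pairing_mx R.
  apply: ev2_ext => x y; have := oJ x y; rewrite !pairingE /ev2 => <-.
  by rewrite trmx_mul !mulmxA.
rewrite !pairingE /ev2 -toC_pairing_mx trmx_mul -[in RHS]e !map_mxM map_trmx.
by rewrite !mulmxA.
Qed.

Lemma plus_i_isotropic J u v : orthogonal J -> plus_i_eigenspace J u -> plus_i_eigenspace J v ->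
  pairing u v = 0.
Proof.
move=> oJ hu hv; have := orthogonalC u v oJ; rewrite hu hv !pairingE ev2Zl ev2Zr mulrA.
rewrite -expr2 sqr_i mulN1r => /eqP; rewrite -subr_eq0 -opprD oppr_eq0 -mulr2n.
by rewrite mulrn_eq0 /= => /eqP.
Qed.

Let eqn (J : 'M[R]_(n.+1 + n.+1)) l : 'rV[C]_(n.+1 + n.+1) := (col l (toC J - 'i%C%:M))^T.

Lemma plus_iP (J : 'M[R]_(n.+1 + n.+1)) v :
  plus_i_eigenspace J v <-> forall l, dot v (eqn J l) = 0.
Proof.
have e l : dot v (eqn J l) = (v *m toC J - 'i%C *: v) 0 l.
  rewrite -mul_mx_scalar -mulmxBr /dot trmxK !mxE; apply: eq_bigr => k _.
  by rewrite [X in _ * X]mxE.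
split=> [h l|h]; first by rewrite e h subrr mxE.
by apply/eqP; rewrite -subr_eq0; apply/eqP/rowP => l; rewrite -e h mxE.
Qed.

(** The integrability condition is tensorial, so that for a left-invariant
    structure it only has to be checked on left-invariant sections. *)
Lemma generalized_complex_cst (J : 'M[R]_(n.+1 + n.+1)) :
  orthogonal J -> J *m J = - 1%:M ->
  (forall u v, plus_i_eigenspace J u -> plus_i_eigenspace J v ->
     plus_i_eigenspace J (courant_alg g u v)) ->
  generalized_complex M (fun=> J).
Proof.
move=> oJ J2 cJ; split=> //; first by move=> j k; apply: smooth_cst.
move=> s t [[_ ss] sL] [[_ st] tL] p; rewrite courant_expand //.
have dL (a : V -> 'rV[C]_(n.+1 + n.+1)) k : (forall l, smoothC g (fun q => a q 0 l)) ->
  (forall q, plus_i_eigenspace J (a q)) -> plus_i_eigenspace J (section_derive g a p k).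
  move=> sa aL; apply/plus_iP => l; apply: left_deriveC_ann => // q.
  by have /plus_iP := aL q; apply.
rewrite (_ : \row_k _ = 0) ?row_mx0 ?addr0; last first.
  apply/rowP => k; rewrite !mxE (plus_i_isotropic oJ (dL s k ss sL) (tL p)).
  by rewrite (plus_i_isotropic oJ (sL p) (dL t k st tL)) subrr.
have sumL (c : 'I_n.+1 -> C) (F : 'I_n.+1 -> 'rV[C]_(n.+1 + n.+1)) l :
  (forall j, plus_i_eigenspace J (F j)) -> dot (\sum_j c j *: F j) (eqn J l) = 0.
  move=> FL; rewrite dotC dot_sumr big1 // => j _; rewrite dotZr dotC.
  by have /plus_iP -> := FL j; rewrite mulr0.
apply/plus_iP => l; rewrite dotDl dotNl dotDl !sumL => [||j]; last 2 first.
- by move=> j; apply: dL.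
- exact: dL.
by have /plus_iP -> := cJ _ _ (sL p) (tL p); rewrite subr0 addr0.
Qed.

Lemma left_invariant_generalized_complex (J : V -> 'M[R]_(n.+1 + n.+1)) :
  generalized_complex M J -> left_invariant M J ->
  [/\ orthogonal (J 0), J 0 *m J 0 = - 1%:M &
    forall u v, plus_i_eigenspace (J 0) u -> plus_i_eigenspace (J 0) v ->
     plus_i_eigenspace (J 0) (courant_alg g u v)].
Proof.
move=> gc li; split=> [u v||u v hu hv]; [exact: (gc_orthogonal gc 0)|exact: (gc_square gc 0)|].
have sec w : plus_i_eigenspace (J 0) w -> section_of_L M J (fun=> w).
  move=> hw; split; last by move=> p; rewrite (left_invariant_cst _ li).
  by split=> // k; apply: smoothC_cst.
by have := gc_integrable gc (sec u hu) (sec v hv) 0; rewrite courant_cst.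
Qed.
End ConstantStructure.

(** * Integrability in terms of a subalgebra and a closed form *)

Section FormMatrix.
Variables (n : nat) (K : numFieldType).
Implicit Types (X Z : 'rV[K]_n) (F : form K n).

Definition form_mx F : 'M[K]_n := \matrix_j contract_row (delta_mx 0 j) F.

Lemma form_mxE F X Z : dot (contract_row X F) Z = ev2 (form_mx F) X Z.
Proof.
rewrite /ev2 -/(dot _ Z); congr dot; apply/rowP => k; rewrite !mxE.
rewrite {1}(row_decomp X) contract_suml sum_ffunE; apply: eq_bigr => j _.
by rewrite contractZl ffunE !mxE.
Qed.

Lemma form_mx_anti F X Z : homogeneous 2 F -> ev2 (form_mx F) Z X = - ev2 (form_mx F) X Z.
Proof.
move=> hF; have e U W : contract W (contract U F) = ev2 (form_mx F) U W *: monomial K finset.set0.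
  by rewrite (homog2_contract U hF) contract_oneform -form_mxE.
have /ffunP/(_ finset.set0) : contract X (contract Z F) = - contract Z (contract X F).
  exact: contract_anticomm.
by rewrite !e !ffunE eqxx /GRing.scale /= !mulr1.
Qed.

Lemma contract_row_oneform X F xi : contract X F = oneform xi -> contract_row X F = xi.
Proof.
move=> e; apply/rowP => k; rewrite mxE e sum_ffunE (bigD1 k) //= big1 ?addr0.
  by rewrite !ffunE eqxx /GRing.scale /= mulr1.
move=> j jk; rewrite !ffunE; case: eqP => [/finset.set1_inj ekj|_]; last by rewrite scaler0.
by rewrite ekj eqxx in jk.
Qed.
End FormMatrix.

Section Integrability.
Variables (R : realType) (n : nat) (g : lie_algebra R n.+1).
Local Notation C := R[i].
Local Notation toC := (map_mx (real_complex R)).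
Implicit Types (t X Y Z : 'rV[C]_n.+1) (F : form C n.+1) (A : 'M[C]_n.+1).

Definition subalgebra (a : 'rV[C]_n.+1 -> Prop) :=
  forall X Y, a X -> a Y -> a (bracketC g X Y).

(** The exterior derivative of the 2-form A on the subalgebra a is zero. *)
Definition closed_on (a : 'rV[C]_n.+1 -> Prop) A := forall X Y Z, a X -> a Y -> a Z ->
  ev2 A (bracketC g X Y) Z + ev2 A (bracketC g Y Z) X + ev2 A (bracketC g Z X) Y = 0.

Lemma isotropic_row (t1 t2 : 'rV[C]_n.+1) F X xi : isotropic_of t1 t2 F (row_mx X xi) <->
  ann2 t1 t2 X /\ forall Z, ann2 t1 t2 Z -> dot xi Z + ev2 (form_mx F) X Z = 0.
Proof.
rewrite /isotropic_of row_mxKl row_mxKr.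
by split=> -[aX h]; (split; first exact: aX) => Z aZ; rewrite -(h Z aZ) form_mxE.
Qed.

Lemma isotropic_lift (t1 t2 : 'rV[C]_n.+1) F X : ann2 t1 t2 X ->
  isotropic_of t1 t2 F (row_mx X (- contract_row X F)).
Proof. by move=> aX; apply/isotropic_row; split=> // Z _; rewrite dotNl form_mxE addNr. Qed.

(** On X + xi and Y + eta, the value at Z of the covector part of the Courant bracket
    plus F ([X, Y], Z) is, up to sign, d F (X, Y, Z). *)
Lemma isotropic_courant (t1 t2 : 'rV[C]_n.+1) F : homogeneous 2 F ->
  subalgebra (ann2 t1 t2) -> closed_on (ann2 t1 t2) (form_mx F) ->
  forall u v, isotropic_of t1 t2 F u -> isotropic_of t1 t2 F v ->
    isotropic_of t1 t2 F (courant_alg g u v).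
Proof.
move=> hF sub cl u v; rewrite -(hsubmxK u) -(hsubmxK v).
move: (lsubmx u) (rsubmx u) (lsubmx v) (rsubmx v) => X xi Y eta {u v}.
move=> /isotropic_row[aX hX] /isotropic_row[aY hY]; rewrite courant_alg_row.
apply/isotropic_row; split=> [|Z aZ]; first exact: sub.
rewrite dot_dmxC -(cl _ _ _ aX aY aZ).
have := hY _ (sub _ _ aX aZ); have := hX _ (sub _ _ aY aZ).
move=> /eqP; rewrite addr_eq0 => /eqP -> /eqP; rewrite addr_eq0 => /eqP ->.
rewrite (bracketC_anti g X Z) ev2Nl.
rewrite (form_mx_anti X (bracketC g Y Z) hF) (form_mx_anti Y (bracketC g X Z) hF).
by move: (ev2 _ _ _) (ev2 _ _ _) (ev2 _ _ _) => a b c; ring.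
Qed.

Lemma courant_isotropic (t1 t2 : 'rV[C]_n.+1) F : homogeneous 2 F ->
  (forall u v, isotropic_of t1 t2 F u -> isotropic_of t1 t2 F v ->
    isotropic_of t1 t2 F (courant_alg g u v)) ->
  subalgebra (ann2 t1 t2) /\ closed_on (ann2 t1 t2) (form_mx F).
Proof.
move=> hF h; have H X Y (aX : ann2 t1 t2 X) (aY : ann2 t1 t2 Y) :
    ann2 t1 t2 (bracketC g X Y) /\ forall Z, ann2 t1 t2 Z ->
    dot (- contract_row X F) (bracketC g Y Z) - dot (- contract_row Y F) (bracketC g X Z)
      + ev2 (form_mx F) (bracketC g X Y) Z = 0.
  have := h _ _ (isotropic_lift F aX) (isotropic_lift F aY).
  rewrite courant_alg_row => /isotropic_row[s c]; split=> // Z aZ.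
  by rewrite -dot_dmxC c.
split=> [X Y aX aY|X Y Z aX aY aZ]; first by have [] := H X Y aX aY.
have [_ /(_ Z aZ) <-] := H X Y aX aY.
rewrite !dotNl !form_mxE (bracketC_anti g X Z) ev2Nl.
rewrite (form_mx_anti X (bracketC g Y Z) hF) (form_mx_anti Y (bracketC g X Z) hF).
by move: (ev2 _ _ _) (ev2 _ _ _) (ev2 _ _ _) => a b c; ring.
Qed.
End Integrability.

Section ModelStructure.
Variable K : fieldType.
Variables f1 f2 f3 f4 f5 f6 x1 x2 x3 x4 x5 x6 : 'rV[K]_6.
Hypothesis biorth : mx6 [:: f1; f2; f3; f4; f5; f6] *m (mx6 [:: x1; x2; x3; x4; x5; x6])^T = 1%:M.

(** In the frame x_1, .., x_6: the complex structure on the first four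
    directions, the symplectic one on the last two. *)
Definition model_mx : 'M[K]_(6 + 6) := block_mx
  (f2^T *m x1 - f1^T *m x2 + f4^T *m x3 - f3^T *m x4)
  (f5^T *m f6 - f6^T *m f5)
  (x5^T *m x6 - x6^T *m x5)
  (x2^T *m f1 - x1^T *m f2 + x4^T *m f3 - x3^T *m f4).

Let d : dual f1 f2 f3 f4 f5 f6 x1 x2 x3 x4 x5 x6.
Proof. exact: mx6_dual. Qed.

Let d' : dual x1 x2 x3 x4 x5 x6 f1 f2 f3 f4 f5 f6.
Proof. by apply: mx6_dual; rewrite -[mx6 [:: x1; _; _; _; _; _]]trmxK -trmx_mul biorth trmx1. Qed.

Lemma mul_outer m (v a : 'rV[K]_6) (b : 'rV[K]_m) : v *m (a^T *m b) = dot a v *: b.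
Proof. by rewrite mulmxA [v *m a^T]mx11_scalar mul_scalar_mx dotC. Qed.

Lemma model_l v : lsubmx (v *m model_mx) =
  dot f2 (lsubmx v) *: x1 + (- dot f1 (lsubmx v)) *: x2 + dot f4 (lsubmx v) *: x3
  + (- dot f3 (lsubmx v)) *: x4 + (- dot x6 (rsubmx v)) *: x5 + dot x5 (rsubmx v) *: x6.
Proof.
rewrite -{1}(hsubmxK v) mul_row_block row_mxKl.
rewrite !(mulmxDr, mulmxBr, mulmxN) !mul_outer !scaleNr -!addrA; do 4 congr (_ + _).
by rewrite addrC.
Qed.

Lemma model_r v : rsubmx (v *m model_mx) =
  dot x2 (rsubmx v) *: f1 + (- dot x1 (rsubmx v)) *: f2 + dot x4 (rsubmx v) *: f3
  + (- dot x3 (rsubmx v)) *: f4 + (- dot f6 (lsubmx v)) *: f5 + dot f5 (lsubmx v) *: f6.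
Proof.
rewrite -{1}(hsubmxK v) mul_row_block row_mxKr.
rewrite !(mulmxDr, mulmxBr, mulmxN) !mul_outer !scaleNr addrC -!addrA; do 4 congr (_ + _).
by rewrite addrC.
Qed.

Lemma row_eq (u v : 'rV[K]_(6 + 6)) :
  dot f1 (lsubmx u) = dot f1 (lsubmx v) -> dot f2 (lsubmx u) = dot f2 (lsubmx v) ->
  dot f3 (lsubmx u) = dot f3 (lsubmx v) -> dot f4 (lsubmx u) = dot f4 (lsubmx v) ->
  dot f5 (lsubmx u) = dot f5 (lsubmx v) -> dot f6 (lsubmx u) = dot f6 (lsubmx v) ->
  dot x1 (rsubmx u) = dot x1 (rsubmx v) -> dot x2 (rsubmx u) = dot x2 (rsubmx v) ->
  dot x3 (rsubmx u) = dot x3 (rsubmx v) -> dot x4 (rsubmx u) = dot x4 (rsubmx v) ->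
  dot x5 (rsubmx u) = dot x5 (rsubmx v) -> dot x6 (rsubmx u) = dot x6 (rsubmx v) -> u = v.
Proof.
move=> e1 e2 e3 e4 e5 e6 e7 e8 e9 e10 e11 e12.
rewrite -(hsubmxK u) -(hsubmxK v) (dual_vec d (lsubmx u)) (dual_vec d' (rsubmx u)).
rewrite (dual_vec d (lsubmx v)) (dual_vec d' (rsubmx v)).
by rewrite e1 e2 e3 e4 e5 e6 e7 e8 e9 e10 e11 e12.
Qed.

Let dE := (dual1 d, dual2 d, dual3 d, dual4 d, dual5 d, dual6 d,
  dual1 d', dual2 d', dual3 d', dual4 d', dual5 d', dual6 d').

Lemma model_coord v : let w := v *m model_mx in
  (dot f1 (lsubmx w) = dot f2 (lsubmx v)) * (dot f2 (lsubmx w) = - dot f1 (lsubmx v)) *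
  (dot f3 (lsubmx w) = dot f4 (lsubmx v)) * (dot f4 (lsubmx w) = - dot f3 (lsubmx v)) *
  (dot f5 (lsubmx w) = - dot x6 (rsubmx v)) * (dot f6 (lsubmx w) = dot x5 (rsubmx v)) *
  (dot x1 (rsubmx w) = dot x2 (rsubmx v)) * (dot x2 (rsubmx w) = - dot x1 (rsubmx v)) *
  (dot x3 (rsubmx w) = dot x4 (rsubmx v)) * (dot x4 (rsubmx w) = - dot x3 (rsubmx v)) *
  (dot x5 (rsubmx w) = - dot f6 (lsubmx v)) * (dot x6 (rsubmx w) = dot f5 (lsubmx v)).
Proof. by rewrite /= !model_l !model_r !dE. Qed.

Lemma model_sq : model_mx *m model_mx = - 1%:M.
Proof.
apply/row_matrixP => i; rewrite !rowE mulmxA mulmxN mulmx1; move: (delta_mx _ _) => v.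
have nl (w : 'rV[K]_(6 + 6)) : lsubmx (- w) = - lsubmx w by apply/rowP => k; rewrite !mxE.
have nr (w : 'rV[K]_(6 + 6)) : rsubmx (- w) = - rsubmx w by apply/rowP => k; rewrite !mxE.
by apply: row_eq; rewrite ?nl ?nr !dotNr !(model_coord (v *m model_mx)) !model_coord ?opprK.
Qed.

Lemma dot_coord (xi X : 'rV[K]_6) : dot xi X = dot x1 xi * dot f1 X + dot x2 xi * dot f2 X
  + dot x3 xi * dot f3 X + dot x4 xi * dot f4 X + dot x5 xi * dot f5 X + dot x6 xi * dot f6 X.
Proof.
by rewrite {1}(dual_vec d' xi) !dotE.
Qed.

Lemma model_orthogonal u v : pairing (u *m model_mx) (v *m model_mx) = pairing u v.
Proof.
rewrite /pairing (dot_coord (rsubmx (u *m _))) (dot_coord (rsubmx (v *m _))).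
rewrite (dot_coord (rsubmx u)) (dot_coord (rsubmx v)) !model_coord.
by congr (_ * _); ring.
Qed.
End ModelStructure.

(** * Existence: split structures of type 2 *)

(** With X + xi of coordinates a and b and Z of coordinates z, these are the scalar
    identities relating the equation of the +i-eigenspace of the model to that of
    the isotropic subspace of its spinor. *)
Lemma isotropic_scalars (K : comNzRingType) (i a5 a6 b1 b3 b5 b6 z1 z2 z3 z4 z5 z6 : K) :
  i * i = -1 -> i * a6 = b5 -> i * b6 = a5 -> z1 + i * z2 = 0 -> z3 + i * z4 = 0 ->
  b1 * z1 + i * b1 * z2 + b3 * z3 + i * b3 * z4 + b5 * z5 + b6 * z6 + i * (a5 * z6 - a6 * z5) = 0.
Proof.
move=> i2 <- <- e1 e2; transitivity (b1 * (z1 + i * z2) + b3 * (z3 + i * z4) + (1 + i * i) * b6 * z6).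
  by ring.
by rewrite e1 e2 i2; ring.
Qed.

Lemma isotropic_scalars2 (K : comNzRingType) (i x y : K) :
  i * i = -1 -> x + i * y = 0 -> y = i * x /\ - x = i * y.
Proof.
move=> i2 /eqP; rewrite addr_eq0 => /eqP ->.
by rewrite mulrN mulrA i2 mulN1r !opprK.
Qed.

Lemma isotropic_scalars3 (K : comNzRingType) (i a5 a6 b1 b2 b3 b4 b5 b6 : K) :
  i * i = -1 -> (forall c1 c2 c3 c4 c5 c6, c1 + i * c2 = 0 -> c3 + i * c4 = 0 ->
    b1 * c1 + b2 * c2 + b3 * c3 + b4 * c4 + b5 * c5 + b6 * c6 + i * (a5 * c6 - a6 * c5) = 0) ->
  [/\ b1 + i * b2 = 0, b3 + i * b4 = 0, b5 + i * - a6 = 0 & b6 + i * a5 = 0].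
Proof.
move=> i2 h; have z : 0 + i * 0 = 0 by rewrite mulr0 addr0.
have u : 1 + i * i = 0 by rewrite i2 subrr.
split; [rewrite -(h 1 i 0 0 0 0 u z)|rewrite -(h 0 0 1 i 0 0 z u)|rewrite -(h 0 0 0 0 1 0 z z)
  |rewrite -(h 0 0 0 0 0 1 z z)]; ring.
Qed.

Lemma isotropic_scalars4 (K : comNzRingType) (i x y : K) :
  i * i = -1 -> i * x = y -> x + i * y = 0.
Proof. by move=> i2 <-; rewrite mulrA i2 mulN1r subrr. Qed.

Lemma dot_lsubZ (K : comNzRingType) (a : 'rV[K]_6) c (w : 'rV[K]_(6 + 6)) :
  dot a (lsubmx (c *: w)) = c * dot a (lsubmx w).
Proof. by rewrite -dotZr; congr dot; apply/rowP => k; rewrite !mxE. Qed.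

Lemma dot_rsubZ (K : comNzRingType) (a : 'rV[K]_6) c (w : 'rV[K]_(6 + 6)) :
  dot a (rsubmx (c *: w)) = c * dot a (rsubmx w).
Proof. by rewrite -dotZr; congr dot; apply/rowP => k; rewrite !mxE. Qed.

Lemma big_ord2 (T : Type) (op : T -> T -> T) idx (F : 'I_2 -> T) :
  \big[op/idx]_i F i = op (F ord0) (op (F (lift ord0 ord0)) idx).
Proof. by rewrite !big_ord_recl big_ord0. Qed.

Section ModelType2.
Variables (R : realType) (M : nilmanifold R 6).
Local Notation C := R[i].
Local Notation toC := (map_mx (real_complex R)).
Local Notation g := (nil_algebra M).

Definition cplx (a b : 'rV[R]_6) : 'rV[C]_6 := toC a + 'i%C *: toC b.

(** The integrability of the structure whose spinor is
    exp (i f5 /\ f6) /\ (f1 + i f2) /\ (f3 + i f4), for a real coframe f. *)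
Definition split_type2 (h : lie_algebra R 6) := exists f1 f2 f3 f4 f5 f6 : 'rV[R]_6,
  [/\ coframe f1 f2 f3 f4 f5 f6, subalgebra h (ann2 (cplx f1 f2) (cplx f3 f4))
    & closed_on h (ann2 (cplx f1 f2) (cplx f3 f4)) (toC (wd f5 f6))].

Lemma dot_cplx a b X : dot (cplx a b) X = dot (toC a) X + 'i%C * dot (toC b) X.
Proof. by rewrite dotDl dotZl. Qed.

Lemma mx6_toC s : size s = 6 -> toC (mx6 s) = mx6 [seq toC v | v <- s].
Proof.
move=> hs; apply/row_matrixP => i; rewrite -map_row !rowK (nth_map 0) ?hs //.
Qed.

Lemma toC_model (f1 f2 f3 f4 f5 f6 x1 x2 x3 x4 x5 x6 : 'rV[R]_6) :
  toC (model_mx f1 f2 f3 f4 f5 f6 x1 x2 x3 x4 x5 x6) =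
  model_mx (toC f1) (toC f2) (toC f3) (toC f4) (toC f5) (toC f6)
    (toC x1) (toC x2) (toC x3) (toC x4) (toC x5) (toC x6).
Proof.
by rewrite /model_mx map_block_mx !(map_mxD, map_mxB, map_mxN, map_mxM, map_trmx).
Qed.

Section Frame.
Variables f1 f2 f3 f4 f5 f6 x1 x2 x3 x4 x5 x6 : 'rV[R]_6.
Hypothesis biorth : mx6 [:: f1; f2; f3; f4; f5; f6] *m (mx6 [:: x1; x2; x3; x4; x5; x6])^T = 1%:M.

Lemma toC_dual : mx6 [:: toC f1; toC f2; toC f3; toC f4; toC f5; toC f6] *m
  (mx6 [:: toC x1; toC x2; toC x3; toC x4; toC x5; toC x6])^T = 1%:M.
Proof.
have := congr1 (fun A : 'M[R]_6 => toC A) biorth.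
rewrite map_mxM -map_trmx map_mx1 (@mx6_toC [:: f1; _; _; _; _; _]) //.
by rewrite (@mx6_toC [:: x1; _; _; _; _; _]).
Qed.

Definition dual_toC := mx6_dual toC_dual.

Definition model_form : form C 6 := 'i%C *: wedge (oneform (toC f5)) (oneform (toC f6)).

Lemma homogeneous_model_form : homogeneous 2 model_form.
Proof. by apply/homogeneousZ/(@homogeneous_wedge _ _ 1 1); apply: homogeneous_oneform. Qed.

Lemma contract_row_model X : contract_row X model_form =
  'i%C *: (dot (toC f5) X *: toC f6 - dot (toC f6) X *: toC f5).
Proof.
apply: contract_row_oneform; rewrite /model_form contractZr contract_wedge1 contract_oneform.
by rewrite wedgeZr wedge1r oneformZ oneformD oneformN !oneformZ.
Qed.

Lemma ev2_model X Z : ev2 (form_mx model_form) X Z = 'i%C * ev2 (toC (wd f5 f6)) X Z.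
Proof.
rewrite -form_mxE contract_row_model toC_wd ev2_wd !dotE.
by move: (dot _ _) (dot _ _) (dot _ _) (dot _ _) => a b c d; rewrite (mulrC d).
Qed.

Lemma model_eigen v :
  plus_i_eigenspace (model_mx f1 f2 f3 f4 f5 f6 x1 x2 x3 x4 x5 x6) v <->
  isotropic_of (cplx f1 f2) (cplx f3 f4) model_form v.
Proof.
have mc := model_coord toC_dual v; have dc := dot_coord toC_dual.
rewrite /= in mc; move: (toC_model f1 f2 f3 f4 f5 f6 x1 x2 x3 x4 x5 x6) => eJ.
have i2 : 'i%C * 'i%C = -1 :> C by rewrite -expr2 sqr_i.
have [d1 d2 d3 d4 d5 d6 _] := dual_toC.
rewrite /plus_i_eigenspace eJ; set w := v *m _ in mc *.
rewrite -{2}(hsubmxK v); split=> [e|/isotropic_row[[a1 a2] h]].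
  apply/isotropic_row.
  move: mc; rewrite e !dot_lsubZ !dot_rsubZ; move: (lsubmx v) (rsubmx v) => X xi mc.
  have [[[[[[[[[[[m1 m2] m3] m4] m5] m6] m7] m8] m9] m10] m11] m12] := mc.
  split.
    rewrite /ann2 (dot_cplx f1) (dot_cplx f3).
    by split; [exact: (isotropic_scalars4 i2 m1)|exact: (isotropic_scalars4 i2 m3)].
  move=> Z [z1 z2]; rewrite ev2_model toC_wd ev2_wd dc -m7 -m9.
  rewrite dot_cplx in z1; rewrite dot_cplx in z2.
  exact: (isotropic_scalars _ _ _ _ i2 m6 m12 z1 z2).
have H c1 c2 c3 c4 c5 c6 : c1 + 'i%C * c2 = 0 -> c3 + 'i%C * c4 = 0 ->
    dot (toC x1) (rsubmx v) * c1 + dot (toC x2) (rsubmx v) * c2 + dot (toC x3) (rsubmx v) * c3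
    + dot (toC x4) (rsubmx v) * c4 + dot (toC x5) (rsubmx v) * c5 + dot (toC x6) (rsubmx v) * c6
    + 'i%C * (dot (toC f5) (lsubmx v) * c6 - dot (toC f6) (lsubmx v) * c5) = 0.
  move=> e1 e2; have := h (c1 *: toC x1 + c2 *: toC x2 + c3 *: toC x3 + c4 *: toC x4 + c5 *: toC x5 + c6 *: toC x6).
  by rewrite /ann2 !dot_cplx ev2_model toC_wd ev2_wd (dc (rsubmx v)) d1 d2 d3 d4 d5 d6; apply.
have [h1 h2 h3 h4] := isotropic_scalars3 i2 H.
rewrite dot_cplx in a1; rewrite dot_cplx in a2; move: a1 a2 h1 h2 h3 h4.
case: mc => -[[[[[[[[[[m1 m2] m3] m4] m5] m6] m7] m8] m9] m10] m11] m12.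
move=> /(isotropic_scalars2 i2)[e2 e1] /(isotropic_scalars2 i2)[e4 e3].
move=> /(isotropic_scalars2 i2)[e8 e7] /(isotropic_scalars2 i2)[e10 e9].
move=> /(isotropic_scalars2 i2)[e11 /eqP]; rewrite mulrN eqr_opp => /eqP e5.
move=> /(isotropic_scalars2 i2)[e12 e6].
apply: (row_eq toC_dual).
- exact: (etrans (etrans m1 e2) (esym (dot_lsubZ _ _ _))).
- exact: (etrans (etrans m2 e1) (esym (dot_lsubZ _ _ _))).
- exact: (etrans (etrans m3 e4) (esym (dot_lsubZ _ _ _))).
- exact: (etrans (etrans m4 e3) (esym (dot_lsubZ _ _ _))).
- exact: (etrans (etrans m5 e6) (esym (dot_lsubZ _ _ _))).
- exact: (etrans (etrans m6 e5) (esym (dot_lsubZ _ _ _))).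
- exact: (etrans (etrans m7 e8) (esym (dot_rsubZ _ _ _))).
- exact: (etrans (etrans m8 e7) (esym (dot_rsubZ _ _ _))).
- exact: (etrans (etrans m9 e10) (esym (dot_rsubZ _ _ _))).
- exact: (etrans (etrans m10 e9) (esym (dot_rsubZ _ _ _))).
- exact: (etrans (etrans m11 e11) (esym (dot_rsubZ _ _ _))).
- exact: (etrans (etrans m12 e12) (esym (dot_rsubZ _ _ _))).
Qed.

Lemma cplx_dual : [/\ dot (cplx f1 f2) (toC x1) = 1, dot (cplx f3 f4) (toC x3) = 1,
  dot (cplx f1 f2) (toC x3) = 0 & dot (cplx f3 f4) (toC x1) = 0].
Proof.
have [d1 d2 d3 d4 _ _ _] := mx6_dual biorth.
have := (d1 1 0 0 0 0 0, d2 1 0 0 0 0 0, d3 1 0 0 0 0 0, d4 1 0 0 0 0 0,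
  d1 0 0 1 0 0 0, d2 0 0 1 0 0 0, d3 0 0 1 0 0 0, d4 0 0 1 0 0 0).
rewrite !scale1r !scale0r !addr0 !add0r => h.
by split; rewrite dot_cplx !dot_toC !h !rmorph0 ?rmorph1 mulr0 ?addr0.
Qed.

Lemma complexify_oneform (a : 'rV[R]_6) : complexify (oneform a) = oneform (toC a).
Proof.
apply/ffunP => S; rewrite ffunE /oneform !sum_ffunE rmorph_sum; apply: eq_bigr => k _ /=.
by rewrite !ffunE !mxE rmorphM /= rmorph_nat.
Qed.

Lemma complexify_wedge (a b : form R 6) : complexify (wedge a b) = wedge (complexify a) (complexify b).
Proof.
apply/ffunP => S; rewrite !ffunE rmorph_sum; apply: eq_bigr => T _ /=.
by rewrite !ffunE !rmorphM /= rmorph_sign.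
Qed.

Lemma complexify0 : complexify (0 : form R 6) = 0.
Proof. by apply/ffunP => S; rewrite !ffunE. Qed.

Lemma model_has_type :
  has_type (plus_i_eigenspace (model_mx f1 f2 f3 f4 f5 f6 x1 x2 x3 x4 x5 x6)) 2.
Proof.
have [t11 t22 t12 t21] := cplx_dual.
exists 0, (wedge (oneform f5) (oneform f6)), (fun i : 'I_2 => if i == ord0 then cplx f1 f2 else cplx f3 f4).
rewrite /= complexify0 add0r complexify_wedge !complexify_oneform -/model_form.
have -> : \big[@wedge 6 C/monomial C finset.set0]_(i < 2)
    oneform (if i == ord0 then cplx f1 f2 else cplx f3 f4) =
    wedge (oneform (cplx f1 f2)) (oneform (cplx f3 f4))
  by rewrite big_ord2; exact: (congr1 (wedge _) (wedge1r _)).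
split.
- by move=> S _; rewrite ffunE.
- by apply: (@homogeneous_wedge _ _ 1 1); apply: homogeneous_oneform.
- apply/eqP => e; have := contract_wedge1 (toC x1) (cplx f1 f2) (oneform (cplx f3 f4)).
  rewrite e contract0r t11 scale1r contract_oneform t21 scale0r wedge0r subr0.
  move=> /(congr1 (contract (toC x3))); rewrite contract0r contract_oneform t22 scale1r.
  by move=> /ffunP/(_ finset.set0)/eqP; rewrite !ffunE eqxx eq_sym oner_eq0.
move=> phi; rewrite -(pure_spinor_line _ homogeneous_model_form t11 t22 t12 t21) //.
by split=> h v hv; apply: h; apply/model_eigen.
Qed.
End Frame.

Theorem split_type2_exists : split_type2 g ->
  exists J : 'rV[R]_6 -> 'M[R]_(6 + 6),
    [/\ generalized_complex M J, left_invariant M J & of_type J 2].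
Proof.
move=> [f1 [f2 [f3 [f4 [f5 [f6 [cf sub cl]]]]]]].
have [x1 [x2 [x3 [x4 [x5 [x6 b]]]]]] := coframe_dual cf.
exists (fun=> model_mx f1 f2 f3 f4 f5 f6 x1 x2 x3 x4 x5 x6); split=> //; last first.
  by move=> p; apply: model_has_type.
apply: generalized_complex_cst; [exact: model_orthogonal|exact: model_sq|].
move=> u v /(model_eigen b) hu /(model_eigen b) hv; apply/(model_eigen b).
apply: (isotropic_courant (homogeneous_model_form f5 f6) sub _ hu hv).
move=> X Y Z aX aY aZ; rewrite !ev2_model -!mulrDr.
by rewrite (cl X Y Z) ?mulr0.
Qed.
End ModelType2.

(** * Necessary conditions *)

Section NecessaryCondition.
Variables (R : realType).
Local Notation C := R[i].
Local Notation toC := (map_mx (real_complex R)).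
Local Notation conj := (map_mx (@conjc R)).

(** What a left-invariant structure of type 2 with spinor
    exp F /\ t1 /\ t2 provides on the Lie algebra: the last condition says
    that F is nondegenerate on the real plane annihilated by t1 and t2. *)
Definition type2_data (h : lie_algebra R 6) := exists (t1 t2 : 'rV[C]_6) (A : 'M[C]_6),
  [/\ forall X Y, ev2 A Y X = - ev2 A X Y,
      forall a b c d, a *: t1 + b *: t2 = c *: conj t1 + d *: conj t2 -> a = 0 /\ b = 0,
      subalgebra h (ann2 t1 t2),
      closed_on h (ann2 t1 t2) A &
      forall p q : 'rV[R]_6, ann2 t1 t2 (toC p) -> ann2 t1 t2 (toC q) ->
        ev2 A (toC p) (toC q) = 0 ->
        forall a b : 'rV[R]_6, dot a p * dot b q = dot b p * dot a q].

Variable J : 'M[R]_(6 + 6).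
Hypotheses (oJ : orthogonal J) (J2 : J *m J = - 1%:M).

Lemma pairing_nondeg (u : 'rV[C]_(6 + 6)) : (forall v, pairing u v = 0) -> u = 0.
Proof.
move=> h; have h2 : (2^-1 : C) != 0 by rewrite invr_eq0 pnatr_eq0.
rewrite -(hsubmxK u) -(row_mx0 _ 1 6 6); congr row_mx; apply: dot_eq => Z; rewrite dot0l.
  have /eqP := h (row_mx 0 Z); rewrite /pairing row_mxKl row_mxKr dot0r add0r.
  by rewrite mulf_eq0 (negPf h2) dotC /= => /eqP.
have /eqP := h (row_mx Z 0); rewrite /pairing row_mxKl row_mxKr dot0l addr0.
by rewrite mulf_eq0 (negPf h2) /= => /eqP.
Qed.

(** The vectors u - i u J are +i-eigenvectors; pairing w with them shows that
    w + i w J is orthogonal to everything. *)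
Lemma plus_i_maximal w : (forall v, plus_i_eigenspace J v -> pairing w v = 0) ->
  plus_i_eigenspace J w.
Proof.
move=> h; have i2 : 'i%C * 'i%C = -1 :> C by rewrite -expr2 sqr_i.
have CJ2 : toC J *m toC J = - 1%:M by rewrite -map_mxM J2 map_mxN map_mx1.
suff /eqP : w + 'i%C *: (w *m toC J) = 0.
  rewrite addr_eq0 => /eqP e; rewrite /plus_i_eigenspace {2}e scalerN scalerA i2.
  by rewrite scaleN1r opprK.
apply: pairing_nondeg => u.
have hu : plus_i_eigenspace J (u - 'i%C *: (u *m toC J)).
  rewrite /plus_i_eigenspace mulmxBl -scalemxAl -mulmxA CJ2 mulmxN mulmx1.
  by rewrite scalerBr scalerA i2 scaleN1r opprK scalerN opprK addrC.
have := h _ hu; rewrite !pairingE ev2Dr ev2Nr ev2Zr ev2Dl ev2Zl.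
have := orthogonalC w (u *m toC J) oJ.
rewrite -mulmxA CJ2 mulmxN mulmx1 !pairingE ev2Nr => <-.
by rewrite mulrN opprK.
Qed.

Lemma conj_toC m n (A : 'M[R]_(m, n)) : conj (toC A) = toC A.
Proof. by apply/matrixP => i j; rewrite !mxE conjc_real. Qed.

Lemma plus_i_conj v : plus_i_eigenspace J v -> plus_i_eigenspace J (conj v) -> v = 0.
Proof.
rewrite /plus_i_eigenspace => h /(congr1 (fun u : 'rV[C]_(6 + 6) => conj u)).
rewrite map_mxM map_mxZ conj_toC -map_mx_comp.
have -> : map_mx (conjc \o conjc) v = v.
  by apply/rowP => k; rewrite mxE /= conjcK.
rewrite h => /eqP; rewrite -subr_eq0 -scalerBl scaler_eq0 => /orP[|/eqP //].
rewrite [X in _ - X](_ : _ = - 'i%C); last first.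
  by apply/eqP; rewrite eq_complex /= oppr0 !eqxx.
by rewrite opprK -mulr2n mulrn_eq0 /= eq_complex /= oner_eq0 andbF.
Qed.

End NecessaryCondition.

Lemma free_coframe (K : fieldType) (f1 f2 f3 f4 f5 f6 : 'rV[K]_6) :
  (forall c1 c2 c3 c4 c5 c6,
     c1 *: f1 + c2 *: f2 + c3 *: f3 + c4 *: f4 + c5 *: f5 + c6 *: f6 = 0 ->
     [/\ c1 = 0, c2 = 0, c3 = 0 & c4 = 0] /\ c5 = 0 /\ c6 = 0) ->
  coframe f1 f2 f3 f4 f5 f6.
Proof.
set s := [:: f1; f2; f3; f4; f5; f6] => h X e1 e2 e3 e4 e5 e6.
have u : mx6 s \in unitmx.
  rewrite -row_free_unit -kermx_eq0; apply/eqP/row_matrixP => i; rewrite row0.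
  have := sub_kermxP (row_sub i (kermx (mx6 s))); move: (row i _) => c e.
  have : c *m mx6 s = \sum_(i < 6) c 0 i *: s`_i.
    by rewrite mulmx_sum_row; apply: eq_bigr => k _; rewrite rowK.
  rewrite e 6!big_ord_recr big_ord0 /= add0r => /esym/h[[c1 c2 c3 c4] [c5 c6]].
  apply/rowP => -[k hk]; rewrite mxE.
  case: k hk => [|[|[|[|[|[|//]]]]]] hk; [rewrite -[RHS]c1|rewrite -[RHS]c2|rewrite -[RHS]c3
    |rewrite -[RHS]c4|rewrite -[RHS]c5|rewrite -[RHS]c6]; congr (c 0 _); exact/val_inj.
suff : mx6 s *m X^T = 0.
  by move=> /(congr1 (mulmx (invmx (mx6 s)))); rewrite mulKmx // mulmx0 => /(congr1 trmx); rewrite trmxK trmx0.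
apply/colP => -[k hk]; rewrite [RHS]mxE.
have -> : (mx6 s *m X^T) (Ordinal hk) 0 = dot s`_k X.
  by rewrite /dot !mxE; apply: eq_bigr => j _; rewrite !mxE.
by move: k hk; do 6 case=> //.
Qed.

Lemma lift_vector (K : fieldType) (i a1 a2 a3 a4 : K) (A : 'M[K]_6)
    (f1 f2 f3 f4 f5 f6 x1 x2 x3 x4 x5 x6 Z : 'rV[K]_6) :
  i * i = -1 -> dual f1 f2 f3 f4 f5 f6 x1 x2 x3 x4 x5 x6 ->
  dot f1 Z + i * dot f2 Z = 0 -> dot f3 Z + i * dot f4 Z = 0 ->
  ev2 A x5 x5 = 0 -> ev2 A x5 x6 = 0 ->
  ev2 A x5 x1 + i * ev2 A x5 x2 = - (a1 + i * a2) ->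
  ev2 A x5 x3 + i * ev2 A x5 x4 = - (a3 + i * a4) ->
  dot (a1 *: f1 + a2 *: f2 + a3 *: f3 + a4 *: f4) Z + ev2 A x5 Z = 0.
Proof.
move=> i2 d z1 z2 A5 A6 e1 e2.
rewrite !dotDl !dotZl [in ev2 A x5 Z](dual_vec d Z) !ev2Dr !ev2Zr A5 A6.
move: (dot f1 Z) (dot f2 Z) (dot f3 Z) (dot f4 Z) (dot f5 Z) (dot f6 Z) z1 z2.
move: (ev2 A x5 x1) (ev2 A x5 x2) (ev2 A x5 x3) (ev2 A x5 x4) e1 e2.
move=> A1 A2 A3 A4 e1 e2 u1 u2 u3 u4 u5 u6.
move=> /eqP; rewrite addr_eq0 => /eqP -> /eqP; rewrite addr_eq0 => /eqP ->.
transitivity (- i * u2 * ((A1 + i * A2) + (a1 + i * a2)) - i * u4 * ((A3 + i * A4) + (a3 + i * a4))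
  + (1 + i * i) * (u2 * (A2 + a2) + u4 * (A4 + a4))); first by ring.
by rewrite e1 e2 i2; ring.
Qed.

Lemma toC_comb4 (R : realType) (a1 a2 a3 a4 : R) (f1 f2 f3 f4 : 'rV[R]_6) :
  map_mx (real_complex R) (a1 *: f1 + a2 *: f2 + a3 *: f3 + a4 *: f4) =
  a1%:C%C *: map_mx (real_complex R) f1 + a2%:C%C *: map_mx (real_complex R) f2 +
  a3%:C%C *: map_mx (real_complex R) f3 + a4%:C%C *: map_mx (real_complex R) f4.
Proof. by rewrite !toC_D !toC_Z. Qed.

Lemma opp_reim (R : rcfType) (z : R[i]) :
  exists a b : R, z = - (a%:C%C + 'i%C * b%:C%C).
Proof.
exists (- complex.Re z), (- complex.Im z); case: z => x y.
by apply/eqP; rewrite eq_complex /=; apply/andP; split; apply/eqP; ring.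
Qed.

Section TypeTwoSpinor.
Variables (R : realType).
Local Notation C := R[i].
Local Notation toC := (map_mx (real_complex R)).
Local Notation conj := (map_mx (@conjc R)).
Variables (J : 'M[R]_(6 + 6)) (t1 t2 : 'rV[C]_6) (F : form C 6).
Hypotheses (oJ : orthogonal J) (J2 : J *m J = - 1%:M) (hF : homogeneous 2 F).
Local Notation Omega := (wedge (oneform t1) (oneform t2)).
Hypotheses (Om0 : Omega != 0)
  (kill : forall v, plus_i_eigenspace J v -> clifford v (wedge (form_exp F) Omega) = 0).

Lemma homogeneous_Omega : homogeneous 2 Omega.
Proof. by apply: (@homogeneous_wedge _ _ 1 1); apply: homogeneous_oneform. Qed.

Lemma homogeneous_add0 p q (a b : form C 6) : p != q -> homogeneous p a -> homogeneous q b ->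
  a + b = 0 -> a = 0 /\ b = 0.
Proof.
move=> pq ha hb e; suff a0 : a = 0 by rewrite a0 add0r in e.
apply/ffunP => S; rewrite [RHS]ffunE; have /ffunP/(_ S) := e; rewrite [LHS]ffunE [RHS]ffunE.
case: (boolP (#|S| == p)) => [/eqP eS|/ha //].
by rewrite (hb S) ?addr0 // eS.
Qed.

Lemma wedge_dep a b : a *: t1 + b *: t2 = 0 -> a = 0 /\ b = 0.
Proof.
move=> e.
have : wedge (oneform (a *: t1 + b *: t2)) (oneform t2) = 0 by rewrite e oneform0 wedge0l.
have : wedge (oneform t1) (oneform (a *: t1 + b *: t2)) = 0 by rewrite e oneform0 wedge0r.
have sq t : wedge (oneform t) (oneform t) = 0 :> form C 6.
  by have := wedge_oneform_sq t (monomial C finset.set0); rewrite wedge1r.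
rewrite !oneformD !oneformZ wedgeDl wedgeDr !wedgeZl !wedgeZr !sq !scaler0 add0r addr0.
move=> /eqP; rewrite scaler_eq0 (negPf Om0) orbF => /eqP b0.
by move=> /eqP; rewrite scaler_eq0 (negPf Om0) orbF => /eqP.
Qed.

Lemma contract_Omega X : contract X Omega = oneform (dot t1 X *: t2 - dot t2 X *: t1).
Proof.
by rewrite contract_wedge1 contract_oneform wedgeZr wedge1r oneformD oneformN !oneformZ.
Qed.

Lemma oneform_inj (xi : 'rV[C]_6) : oneform xi = 0 :> form C 6 -> xi = 0.
Proof.
move=> e; apply: dot_eq => X; rewrite dot0l.
have := contract_oneform X xi; rewrite e contract0r => /esym/ffunP/(_ finset.set0).
by rewrite !ffunE eqxx /GRing.scale /= mulr1.
Qed.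

(** The components of degree 1 and 3 of the spinor equation say that X is
    annihilated by t1 and t2, and that xi + F (X, -) is a combination of them. *)
Lemma plus_i_isotropic_of v : plus_i_eigenspace J v -> isotropic_of t1 t2 F v.
Proof.
move=> /kill; rewrite clifford_exp // => /(@wedge_exp_eq0 6 _ F _ isT hF).
case/(@homogeneous_add0 1 3) => //.
- exact/homogeneous_contract/homogeneous_Omega.
- by apply: (@homogeneous_wedge _ _ 1 2); [apply: homogeneous_oneform|apply: homogeneous_Omega].
move=> e1 e2; have aX : ann2 t1 t2 (lsubmx v).
  move: e1; rewrite contract_Omega => /oneform_inj; rewrite addrC -scaleNr => /wedge_dep[/eqP].
  by rewrite oppr_eq0 => /eqP ? ?.
split=> // Z [z1 z2]; have := congr1 (contract Z) e2.
rewrite contract0r contract_wedge1 contract_Omega z1 z2 !scale0r subr0 oneform0 wedge0r subr0.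
by move/eqP; rewrite scaler_eq0 (negPf Om0) orbF dotDl => /eqP.
Qed.

(** An isotropic subspace containing the +i-eigenspace equals it. *)
Lemma isotropic_of_plus_i v : plus_i_eigenspace J v <-> isotropic_of t1 t2 F v.
Proof.
split; first exact: plus_i_isotropic_of.
move=> hv; apply: plus_i_maximal => // w /plus_i_isotropic_of; move: hv.
rewrite -{1}(hsubmxK v) -{1}(hsubmxK w) /pairing.
move: (lsubmx v) (rsubmx v) (lsubmx w) (rsubmx w) => X xi Y eta.
move=> /isotropic_row[aX hX] /isotropic_row[aY hY].
have /eqP := hX Y aY; rewrite addr_eq0 => /eqP ->.
have /eqP := hY X aX; rewrite addr_eq0 => /eqP ->.
by rewrite (form_mx_anti X Y hF) opprK addrC subrr mulr0.
Qed.

(** A common vector of the spans of t1, t2 and of their conjugates would lie in the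
    +i-eigenspace and in its conjugate. *)
Lemma conj_independent a b c d :
  a *: t1 + b *: t2 = c *: conj t1 + d *: conj t2 -> a = 0 /\ b = 0.
Proof.
move=> e; set eta := a *: t1 + b *: t2 in e.
suff eta0 : row_mx 0 eta = 0 :> 'rV[C]_(6 + 6).
  by apply: wedge_dep; rewrite -/eta -[eta](row_mxKr (0 : 'rV_6)) eta0; apply/rowP => k; rewrite !mxE.
have sp x y : plus_i_eigenspace J (row_mx 0 (x *: t1 + y *: t2)).
  apply/isotropic_of_plus_i/isotropic_row; split; first by rewrite /ann2 !dot0r.
  move=> Z [z1 z2]; rewrite dotDl !dotZl z1 z2 !mulr0 -(scale0r (0 : 'rV[C]_6)) ev2Zl mul0r.
  by rewrite !addr0.
apply: (@plus_i_conj _ J); first exact: (sp a b).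
rewrite map_row_mx e map_mx0 map_mxD !map_mxZ -!map_mx_comp.
have cK (t : 'rV[C]_6) : map_mx (conjc \o conjc) t = t by apply/rowP => k; rewrite mxE /= conjcK.
by rewrite !cK; apply: sp.
Qed.

Let re (t : 'rV[C]_6) : 'rV[R]_6 := map_mx (@complex.Re R) t.
Let im (t : 'rV[C]_6) : 'rV[R]_6 := map_mx (@complex.Im R) t.

Let reimK t : t = cplx (re t) (im t).
Proof. exact: real_imaginary. Qed.

Let re_im_free c1 c2 c3 c4 :
  c1 *: re t1 + c2 *: im t1 + c3 *: re t2 + c4 *: im t2 = 0 ->
  [/\ c1 = 0, c2 = 0, c3 = 0 & c4 = 0].
Proof.
move=> e; pose a : C := Complex c1 (- c2); pose b : C := Complex c3 (- c4).
have : a *: t1 + b *: t2 = (- conjc a) *: conj t1 + (- conjc b) *: conj t2.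
  apply/rowP => k; have /rowP/(_ k) := e; rewrite !mxE /a /b.
  case: (t1 0 k) => x1 y1; case: (t2 0 k) => x2 y2 /= e2.
  apply/eqP; rewrite eq_complex /=; apply/andP; split; apply/eqP; last by ring.
  by apply/eqP; rewrite -subr_eq0 -(mulr0 2) -e2; apply/eqP; ring.
case/conj_independent => /eqP; rewrite eq_complex /= oppr_eq0 => /andP[/eqP -> /eqP ->].
by move=> /eqP; rewrite eq_complex /= oppr_eq0 => /andP[/eqP -> /eqP ->].
Qed.

(** Otherwise some p <> 0 in the real plane would be orthogonal to it for F, and
    would have a real lift p + xi to the +i-eigenspace: the values on p of F with
    the four remaining vectors of a real frame are matched by a real combination of
    the real and imaginary parts of t1 and t2.  But a real +i-eigenvector is 0. *)
Lemma form_nondegenerate (p q : 'rV[R]_6) : ann2 t1 t2 (toC p) -> ann2 t1 t2 (toC q) ->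
  ev2 (form_mx F) (toC p) (toC q) = 0 ->
  forall a b : 'rV[R]_6, dot a p * dot b q = dot b p * dot a q.
Proof.
move=> ap aq Fpq a b; apply/eqP; rewrite -subr_eq0; apply/negPn/negP => D0.
set D := _ - _ in D0.
pose a' := (dot b q / D) *: a - (dot a q / D) *: b.
pose b' := (dot a p / D) *: b - (dot b p / D) *: a.
have ap1 : dot a' p = 1 by rewrite !dotE; move: D0; rewrite /D => D0; field.
have aq0 : dot a' q = 0 by rewrite !dotE; move: D0; rewrite /D => D0; field.
have bp0 : dot b' p = 0 by rewrite !dotE; move: D0; rewrite /D => D0; field.
have bq1 : dot b' q = 1 by rewrite !dotE; move: D0; rewrite /D => D0; field.
have annE x : ann2 t1 t2 (toC x) -> [/\ dot (re t1) x = 0, dot (im t1) x = 0, dot (re t2) x = 0 & dot (im t2) x = 0].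
  rewrite /ann2 {1}[t1]reimK {1}[t2]reimK !dot_cplx !dot_toC => -[/eqP e1 /eqP e2].
  move: e1 e2; rewrite !eq_complex /= !mul0r !mul1r !subr0 !addr0 !add0r.
  by move=> /andP[/eqP -> /eqP ->] /andP[/eqP -> /eqP ->].
have [p1 p2 p3 p4] := annE _ ap; have [q1 q2 q3 q4] := annE _ aq.
have cf : coframe (re t1) (im t1) (re t2) (im t2) a' b'.
  apply: free_coframe => c1 c2 c3 c4 c5 c6 e.
  have c50 : c5 = 0.
    have := congr1 (fun f => dot f p) e; rewrite !dotDl !dotZl dot0l p1 p2 p3 p4 ap1 bp0.
    by rewrite !mulr0 mulr1 !add0r addr0.
  have c60 : c6 = 0.
    have := congr1 (fun f => dot f q) e; rewrite !dotDl !dotZl dot0l q1 q2 q3 q4 aq0 bq1.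
    by rewrite !mulr0 mulr1 !add0r.
  by move: e; rewrite c50 c60 !scale0r !addr0 => /re_im_free[-> -> -> ->].
have [x1 [x2 [x3 [x4 [x5 [x6 bi]]]]]] := coframe_dual cf.
have d := mx6_dual bi; have dC := dual_toC bi.
have ep : p = x5.
  by rewrite (dual_vec d p) p1 p2 p3 p4 ap1 bp0 !scale0r scale1r !add0r addr0.
have eq : q = x6.
  by rewrite (dual_vec d q) q1 q2 q3 q4 aq0 bq1 !scale0r scale1r !add0r.
pose A := form_mx F.
have App : ev2 A (toC p) (toC p) = 0.
  have /eqP := form_mx_anti (toC p) (toC p) hF; rewrite -/A -addr_eq0 -mulr2n.
  by rewrite mulrn_eq0 /= => /eqP.
have [a1 [a2 ea]] := opp_reim (ev2 A (toC x5) (toC x1) + 'i%C * ev2 A (toC x5) (toC x2)).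
have [a3 [a4 ea']] := opp_reim (ev2 A (toC x5) (toC x3) + 'i%C * ev2 A (toC x5) (toC x4)).
pose xi := a1 *: re t1 + a2 *: im t1 + a3 *: re t2 + a4 *: im t2.
have hv : plus_i_eigenspace J (toC (row_mx p xi)).
  rewrite map_row_mx; apply/isotropic_of_plus_i/isotropic_row; split=> // Z [].
  rewrite {1}(reimK t1) {1}(reimK t2) !dot_cplx => aZ1 aZ2.
  rewrite toC_comb4 ep; rewrite ep in App Fpq; rewrite eq in Fpq.
  have i2 : 'i%C * 'i%C = -1 :> C by rewrite -expr2 sqr_i.
  exact: (lift_vector i2 dC aZ1 aZ2 App Fpq ea ea').
have v0 : toC (row_mx p xi) = 0 :> 'rV[C]_(6 + 6).
  by apply: (plus_i_conj hv); rewrite conj_toC.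
have p0 : p = 0.
  apply/rowP => k; have /rowP/(_ (lshift 6 k)) := v0; rewrite mxE row_mxEl !mxE.
  by move=> /eqP; rewrite eq_complex /= => /andP[/eqP].
by move: ap1; rewrite p0 dot0r => /eqP; rewrite eq_sym oner_eq0.
Qed.
End TypeTwoSpinor.

Theorem type2_necessary (R : realType) (M : nilmanifold R 6) (J : 'rV[R]_6 -> 'M[R]_(6 + 6)) :
  generalized_complex M J -> left_invariant M J -> of_type J 2 -> type2_data (nil_algebra M).
Proof.
move=> gc li /(_ 0)[B [w [theta [hB hw]]]].
have [oJ J2 cJ] := left_invariant_generalized_complex gc li.
rewrite !big_ord2 wedge1r; set t1 := theta _; set t2 := theta _ => Om0 line.
set F := complexify B + 'i%C *: complexify w in line.
have hF : homogeneous 2 F.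
  apply: homogeneousD; first by move=> S nS; rewrite ffunE hB.
  by apply: homogeneousZ => S nS; rewrite ffunE hw.
have kill v : plus_i_eigenspace (J 0) v ->
    clifford v (wedge (form_exp F) (wedge (oneform t1) (oneform t2))) = 0.
  by apply: (line _).2; exists 1; rewrite scale1r.
have LE := isotropic_of_plus_i oJ J2 hF Om0 kill.
exists t1, t2, (form_mx F); split.
- by move=> X Y; apply: form_mx_anti.
- exact: (conj_independent oJ J2 hF Om0 kill).
- by apply: (courant_isotropic hF _).1 => u v /LE hu /LE hv; apply/LE/cJ.
- by apply: (courant_isotropic hF _).2 => u v /LE hu /LE hv; apply/LE/cJ.
- exact: (form_nondegenerate oJ J2 hF Om0 kill).
Qed.

(** * The lower central series and triangular coframes *)

Section LowerCentralSeries.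
Variables (R : realType) (n : nat) (g : lie_algebra R n).
Local Notation V := 'rV[R]_n.
Implicit Types (x y eta : V) (U W : {vspace V}).

Definition bracket_span U : {vspace V} :=
  <<[seq g x y | x <- vbasis U, y <- vbasis fullv]>>%VS.

Lemma bracket_span_subset U W :
  reflect (forall x y, x \in U -> g x y \in W) (bracket_span U <= W)%VS.
Proof.
apply: (iffP idP) => [UW x y xU|h]; last first.
  by apply/span_subvP => z /allpairsP[[x y] /= [/vbasis_mem xU _ ->]]; apply: h.
apply: (subvP UW); rewrite (coord_vbasis xU) (coord_vbasis (memvf y)).
rewrite br_suml; apply: rpred_sum => i _; rewrite br_sumr; apply: rpred_sum => j _.
rewrite brZl brZr; do 2 apply: rpredZ; apply: memv_span.
by apply/allpairsP; exists ((vbasis U)`_i, (vbasis fullv)`_j); split=> //;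
  apply: mem_nth; rewrite size_tuple.
Qed.

Lemma mem_bracket_span U x y : x \in U -> g x y \in bracket_span U.
Proof. by move=> xU; have /bracket_span_subset := subvv (bracket_span U); apply. Qed.

Lemma mem_lower_central k x y : x \in lower_central g k -> g x y \in lower_central g k.+1.
Proof. exact: mem_bracket_span. Qed.

Lemma lower_central_le j k : (j <= k)%N -> (lower_central g k <= lower_central g j)%VS.
Proof.
have s i : (lower_central g i.+1 <= lower_central g i)%VS.
  elim: i => [|i IH]; first exact: subvf.
  apply/bracket_span_subset => x y xU; exact/mem_lower_central/(subvP IH).
by elim: k => [|k IH]; rewrite leq_eqVlt => /orP[/eqP -> //|// jk]; apply: subv_trans (s k) (IH jk).
Qed.

(** By induction, U lies in every term of the lower central series. *)
Lemma nilpotent_not_self U : nilpotent_lie g -> (U <= bracket_span U)%VS -> U = 0%VS.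
Proof.
move=> [s /eqP es] h; apply/eqP; rewrite -subv0 -es; elim: s {es} => [|k IH]; first exact: subvf.
apply: (subv_trans h); apply/bracket_span_subset => x y /(subvP IH); exact: mem_lower_central.
Qed.

Lemma covector_separation U x : x \notin U ->
  exists2 eta, dot eta x != 0 & forall y, y \in U -> dot eta y = 0.
Proof.
move=> xU; pose f y := y - projv U y.
have f0 : f x != 0.
  by apply: contra xU; rewrite subr_eq0 => /eqP ->; apply: memv_proj.
have [k xk] : exists k, f x 0 k != 0.
  by apply/existsP; apply: contraR f0; rewrite negb_exists => /forallP h; apply/eqP/rowP => k;
    rewrite [RHS]mxE; apply/eqP; have := h k; rewrite negbK.
exists (\row_j f (delta_mx 0 j) 0 k).
  suff -> : dot (\row_j f (delta_mx 0 j) 0 k) x = f x 0 k by [].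
  rewrite dot_mxE {2}[x]row_decomp /f linear_sum /= -sumrB summxE; apply: eq_bigr => j _.
  by rewrite linearZ /= -scalerBr !mxE mulrC.
move=> y yU; suff -> : dot (\row_j f (delta_mx 0 j) 0 k) y = f y 0 k.
  by rewrite /f projv_id // subrr mxE.
rewrite dot_mxE {2}[y]row_decomp /f linear_sum /= -sumrB summxE; apply: eq_bigr => j _.
by rewrite linearZ /= -scalerBr !mxE mulrC.
Qed.

(** Engel's theorem in dual form: as long as there are fewer than n of them, an
    invariant set of covectors can be enlarged. *)
Lemma next_covector k (A : 'M[R]_(n, k)) : nilpotent_lie g -> (k < n)%N ->
  exists eta, (exists2 x, x *m A = 0 & dot eta x != 0) /\
    forall x y, x *m A = 0 -> dot eta (g x y) = 0.
Proof.
move=> gnil kn; pose U := lker (linfun (mulmxr A : V -> 'rV[R]_k)).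
have UP x : (x \in U) = (x *m A == 0) by rewrite memv_ker lfunE.
have U0 : U <> 0%VS.
  move=> U0; have : kermx A != 0.
    rewrite -mxrank_eq0 mxrank_ker -lt0n subn_gt0.
    by apply: leq_ltn_trans (rank_leq_col A) kn.
  case/eqP; apply/row_matrixP => i; rewrite row0; apply/eqP.
  rewrite -memv0 -U0 UP; apply/eqP/sub_kermxP; exact: row_sub.
have : ~~ (U <= bracket_span U)%VS by apply/negP => /(nilpotent_not_self gnil).
case/subvPn => x xU xb; have [eta ex eb] := covector_separation xb.
exists eta; split; first by exists x => //; apply/eqP; rewrite -UP.
by move=> z y zA; apply/eb/mem_bracket_span; rewrite UP; apply/eqP.
Qed.

Definition vanish (s : seq V) x : Prop := foldr (fun f P => dot f x = 0 /\ P) True s.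

Lemma vanishP s x : vanish s x <-> forall f, f \in s -> dot f x = 0.
Proof.
elim: s => [|f s IH] /=; first by split.
rewrite IH; split=> [[h1 h2] e|h].
  by rewrite inE => /orP[/eqP -> //|]; apply: h2.
by split=> [|e es]; apply: h; rewrite inE ?eqxx ?es ?orbT.
Qed.

Lemma next_covector_seq s : nilpotent_lie g -> (size s < n)%N ->
  exists eta, (exists2 x, vanish s x & dot eta x != 0) /\
    forall x y, vanish s x -> dot eta (g x y) = 0.
Proof.
move=> gnil /(next_covector (\matrix_(i < n, j < size s) s`_j 0 i) gnil)[eta].
have e x : x *m (\matrix_(i < n, j < size s) s`_j 0 i) = 0 <-> vanish s x.
  rewrite vanishP; split=> [/rowP h f fs|h].
    move: fs => /(nthP 0)[j hj <-]; have := h (Ordinal hj); rewrite !mxE => <-.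
    by rewrite dotC dot_mxE; apply: eq_bigr => i _; rewrite mxE.
  apply/rowP => j; rewrite [RHS]mxE -(h s`_j) ?mem_nth // dotC dot_mxE mxE.
  by apply: eq_bigr => i _; rewrite mxE.
by case=> [[x /e hx ex] h]; exists eta; split; [exists x|move=> y z /e; apply: h].
Qed.

Lemma vanish_lower_central k (A : seq V) eta :
  (forall f, f \in A -> forall x, x \in lower_central g k -> dot f x = 0) ->
  (forall x y, (forall f, f \in A -> dot f x = 0) -> dot eta (g x y) = 0) ->
  forall x, x \in lower_central g k.+1 -> dot eta x = 0.
Proof.
move=> hA he x; pose W := lker (linfun (mulmxr eta^T : V -> 'rV[R]_1)).
have WP y : (y \in W) = (dot eta y == 0).
  rewrite memv_ker lfunE /= dotC /dot; apply/eqP/eqP => [->|e]; first by rewrite mxE.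
  by apply/rowP => i; rewrite ord1 e mxE.
have /subvP h : (lower_central g k.+1 <= W)%VS.
  by apply/bracket_span_subset => y z yk; rewrite WP he // => f fA; apply: hA.
by move=> /h; rewrite WP => /eqP.
Qed.

Lemma ann_lower_centralP i eta :
  reflect (forall x, x \in lower_central g i -> dot eta x = 0) (eta \in ann_lower_central g i).
Proof.
have lP (x : V) : (eta \in lker (linfun (mulmxr x^T : V -> 'rV[R]_1))) = (dot eta x == 0).
  rewrite memv_ker lfunE /= /dot; apply/eqP/eqP => [->|e]; first by rewrite mxE.
  by apply/rowP => j; rewrite ord1 e mxE.
have memP : eta \in ann_lower_central g i = all (fun x => dot eta x == 0) (vbasis (lower_central g i)).
  rewrite /ann_lower_central; elim: (tval _) => [|x s IH]; first by rewrite big_nil memvf.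
  by rewrite big_cons memv_cap lP IH.
rewrite memP; apply: (iffP allP) => [h x xi|h x /vbasis_mem /h ->] //.
rewrite (coord_vbasis xi) dot_sumr big1 // => j _; rewrite dotZr.
by rewrite (eqP (h _ _)) ?mulr0 // mem_nth // size_tuple.
Qed.

End LowerCentralSeries.

Section TriangularCoframe.
Variable R : realType.
Local Notation V := 'rV[R]_6.

Lemma alternating_dual (A : 'M[R]_6) (e1 e2 e3 e4 e5 e6 x1 x2 x3 x4 x5 x6 : V) :
  dual e1 e2 e3 e4 e5 e6 x1 x2 x3 x4 x5 x6 -> (forall x y, ev2 A y x = - ev2 A x y) ->
  A = ev2 A x1 x2 *: wd e1 e2 + ev2 A x1 x3 *: wd e1 e3 + ev2 A x2 x3 *: wd e2 e3
    + ev2 A x1 x4 *: wd e1 e4 + ev2 A x2 x4 *: wd e2 e4 + ev2 A x3 x4 *: wd e3 e4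
    + ev2 A x1 x5 *: wd e1 e5 + ev2 A x2 x5 *: wd e2 e5 + ev2 A x3 x5 *: wd e3 e5
    + ev2 A x4 x5 *: wd e4 e5
    + ev2 A x1 x6 *: wd e1 e6 + ev2 A x2 x6 *: wd e2 e6 + ev2 A x3 x6 *: wd e3 e6
    + ev2 A x4 x6 *: wd e4 e6 + ev2 A x5 x6 *: wd e5 e6.
Proof.
move=> d alt; have sq x : ev2 A x x = 0.
  by have /eqP := alt x x; rewrite -addr_eq0 -mulr2n mulrn_eq0 /= => /eqP.
apply: ev2_ext => x y; rewrite {1}(dual_vec d x) {1}(dual_vec d y).
rewrite !ev2Dl !ev2Zl !ev2Dr !ev2Zr !ev2D !ev2Z !ev2_wd !sq.
rewrite (alt x1 x2) (alt x1 x3) (alt x1 x4) (alt x1 x5) (alt x1 x6) (alt x2 x3) (alt x2 x4).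
rewrite (alt x2 x5) (alt x2 x6) (alt x3 x4) (alt x3 x5) (alt x3 x6) (alt x4 x5) (alt x4 x6) (alt x5 x6).
ring.
Qed.

Variable g : lie_algebra R 6.

Lemma dmx_anti eta x y : ev2 (dmx g eta) y x = - ev2 (dmx g eta) x y.
Proof. by rewrite !ev2_dmx br_anti dotNr. Qed.

(** Repeated use of [next_covector_seq]: e_k kills the brackets with the annihilator of
    e_1, .., e_(k-1), so that d e_k is a 2-form in e_1, .., e_(k-1). *)
Lemma triangular_coframe : nilpotent_lie g ->
  exists e1 e2 e3 e4 e5 e6 a b1 b2 b3 c1 c2 c3 c4 c5 c6 d1 d2 d3 d4 d5 d6 d7 d8 d9 d0,
  [/\ coframe e1 e2 e3 e4 e5 e6, dmx g e1 = 0 /\ dmx g e2 = 0, dmx g e3 = a *: wd e1 e2,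
    dmx g e4 = b1 *: wd e1 e2 + b2 *: wd e1 e3 + b3 *: wd e2 e3 &
    dmx g e5 = c1 *: wd e1 e2 + c2 *: wd e1 e3 + c3 *: wd e2 e3 +
      c4 *: wd e1 e4 + c5 *: wd e2 e4 + c6 *: wd e3 e4 /\
    dmx g e6 = d1 *: wd e1 e2 + d2 *: wd e1 e3 + d3 *: wd e2 e3 +
      d4 *: wd e1 e4 + d5 *: wd e2 e4 + d6 *: wd e3 e4 +
      d7 *: wd e1 e5 + d8 *: wd e2 e5 + d9 *: wd e3 e5 + d0 *: wd e4 e5].
Proof.
move=> gnil.
have [e1 [[y1 _ n1] h1]] := next_covector_seq (s := [::]) gnil isT.
have [e2 [[y2 v2 n2] h2]] := next_covector_seq (s := [:: e1]) gnil isT.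
have [e3 [[y3 v3 n3] h3]] := next_covector_seq (s := [:: e1; e2]) gnil isT.
have [e4 [[y4 v4 n4] h4]] := next_covector_seq (s := [:: e1; e2; e3]) gnil isT.
have [e5 [[y5 v5 n5] h5]] := next_covector_seq (s := [:: e1; e2; e3; e4]) gnil isT.
have [e6 [[y6 v6 n6] h6]] := next_covector_seq (s := [:: e1; e2; e3; e4; e5]) gnil isT.
rewrite /= in v2 v3 v4 v5 v6 h1 h2 h3 h4 h5 h6.
have cf : coframe e1 e2 e3 e4 e5 e6.
  apply: free_coframe => c1 c2 c3 c4 c5 c6 e.
  have ev x : c1 * dot e1 x + c2 * dot e2 x + c3 * dot e3 x + c4 * dot e4 x + c5 * dot e5 x + c6 * dot e6 x = 0.
    by rewrite -!dotZl -!dotDl e dot0l.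
  have z c x : c * x = 0 -> x != 0 -> c = 0 :> R.
    by move=> /eqP; rewrite mulf_eq0 => /orP[/eqP //|/eqP ->]; rewrite eqxx.
  have c60 : c6 = 0.
    by case: v6 => a1 [a2 [a3 [a4 [a5 _]]]]; have := ev y6; rewrite a1 a2 a3 a4 a5 !mulr0 !add0r => /z; apply.
  have c50 : c5 = 0.
    by case: v5 => a1 [a2 [a3 [a4 _]]]; have := ev y5; rewrite a1 a2 a3 a4 c60 !mulr0 mul0r addr0 !add0r => /z; apply.
  have c40 : c4 = 0.
    by case: v4 => a1 [a2 [a3 _]]; have := ev y4; rewrite a1 a2 a3 c60 c50 !mulr0 !mul0r !addr0 !add0r => /z; apply.
  have c30 : c3 = 0.
    by case: v3 => a1 [a2 _]; have := ev y3; rewrite a1 a2 c60 c50 c40 !mulr0 !mul0r !addr0 !add0r => /z; apply.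
  have c20 : c2 = 0.
    by case: v2 => a1 _; have := ev y2; rewrite a1 c60 c50 c40 c30 !mulr0 !mul0r !addr0 !add0r => /z; apply.
  by have := ev y1; rewrite c60 c50 c40 c30 c20 !mul0r !addr0 => /z ->.
have [x1 [x2 [x3 [x4 [x5 [x6 bi]]]]]] := coframe_dual cf; have d := mx6_dual bi.
have ev := dual_ev d.
have z11 y : ev2 (dmx g e1) y x1 = 0 by rewrite dmx_anti ev2_dmx h1 ?dot0r ?oppr0 //= ?oppr0 ?ev.
have z12 y : ev2 (dmx g e1) y x2 = 0 by rewrite dmx_anti ev2_dmx h1 ?dot0r ?oppr0 //= ?oppr0 ?ev.
have z13 y : ev2 (dmx g e1) y x3 = 0 by rewrite dmx_anti ev2_dmx h1 ?dot0r ?oppr0 //= ?oppr0 ?ev.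
have z14 y : ev2 (dmx g e1) y x4 = 0 by rewrite dmx_anti ev2_dmx h1 ?dot0r ?oppr0 //= ?oppr0 ?ev.
have z15 y : ev2 (dmx g e1) y x5 = 0 by rewrite dmx_anti ev2_dmx h1 ?dot0r ?oppr0 //= ?oppr0 ?ev.
have z16 y : ev2 (dmx g e1) y x6 = 0 by rewrite dmx_anti ev2_dmx h1 ?dot0r ?oppr0 //= ?oppr0 ?ev.
have z22 y : ev2 (dmx g e2) y x2 = 0 by rewrite dmx_anti ev2_dmx h2 ?dot0r ?oppr0 //= ?oppr0 ?ev.
have z23 y : ev2 (dmx g e2) y x3 = 0 by rewrite dmx_anti ev2_dmx h2 ?dot0r ?oppr0 //= ?oppr0 ?ev.
have z24 y : ev2 (dmx g e2) y x4 = 0 by rewrite dmx_anti ev2_dmx h2 ?dot0r ?oppr0 //= ?oppr0 ?ev.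
have z25 y : ev2 (dmx g e2) y x5 = 0 by rewrite dmx_anti ev2_dmx h2 ?dot0r ?oppr0 //= ?oppr0 ?ev.
have z26 y : ev2 (dmx g e2) y x6 = 0 by rewrite dmx_anti ev2_dmx h2 ?dot0r ?oppr0 //= ?oppr0 ?ev.
have z33 y : ev2 (dmx g e3) y x3 = 0 by rewrite dmx_anti ev2_dmx h3 ?dot0r ?oppr0 //= ?oppr0 ?ev.
have z34 y : ev2 (dmx g e3) y x4 = 0 by rewrite dmx_anti ev2_dmx h3 ?dot0r ?oppr0 //= ?oppr0 ?ev.
have z35 y : ev2 (dmx g e3) y x5 = 0 by rewrite dmx_anti ev2_dmx h3 ?dot0r ?oppr0 //= ?oppr0 ?ev.
have z36 y : ev2 (dmx g e3) y x6 = 0 by rewrite dmx_anti ev2_dmx h3 ?dot0r ?oppr0 //= ?oppr0 ?ev.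
have z44 y : ev2 (dmx g e4) y x4 = 0 by rewrite dmx_anti ev2_dmx h4 ?dot0r ?oppr0 //= ?oppr0 ?ev.
have z45 y : ev2 (dmx g e4) y x5 = 0 by rewrite dmx_anti ev2_dmx h4 ?dot0r ?oppr0 //= ?oppr0 ?ev.
have z46 y : ev2 (dmx g e4) y x6 = 0 by rewrite dmx_anti ev2_dmx h4 ?dot0r ?oppr0 //= ?oppr0 ?ev.
have z55 y : ev2 (dmx g e5) y x5 = 0 by rewrite dmx_anti ev2_dmx h5 ?dot0r ?oppr0 //= ?oppr0 ?ev.
have z56 y : ev2 (dmx g e5) y x6 = 0 by rewrite dmx_anti ev2_dmx h5 ?dot0r ?oppr0 //= ?oppr0 ?ev.
have z66 y : ev2 (dmx g e6) y x6 = 0 by rewrite dmx_anti ev2_dmx h6 ?dot0r ?oppr0 //= ?oppr0 ?ev.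
have r k := alternating_dual d (dmx_anti k).
exists e1, e2, e3, e4, e5, e6, (ev2 (dmx g e3) x1 x2), (ev2 (dmx g e4) x1 x2), (ev2 (dmx g e4) x1 x3), (ev2 (dmx g e4) x2 x3).
exists (ev2 (dmx g e5) x1 x2), (ev2 (dmx g e5) x1 x3), (ev2 (dmx g e5) x2 x3), (ev2 (dmx g e5) x1 x4), (ev2 (dmx g e5) x2 x4), (ev2 (dmx g e5) x3 x4).
exists (ev2 (dmx g e6) x1 x2), (ev2 (dmx g e6) x1 x3), (ev2 (dmx g e6) x2 x3), (ev2 (dmx g e6) x1 x4), (ev2 (dmx g e6) x2 x4), (ev2 (dmx g e6) x3 x4), (ev2 (dmx g e6) x1 x5), (ev2 (dmx g e6) x2 x5), (ev2 (dmx g e6) x3 x5), (ev2 (dmx g e6) x4 x5).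
split=> //; [split| | |split].
- by rewrite {1}[dmx g e1]r !z12 !z13 !z14 !z15 !z16 !scale0r ?addr0.
- by rewrite {1}[dmx g e2]r !z22 !z23 !z24 !z25 !z26 !scale0r ?addr0.
- by rewrite {1}[dmx g e3]r !z33 !z34 !z35 !z36 !scale0r ?addr0.
- by rewrite {1}[dmx g e4]r !z44 !z45 !z46 !scale0r ?addr0.
- by rewrite {1}[dmx g e5]r !z55 !z56 !scale0r ?addr0.
- by rewrite {1}[dmx g e6]r !z66 !scale0r ?addr0.
Qed.
End TriangularCoframe.

(** * Criteria for the existence of split structures *)

Section SplitCriterion.
Variables (K : fieldType) (V : Type) (br : V -> V -> V) (i : K).
Hypothesis i2 : i * i = -1.

(** The conditions of [split_type2], for the 2-form (p5 + mu p4) /\ p6 and in terms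
    of coordinates [p1, .., p6] on the complexified Lie algebra, the
    annihilator of p1 + i p2 and p3 + i p4 being p2 = i p1, p4 = i p3.  The complex
    parameter mu is available because, on this annihilator, mu p4 agrees with a
    real combination of p3 and p4, which can be added to p5.  It is used to satisfy the
    closedness of the 2-form when this amounts to a single equation.  In the names of
    the lemmas, digits j k stand for the term e_j /\ e_k of a differential. *)
Definition split_crit (mu : K) (p1 p2 p3 p4 p5 p6 : V -> K) :=
  (forall X Y, p2 X = i * p1 X -> p4 X = i * p3 X -> p2 Y = i * p1 Y -> p4 Y = i * p3 Y ->
     p2 (br X Y) = i * p1 (br X Y) /\ p4 (br X Y) = i * p3 (br X Y)) /\
  (forall X Y Z, p2 X = i * p1 X -> p4 X = i * p3 X -> p2 Y = i * p1 Y -> p4 Y = i * p3 Y ->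
     p2 Z = i * p1 Z -> p4 Z = i * p3 Z ->
     let F U W := (p5 U + mu * p4 U) * p6 W - p6 U * (p5 W + mu * p4 W) in
     F (br X Y) Z + F (br Y Z) X + F (br Z X) Y = 0).

Definition w2 (a b : V -> K) X Y := a X * b Y - b X * a Y.
Definition closedf (e : V -> K) := forall X Y, e (br X Y) = 0.

Variables e1 e2 e3 e4 e5 e6 : V -> K.

Lemma crit_12_13 a b d e f1 f2 f3 mu : closedf e1 -> closedf e2 -> closedf e3 ->
  (forall X Y, e4 (br X Y) = - w2 e1 e2 X Y) ->
  (forall X Y, e5 (br X Y) = - w2 e1 e3 X Y) ->
  (forall X Y, e6 (br X Y) = - (a * w2 e1 e4 X Y + b * w2 e1 e5 X Y
     + (e - i * d *+ 2 + mu * i * (a + i * b)) * w2 e2 e4 X Y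
     + d * (w2 e2 e5 X Y + w2 e3 e4 X Y) + e * w2 e3 e5 X Y
     + f1 * w2 e1 e2 X Y + f2 * w2 e1 e3 X Y + f3 * w2 e2 e3 X Y)) ->
  split_crit mu e4 e5 e2 e3 e1 e6.
Proof.
move=> h1 h2 h3 h4 h5 h6; split=> [X Y x1 x2 y1 y2|X Y Z x1 x2 y1 y2 z1 z2 F].
  by rewrite h2 h3 h4 h5 mulr0; split=> //; rewrite /w2 x2 y2; ring.
rewrite /F !h1 !h3 !h6 /w2 !x1 !y1 !z1 !x2 !y2 !z2; ring: i2.
Qed.

Lemma crit_closed4 u v x y u' v' x' y' : closedf e1 -> closedf e2 -> closedf e3 -> closedf e4 ->
  (forall X Y, e5 (br X Y) = - (u * w2 e1 e2 X Y + v * w2 e3 e4 X Y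
     + x * (w2 e1 e3 X Y + w2 e2 e4 X Y) + y * (w2 e1 e4 X Y - w2 e2 e3 X Y))) ->
  (forall X Y, e6 (br X Y) = - (u' * w2 e1 e2 X Y + v' * w2 e3 e4 X Y
     + x' * (w2 e1 e3 X Y + w2 e2 e4 X Y) + y' * (w2 e1 e4 X Y - w2 e2 e3 X Y))) ->
  split_crit 0 e1 e2 e3 e4 e5 e6.
Proof.
move=> h1 h2 h3 h4 h5 h6; split=> [X Y x1 x2 y1 y2|X Y Z x1 x2 y1 y2 z1 z2 F].
  by rewrite h1 h2 h3 h4 mulr0.
rewrite /F !h5 !h6 /w2 !x1 !y1 !z1 !x2 !y2 !z2; ring: i2.
Qed.

Lemma crit_15 k b12 b13 b14 b23 b24 b34 :
  closedf e1 -> closedf e2 -> closedf e3 -> closedf e4 ->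
  (forall X Y, e5 (br X Y) = - (k * w2 e1 e2 X Y)) ->
  (forall X Y, e6 (br X Y) = - (w2 e1 e5 X Y + b12 * w2 e1 e2 X Y + b13 * w2 e1 e3 X Y
     + b14 * w2 e1 e4 X Y + b23 * w2 e2 e3 X Y + b24 * w2 e2 e4 X Y + b34 * w2 e3 e4 X Y)) ->
  split_crit (- i * (b13 + i * b14 + i * b23 - b24)) e1 e2 e3 e4 e5 e6.
Proof.
move=> h1 h2 h3 h4 h5 h6; split=> [X Y x1 x2 y1 y2|X Y Z x1 x2 y1 y2 z1 z2 F].
  by rewrite h1 h2 h3 h4 mulr0.
rewrite /F !h4 !h5 !h6 /w2 !x1 !y1 !z1 !x2 !y2 !z2; ring: i2.
Qed.

(** The complex 2-form psi = d (e5 + i e6) satisfies psi /\ psi = 0, so that it is a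
    multiple of t1 /\ t2, where t1 and t2 are its interior products by the vectors
    dual to e2 and e1, up to sign.  The structure has the covectors t1 and
    e5 + i e6, and the real and imaginary parts of t2 give its 2-form, which is
    closed. *)
Lemma crit_definite a12 a13 a14 a23 a24 a34 b12 b13 b14 b23 b24 b34 :
  a12 + i * b12 != 0 ->
  a12 * a34 - a13 * a24 + a14 * a23 = b12 * b34 - b13 * b24 + b14 * b23 ->
  a12 * b34 + b12 * a34 - a13 * b24 - b13 * a24 + a14 * b23 + b14 * a23 = 0 ->
  closedf e1 -> closedf e2 -> closedf e3 -> closedf e4 ->
  (forall X Y, e5 (br X Y) = - (a12 * w2 e1 e2 X Y + a13 * w2 e1 e3 X Y
     + a14 * w2 e1 e4 X Y + a23 * w2 e2 e3 X Y + a24 * w2 e2 e4 X Y + a34 * w2 e3 e4 X Y)) ->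
  (forall X Y, e6 (br X Y) = - (b12 * w2 e1 e2 X Y + b13 * w2 e1 e3 X Y
     + b14 * w2 e1 e4 X Y + b23 * w2 e2 e3 X Y + b24 * w2 e2 e4 X Y + b34 * w2 e3 e4 X Y)) ->
  split_crit 0 (fun X => a12 * e1 X - a23 * e3 X - a24 * e4 X)
    (fun X => b12 * e1 X - b23 * e3 X - b24 * e4 X) e5 e6
    (fun X => a12 * e2 X + a13 * e3 X + a14 * e4 X)
    (fun X => b12 * e2 X + b13 * e3 X + b14 * e4 X).
Proof.
move=> n0 pf bil h1 h2 h3 h4 h5 h6; split=> [X Y x1 x2 y1 y2|X Y Z x1 x2 y1 y2 z1 z2 F].
  rewrite !h1 !h3 !h4; split; first by ring.
  pose t1 X := (a12 + i * b12) * e1 X - (a23 + i * b23) * e3 X - (a24 + i * b24) * e4 X.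
  pose t2 X := (a12 + i * b12) * e2 X + (a13 + i * b13) * e3 X + (a14 + i * b14) * e4 X.
  have tX : t1 X = 0.
    transitivity ((a12 * e1 X - a23 * e3 X - a24 * e4 X) + i * (b12 * e1 X - b23 * e3 X - b24 * e4 X)).
      by rewrite /t1; ring.
    by rewrite x1; ring: i2.
  have tY : t1 Y = 0.
    transitivity ((a12 * e1 Y - a23 * e3 Y - a24 * e4 Y) + i * (b12 * e1 Y - b23 * e3 Y - b24 * e4 Y)).
      by rewrite /t1; ring.
    by rewrite y1; ring: i2.
  apply/eqP; rewrite -subr_eq0 -(mulrI_eq0 _ (mulfI n0)); apply/eqP.
  transitivity (i * (t1 X * t2 Y - t2 X * t1 Y) + i * w2 e3 e4 X Y *
    ((a12 * a34 - a13 * a24 + a14 * a23) - (b12 * b34 - b13 * b24 + b14 * b23)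
     + i * (a12 * b34 + b12 * a34 - a13 * b24 - b13 * a24 + a14 * b23 + b14 * a23))).
    by rewrite h5 h6 /t1 /t2 /w2; ring: i2.
  by rewrite tX tY pf bil; ring.
by rewrite /F !h2 !h3 !h4; ring.
Qed.

Lemma crit_filiform q l d1 d2 d3 d4 d5 : q != 0 -> l != 0 ->
  closedf e1 -> closedf e2 -> closedf e3 ->
  (forall X Y, e4 (br X Y) = - w2 e1 e2 X Y) ->
  (forall X Y, e5 (br X Y) = - (w2 e1 e4 X Y + q * w2 e2 e3 X Y)) ->
  (forall X Y, e6 (br X Y) = - (l * (w2 e1 e5 X Y - q * w2 e3 e4 X Y) + d1 * w2 e1 e2 X Y
     + d2 * w2 e1 e3 X Y + d3 * w2 e2 e3 X Y + d4 * w2 e1 e4 X Y + d5 * w2 e2 e4 X Y)) ->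
  split_crit (- i * (d2 * i / q - d3 / q + d4 + i * d5) / l)
    e1 e2 e4 (fun X => q * e3 X) e5 e6.
Proof.
move=> q0 l0 h1 h2 h3 h4 h5 h6; split=> [X Y x1 x2 y1 y2|X Y Z x1 x2 y1 y2 z1 z2 F].
  by rewrite h1 h2 h3 h4 /w2 x1 y1 !mulr0; split=> //; ring.
have e3E U : q * e3 U = i * e4 U -> e3 U = i * e4 U / q.
  by move=> <-; rewrite mulrC mulKf.
rewrite /F !h3 !h5 !h6 /w2 (e3E X) // (e3E Y) // (e3E Z) // !x1 !y1 !z1.
field: i2; by rewrite q0 l0.
Qed.

Lemma crit_elliptic p q m w : m != 0 -> w * w = - (p * p + q * m) ->
  closedf e1 -> closedf e2 -> closedf e3 ->
  (forall X Y, e4 (br X Y) = - w2 e1 e2 X Y) ->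
  (forall X Y, e5 (br X Y) = - (w2 e1 e4 X Y + p * w2 e1 e3 X Y + q * w2 e2 e3 X Y)) ->
  (forall X Y, e6 (br X Y) = - (w2 e2 e4 X Y + m * w2 e1 e3 X Y - p * w2 e2 e3 X Y)) ->
  split_crit 0 (fun X => m * e1 X - p * e2 X) (fun X => w * e2 X)
    (fun X => m * e5 X - p * e6 X) (fun X => w * e6 X) e3 e4.
Proof.
move=> m0 ew h1 h2 h3 h4 h5 h6.
have e1E U : w * e2 U = i * (m * e1 U - p * e2 U) -> e1 U = (p - i * w) * e2 U / m.
  move=> e; apply: (mulfI m0); rewrite mulrCA divff // mulr1.
  transitivity (p * e2 U - i * (w * e2 U)); last by ring.
  by rewrite e; ring: i2.
split=> [X Y x1 x2 y1 y2|X Y Z x1 x2 y1 y2 z1 z2 F].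
  rewrite !h1 !h2 !mulr0 subrr mulr0; split=> //.
  rewrite h5 h6 /w2 (e1E X) // (e1E Y) //.
  by field: i2 ew.
rewrite /F !h3 !h4 /w2 (e1E X) // (e1E Y) // (e1E Z) //; by field.
Qed.

Lemma crit_14_24 : closedf e1 -> closedf e2 -> closedf e3 ->
  (forall X Y, e4 (br X Y) = - w2 e1 e2 X Y) ->
  (forall X Y, e5 (br X Y) = - w2 e1 e4 X Y) ->
  (forall X Y, e6 (br X Y) = - w2 e2 e4 X Y) ->
  split_crit 0 e1 e2 e5 e6 e3 e4.
Proof.
move=> h1 h2 h3 h4 h5 h6; split=> [X Y x1 x2 y1 y2|X Y Z x1 x2 y1 y2 z1 z2 F].
  by rewrite h1 h2 h5 h6 /w2 x1 y1 mulr0; split=> //; ring.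
rewrite /F !h3 !h4 /w2 !x1 !y1 !z1; ring.
Qed.

Lemma crit_13_23 : closedf e1 -> closedf e2 ->
  (forall X Y, e3 (br X Y) = - w2 e1 e2 X Y) ->
  (forall X Y, e4 (br X Y) = - w2 e1 e3 X Y) ->
  (forall X Y, e5 (br X Y) = - w2 e2 e3 X Y) ->
  (forall X Y, e6 (br X Y) = - (w2 e1 e4 X Y + w2 e2 e5 X Y)) ->
  split_crit 0 e1 e2 e4 e5 e3 e6.
Proof.
move=> h1 h2 h3 h4 h5 h6; split=> [X Y x1 x2 y1 y2|X Y Z x1 x2 y1 y2 z1 z2 F].
  by rewrite h1 h2 h4 h5 /w2 x1 y1 mulr0; split=> //; ring.
rewrite /F !h3 !h5 !h6 /w2 !x1 !y1 !z1 !x2 !y2 !z2; ring: i2.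
Qed.

End SplitCriterion.

Lemma absorb_scalars (K : comNzRingType) (i a b x y : K) : i * i = -1 ->
  x + a * (i * y) - b * y = x + (a + i * b) * (i * y).
Proof. by move=> i2; ring: i2. Qed.

Section SplitType2.
Variables (R : realType) (g : lie_algebra R 6).
Local Notation C := R[i].
Local Notation toC := (map_mx (real_complex R)).
Local Notation V := 'rV[R]_6.
Implicit Types (e f : V).

(** The real and imaginary parts of mu are m1 and m2; on the annihilator, i m2 p4 is
    - m2 p3. *)
Lemma split_type2_crit (f1 f2 f3 f4 f5 f6 : V) (mu : C) : coframe f1 f2 f3 f4 f5 f6 ->
  split_crit (bracketC g) 'i%C mu (dot (toC f1)) (dot (toC f2)) (dot (toC f3)) (dot (toC f4))
    (dot (toC f5)) (dot (toC f6)) -> split_type2 g.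
Proof.
move=> cf [sub cl]; case: mu cl => m1 m2 cl.
have i2 : 'i%C * 'i%C = -1 :> C by rewrite -expr2 sqr_i.
have annE a b c d X : ann2 (cplx a b) (cplx c d) X ->
    dot (toC b) X = 'i%C * dot (toC a) X /\ dot (toC d) X = 'i%C * dot (toC c) X.
  rewrite /ann2 !dot_cplx => -[/(isotropic_scalars2 i2)[h _] /(isotropic_scalars2 i2)[h' _]].
  by split.
have annI a b c d X : dot (toC b) X = 'i%C * dot (toC a) X ->
    dot (toC d) X = 'i%C * dot (toC c) X -> ann2 (cplx a b) (cplx c d) X.
  by move=> h h'; rewrite /ann2 !dot_cplx; split; apply: isotropic_scalars4.
have sub' : subalgebra g (ann2 (cplx f1 f2) (cplx f3 f4)).
  move=> X Y /annE[x1 x2] /annE[y1 y2]; have [h h'] := sub X Y x1 x2 y1 y2.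
  exact: annI.
exists f1, f2, f3, f4, (f5 + m1 *: f4 - m2 *: f3), f6; split=> //.
  move=> x h1 h2 h3 h4; rewrite dotDl dotNl dotDl !dotZl h3 h4 !mulr0 addr0 subr0.
  exact: cf.
move=> X Y Z aX aY aZ.
have [x1 x2] := annE _ _ _ _ _ aX; have [y1 y2] := annE _ _ _ _ _ aY.
have [z1 z2] := annE _ _ _ _ _ aZ.
have muE U : ann2 (cplx f1 f2) (cplx f3 f4) U -> dot (toC (f5 + m1 *: f4 - m2 *: f3)) U =
    dot (toC f5) U + (m1 +i* m2)%C * dot (toC f4) U.
  move=> /annE[_ u2]; rewrite toC_D toC_N toC_D !toC_Z dotDl dotNl dotDl !dotZl u2.
  have -> : (m1 +i* m2)%C = m1%:C%C + 'i%C * m2%:C%C.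
    by apply/eqP; rewrite eq_complex /=; apply/andP; split; apply/eqP; ring.
  exact: absorb_scalars.
have e U W : ann2 (cplx f1 f2) (cplx f3 f4) U -> ann2 (cplx f1 f2) (cplx f3 f4) W ->
    ev2 (toC (wd (f5 + m1 *: f4 - m2 *: f3) f6)) U W =
    (dot (toC f5) U + (m1 +i* m2)%C * dot (toC f4) U) * dot (toC f6) W -
    dot (toC f6) U * (dot (toC f5) W + (m1 +i* m2)%C * dot (toC f4) W).
  by move=> aU aW; rewrite toC_wd ev2_wd !muE.
rewrite (e _ _ (sub' _ _ aX aY) aZ) (e _ _ (sub' _ _ aY aZ) aX) (e _ _ (sub' _ _ aZ aX) aY).
exact: (cl X Y Z x1 x2 y1 y2 z1 z2).
Qed.

End SplitType2.

(** * Shapes of coframes giving split structures *)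

Definition has_split (K : fieldType) (R : fieldType) (phi : R -> K) (br : 'rV[K]_6 -> 'rV[K]_6 -> 'rV[K]_6)
    (i : K) := exists f1 f2 f3 f4 f5 f6 mu, coframe f1 f2 f3 f4 f5 f6 /\
  split_crit br i mu (dot (map_mx phi f1)) (dot (map_mx phi f2)) (dot (map_mx phi f3))
    (dot (map_mx phi f4)) (dot (map_mx phi f5)) (dot (map_mx phi f6)).

(** The scalar extension is kept abstract: [br] extends the bracket of a Lie
    algebra over R to K = R + i R, and [d e] is the matrix of the differential of e. *)
Section SplitCases.
Variables (R K : fieldType) (phi : {rmorphism R -> K}) (i : K).
Variables (d : 'rV[R]_6 -> 'M[R]_6) (br : 'rV[K]_6 -> 'rV[K]_6 -> 'rV[K]_6).
Hypothesis i2 : i * i = -1.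
Hypothesis free1i : forall a b : R, phi a + i * phi b = 0 -> a = 0 /\ b = 0.
Local Notation toK := (map_mx phi).
Hypothesis struct : forall e X Y, dot (toK e) (br X Y) = - ev2 (toK (d e)) X Y.
Local Notation V := 'rV[R]_6.
Local Notation split := (has_split phi br i).

Let toK_wd a b : toK (wd a b) = wd (toK a) (toK b) :> 'M[K]_6.
Proof. by rewrite /wd map_mxB !map_mxM !map_trmx. Qed.

Let toKE := (toK_wd, map_mxD phi, map_mxN phi, map_mxZ phi, map_mx0 phi).

Let evKwd (a b : V) X Y : ev2 (toK (wd a b)) X Y = dot (toK a) X * dot (toK b) Y - dot (toK b) X * dot (toK a) Y.
Proof. by rewrite toK_wd ev2_wd. Qed.

Let evKD (A B : 'M[R]_6) X Y : ev2 (toK (A + B)) X Y = ev2 (toK A) X Y + ev2 (toK B) X Y.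
Proof. by rewrite map_mxD ev2D. Qed.

Let evKN (A : 'M[R]_6) X Y : ev2 (toK (- A)) X Y = - ev2 (toK A) X Y.
Proof. by rewrite map_mxN ev2N. Qed.

Let evKZ k (A : 'M[R]_6) X Y : ev2 (toK (k *: A)) X Y = phi k * ev2 (toK A) X Y.
Proof. by rewrite map_mxZ ev2Z. Qed.

Let evKE := (evKwd, evKD, evKN, evKZ).

Lemma closed_toK e : d e = 0 -> closedf br (dot (toK e)).
Proof. by move=> h X Y; rewrite struct h toKE ev20 oppr0. Qed.

Lemma wd_toK e (f1 f2 : V) : d e = wd f1 f2 ->
  forall X Y, dot (toK e) (br X Y) = - w2 (dot (toK f1)) (dot (toK f2)) X Y.
Proof. by move=> h X Y; rewrite struct h toK_wd ev2_wd. Qed.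

(** The coefficient c of e2 /\ e4 is arbitrary when (a, b) <> 0, since
    phi a + i phi b is then invertible and mu can be solved for. *)
Lemma split_12_13_aux (e1 e2 e3 e4 e5 e6 : V) (a b c d' e f1 f2 f3 : R) :
  coframe e1 e2 e3 e4 e5 e6 -> d e1 = 0 -> d e2 = 0 -> d e3 = 0 ->
  d e4 = wd e1 e2 -> d e5 = wd e1 e3 ->
  d e6 = a *: wd e1 e4 + b *: wd e1 e5 + c *: wd e2 e4 + d' *: (wd e2 e5 + wd e3 e4) + e *: wd e3 e5
    + f1 *: wd e1 e2 + f2 *: wd e1 e3 + f3 *: wd e2 e3 ->
  (a != 0) || (b != 0) || [&& c == 0, d' == 0 & e == 0] -> split.
Proof.
move=> cf h1 h2 h3 h4 h5 h6 cond.
have cf' : coframe e4 e5 e2 e3 e1 e6 by move=> x ? ? ? ? ? ?; apply: cf.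
have [mu hmu] : exists mu : K, phi c = phi e - i * phi d' *+ 2 + mu * i * (phi a + i * phi b).
  case/orP: cond => [ab|/and3P[/eqP -> /eqP -> /eqP ->]]; last first.
    by exists 0; rewrite !mul0r rmorph0 mulr0 mul0rn subr0 addr0.
  have n0 : phi a + i * phi b != 0.
    by apply/eqP => /free1i[a0 b0]; move: ab; rewrite a0 b0 eqxx.
  have ni : i != 0 by apply/eqP => i0; move: i2; rewrite i0 mul0r => /esym/eqP; rewrite oppr_eq0 oner_eq0.
  exists ((phi c - phi e + i * phi d' *+ 2) / (i * (phi a + i * phi b))).
  rewrite -mulrA divfK ?mulf_neq0 //; ring.
exists e4, e5, e2, e3, e1, e6, mu; split=> //.
apply: (crit_12_13 i2 (a := phi a) (b := phi b) (d := phi d') (e := phi e)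
  (f1 := phi f1) (f2 := phi f2) (f3 := phi f3)).
- exact: closed_toK.
- exact: closed_toK.
- exact: closed_toK.
- exact: wd_toK.
- exact: wd_toK.
by move=> X Y; rewrite struct h6 !evKE -hmu.
Qed.

Lemma split_closed4 (e1 e2 e3 e4 e5 e6 : V) u v x y u' v' x' y' :
  coframe e1 e2 e3 e4 e5 e6 -> d e1 = 0 -> d e2 = 0 -> d e3 = 0 -> d e4 = 0 ->
  d e5 = u *: wd e1 e2 + v *: wd e3 e4 + x *: (wd e1 e3 + wd e2 e4) + y *: (wd e1 e4 - wd e2 e3) ->
  d e6 = u' *: wd e1 e2 + v' *: wd e3 e4 + x' *: (wd e1 e3 + wd e2 e4) + y' *: (wd e1 e4 - wd e2 e3) ->
  split.
Proof.
move=> cf h1 h2 h3 h4 h5 h6; exists e1, e2, e3, e4, e5, e6, 0; split=> //.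
apply: (crit_closed4 i2 (closed_toK h1) (closed_toK h2) (closed_toK h3) (closed_toK h4)
  (u := phi u) (v := phi v) (x := phi x) (y := phi y)
  (u' := phi u') (v' := phi v') (x' := phi x') (y' := phi y')).
  by move=> X Y; rewrite struct h5 !evKE.
by move=> X Y; rewrite struct h6 !evKE.
Qed.

Lemma split_15 (e1 e2 e3 e4 e5 e6 : V) k b12 b13 b14 b23 b24 b34 :
  coframe e1 e2 e3 e4 e5 e6 -> d e1 = 0 -> d e2 = 0 -> d e3 = 0 -> d e4 = 0 ->
  d e5 = k *: wd e1 e2 ->
  d e6 = wd e1 e5 + b12 *: wd e1 e2 + b13 *: wd e1 e3 + b14 *: wd e1 e4 + b23 *: wd e2 e3
    + b24 *: wd e2 e4 + b34 *: wd e3 e4 -> split.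
Proof.
move=> cf h1 h2 h3 h4 h5 h6.
have := @crit_15 _ _ br _ i2 (dot (toK e1)) (dot (toK e2)) (dot (toK e3)) (dot (toK e4))
  (dot (toK e5)) (dot (toK e6)) (phi k) (phi b12) (phi b13) (phi b14) (phi b23) (phi b24) (phi b34) 
  (closed_toK h1) (closed_toK h2) (closed_toK h3) (closed_toK h4).
move=> H; exists e1, e2, e3, e4, e5, e6; eexists; split; [exact: cf|apply: H].
  by move=> X Y; rewrite struct h5 !evKE.
by move=> X Y; rewrite struct h6 !evKE.
Qed.

(** The first two rows of the complex 2-form psi = alpha + i beta span its row
    space since psi /\ psi = 0, so that psi vanishes on x, hence so does alpha,
    which is nondegenerate. *)
Lemma definite_nondegenerate (a12 a13 a14 a23 a24 a34 b12 b13 b14 b23 b24 b34 x1 x2 x3 x4 : R) :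
  (a12 != 0) || (b12 != 0) ->
  a12 * a34 - a13 * a24 + a14 * a23 != 0 ->
  a12 * a34 - a13 * a24 + a14 * a23 = b12 * b34 - b13 * b24 + b14 * b23 ->
  a12 * b34 + b12 * a34 - a13 * b24 - b13 * a24 + a14 * b23 + b14 * a23 = 0 ->
  a12 * x1 - a23 * x3 - a24 * x4 = 0 -> b12 * x1 - b23 * x3 - b24 * x4 = 0 ->
  a12 * x2 + a13 * x3 + a14 * x4 = 0 -> b12 * x2 + b13 * x3 + b14 * x4 = 0 ->
  [/\ x1 = 0, x2 = 0, x3 = 0 & x4 = 0].
Proof.
move=> n0 pf0 pf bil p1 p2 p3 p4.
pose psi a b := phi a + i * phi b.
have psi12 : psi a12 b12 != 0 by apply/eqP => /free1i[a0 b0]; move: n0; rewrite a0 b0 eqxx.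
have row a b : psi a12 b12 * psi a b = 0 -> a = 0.
  by move=> /eqP; rewrite mulf_eq0 (negPf psi12) /= => /eqP /free1i[].
have Pf : psi a12 b12 * psi a34 b34 - psi a13 b13 * psi a24 b24 + psi a14 b14 * psi a23 b23 = 0.
  transitivity (phi ((a12 * a34 - a13 * a24 + a14 * a23) - (b12 * b34 - b13 * b24 + b14 * b23))
    + i * phi (a12 * b34 + b12 * a34 - a13 * b24 - b13 * a24 + a14 * b23 + b14 * a23)).
    by rewrite /psi; ring: i2.
  by rewrite pf bil subrr rmorph0 mulr0 addr0.
have q1 : psi a12 b12 * phi x1 - psi a23 b23 * phi x3 - psi a24 b24 * phi x4 = 0.
  transitivity (phi (a12 * x1 - a23 * x3 - a24 * x4) + i * phi (b12 * x1 - b23 * x3 - b24 * x4)).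
    by rewrite /psi; ring.
  by rewrite p1 p2 rmorph0 mulr0 addr0.
have q2 : psi a12 b12 * phi x2 + psi a13 b13 * phi x3 + psi a14 b14 * phi x4 = 0.
  transitivity (phi (a12 * x2 + a13 * x3 + a14 * x4) + i * phi (b12 * x2 + b13 * x3 + b14 * x4)).
    by rewrite /psi; ring.
  by rewrite p3 p4 rmorph0 mulr0 addr0.
have r3 : a13 * x1 + a23 * x2 - a34 * x4 = 0.
  apply: (row _ (b13 * x1 + b23 * x2 - b34 * x4)).
  transitivity (psi a13 b13 * (psi a12 b12 * phi x1 - psi a23 b23 * phi x3 - psi a24 b24 * phi x4)
    + psi a23 b23 * (psi a12 b12 * phi x2 + psi a13 b13 * phi x3 + psi a14 b14 * phi x4)
    - (psi a12 b12 * psi a34 b34 - psi a13 b13 * psi a24 b24 + psi a14 b14 * psi a23 b23) * phi x4).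
    by rewrite /psi; ring.
  by rewrite q1 q2 Pf; ring.
have r4 : a14 * x1 + a24 * x2 + a34 * x3 = 0.
  apply: (row _ (b14 * x1 + b24 * x2 + b34 * x3)).
  transitivity (psi a14 b14 * (psi a12 b12 * phi x1 - psi a23 b23 * phi x3 - psi a24 b24 * phi x4)
    + psi a24 b24 * (psi a12 b12 * phi x2 + psi a13 b13 * phi x3 + psi a14 b14 * phi x4)
    + (psi a12 b12 * psi a34 b34 - psi a13 b13 * psi a24 b24 + psi a14 b14 * psi a23 b23) * phi x3).
    by rewrite /psi; ring.
  by rewrite q1 q2 Pf; ring.
have z x : (a12 * a34 - a13 * a24 + a14 * a23) * x = 0 -> x = 0.
  by move=> /eqP; rewrite mulf_eq0 (negPf pf0) /= => /eqP.
split; apply: z.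
- transitivity (a34 * (a12 * x1 - a23 * x3 - a24 * x4) - a24 * (a13 * x1 + a23 * x2 - a34 * x4)
    + a23 * (a14 * x1 + a24 * x2 + a34 * x3)); first by ring.
  by rewrite p1 r3 r4; ring.
- transitivity (a34 * (a12 * x2 + a13 * x3 + a14 * x4) - a13 * (a14 * x1 + a24 * x2 + a34 * x3)
    + a14 * (a13 * x1 + a23 * x2 - a34 * x4)); first by ring.
  by rewrite p3 r3 r4; ring.
- transitivity (- a24 * (a12 * x2 + a13 * x3 + a14 * x4) - a14 * (a12 * x1 - a23 * x3 - a24 * x4)
    + a12 * (a14 * x1 + a24 * x2 + a34 * x3)); first by ring.
  by rewrite p1 p3 r4; ring.
transitivity (a23 * (a12 * x2 + a13 * x3 + a14 * x4) + a13 * (a12 * x1 - a23 * x3 - a24 * x4)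
    - a12 * (a13 * x1 + a23 * x2 - a34 * x4)); first by ring.
by rewrite p1 p3 r3; ring.
Qed.

Lemma split_definite (e1 e2 e3 e4 e5 e6 : V) a12 a13 a14 a23 a24 a34 b12 b13 b14 b23 b24 b34 :
  coframe e1 e2 e3 e4 e5 e6 -> d e1 = 0 -> d e2 = 0 -> d e3 = 0 -> d e4 = 0 ->
  d e5 = a12 *: wd e1 e2 + a13 *: wd e1 e3 + a14 *: wd e1 e4 + a23 *: wd e2 e3
    + a24 *: wd e2 e4 + a34 *: wd e3 e4 ->
  d e6 = b12 *: wd e1 e2 + b13 *: wd e1 e3 + b14 *: wd e1 e4 + b23 *: wd e2 e3
    + b24 *: wd e2 e4 + b34 *: wd e3 e4 ->
  (a12 != 0) || (b12 != 0) ->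
  a12 * a34 - a13 * a24 + a14 * a23 != 0 ->
  a12 * a34 - a13 * a24 + a14 * a23 = b12 * b34 - b13 * b24 + b14 * b23 ->
  a12 * b34 + b12 * a34 - a13 * b24 - b13 * a24 + a14 * b23 + b14 * a23 = 0 ->
  split.
Proof.
move=> cf h1 h2 h3 h4 h5 h6 n0 pf0 pf bil.
have lE a b c f1 f2 f3 : dot (toK (a *: f1 - b *: f2 - c *: f3)) =
    (fun X => phi a * dot (toK f1) X - phi b * dot (toK f2) X - phi c * dot (toK f3) X).
  by apply: boolp.funext => X; rewrite !toKE !dotE.
have lE' a b c f1 f2 f3 : dot (toK (a *: f1 + b *: f2 + c *: f3)) =
    (fun X => phi a * dot (toK f1) X + phi b * dot (toK f2) X + phi c * dot (toK f3) X).
  by apply: boolp.funext => X; rewrite !toKE !dotE.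
exists (a12 *: e1 - a23 *: e3 - a24 *: e4), (b12 *: e1 - b23 *: e3 - b24 *: e4),
  e5, e6, (a12 *: e2 + a13 *: e3 + a14 *: e4), (b12 *: e2 + b13 *: e3 + b14 *: e4), 0; split.
  move=> X; rewrite !dotE => p1 p2 p5 p6 p3 p4.
  move: (dot e1 X) (dot e2 X) (dot e3 X) (dot e4 X) p1 p2 p3 p4 (cf X) => x1 x2 x3 x4 p1 p2 p3 p4 cX.
  suff [? ? ? ?] : [/\ x1 = 0, x2 = 0, x3 = 0 & x4 = 0] by apply: cX.
  exact: (definite_nondegenerate n0 pf0 pf bil p1 p2 p3 p4).
rewrite !lE !lE'; apply: (crit_definite i2 _ _ _ (closed_toK h1) (closed_toK h2) (closed_toK h3)
  (closed_toK h4) (a34 := phi a34) (b34 := phi b34)).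
- by apply/eqP => /free1i[a0 b0]; move: n0; rewrite a0 b0 eqxx.
- by rewrite -!rmorphM -!rmorphB -!rmorphD pf.
- by rewrite -!rmorphM -rmorphD -!rmorphB -!rmorphD bil rmorph0.
- by move=> X Y; rewrite struct h5 !evKE.
by move=> X Y; rewrite struct h6 !evKE.
Qed.

Lemma split_filiform (e1 e2 e3 e4 e5 e6 : V) q l d1 d2 d3 d4 d5 :
  coframe e1 e2 e3 e4 e5 e6 -> q != 0 -> l != 0 -> d e1 = 0 -> d e2 = 0 -> d e3 = 0 ->
  d e4 = wd e1 e2 -> d e5 = wd e1 e4 + q *: wd e2 e3 ->
  d e6 = l *: (wd e1 e5 - q *: wd e3 e4) + d1 *: wd e1 e2 + d2 *: wd e1 e3 + d3 *: wd e2 e3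
    + d4 *: wd e1 e4 + d5 *: wd e2 e4 -> split.
Proof.
move=> cf q0 l0 h1 h2 h3 h4 h5 h6.
have cf' : coframe e1 e2 e4 (q *: e3) e5 e6.
  move=> X ? ? ?; rewrite dotZl => /eqP; rewrite mulf_eq0 (negPf q0) /= => /eqP ? ? ?; exact: cf.
have qC : phi q != 0 by rewrite fmorph_eq0.
have lC : phi l != 0 by rewrite fmorph_eq0.
have eq3 : dot (toK (q *: e3)) = fun X => phi q * dot (toK e3) X.
  by apply: boolp.funext => X; rewrite map_mxZ dotZl.
have := @crit_filiform _ _ br _ i2 (dot (toK e1)) (dot (toK e2)) (dot (toK e3)) (dot (toK e4))
  (dot (toK e5)) (dot (toK e6)) (phi q) (phi l) (phi d1) (phi d2) (phi d3) (phi d4) (phi d5) qC lC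
  (closed_toK h1) (closed_toK h2) (closed_toK h3) (wd_toK h4).
rewrite -eq3 => H; exists e1, e2, e4, (q *: e3), e5, e6; eexists; split; [exact: cf'|apply: H].
  by move=> X Y; rewrite struct h5 !evKE.
by move=> X Y; rewrite struct h6 !evKE.
Qed.

Lemma split_elliptic (e1 e2 e3 e4 e5 e6 : V) p q m w :
  coframe e1 e2 e3 e4 e5 e6 -> m != 0 -> w != 0 -> w * w = - (p * p + q * m) -> d e1 = 0 -> d e2 = 0 -> d e3 = 0 ->
  d e4 = wd e1 e2 -> d e5 = wd e1 e4 + p *: wd e1 e3 + q *: wd e2 e3 ->
  d e6 = wd e2 e4 + m *: wd e1 e3 - p *: wd e2 e3 -> split.
Proof.
move=> cf m0 w0 ew h1 h2 h3 h4 h5 h6.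
have cf' : coframe (m *: e1 - p *: e2) (w *: e2) (m *: e5 - p *: e6) (w *: e6) e3 e4.
  move=> X; rewrite !dotE => a1 a2 a3 a4 a5 a6.
  have b2 : dot e2 X = 0 by apply/eqP; move/eqP: a2; rewrite mulf_eq0 (negPf w0).
  have b6 : dot e6 X = 0 by apply/eqP; move/eqP: a4; rewrite mulf_eq0 (negPf w0).
  have b1 : dot e1 X = 0 by apply/eqP; move/eqP: a1; rewrite b2 mulr0 subr0 mulf_eq0 (negPf m0).
  have b5 : dot e5 X = 0 by apply/eqP; move/eqP: a3; rewrite b6 mulr0 subr0 mulf_eq0 (negPf m0).
  exact: cf.
have mC : phi m != 0 by rewrite fmorph_eq0.
have ewC : phi w * phi w = - (phi p * phi p + phi q * phi m) :> K.
  by rewrite -!rmorphM -rmorphD -rmorphN ew.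
have lE a b f1 f2 : dot (toK (a *: f1 - b *: f2)) =
    (fun X => phi a * dot (toK f1) X - phi b * dot (toK f2) X).
  by apply: boolp.funext => X; rewrite !toKE !dotE.
have lE' a f1 : dot (toK (a *: f1)) = (fun X => phi a * dot (toK f1) X).
  by apply: boolp.funext => X; rewrite !toKE !dotE.
exists (m *: e1 - p *: e2), (w *: e2), (m *: e5 - p *: e6), (w *: e6), e3, e4, 0; split=> //.
rewrite !lE !lE'.
apply: (crit_elliptic i2 mC ewC (closed_toK h1) (closed_toK h2) (closed_toK h3) (wd_toK h4)).
  by move=> X Y; rewrite struct h5 !evKE.
by move=> X Y; rewrite struct h6 !evKE.
Qed.

Lemma split_14_24 (e1 e2 e3 e4 e5 e6 : V) :
  coframe e1 e2 e3 e4 e5 e6 -> d e1 = 0 -> d e2 = 0 -> d e3 = 0 ->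
  d e4 = wd e1 e2 -> d e5 = wd e1 e4 -> d e6 = wd e2 e4 -> split.
Proof.
move=> cf h1 h2 h3 h4 h5 h6.
have cf' : coframe e1 e2 e5 e6 e3 e4 by move=> x ? ? ? ? ? ?; apply: cf.
exists e1, e2, e5, e6, e3, e4, 0; split=> //.
exact: (@crit_14_24 _ _ br i _ _ _ _ _ _ (closed_toK h1) (closed_toK h2) (closed_toK h3) (wd_toK h4)
  (wd_toK h5) (wd_toK h6)).
Qed.

Lemma split_13_23 (e1 e2 e3 e4 e5 e6 : V) :
  coframe e1 e2 e3 e4 e5 e6 -> d e1 = 0 -> d e2 = 0 -> d e3 = wd e1 e2 ->
  d e4 = wd e1 e3 -> d e5 = wd e2 e3 -> d e6 = wd e1 e4 + wd e2 e5 -> split.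
Proof.
move=> cf h1 h2 h3 h4 h5 h6.
have cf' : coframe e1 e2 e4 e5 e3 e6 by move=> x ? ? ? ? ? ?; apply: cf.
exists e1, e2, e4, e5, e3, e6, 0; split=> //.
apply: (crit_13_23 i2 (closed_toK h1) (closed_toK h2) (wd_toK h3) (wd_toK h4) (wd_toK h5)).
by move=> X Y; rewrite struct h6 !evKE.
Qed.

End SplitCases.

Section Existence.
Variables (R : realType) (g : lie_algebra R 6).
Local Notation V := 'rV[R]_6.

Lemma split_type2_has_split :
  has_split (real_complex R) (bracketC g) ('i%C : R[i]) -> split_type2 g.
Proof.
move=> [f1 [f2 [f3 [f4 [f5 [f6 [mu [cf crit]]]]]]]].
exact: (split_type2_crit cf crit).
Qed.

Lemma i2C : 'i%C * 'i%C = -1 :> R[i].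
Proof. by rewrite -expr2 sqr_i. Qed.

Lemma free1iC (a b : R) : real_complex R a + 'i%C * real_complex R b = 0 -> a = 0 /\ b = 0.
Proof.
move=> /eqP; rewrite eq_complex /= => /andP[/eqP h1 /eqP h2].
by move: h1 h2; rewrite !(mul0r, mulr0, mul1r, add0r, addr0, subr0).
Qed.

End Existence.

(** * Reduction of a nilpotent Lie algebra of dimension 6 to normal form *)

Section Reduction.
Variables (R : realType) (g : lie_algebra R 6).
Local Notation V := 'rV[R]_6.
Local Notation d := (dmx g).
Local Notation ok := (split_type2 g).

Lemma opp0_inv (u : R) : - u = 0 -> u = 0.
Proof. by move=> /eqP; rewrite oppr_eq0 => /eqP. Qed.

Lemma cramer2 (a b c e u v : R) : a * e - b * c != 0 ->
  a * u + b * v = 0 -> c * u + e * v = 0 -> u = 0 /\ v = 0.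
Proof.
move=> D h1 h2; split; apply: (mulf_cancel0 D).
  transitivity (e * (a * u + b * v) - b * (c * u + e * v)); [ring|by rewrite h1 h2; ring].
transitivity (a * (c * u + e * v) - c * (a * u + b * v)); [ring|by rewrite h1 h2; ring].
Qed.

(** Encodes that A is a 2-form in the covectors of s, without choosing coefficients:
    it is stable under changes of basis of the span of s. *)
Definition supp (s : seq V) (A : 'M[R]_6) := forall x y, vanish s x -> ev2 A x y = 0.

Lemma ev2D_eq A B (x y : V) a b : ev2 A x y = a -> ev2 B x y = b -> ev2 (A + B) x y = a + b.
Proof. by move=> <- <-; rewrite ev2D. Qed.

Lemma ev2N_eq A (x y : V) a : ev2 A x y = a -> ev2 (- A) x y = - a.
Proof. by move=> <-; rewrite ev2N. Qed.

Lemma ev2Z_eq c A (x y : V) a : ev2 A x y = a -> ev2 (c *: A) x y = c * a.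
Proof. by move=> <-; rewrite ev2Z. Qed.

Lemma ev2_wd_eq (u v x y : V) a b a' b' : dot u x = a -> dot v y = b -> dot v x = a' -> dot u y = b' ->
  ev2 (wd u v) x y = a * b - a' * b'.
Proof. by move=> <- <- <- <-; rewrite ev2_wd. Qed.

Lemma dotD_eq (u v x : V) a b : dot u x = a -> dot v x = b -> dot (u + v) x = a + b.
Proof. by move=> <- <-; rewrite dotDl. Qed.

Lemma dotN_eq (u x : V) a : dot u x = a -> dot (- u) x = - a.
Proof. by move=> <-; rewrite dotNl. Qed.

Lemma dotZ_eq c (u x : V) a : dot u x = a -> dot (c *: u) x = c * a.
Proof. by move=> <-; rewrite dotZl. Qed.

End Reduction.

Ltac zeros :=
  repeat match goal with
  | H : _ /\ _ |- _ => destruct H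
  | H : is_true (?k != 0), H' : ?k * _ = 0 |- _ => apply (mulf_cancel0 H) in H'
  | H : - _ = 0 |- _ => apply opp0_inv in H
  | H : dot ?e ?x = 0, H' : context [dot ?e ?x] |- _ =>
     lazymatch H' with H => fail | _ => idtac end;
     lazymatch type of H' with
     | dot e x = 0 => clear H'
     | _ => rewrite ?H ?(mulr0, mul0r, addr0, add0r, subr0, sub0r, oppr0) in H' end
  | H : dot ?e ?x = 0 |- context [dot ?e ?x] => rewrite H
  end.

(* Derives the vanishing of the covectors of a coframe from that of a second one,
   obtained from the first by a triangular substitution. *)
Ltac change_coframe cf :=
  let X := fresh "X" in move=> X; rewrite !dotE;
  let z1 := fresh "z" in move=> z1; let z1 := fresh "z" in move=> z1;
  let z1 := fresh "z" in move=> z1; let z1 := fresh "z" in move=> z1;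
  let z1 := fresh "z" in move=> z1; let z1 := fresh "z" in move=> z1;
  zeros; apply: cf; assumption.

(* Same thing for the support of a 2-form. *)
Ltac change_supp h :=
  let x := fresh "x" in let y := fresh "y" in let v := fresh "v" in
  move=> x y v; apply: h; move: v; rewrite /vanish /= ?dotE => v; zeros; by do ?split.

(* [dot_value u x] and [ev2_value A x y] prove that dot u x and ev2 A x y equal
   their expansions, following the syntax of u and A. *)
Ltac dot_value u x :=
  lazymatch u with
  | ?v + ?w => let p := dot_value v x in let q := dot_value w x in constr:(dotD_eq p q)
  | - ?v => let p := dot_value v x in constr:(dotN_eq p)
  | ?c *: ?v => let p := dot_value v x in constr:(dotZ_eq c p)
  | _ => constr:(erefl (dot u x))
  end.

Ltac ev2_value A x y :=
  lazymatch A with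
  | ?B + ?C => let p := ev2_value B x y in let q := ev2_value C x y in constr:(ev2D_eq p q)
  | - ?B => let p := ev2_value B x y in constr:(ev2N_eq p)
  | ?c *: ?B => let p := ev2_value B x y in constr:(ev2Z_eq c p)
  | wd ?u ?v => let p := dot_value u x in let q := dot_value v y in
      let p' := dot_value v x in let q' := dot_value u y in constr:(ev2_wd_eq p q p' q')
  | 0 => constr:(ev20 x y)
  | _ => constr:(erefl (ev2 A x y))
  end.

(* Reduces an identity between 2-forms to an identity between scalars. *)
Ltac forms :=
  apply: ev2_ext => ? ?;
  lazymatch goal with |- ev2 ?A ?x ?y = ev2 ?B _ _ =>
    let p := ev2_value A x y in let q := ev2_value B x y in
    refine (eq_trans p (eq_trans _ (esym q))) end.

(* Evaluates an expression in the differentials of a coframe on the vectors of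
   the dual basis. *)
Ltac expand_ev2 :=
  repeat match goal with |- context [ev2 ?A ?x ?y] =>
    let p := ev2_value A x y in rewrite p end.

Ltac coordinates h dl H := rewrite h; expand_ev2; rewrite !dot_br !H; expand_ev2; rewrite !(dual_ev dl).

Section ReductionA.
Variables (R : realType) (g : lie_algebra R 6).
Local Notation V := 'rV[R]_6.
Local Notation d := (dmx g).
Local Notation ok := (split_type2 g).

Lemma supp5 (e1 e2 e3 e4 e5 e6 : V) A : coframe e1 e2 e3 e4 e5 e6 ->
  (forall x y, ev2 A y x = - ev2 A x y) -> supp [:: e1; e2; e3; e4; e5] A ->
  exists a12 a13 a23 a14 a24 a34 a15 a25 a35 a45,
  A = a12 *: wd e1 e2 + a13 *: wd e1 e3 + a23 *: wd e2 e3 + a14 *: wd e1 e4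
    + a24 *: wd e2 e4 + a34 *: wd e3 e4 + a15 *: wd e1 e5 + a25 *: wd e2 e5
    + a35 *: wd e3 e5 + a45 *: wd e4 e5.
Proof.
move=> cf alt s; have [x1 [x2 [x3 [x4 [x5 [x6 /mx6_dual dl]]]]]] := coframe_dual cf.
have v6 : vanish [:: e1; e2; e3; e4; e5] x6 by rewrite /= !(dual_ev dl).
have z x : ev2 A x x6 = 0 by rewrite alt s ?oppr0.
do 10!eexists; rewrite {1}(alternating_dual dl alt) !z !scale0r !addr0; reflexivity.
Qed.

Lemma supp4 (e1 e2 e3 e4 e5 e6 : V) A : coframe e1 e2 e3 e4 e5 e6 ->
  (forall x y, ev2 A y x = - ev2 A x y) -> supp [:: e1; e2; e3; e4] A ->
  exists a12 a13 a23 a14 a24 a34,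
  A = a12 *: wd e1 e2 + a13 *: wd e1 e3 + a23 *: wd e2 e3 + a14 *: wd e1 e4
    + a24 *: wd e2 e4 + a34 *: wd e3 e4.
Proof.
move=> cf alt s; have [x1 [x2 [x3 [x4 [x5 [x6 /mx6_dual dl]]]]]] := coframe_dual cf.
have v5 : vanish [:: e1; e2; e3; e4] x5 by rewrite /= !(dual_ev dl).
have v6 : vanish [:: e1; e2; e3; e4] x6 by rewrite /= !(dual_ev dl).
have z x : ev2 A x x6 = 0 by rewrite alt s ?oppr0.
have z' x : ev2 A x x5 = 0 by rewrite alt s ?oppr0.
do 6!eexists; rewrite {1}(alternating_dual dl alt) !z !z' !scale0r !addr0; reflexivity.
Qed.

Lemma supp3 (e1 e2 e3 e4 e5 e6 : V) A : coframe e1 e2 e3 e4 e5 e6 ->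
  (forall x y, ev2 A y x = - ev2 A x y) -> supp [:: e1; e2; e3] A ->
  exists a12 a13 a23, A = a12 *: wd e1 e2 + a13 *: wd e1 e3 + a23 *: wd e2 e3.
Proof.
move=> cf alt s; have [x1 [x2 [x3 [x4 [x5 [x6 /mx6_dual dl]]]]]] := coframe_dual cf.
have v4 : vanish [:: e1; e2; e3] x4 by rewrite /= !(dual_ev dl).
have v5 : vanish [:: e1; e2; e3] x5 by rewrite /= !(dual_ev dl).
have v6 : vanish [:: e1; e2; e3] x6 by rewrite /= !(dual_ev dl).
have z x : ev2 A x x6 = 0 by rewrite alt s ?oppr0.
have z' x : ev2 A x x5 = 0 by rewrite alt s ?oppr0.
have z'' x : ev2 A x x4 = 0 by rewrite alt s ?oppr0.
do 3!eexists; rewrite {1}(alternating_dual dl alt) !z !z' !z'' !scale0r !addr0; reflexivity.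
Qed.

(** A shift of e2 and e3 by multiples of e1 makes the coefficients of e1 /\ e4 and
    e1 /\ e5 not both zero, unless those of e2 /\ e4, e2 /\ e5 and e3 /\ e5 all vanish. *)
Lemma ok_12_13 (e1 e2 e3 e4 e5 e6 : V) :
  coframe e1 e2 e3 e4 e5 e6 -> d e1 = 0 -> d e2 = 0 -> d e3 = 0 ->
  d e4 = wd e1 e2 -> d e5 = wd e1 e3 -> supp [:: e1; e2; e3; e4; e5] (d e6) -> ok.
Proof.
move=> cf h1 h2 h3 h4 h5 /(supp5 cf (dmx_anti g _))
  [a12 [a13 [a23 [a14 [a24 [a34 [a15 [a25 [a35 [a45 h6]]]]]]]]]].
have [x1 [x2 [x3 [x4 [x5 [x6 /mx6_dual dl]]]]]] := coframe_dual cf.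
have J x y z : _ = 0 := dd0 g e6 x y z.
have e45 : a45 = 0.
  have := J x1 x2 x5; coordinates h6 dl (h1, h2, h3, h4, h5).
  lra.
have e25 : a34 = a25.
  have := J x1 x2 x3; coordinates h6 dl (h1, h2, h3, h4, h5).
  lra.
have key s t : (a14 - a24 * s - a25 * t != 0) || (a15 - a25 * s - a35 * t != 0) ||
    [&& a24 == 0, a25 == 0 & a35 == 0] -> ok.
  move=> c; apply: split_type2_has_split.
  apply: (@split_12_13_aux R _ (real_complex R) 'i%C d (bracketC g) (i2C R) (@free1iC R) (@dot_brC R _ g)
    e1 (e2 + s *: e1) (e3 + t *: e1) e4 e5 e6 _ _ _ _ _ (a12 + a23 * t) (a13 - a23 * s) a23 _ _ _ _ _ _ _ c) => //.
  - by change_coframe cf.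
  - by rewrite !dmxE h1 h2 scaler0 addr0.
  - by rewrite !dmxE h1 h3 scaler0 addr0.
  - by rewrite h4; forms; ring.
  - rewrite h5; forms; ring.
  by rewrite h6 e45 e25; forms; ring.
have [a14_0|n14] := eqVneq a14 0; last first.
  by apply: (key 0 0); rewrite !mulr0 !subr0 n14.
have [a15_0|n15] := eqVneq a15 0; last first.
  by apply: (key 0 0); rewrite !mulr0 !subr0 n15 orbT.
have [a24_0|n24] := eqVneq a24 0; last first.
  by apply: (key (-1) 0); rewrite a14_0 mulr0 mulrN1 opprK add0r subr0 n24.
have [a25_0|n25] := eqVneq a25 0; last first.
  by apply: (key (-1) 0); rewrite a15_0 !mulr0 !mulrN1 !opprK !add0r !subr0 n25 orbT.
have [a35_0|n35] := eqVneq a35 0; last first.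
  by apply: (key 0 (-1)); rewrite a15_0 !mulr0 !mulrN1 !opprK !subr0 !add0r n35 orbT.
by apply: (key 0 0); rewrite a24_0 a25_0 a35_0 eqxx !orbT.
Qed.

Lemma ok_closed4 (f1 f2 f3 f4 e5 e6 : V) u v x y u' v' x' y' :
  coframe f1 f2 f3 f4 e5 e6 -> d f1 = 0 -> d f2 = 0 -> d f3 = 0 -> d f4 = 0 ->
  d e5 = u *: wd f1 f2 + v *: wd f3 f4 + x *: (wd f1 f3 + wd f2 f4) + y *: (wd f1 f4 - wd f2 f3) ->
  d e6 = u' *: wd f1 f2 + v' *: wd f3 f4 + x' *: (wd f1 f3 + wd f2 f4) + y' *: (wd f1 f4 - wd f2 f3) ->
  ok.
Proof.
move=> cf z1 z2 z3 z4 z5 z6; apply: split_type2_has_split.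
exact: (split_closed4 (@i2C R) (@dot_brC R _ g) cf z1 z2 z3 z4 z5 z6).
Qed.

Lemma ok_closed4_12_13 (e1 e2 e3 e4 e5 e6 : V) k b :
  coframe e1 e2 e3 e4 e5 e6 -> d e1 = 0 -> d e2 = 0 -> d e3 = 0 -> d e4 = 0 ->
  d e5 = k *: wd e1 e2 -> d e6 = b *: wd e1 e2 + wd e1 e3 -> ok.
Proof.
move=> cf h1 h2 h3 h4 h5 h6; have [k0|nk] := eqVneq k 0.
  apply: (@ok_closed4 e1 (e3 + b *: e2) e2 e4 e5 e6 0 0 0 0 1 0 0 0) => //.
  - by change_coframe cf.
  - by rewrite !dmxE h2 h3 scaler0 addr0.
  - by rewrite h5 k0 !scale0r !addr0.
  rewrite h6; forms; ring.
have nk' : k^-1 != 0 by rewrite invr_eq0.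
apply: (@ok_12_13 e1 e2 e3 (k^-1 *: e5) (e6 - (b / k) *: e5) e4) => //.
- by change_coframe cf.
- by rewrite !dmxE h5; forms; field.
- by rewrite !dmxE h5 h6; forms; field.
by move=> x y _; rewrite h4 ev20.
Qed.

(** Completes a covector of the span of e1, e2 to a basis with the same exterior
    product, so that d e4 = e1 /\ e2 is preserved by the change of basis. *)
Lemma unimodular2 (e1 e2 : V) (p q : R) : (p != 0) || (q != 0) -> exists f2,
  [/\ wd (p *: e1 + q *: e2) f2 = wd e1 e2,
      forall X, dot (p *: e1 + q *: e2) X = 0 -> dot f2 X = 0 -> dot e1 X = 0 /\ dot e2 X = 0 &
      d e1 = 0 -> d e2 = 0 -> d f2 = 0].
Proof.
move=> n0; have [p0|np] := eqVneq p 0; last first.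
  have ip : p^-1 != 0 by rewrite invr_eq0.
  exists (p^-1 *: e2); split; first by forms; field.
    by move=> X; rewrite !dotE => z1 z2; zeros.
  by move=> _ h2; rewrite !dmxE h2 scaler0.
have nq : q != 0 by move: n0; rewrite p0 eqxx.
have iq : q^-1 != 0 by rewrite invr_eq0.
exists (- (q^-1 *: e1)); split; first by rewrite p0; forms; field.
  by move=> X; rewrite p0 !dotE => z1 z2; zeros.
by move=> h1 _; rewrite !dmxE h1 scaler0 oppr0.
Qed.

(** If d e6 involves e3 /\ e4, its terms mixing e1, e2 with e3, e4 can be absorbed in it.
    Otherwise these terms form a 2 x 2 matrix, which is brought to the identity when
    it is invertible, and to a matrix with at most one entry when it is not. *)
Lemma ok_closed4_decomposable (e1 e2 e3 e4 e5 e6 : V) (k : R) :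
  coframe e1 e2 e3 e4 e5 e6 -> d e1 = 0 -> d e2 = 0 -> d e3 = 0 -> d e4 = 0 ->
  d e5 = k *: wd e1 e2 -> supp [:: e1; e2; e3; e4] (d e6) -> ok.
Proof.
move=> cf h1 h2 h3 h4 h5 /(supp4 cf (dmx_anti g _))[b12 [b13 [b23 [b14 [b24 [b34 h6]]]]]].
have [b34_0|n34] := eqVneq b34 0; last first.
  pose f3 := e3 + (b14 / b34) *: e1 + (b24 / b34) *: e2.
  pose f4 := e4 - (b13 / b34) *: e1 - (b23 / b34) *: e2.
  apply: (@ok_closed4 e1 e2 f3 f4 e5 e6 k 0 0 0 (b12 + (b14 * b23 - b24 * b13) / b34) b34 0 0) => //.
  - by change_coframe cf.
  - by rewrite /f3 !dmxE h1 h2 h3 !scaler0 !addr0.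
  - by rewrite /f4 !dmxE h1 h2 h4 !scaler0 !subr0.
  - rewrite h5; forms; ring.
  by rewrite h6 /f3 /f4; forms; field.
have [det0|det] := eqVneq (b13 * b24 - b14 * b23) 0; last first.
  apply: (@ok_closed4 e1 e2 (b13 *: e3 + b14 *: e4) (b23 *: e3 + b24 *: e4) e5 e6 k 0 0 0 b12 0 1 0) => //.
  - move=> X; rewrite !dotE => z1 z2 z3 z4 z5 z6.
    by have [z7 z8] := cramer2 det z3 z4; apply: cf.
  - by rewrite !dmxE h3 h4 !scaler0 addr0.
  - by rewrite !dmxE h3 h4 !scaler0 addr0.
  - rewrite h5; forms; ring.
  by rewrite h6 b34_0; forms; ring.
(* d e6 = (p e1 + q e2) /\ (r e3 + s e4), up to a multiple of e1 /\ e2 *)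
have [p [q [r [s [E13 E14 E23 E24]]]]] : exists p q r s,
    [/\ b13 = p * r, b14 = p * s, b23 = q * r & b24 = q * s].
  have [z13|n13] := eqVneq b13 0.
    have [z23|n23] := eqVneq b23 0.
      by exists b14, b24, 0, 1; rewrite z13 z23 !mulr0 !mulr1.
    exists 0, 1, b23, b24; rewrite z13 !mul0r !mul1r; split=> //.
    by move: det0; rewrite z13 mul0r sub0r => /opp0_inv; rewrite mulrC => /(mulf_cancel0 n23).
  exists 1, (b23 / b13), b13, b14; rewrite !mul1r; split=> //; first by rewrite divfK.
  by apply: (mulfI n13); move/eqP: det0; rewrite subr_eq0 => /eqP ->; field.
have [pq0|pq] := boolP ((p == 0) && (q == 0)).
  move: pq0 E13 E14 E23 E24 => /andP[/eqP-> /eqP->]; rewrite !mul0r => E13 E14 E23 E24.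
  apply: (@ok_closed4 e1 e2 e3 e4 e5 e6 k 0 0 0 b12 0 0 0) => //.
    rewrite h5; forms; ring.
  by rewrite h6 b34_0 E13 E14 E23 E24; forms; ring.
have [rs0|rs] := boolP ((r == 0) && (s == 0)).
  move: rs0 E13 E14 E23 E24 => /andP[/eqP-> /eqP->]; rewrite !mulr0 => E13 E14 E23 E24.
  apply: (@ok_closed4 e1 e2 e3 e4 e5 e6 k 0 0 0 b12 0 0 0) => //.
    rewrite h5; forms; ring.
  by rewrite h6 b34_0 E13 E14 E23 E24; forms; ring.
rewrite negb_and in pq; rewrite negb_and in rs.
have [f2 [w2 c2 hf2]] := unimodular2 e1 e2 pq.
have [f4 [w4 c4 hf4]] := unimodular2 e3 e4 rs.
apply: (@ok_closed4_12_13 (p *: e1 + q *: e2) f2 (r *: e3 + s *: e4) f4 e5 e6 k b12).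
- by move=> X z1 z2 z3 z4; have [z5 z6] := c2 X z1 z2; have [z7 z8] := c4 X z3 z4; apply: cf.
- by rewrite !dmxE h1 h2 !scaler0 addr0.
- exact: hf2.
- by rewrite !dmxE h3 h4 !scaler0 addr0.
- exact: hf4.
- by rewrite h5 w2.
by rewrite h6 w2 b34_0 E13 E14 E23 E24; forms; ring.
Qed.

Lemma alt_sub (A B : 'M[R]_6) : (forall x y, ev2 A y x = - ev2 A x y) -> (forall x y, ev2 B y x = - ev2 B x y) ->
  forall x y, ev2 (A - B) y x = - ev2 (A - B) x y.
Proof. by move=> hA hB x y; rewrite !(ev2D, ev2N) hA hB; ring. Qed.

Lemma alt_wd (a b x y : V) : ev2 (wd a b) y x = - ev2 (wd a b) x y.
Proof. by rewrite !ev2_wd; ring. Qed.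

Lemma ok_15 (e1 e2 e3 e4 e5 e6 : V) k :
  coframe e1 e2 e3 e4 e5 e6 -> d e1 = 0 -> d e2 = 0 -> d e3 = 0 -> d e4 = 0 ->
  d e5 = k *: wd e1 e2 -> supp [:: e1; e2; e3; e4] (d e6 - wd e1 e5) -> ok.
Proof.
move=> cf h1 h2 h3 h4 h5 /(supp4 cf (alt_sub (dmx_anti g _) (@alt_wd _ _))).
move=> [b12 [b13 [b23 [b14 [b24 [b34 /eqP]]]]]].
rewrite subr_eq => /eqP h6; apply: split_type2_has_split.
apply: (@split_15 R _ (real_complex R) 'i%C d (bracketC g) (@i2C R) (@dot_brC R _ g)
  e1 e2 e3 e4 e5 e6 k b12 b13 b14 b23 b24 b34) => //.
rewrite h6; forms; ring.
Qed.

(** If d e6 involves e5, through delta /\ e5, then d d e6 = 0 gives delta /\ d e5 = 0,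
    so that delta divides d e5. *)
Lemma ok_closed4_delta (e1 e2 e3 e4 e5 e6 : V) a12 a13 a23 a14 a24 a34 b12 b13 b23 b14 b24 b34 c1 c2 c3 c4 :
  coframe e1 e2 e3 e4 e5 e6 -> d e1 = 0 -> d e2 = 0 -> d e3 = 0 -> d e4 = 0 ->
  d e5 = a12 *: wd e1 e2 + a13 *: wd e1 e3 + a23 *: wd e2 e3 + a14 *: wd e1 e4
    + a24 *: wd e2 e4 + a34 *: wd e3 e4 ->
  d e6 = b12 *: wd e1 e2 + b13 *: wd e1 e3 + b23 *: wd e2 e3 + b14 *: wd e1 e4
    + b24 *: wd e2 e4 + b34 *: wd e3 e4 + c1 *: wd e1 e5 + c2 *: wd e2 e5 + c3 *: wd e3 e5
    + c4 *: wd e4 e5 -> c1 != 0 -> ok.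
Proof.
move=> cf h1 h2 h3 h4 h5 h6 n1.
have [x1 [x2 [x3 [x4 [x5 [x6 /mx6_dual dl]]]]]] := coframe_dual cf.
have J x y z : _ = 0 := dd0 g e6 x y z.
have e23 : a23 = (c2 * a13 - c3 * a12) / c1.
  apply: (canRL (mulfK n1)); have := J x1 x2 x3; coordinates h6 dl (h1, h2, h3, h4, h5) => H.
  lra.
have e24 : a24 = (c2 * a14 - c4 * a12) / c1.
  apply: (canRL (mulfK n1)); have := J x1 x2 x4; coordinates h6 dl (h1, h2, h3, h4, h5) => H.
  lra.
have e34 : a34 = (c3 * a14 - c4 * a13) / c1.
  apply: (canRL (mulfK n1)); have := J x1 x3 x4; coordinates h6 dl (h1, h2, h3, h4, h5) => H.
  lra.
have {e23 e24 e34 h5} h5 : d e5 = c1^-1 *: wd (c1 *: e1 + c2 *: e2 + c3 *: e3 + c4 *: e4)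
    (a12 *: e2 + a13 *: e3 + a14 *: e4).
  by rewrite h5 e23 e24 e34; forms; field.
have {}h6 : d e6 = b12 *: wd e1 e2 + b13 *: wd e1 e3 + b23 *: wd e2 e3 + b14 *: wd e1 e4
    + b24 *: wd e2 e4 + b34 *: wd e3 e4 + wd (c1 *: e1 + c2 *: e2 + c3 *: e3 + c4 *: e4) e5.
  rewrite h6; forms; ring.
set f1 := c1 *: e1 + c2 *: e2 + c3 *: e3 + c4 *: e4 in h5 h6.
have df1 : d f1 = 0 by rewrite /f1 !dmxE h1 h2 h3 h4 !scaler0 !addr0.
set f2 := a12 *: e2 + a13 *: e3 + a14 *: e4 in h5.
have df2 : d f2 = 0 by rewrite /f2 !dmxE h2 h3 h4 !scaler0 !addr0.
have {}h6 : supp [:: e1; e2; e3; e4] (d e6 - wd f1 e5).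
  by move=> x y /= v; zeros; rewrite h6; rewrite [_ - _]addrK; expand_ev2; zeros; ring.
have [z12|n12] := eqVneq a12 0; last first.
  apply: (@ok_15 f1 f2 e3 e4 e5 e6 c1^-1) => //; first by rewrite /f1 /f2; change_coframe cf.
  by rewrite /f1 /f2; change_supp h6.
have [z13|n13] := eqVneq a13 0; last first.
  apply: (@ok_15 f1 f2 e2 e4 e5 e6 c1^-1) => //; first by rewrite /f1 /f2 z12 scale0r add0r; change_coframe cf.
  by rewrite /f1 /f2 z12 scale0r add0r; change_supp h6.
have [z14|n14] := eqVneq a14 0; last first.
  apply: (@ok_15 f1 f2 e2 e3 e5 e6 c1^-1) => //.
    by rewrite /f1 /f2 z12 z13 !scale0r !add0r; change_coframe cf.
  by rewrite /f1 /f2 z12 z13 !scale0r !add0r; change_supp h6.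
apply: (@ok_15 f1 e2 e3 e4 e5 e6 0) => //; first by rewrite /f1; change_coframe cf.
  by rewrite h5 /f2 z12 z13 z14; forms; ring.
by rewrite /f1; change_supp h6.
Qed.

(** By an even permutation of e1, .., e4.  The Pfaffians of the two forms and their
    polarization do not change. *)
Lemma nonzero12 (e1 e2 e3 e4 : V) (a12 a13 a23 a14 a24 a34 b12 b13 b23 b14 b24 b34 : R) :
  ~~ [&& a12 == 0, a13 == 0, a23 == 0, a14 == 0, a24 == 0 & a34 == 0] ->
  exists f1 f2 f3 f4 a12' a13' a23' a14' a24' a34' b12' b13' b23' b14' b24' b34',
  [/\ forall P : V -> Prop, P e1 -> P e2 -> P e3 -> P e4 -> [/\ P f1, P f2, P f3 & P f4],
      forall P : V -> Prop, P f1 -> P f2 -> P f3 -> P f4 -> [/\ P e1, P e2, P e3 & P e4],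
      a12 *: wd e1 e2 + a13 *: wd e1 e3 + a23 *: wd e2 e3 + a14 *: wd e1 e4
        + a24 *: wd e2 e4 + a34 *: wd e3 e4 =
      a12' *: wd f1 f2 + a13' *: wd f1 f3 + a23' *: wd f2 f3 + a14' *: wd f1 f4
        + a24' *: wd f2 f4 + a34' *: wd f3 f4 /\
      b12 *: wd e1 e2 + b13 *: wd e1 e3 + b23 *: wd e2 e3 + b14 *: wd e1 e4
        + b24 *: wd e2 e4 + b34 *: wd e3 e4 =
      b12' *: wd f1 f2 + b13' *: wd f1 f3 + b23' *: wd f2 f3 + b14' *: wd f1 f4
        + b24' *: wd f2 f4 + b34' *: wd f3 f4,
      [/\ a12 * a34 - a13 * a24 + a14 * a23 = a12' * a34' - a13' * a24' + a14' * a23',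
          b12 * b34 - b13 * b24 + b14 * b23 = b12' * b34' - b13' * b24' + b14' * b23' &
          a12 * b34 + b12 * a34 - a13 * b24 - b13 * a24 + a14 * b23 + b14 * a23 =
          a12' * b34' + b12' * a34' - a13' * b24' - b13' * a24' + a14' * b23' + b14' * a23'] &
      a12' != 0].
Proof.
move=> n0.
have [z12|n12] := eqVneq a12 0; last first.
  exists e1, e2, e3, e4, a12, a13, a23, a14, a24, a34, b12, b13, b23, b14, b24, b34.
  by split.
have [z13|n13] := eqVneq a13 0; last first.
  exists e1, e3, e4, e2, a13, a14, a34, a12, (- a23 : R), (- a24 : R),
    b13, b14, b34, b12, (- b23), (- b24).
  by split=> //; [split; forms; ring|split; ring].
have [z14|n14] := eqVneq a14 0; last first.
  exists e1, e4, e2, e3, a14, a12, (- a24 : R), a13, (- a34 : R), a23,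
    b14, b12, (- b24), b13, (- b34), b23.
  by split=> //; [split; forms; ring|split; ring].
have [z23|n23] := eqVneq a23 0; last first.
  exists e2, e3, e1, e4, a23, (- a12 : R), (- a13 : R), a24, a34, a14,
    b23, (- b12), (- b13), b24, b34, b14.
  by split=> //; [split; forms; ring|split; ring].
have [z24|n24] := eqVneq a24 0; last first.
  exists e2, e4, e3, e1, a24, a23, (- a34 : R), (- a12 : R), (- a14 : R), (- a13 : R),
    b24, b23, (- b34), (- b12), (- b14), (- b13).
  by split=> //; [split; forms; ring|split; ring].
have [z34|n34] := eqVneq a34 0; last first.
  exists e3, e4, e1, e2, a34, (- a13 : R), (- a14 : R), (- a23 : R), (- a24 : R), a12,
    b34, (- b13), (- b14), (- b23), (- b24), b12.
  by split=> //; [split; forms; ring|split; ring].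
by move: n0; rewrite z12 z13 z14 z23 z24 z34 eqxx.
Qed.

(** A 2-form in four covectors with vanishing Pfaffian is decomposable. *)
Lemma ok_closed4_pfaffian0 (e1 e2 e3 e4 e5 e6 : V) a12 a13 a23 a14 a24 a34 :
  coframe e1 e2 e3 e4 e5 e6 -> d e1 = 0 -> d e2 = 0 -> d e3 = 0 -> d e4 = 0 ->
  d e5 = a12 *: wd e1 e2 + a13 *: wd e1 e3 + a23 *: wd e2 e3 + a14 *: wd e1 e4
    + a24 *: wd e2 e4 + a34 *: wd e3 e4 ->
  a12 * a34 - a13 * a24 + a14 * a23 = 0 ->
  supp [:: e1; e2; e3; e4] (d e6) -> ok.
Proof.
move=> cf h1 h2 h3 h4 h5 pf s6.
have [/and5P[/eqP z12 /eqP z13 /eqP z23 /eqP z14 /andP[/eqP z24 /eqP z34]]|n0] :=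
    boolP [&& a12 == 0, a13 == 0, a23 == 0, a14 == 0, a24 == 0 & a34 == 0].
  apply: (@ok_closed4_decomposable e1 e2 e3 e4 e5 e6 0) => //.
  by rewrite h5 z12 z13 z23 z14 z24 z34; forms; ring.
have [f1 [f2 [f3 [f4 [b12 [b13 [b23 [b14 [b24 [b34 [_ [_ [_ [_ [_ [_ [P Q [E _] [pfE _ _] n12]]]]]]]]]]]]]]]]]
  := nonzero12 e1 e2 e3 e4 0 0 0 0 0 0 n0.
have [k1 k2 k3 k4] := P (fun e => d e = 0) h1 h2 h3 h4.
rewrite {}E in h5; rewrite {}pfE in pf.
have e34 : b34 = (b13 * b24 - b14 * b23) / b12 by apply: (canRL (mulfK n12)); lra.
apply: (@ok_closed4_decomposable (f1 - (b23 / b12) *: f3 - (b24 / b12) *: f4)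
  (f2 + (b13 / b12) *: f3 + (b14 / b12) *: f4) f3 f4 e5 e6 b12) => //.
- move=> X; rewrite !dotE => z1 z2 z3 z4; zeros => z5 z6.
  by have [? ? ? ?] := Q (fun e => dot e X = 0) z1 z2 z3 z4; apply: cf.
- by rewrite !dmxE k1 k3 k4 !scaler0 !subr0.
- by rewrite !dmxE k2 k3 k4 !scaler0 !addr0.
- by rewrite h5 e34; forms; field.
move=> x y /= v; apply: s6; rewrite !dotE in v; zeros.
have [? ? ? ?] : [/\ dot e1 x = 0, dot e2 x = 0, dot e3 x = 0 & dot e4 x = 0].
  by apply: (Q (fun e => dot e x = 0)).
by do ?split.
Qed.

Lemma ok_closed4_definite (e1 e2 e3 e4 e5 e6 : V) a12 a13 a23 a14 a24 a34 b12 b13 b23 b14 b24 b34 :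
  coframe e1 e2 e3 e4 e5 e6 -> d e1 = 0 -> d e2 = 0 -> d e3 = 0 -> d e4 = 0 ->
  d e5 = a12 *: wd e1 e2 + a13 *: wd e1 e3 + a23 *: wd e2 e3 + a14 *: wd e1 e4
    + a24 *: wd e2 e4 + a34 *: wd e3 e4 ->
  d e6 = b12 *: wd e1 e2 + b13 *: wd e1 e3 + b23 *: wd e2 e3 + b14 *: wd e1 e4
    + b24 *: wd e2 e4 + b34 *: wd e3 e4 ->
  a12 * a34 - a13 * a24 + a14 * a23 != 0 ->
  a12 * a34 - a13 * a24 + a14 * a23 = b12 * b34 - b13 * b24 + b14 * b23 ->
  a12 * b34 + b12 * a34 - a13 * b24 - b13 * a24 + a14 * b23 + b14 * a23 = 0 ->
  ok.
Proof.
move=> cf h1 h2 h3 h4 h5 h6 pf0 pf bil.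
have n0 : ~~ [&& a12 == 0, a13 == 0, a23 == 0, a14 == 0, a24 == 0 & a34 == 0].
  apply: contra pf0 => /and5P[/eqP-> /eqP-> _ /eqP-> _].
  by rewrite !mul0r subrr addr0.
have := nonzero12 e1 e2 e3 e4 b12 b13 b23 b14 b24 b34 n0.
move=> [f1 [f2 [f3 [f4 [a12' [a13' [a23' [a14' [a24' [a34' [b12' [b13' [b23' [b14' [b24' [b34']]]]]]]]]]]]]]]].
move=> [P Q [E E'] [pfE pfE' bilE] n12].
have [k1 k2 k3 k4] := P (fun e => d e = 0) h1 h2 h3 h4.
rewrite E in h5; rewrite E' in h6; rewrite pfE in pf0; rewrite pfE pfE' in pf; rewrite bilE in bil.
apply: split_type2_has_split.
apply: (split_definite (e5 := e5) (e6 := e6) (@i2C R) (@free1iC R) (@dot_brC R _ g) _ k1 k2 k3 k4 _ _ _ pf0 pf bil).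
- move=> X z1 z2 z3 z4 z5 z6.
  by have [? ? ? ?] := Q (fun e => dot e X = 0) z1 z2 z3 z4; apply: cf.
- by rewrite h5; forms; ring.
- by rewrite h6; forms; ring.
by rewrite n12.
Qed.

(** The pencil of 2-forms spanned by d e5 and d e6 either contains a decomposable
    form, or is definite for the Pfaffian, according to the sign of the discriminant
    of the Pfaffian on the pencil. *)
Lemma ok_closed4_pencil (e1 e2 e3 e4 e5 e6 : V) :
  coframe e1 e2 e3 e4 e5 e6 -> d e1 = 0 -> d e2 = 0 -> d e3 = 0 -> d e4 = 0 ->
  supp [:: e1; e2; e3; e4] (d e5) -> supp [:: e1; e2; e3; e4] (d e6) -> ok.
Proof.
move=> cf h1 h2 h3 h4 s5 s6.
have [a12 [a13 [a23 [a14 [a24 [a34 h5]]]]]] := supp4 cf (dmx_anti g _) s5.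
have [b12 [b13 [b23 [b14 [b24 [b34 h6]]]]]] := supp4 cf (dmx_anti g _) s6.
pose pa := a12 * a34 - a13 * a24 + a14 * a23.
pose pb := b12 * b34 - b13 * b24 + b14 * b23.
pose pab := a12 * b34 + b12 * a34 - a13 * b24 - b13 * a24 + a14 * b23 + b14 * a23.
have [pb0|pb0] := eqVneq pb 0.
  apply: (ok_closed4_pfaffian0 (e5 := e6) (e6 := e5) _ h1 h2 h3 h4 h6 pb0 s5).
  by move=> X ? ? ? ? ? ?; apply: cf.
have [disc|disc] := leP 0 (pab ^+ 2 - 4 * pa * pb).
  pose t := (- pab + Num.sqrt (pab ^+ 2 - 4 * pa * pb)) / (2 * pb).
  have h5' : d (e5 + t *: e6) = (a12 + t * b12) *: wd e1 e2 + (a13 + t * b13) *: wd e1 e3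
      + (a23 + t * b23) *: wd e2 e3 + (a14 + t * b14) *: wd e1 e4
      + (a24 + t * b24) *: wd e2 e4 + (a34 + t * b34) *: wd e3 e4.
    by rewrite !dmxE h5 h6; forms; ring.
  apply: (ok_closed4_pfaffian0 _ h1 h2 h3 h4 h5' _ s6); first by change_coframe cf.
  transitivity (pa + t * pab + t ^+ 2 * pb); first by rewrite /pa /pab /pb; ring.
  rewrite /t; move: (sqr_sqrtr disc); set s := Num.sqrt _ => es.
  transitivity ((s ^+ 2 - (pab ^+ 2 - 4 * pa * pb)) / (4 * pb)); first by field.
  by rewrite es subrr mul0r.
pose t := - (pab / (2 * pb)).
have pos : 0 < (pa + t * pab + t ^+ 2 * pb) / pb.
  have -> : (pa + t * pab + t ^+ 2 * pb) / pb = (4 * pa * pb - pab ^+ 2) / (2 * pb) ^+ 2.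
    by rewrite /t; field.
  by apply: divr_gt0; [lra|rewrite exprn_even_gt0 //= mulf_neq0 // pnatr_eq0].
pose s := Num.sqrt ((pa + t * pab + t ^+ 2 * pb) / pb).
have s2 : s ^+ 2 * pb = pa + t * pab + t ^+ 2 * pb.
  by rewrite /s sqr_sqrtr ?ltW // divfK.
have s0 : s != 0 by rewrite /s sqrtr_eq0 -ltNge.
have h5' : d (e5 + t *: e6) = (a12 + t * b12) *: wd e1 e2 + (a13 + t * b13) *: wd e1 e3
    + (a23 + t * b23) *: wd e2 e3 + (a14 + t * b14) *: wd e1 e4
    + (a24 + t * b24) *: wd e2 e4 + (a34 + t * b34) *: wd e3 e4.
  by rewrite !dmxE h5 h6; forms; ring.
have h6' : d (s *: e6) = (s * b12) *: wd e1 e2 + (s * b13) *: wd e1 e3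
    + (s * b23) *: wd e2 e3 + (s * b14) *: wd e1 e4
    + (s * b24) *: wd e2 e4 + (s * b34) *: wd e3 e4.
  by rewrite !dmxE h6; forms; ring.
apply: (ok_closed4_definite _ h1 h2 h3 h4 h5' h6').
- by change_coframe cf.
- have -> : (a12 + t * b12) * (a34 + t * b34) - (a13 + t * b13) * (a24 + t * b24) +
    (a14 + t * b14) * (a23 + t * b23) = pa + t * pab + t ^+ 2 * pb by rewrite /pa /pab /pb; ring.
  by rewrite -s2 mulf_neq0 // expf_neq0.
- transitivity (pa + t * pab + t ^+ 2 * pb); first by rewrite /pa /pab /pb; ring.
  by rewrite -s2 /pb; ring.
transitivity (s * (pab + 2 * t * pb)); first by rewrite /pab /pb; ring.
by rewrite /t; field.
Qed.

Lemma ok_closed4_chain (e1 e2 e3 e4 e5 e6 : V) :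
  coframe e1 e2 e3 e4 e5 e6 -> d e1 = 0 -> d e2 = 0 -> d e3 = 0 -> d e4 = 0 ->
  supp [:: e1; e2; e3; e4] (d e5) -> supp [:: e1; e2; e3; e4; e5] (d e6) -> ok.
Proof.
move=> cf h1 h2 h3 h4 s5 s6.
have [a12 [a13 [a23 [a14 [a24 [a34 h5]]]]]] := supp4 cf (dmx_anti g _) s5.
have [b12 [b13 [b23 [b14 [b24 [b34 [c1 [c2 [c3 [c4 h6]]]]]]]]]] := supp5 cf (dmx_anti g _) s6.
have [c10|c10] := eqVneq c1 0; last exact: (ok_closed4_delta cf h1 h2 h3 h4 h5 h6 c10).
have [c20|c20] := eqVneq c2 0; last first.
  apply: (@ok_closed4_delta e2 e1 e3 e4 e5 e6 (- a12) a23 a13 a24 a14 a34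
    (- b12) b23 b13 b24 b14 b34 c2 c1 c3 c4) => //.
  - by move=> X ? ? ? ? ? ?; apply: cf.
  - by rewrite h5; forms; ring.
  by rewrite h6; forms; ring.
have [c30|c30] := eqVneq c3 0; last first.
  apply: (@ok_closed4_delta e3 e2 e1 e4 e5 e6 (- a23) (- a13) (- a12) a34 a24 a14
    (- b23) (- b13) (- b12) b34 b24 b14 c3 c2 c1 c4) => //.
  - by move=> X ? ? ? ? ? ?; apply: cf.
  - by rewrite h5; forms; ring.
  by rewrite h6; forms; ring.
have [c40|c40] := eqVneq c4 0; last first.
  apply: (@ok_closed4_delta e4 e2 e3 e1 e5 e6 (- a24) (- a34) a23 (- a14) (- a12) (- a13)
    (- b24) (- b34) b23 (- b14) (- b12) (- b13) c4 c2 c3 c1) => //.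
  - by move=> X ? ? ? ? ? ?; apply: cf.
  - by rewrite h5; forms; ring.
  by rewrite h6; forms; ring.
apply: (ok_closed4_pencil cf h1 h2 h3 h4 s5) => x y /= v; zeros.
by rewrite h6 c10 c20 c30 c40; expand_ev2; zeros; ring.
Qed.

End ReductionA.

Section ReductionB.
Variables (R : realType) (g : lie_algebra R 6).
Local Notation V := 'rV[R]_6.
Local Notation d := (dmx g).
Local Notation ok := (split_type2 g).

(** The normal forms that remain when none of the shapes giving split structures
    applies. *)
Inductive exceptional : Prop :=
| Exc_maximal (e1 e2 e3 e4 e5 e6 : V) p q a12 a13 a23 a14 a24 a34 c1 c2 c3 c4 of
    coframe e1 e2 e3 e4 e5 e6 & d e1 = 0 & d e2 = 0 & d e3 = wd e1 e2 & d e4 = wd e1 e3 &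
    d e5 = p *: wd e1 e4 + q *: wd e2 e3 &
    d e6 = a12 *: wd e1 e2 + a13 *: wd e1 e3 + a23 *: wd e2 e3 + a14 *: wd e1 e4
      + a24 *: wd e2 e4 + a34 *: wd e3 e4 + c1 *: wd e1 e5 + c2 *: wd e2 e5
      + c3 *: wd e3 e5 + c4 *: wd e4 e5 &
    p != 0 & ~~ [&& c1 == 0, c2 == 0, c3 == 0 & c4 == 0]
| Exc_12_14 (e1 e2 e3 e4 e5 e6 : V) l a12 a13 a23 a14 a24 of
    coframe e1 e2 e3 e4 e5 e6 & d e1 = 0 & d e2 = 0 & d e3 = 0 & d e4 = wd e1 e2 &
    d e5 = wd e1 e4 &
    d e6 = l *: wd e1 e5 + a12 *: wd e1 e2 + a13 *: wd e1 e3 + a23 *: wd e2 e3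
      + a14 *: wd e1 e4 + a24 *: wd e2 e4 & l != 0
| Exc_12_14_13_24 (e1 e2 e3 e4 e5 e6 : V) of
    coframe e1 e2 e3 e4 e5 e6 & d e1 = 0 & d e2 = 0 & d e3 = 0 & d e4 = wd e1 e2 &
    d e5 = wd e1 e4 & d e6 = wd e1 e3 - wd e2 e4
| Exc_12_14_23_24 (e1 e2 e3 e4 e5 e6 : V) of
    coframe e1 e2 e3 e4 e5 e6 & d e1 = 0 & d e2 = 0 & d e3 = 0 & d e4 = wd e1 e2 &
    d e5 = wd e1 e4 & d e6 = wd e2 e3 + wd e2 e4
| Exc_13_23_14 (e1 e2 e3 e4 e5 e6 : V) of
    coframe e1 e2 e3 e4 e5 e6 & d e1 = 0 & d e2 = 0 & d e3 = wd e1 e2 & d e4 = wd e1 e3 &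
    d e5 = wd e2 e3 & d e6 = wd e1 e4
| Exc_13_23_14_25 (e1 e2 e3 e4 e5 e6 : V) of
    coframe e1 e2 e3 e4 e5 e6 & d e1 = 0 & d e2 = 0 & d e3 = wd e1 e2 & d e4 = wd e1 e3 &
    d e5 = wd e2 e3 & d e6 = wd e1 e4 - wd e2 e5.

Local Notation goal := (ok \/ exceptional).

(** The rows (a, b) and (c, e) are left eigenvectors, for l and - l, of the matrix
    with rows p, q and m, - p: diagonalizing it gives (0,0,0,12,14,23+24). *)
Lemma hyperbolic_12_14 (e1 e2 e3 e4 e5 e6 : V) (p q m a b c e l : R) :
  coframe e1 e2 e3 e4 e5 e6 -> d e1 = 0 -> d e2 = 0 -> d e3 = 0 -> d e4 = wd e1 e2 ->
  d e5 = wd e1 e4 + p *: wd e1 e3 + q *: wd e2 e3 ->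
  d e6 = wd e2 e4 + m *: wd e1 e3 - p *: wd e2 e3 ->
  a * e - b * c != 0 -> l != 0 ->
  a * p + b * m = l * a -> a * q - b * p = l * b ->
  c * p + e * m = - (l * c) -> c * q - e * p = - (l * e) -> exceptional.
Proof.
move=> cf h1 h2 h3 h4 h5 h6 D l0 q1 q2 q3 q4.
pose D' := a * e - b * c.
apply: (@Exc_12_14_23_24 (a *: e1 + b *: e2) (c *: e1 + e *: e2) (- 2 * D' * l *: e3)
  (D' *: e4 + (D' * l) *: e3) (D' *: (a *: e5 + b *: e6)) (D' *: (c *: e5 + e *: e6))).
- move=> X; rewrite !dotE => z1 z2 /(mulf_cancel0 _) z3 z4 /(mulf_cancel0 D) z5 /(mulf_cancel0 D) z6.
  have [? ?] := cramer2 D z1 z2; have [? ?] := cramer2 D z5 z6.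
  have z : dot e3 X = 0 by apply: z3; rewrite !mulf_neq0 // oppr_eq0 pnatr_eq0.
  by move: z4; rewrite z mulr0 addr0 => /(mulf_cancel0 D) ?; apply: cf.
- by rewrite !dmxE h1 h2 !scaler0 addr0.
- by rewrite !dmxE h1 h2 !scaler0 addr0.
- by rewrite !dmxE h3 !scaler0.
- by rewrite !dmxE h3 h4; forms; rewrite /D'; ring.
- transitivity (D' *: (a *: wd e1 e4 + b *: wd e2 e4 + (a * p + b * m) *: wd e1 e3
      + (a * q - b * p) *: wd e2 e3)); first by rewrite !dmxE h5 h6; forms; ring.
  by rewrite q1 q2; forms; ring.
transitivity (D' *: (c *: wd e1 e4 + e *: wd e2 e4 + (c * p + e * m) *: wd e1 e3
    + (c * q - e * p) *: wd e2 e3)); first by rewrite !dmxE h5 h6; forms; ring.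
by rewrite q3 q4; forms; ring.
Qed.

(** Modulo e3, d e5 and d e6 are e1 /\ e4 and e2 /\ e4, and the coefficients of the terms
    in e3 form a traceless 2 x 2 matrix with rows p, q and m, - p.  The shape of g depends on
    the sign of p^2 + q m: with complex eigenvalues there is a split structure, with real
    nonzero ones g is (0,0,0,12,14,23+24), and a nilpotent matrix gives
    (0,0,0,12,14,13-24) unless it is zero. *)
Lemma reduce_14_24 (e1 e2 e3 e4 e5 e6 : V) p q m :
  coframe e1 e2 e3 e4 e5 e6 -> d e1 = 0 -> d e2 = 0 -> d e3 = 0 -> d e4 = wd e1 e2 ->
  d e5 = wd e1 e4 + p *: wd e1 e3 + q *: wd e2 e3 ->
  d e6 = wd e2 e4 + m *: wd e1 e3 - p *: wd e2 e3 -> goal.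
Proof.
move=> cf h1 h2 h3 h4 h5 h6.
pose disc := p * p + q * m.
have [neg|pos|disc0] := ltgtP disc 0.
- left; apply: split_type2_has_split.
  have e : Num.sqrt (- disc) * Num.sqrt (- disc) = - (p * p + q * m).
    by rewrite -expr2 sqr_sqrtr // oppr_ge0 ltW.
  apply: (split_elliptic (@i2C R) (@dot_brC R _ g) cf _ _ e h1 h2 h3 h4 h5 h6).
    apply/eqP => m0; move: neg; rewrite /disc m0 mulr0 addr0 -expr2 ltNge sqr_ge0 //.
  by rewrite sqrtr_eq0 -ltNge oppr_gt0.
- right; pose w := Num.sqrt disc.
  have w2 : w * w = p * p + q * m by rewrite -expr2 sqr_sqrtr // ltW.
  have w0 : w != 0 by rewrite sqrtr_eq0 -ltNge.
  have [q0|q0] := eqVneq q 0; last first.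
    apply: (@hyperbolic_12_14 e1 e2 e3 e4 e5 e6 p q m (w + p) q (p - w) q w) => //.
    - rewrite [X in X != 0](_ : _ = 2 * w * q); last by ring.
      by rewrite !mulf_neq0 // pnatr_eq0.
    - by ring: w2.
    - by ring.
    - by ring: w2.
    by ring.
  have [m0|m0] := eqVneq m 0; last first.
    apply: (@hyperbolic_12_14 e1 e2 e3 e4 e5 e6 p q m m (w - p) m (- w - p) w) => //.
    - rewrite [X in X != 0](_ : _ = - (2 * w * m)); last by ring.
      by rewrite oppr_eq0 !mulf_neq0 // pnatr_eq0.
    - by ring.
    - by ring: w2.
    - by ring.
    by ring: w2.
  have p0 : p != 0 by apply/eqP => p0; move: pos; rewrite /disc p0 m0 !mulr0 addr0 ltxx.
  apply: (@hyperbolic_12_14 e1 e2 e3 e4 e5 e6 p q m 1 0 0 1 p) => //; rewrite ?q0 ?m0; try ring.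
have [q0|q0] := eqVneq q 0.
  have p0 : p = 0.
    by move: disc0; rewrite /disc q0 mul0r addr0 => /eqP; rewrite mulf_eq0 orbb => /eqP.
  have [m0|m0] := eqVneq m 0.
    left; apply: split_type2_has_split; apply: (split_14_24 'i%C (@dot_brC R _ g) cf h1 h2 h3 h4).
      by rewrite h5 p0 q0; forms; ring.
    by rewrite h6 p0 m0; forms; ring.
  right; apply: (@Exc_12_14_13_24 e1 e2 (- (m *: e3)) e4 e5 (- e6)) => //.
  - by change_coframe cf.
  - by rewrite !dmxE h3 scaler0 oppr0.
  - by rewrite h5 p0 q0; forms; ring.
  by rewrite !dmxE h6 p0; forms; ring.
right; apply: (@Exc_12_14_13_24 (p *: e1 + q *: e2) e1 (q *: e3) (- (q *: e4))
  (- (q *: (p *: e5 + q *: e6))) (q *: e5)).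
- by change_coframe cf.
- by rewrite !dmxE h1 h2 !scaler0 addr0.
- by [].
- by rewrite !dmxE h3 scaler0.
- by rewrite !dmxE h4; forms; ring.
- rewrite !dmxE h5 h6; forms.
  have e : q * m = - (p * p) by apply/eqP; rewrite -addr_eq0 addrC; apply/eqP.
  by ring: e.
by rewrite !dmxE h5; forms; ring.
Qed.

Lemma reduce_12_gamma0 (e1 e2 e3 e4 e5 e6 : V) :
  coframe e1 e2 e3 e4 e5 e6 -> d e1 = 0 -> d e2 = 0 -> d e3 = 0 -> d e4 = wd e1 e2 ->
  supp [:: e1; e2; e3] (d e5) -> supp [:: e1; e2; e3; e4; e5] (d e6) -> ok.
Proof.
move=> cf h1 h2 h3 h4 s5 s6.
have [c12 [c13 [c23 h5]]] := supp3 cf (dmx_anti g _) s5.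
have [/andP[/eqP z13 /eqP z23]|n] := boolP ((c13 == 0) && (c23 == 0)).
  apply: (@ok_closed4_chain R g e1 e2 e3 (e5 - c12 *: e4) e4 e6) => //.
  - by change_coframe cf.
  - by rewrite !dmxE h4 h5 z13 z23; forms; ring.
  - by move=> x y /= v; zeros; rewrite h4; expand_ev2; zeros; ring.
  by change_supp s6.
rewrite negb_and in n; have [f2 [w2 c2 hf2]] := unimodular2 g e1 e2 n.
apply: (@ok_12_13 R g (c13 *: e1 + c23 *: e2) f2 e3 e4 (e5 - c12 *: e4) e6) => //.
- move=> X z1 z2 z3 z4; rewrite !dotE => z5 z6; zeros.
  by have [? ?] := c2 X z1 z2; apply: cf.
- by rewrite !dmxE h1 h2 !scaler0 addr0.
- exact: hf2.
- by rewrite w2.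
- by rewrite !dmxE h4 h5; forms; ring.
move=> x y /= [z1 [z2 v]]; apply: s6; have [? ?] := c2 x z1 z2.
by move: v; rewrite !dotE => v; zeros; do ?split.
Qed.

(** The closedness of d e6, evaluated on the dual frame. *)
Lemma differential_12_14 (e1 e2 e3 e4 e5 e6 : V) q :
  coframe e1 e2 e3 e4 e5 e6 -> d e1 = 0 -> d e2 = 0 -> d e3 = 0 -> d e4 = wd e1 e2 ->
  d e5 = wd e1 e4 + q *: wd e2 e3 -> supp [:: e1; e2; e3; e4; e5] (d e6) ->
  exists l a12 a13 a23 a14 a24, d e6 = l *: (wd e1 e5 - q *: wd e3 e4) + a12 *: wd e1 e2
    + a13 *: wd e1 e3 + a23 *: wd e2 e3 + a14 *: wd e1 e4 + a24 *: wd e2 e4.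
Proof.
move=> cf h1 h2 h3 h4 h5 s6.
have [a12 [a13 [a23 [a14 [a24 [a34 [l [c2 [c3 [c4 h6]]]]]]]]]] := supp5 cf (dmx_anti g _) s6.
have [x1 [x2 [x3 [x4 [x5 [x6 /mx6_dual dl]]]]]] := coframe_dual cf.
have J x y z : _ = 0 := dd0 g e6 x y z.
have z4 : c4 = 0 by have := J x1 x2 x5; coordinates h6 dl (h1, h2, h3, h4, h5); lra.
have z2 : c2 = 0 by have := J x1 x2 x4; coordinates h6 dl (h1, h2, h3, h4, h5); lra.
have z3 : c3 = 0 by have := J x1 x3 x4; coordinates h6 dl (h1, h2, h3, h4, h5); lra.
have e34 : a34 = - (l * q) by have := J x1 x2 x3; coordinates h6 dl (h1, h2, h3, h4, h5); lra.
exists l, a12, a13, a23, a14, a24.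
by rewrite h6 z4 z2 z3 e34; forms; ring.
Qed.

Lemma reduce_12_14 (e1 e2 e3 e4 e5 e6 : V) q :
  coframe e1 e2 e3 e4 e5 e6 -> d e1 = 0 -> d e2 = 0 -> d e3 = 0 -> d e4 = wd e1 e2 ->
  d e5 = wd e1 e4 + q *: wd e2 e3 -> supp [:: e1; e2; e3; e4; e5] (d e6) -> goal.
Proof.
move=> cf h1 h2 h3 h4 h5 s6.
have [c1 [a12 [a13 [a23 [a14 [a24 h6]]]]]] := differential_12_14 cf h1 h2 h3 h4 h5 s6.
have [z1|n1] := eqVneq c1 0; last first.
  have [q0|nq] := eqVneq q 0.
    right; apply: (@Exc_12_14 _ _ _ _ _ _ c1 a12 a13 a23 a14 a24 cf h1 h2 h3 h4 _ _ n1).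
      by rewrite h5 q0 scale0r addr0.
    by rewrite h6 q0; forms; ring.
  left; apply: split_type2_has_split.
  exact: (split_filiform (@i2C R) (@dot_brC R _ g) cf nq n1 h1 h2 h3 h4 h5 h6).
have [z24|n24] := eqVneq a24 0.
  left; apply: (@reduce_12_gamma0 e1 e2 e3 e4 (e6 - a14 *: e5) e5) => //.
  - by change_coframe cf.
  - move=> x y /= v; zeros; rewrite !dmxE h6 h5 z1 z24; expand_ev2; zeros; ring.
  by move=> x y /= v; zeros; rewrite h5; expand_ev2; zeros; ring.
pose m := a24^-1 * (a13); pose r := a24^-1 * (a23 - a14 * q).
have i24 : a24^-1 != 0 by rewrite invr_eq0.
apply: (@reduce_14_24 e1 e2 e3 (e4 + (r / 2) *: e3) e5 (a24^-1 *: (e6 - a14 *: e5) - (a24^-1 * a12) *: e4)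
  (- (r / 2)) q m) => //.
- by change_coframe cf.
- by rewrite !dmxE h3 h4 scaler0 addr0.
- by rewrite h5; forms; ring.
by rewrite !dmxE h6 h5 h4 z1 /m /r; forms; field.
Qed.

Lemma reduce_12 (e1 e2 e3 e4 e5 e6 : V) :
  coframe e1 e2 e3 e4 e5 e6 -> d e1 = 0 -> d e2 = 0 -> d e3 = 0 -> d e4 = wd e1 e2 ->
  supp [:: e1; e2; e3; e4] (d e5) -> supp [:: e1; e2; e3; e4; e5] (d e6) -> goal.
Proof.
move=> cf h1 h2 h3 h4 s5 s6.
have [b12 [b13 [b23 [c1 [c2 [c3 h5]]]]]] := supp4 cf (dmx_anti g _) s5.
have [x1 [x2 [x3 [x4 [x5 [x6 /mx6_dual dl]]]]]] := coframe_dual cf.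
have J x y z : _ = 0 := dd0 g e5 x y z.
have z3 : c3 = 0 by have := J x1 x2 x3; coordinates h5 dl (h1, h2, h3, h4); lra.
have [/andP[/eqP z1 /eqP z2]|n] := boolP ((c1 == 0) && (c2 == 0)).
  left; apply: (reduce_12_gamma0 cf h1 h2 h3 h4 _ s6) => x y /= v; zeros.
  by rewrite h5 z1 z2 z3; expand_ev2; zeros; ring.
rewrite negb_and in n; have [f2 [w2 k2 hf2]] := unimodular2 g e1 e2 n.
set f1 := c1 *: e1 + c2 *: e2 in w2 k2.
have df1 : d f1 = 0 by rewrite /f1 !dmxE h1 h2 !scaler0 addr0.
have df2 := hf2 h1 h2.
have cf' : coframe f1 f2 e3 e4 e5 e6.
  by move=> X y1 y2 *; have [? ?] := k2 X y1 y2; apply: cf.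
have [l12 [l13 [l23 /eqP]]] : exists l12 l13 l23,
    d e5 - wd f1 e4 = l12 *: wd f1 f2 + l13 *: wd f1 e3 + l23 *: wd f2 e3.
  apply: (supp3 cf' (alt_sub (dmx_anti g _) (@alt_wd _ _ _))) => x y /= [y1 [y2 v]].
  have [? ?] := k2 x y1 y2; zeros.
  by rewrite h5 z3 /f1; expand_ev2; zeros; ring.
rewrite subr_eq => /eqP h5'; rewrite -w2 in h4; clearbody f1.
apply: (@reduce_12_14 f1 f2 e3 (e4 + l13 *: e3) (e5 - l12 *: e4) e6 l23) => //.
- by change_coframe cf'.
- by rewrite !dmxE h3 h4 scaler0 addr0.
- by rewrite !dmxE h5' h4; forms; ring.
move=> x y /= [y1 [y2 v]]; apply: s6; have [? ?] := k2 x y1 y2.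
by move: v; rewrite !dotE => v; zeros; do ?split.
Qed.

(** A nonzero 2-form in three covectors is decomposable, so that d e4 can be taken
    to be e1 /\ e2. *)
Lemma reduce_closed3 (e1 e2 e3 e4 e5 e6 : V) :
  coframe e1 e2 e3 e4 e5 e6 -> d e1 = 0 -> d e2 = 0 -> d e3 = 0 ->
  supp [:: e1; e2; e3] (d e4) ->
  supp [:: e1; e2; e3; e4] (d e5) -> supp [:: e1; e2; e3; e4; e5] (d e6) -> goal.
Proof.
move=> cf h1 h2 h3 s4 s5 s6.
have [a12 [a13 [a23 h4]]] := supp3 cf (dmx_anti g _) s4.
have key (f1 f2 f3 : V) b12 b13 b23 : b12 != 0 ->
    (forall P : V -> Prop, P e1 -> P e2 -> P e3 -> [/\ P f1, P f2 & P f3]) ->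
    (forall P : V -> Prop, P f1 -> P f2 -> P f3 -> [/\ P e1, P e2 & P e3]) ->
    d e4 = b12 *: wd f1 f2 + b13 *: wd f1 f3 + b23 *: wd f2 f3 -> goal.
  move=> n12 P Q h4'; have [k1 k2 k3] := P (fun e => d e = 0) h1 h2 h3.
  apply: (@reduce_12 (f1 - (b23 / b12) *: f3) (b12 *: f2 + b13 *: f3) f3 e4 e5 e6) => //.
  - move=> X; rewrite !dotE => z1 z2 z3 *; zeros.
    by have [? ? ?] := Q (fun e => dot e X = 0) z1 z2 z3; apply: cf.
  - by rewrite !dmxE k1 k3 scaler0 subr0.
  - by rewrite !dmxE k2 k3 !scaler0 addr0.
  - by rewrite h4'; forms; field.
  - move=> x y /= v; apply: s5; rewrite !dotE in v; zeros.
    have [? ? ?] : [/\ dot e1 x = 0, dot e2 x = 0 & dot e3 x = 0].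
      by apply: (Q (fun e => dot e x = 0)).
    by do ?split.
  move=> x y /= v; apply: s6; rewrite !dotE in v; zeros.
  have [? ? ?] : [/\ dot e1 x = 0, dot e2 x = 0 & dot e3 x = 0].
    by apply: (Q (fun e => dot e x = 0)).
  by do ?split.
have [z12|n12] := eqVneq a12 0; last exact: (key e1 e2 e3 a12 a13 a23).
have [z13|n13] := eqVneq a13 0; last first.
  apply: (key e1 e3 e2 a13 0 (- a23)) => //.
  by rewrite h4 z12; forms; ring.
have [z23|n23] := eqVneq a23 0; last first.
  apply: (key e2 e3 e1 a23 0 0) => //.
  by rewrite h4 z12 z13; forms; ring.
left; apply: (@ok_closed4_chain R g e1 e2 e3 e4 e5 e6) => //.
by rewrite h4 z12 z13 z23; forms; ring.
Qed.

(** Up to exact terms, d e6 is the image of a quadratic form in e1, e2 under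
    e1 |-> e4, e2 |-> e5 in one factor.  If it is indefinite or of rank 1 then g is
    exceptional, if it is definite there is a split structure, and if it is zero there
    is a third closed covector. *)
Lemma reduce_13_23 (e1 e2 e3 e4 e5 e6 : V) :
  coframe e1 e2 e3 e4 e5 e6 -> d e1 = 0 -> d e2 = 0 -> d e3 = wd e1 e2 -> d e4 = wd e1 e3 ->
  d e5 = wd e2 e3 -> supp [:: e1; e2; e3; e4; e5] (d e6) -> goal.
Proof.
move=> cf h1 h2 h3 h4 h5 s6.
have [a12 [a13 [a23 [a14 [a24 [a34 [a15 [a25 [a35 [a45 h6]]]]]]]]]] := supp5 cf (dmx_anti g _) s6.
have [x1 [x2 [x3 [x4 [x5 [x6 /mx6_dual dl]]]]]] := coframe_dual cf.
have J x y z : _ = 0 := dd0 g e6 x y z.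
have e15 : a15 = a24 by have := J x1 x2 x3; coordinates h6 dl (h1, h2, h3, h4, h5); lra.
have z34 : a34 = 0 by have := J x1 x2 x4; coordinates h6 dl (h1, h2, h3, h4, h5); lra.
have z35 : a35 = 0 by have := J x1 x2 x5; coordinates h6 dl (h1, h2, h3, h4, h5); lra.
have z45 : a45 = 0 by have := J x1 x3 x5; coordinates h6 dl (h1, h2, h3, h4, h5); lra.
have {}h6 : d (e6 - a12 *: e3 - a13 *: e4 - a23 *: e5) =
    a14 *: wd e1 e4 + a24 *: (wd e1 e5 + wd e2 e4) + a25 *: wd e2 e5.
  by rewrite !dmxE h6 h3 h4 h5 e15 z34 z35 z45; forms; ring.
have {}cf : coframe e1 e2 e3 e4 e5 (e6 - a12 *: e3 - a13 *: e4 - a23 *: e5) by change_coframe cf.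
move: (e6 - _ - _ - _) h6 cf => e6' h6 cf.
(* the quadratic form is s (f1^2 + eps f2^2), f1 = a e1 + b e2, f2 = c e1 + e e2 *)
have key (s eps a b c e : R) : s != 0 -> a * e - b * c != 0 ->
    a14 = s * (a * a + eps * (c * c)) -> a24 = s * (a * b + eps * (c * e)) ->
    a25 = s * (b * b + eps * (e * e)) -> [\/ eps = 1, eps = 0 | eps = -1] -> goal.
  move=> s0 D E14 E24 E25 eps_val; pose D' := a * e - b * c.
  have cf' : coframe (a *: e1 + b *: e2) (c *: e1 + e *: e2) (D' *: e3) (D' *: (a *: e4 + b *: e5))
      (D' *: (c *: e4 + e *: e5)) ((D' / s) *: e6').
    have Ds : D' / s != 0 by rewrite mulf_neq0 // invr_eq0.
    move=> X; rewrite !dotE => z1 z2 /(mulf_cancel0 D) z3 /(mulf_cancel0 D) z4 /(mulf_cancel0 D) z5 /(mulf_cancel0 Ds) z6.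
    by have [? ?] := cramer2 D z1 z2; have [? ?] := cramer2 D z4 z5; apply: cf.
  have k1 : d (a *: e1 + b *: e2) = 0 by rewrite !dmxE h1 h2 !scaler0 addr0.
  have k2 : d (c *: e1 + e *: e2) = 0 by rewrite !dmxE h1 h2 !scaler0 addr0.
  have k3 : d (D' *: e3) = wd (a *: e1 + b *: e2) (c *: e1 + e *: e2).
    by rewrite !dmxE h3 /D'; forms; ring.
  have k4 : d (D' *: (a *: e4 + b *: e5)) = wd (a *: e1 + b *: e2) (D' *: e3).
    by rewrite !dmxE h4 h5; forms; ring.
  have k5 : d (D' *: (c *: e4 + e *: e5)) = wd (c *: e1 + e *: e2) (D' *: e3).
    by rewrite !dmxE h4 h5; forms; ring.
  have k6 : d ((D' / s) *: e6') = wd (a *: e1 + b *: e2) (D' *: (a *: e4 + b *: e5))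
      + eps *: wd (c *: e1 + e *: e2) (D' *: (c *: e4 + e *: e5)).
    by rewrite dmxZ h6 E14 E24 E25; clearbody D'; forms; field.
  case: eps_val => eps_val; rewrite eps_val in k6.
  - left; apply: split_type2_has_split.
    apply: (split_13_23 (@i2C R) (@dot_brC R _ g) cf' k1 k2 k3 k4 k5).
    by rewrite k6 scale1r.
  - by right; apply: (Exc_13_23_14 cf' k1 k2 k3 k4 k5); rewrite k6 scale0r addr0.
  by right; apply: (Exc_13_23_14_25 cf' k1 k2 k3 k4 k5); rewrite k6 scaleN1r.
have [z14|n14] := eqVneq a14 0; last first.
  pose D := (a14 * a25 - a24 ^+ 2) / a14 ^+ 2.
  have E a : a14 = a14 * (1 * 1 + a * (0 * 0)) by ring.
  have E' a b : a24 = a14 * (1 * (a24 / a14) + a * (0 * b)) by field.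
  have E'' a b : a * (b * b) = D -> a25 = a14 * (a24 / a14 * (a24 / a14) + a * (b * b)).
    by move=> ->; rewrite /D; field.
  have [neg|pos|D0] := ltgtP D 0.
  - have r : - Num.sqrt (- D) ^+ 2 = D by rewrite sqr_sqrtr ?opprK // oppr_ge0 ltW.
    apply: (key a14 (-1) 1 (a24 / a14) 0 (Num.sqrt (- D)) n14 _ (E _) (E' _ _)).
    + by rewrite mul1r mulr0 subr0 sqrtr_eq0 -ltNge oppr_gt0.
    + by apply: E''; rewrite -[RHS]r; ring.
    by constructor 3.
  - have r : Num.sqrt D ^+ 2 = D by rewrite sqr_sqrtr // ltW.
    apply: (key a14 1 1 (a24 / a14) 0 (Num.sqrt D) n14 _ (E _) (E' _ _)).
    + by rewrite mul1r mulr0 subr0 sqrtr_eq0 -ltNge.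
    + by apply: E''; rewrite -[RHS]r; ring.
    by constructor 1.
  apply: (key a14 0 1 (a24 / a14) 0 1 n14 _ (E _) (E' _ _)).
  - by rewrite mul1r mulr0 subr0 oner_eq0.
  - by apply: E''; rewrite D0 mul0r.
  by constructor 2.
have [z25|n25] := eqVneq a25 0; last first.
  have [z24|n24] := eqVneq a24 0.
    apply: (key a25 0 0 1 1 0 n25); rewrite ?z14 ?z24; try ring.
      by rewrite mul0r mul1r sub0r oppr_eq0 oner_eq0.
    by constructor 2.
  apply: (key a25 (-1) (a24 / a25) 1 (a24 / a25) 0 n25); rewrite ?z14; try by field.
    by rewrite mulr0 mul1r sub0r oppr_eq0 mulf_neq0 // invr_eq0.
  by constructor 3.
have [z24|n24] := eqVneq a24 0; last first.
  apply: (key (a24 / 2) (-1) 1 1 1 (-1)); rewrite ?z14 ?z25; try by field.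
  - by rewrite mulf_neq0 // invr_eq0 pnatr_eq0.
  - by rewrite mul1r mulr1 -opprD oppr_eq0 -[1 + 1]/(2%:R) pnatr_eq0.
  by constructor 3.
apply: (@reduce_closed3 e1 e2 e6' e3 e4 e5) => //.
- by move=> X *; apply: cf.
- by rewrite h6 z14 z24 z25; forms; ring.
- by move=> x y /= v; zeros; rewrite h3; expand_ev2; zeros; ring.
- by move=> x y /= v; zeros; rewrite h4; expand_ev2; zeros; ring.
by move=> x y /= v; zeros; rewrite h5; expand_ev2; zeros; ring.
Qed.

Lemma reduce_12_13 (e1 e2 e3 e4 e5 e6 : V) :
  coframe e1 e2 e3 e4 e5 e6 -> d e1 = 0 -> d e2 = 0 -> d e3 = wd e1 e2 -> d e4 = wd e1 e3 ->
  supp [:: e1; e2; e3; e4] (d e5) -> supp [:: e1; e2; e3; e4; e5] (d e6) -> goal.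
Proof.
move=> cf h1 h2 h3 h4 s5 s6.
(* the closed 2-forms in e1, .., e4 do not involve e2 /\ e4 and e3 /\ e4 *)
have closed4 (eta f5 f6 : V) : coframe e1 e2 e3 e4 f5 f6 -> supp [:: e1; e2; e3; e4] (d eta) ->
    exists c12 c13 c23 c14, d eta = c12 *: wd e1 e2 + c13 *: wd e1 e3 + c23 *: wd e2 e3 + c14 *: wd e1 e4.
  move=> cf' s; have [c12 [c13 [c23 [c14 [c24 [c34 h]]]]]] := supp4 cf' (dmx_anti g _) s.
  have [x1 [x2 [x3 [x4 [x5 [x6 /mx6_dual dl]]]]]] := coframe_dual cf'.
  have J x y z : _ = 0 := dd0 g eta x y z.
  have z24 : c24 = 0 by have := J x1 x2 x3; coordinates h dl (h1, h2, h3, h4); lra.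
  have z34 : c34 = 0 by have := J x1 x2 x4; coordinates h dl (h1, h2, h3, h4); lra.
  by exists c12, c13, c23, c14; rewrite h z24 z34 !scale0r !addr0.
have case23 (f5 f6 : V) q : coframe e1 e2 e3 e4 f5 f6 -> d f5 = q *: wd e2 e3 ->
    supp [:: e1; e2; e3; e4; f5] (d f6) -> goal.
  move=> cf' k5 k6; have [q0|nq] := eqVneq q 0.
    apply: (@reduce_closed3 e1 e2 f5 e3 e4 f6) => //.
    - by move=> X *; apply: cf'.
    - by rewrite k5 q0 scale0r.
    - by move=> x y /= v; zeros; rewrite h3; expand_ev2; zeros; ring.
    - by move=> x y /= v; zeros; rewrite h4; expand_ev2; zeros; ring.
    by change_supp k6.
  have iq : q^-1 != 0 by rewrite invr_eq0.
  apply: (@reduce_13_23 e1 e2 e3 e4 (q^-1 *: f5) f6) => //.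
  - by change_coframe cf'.
  - by rewrite dmxZ k5 scalerA mulVf // scale1r.
  by change_supp k6.
have [c12 [c13 [q [p h5]]]] := closed4 e5 e5 e6 cf s5.
have {}cf : coframe e1 e2 e3 e4 (e5 - c12 *: e3 - c13 *: e4) e6 by change_coframe cf.
have {}h5 : d (e5 - c12 *: e3 - c13 *: e4) = p *: wd e1 e4 + q *: wd e2 e3.
  by rewrite !dmxE h5 h3 h4; forms; ring.
have {}s6 : supp [:: e1; e2; e3; e4; e5 - c12 *: e3 - c13 *: e4] (d e6) by change_supp s6.
move: (e5 - _ - _) cf h5 s6 => e5' cf h5 s6 {s5}.
have [p0|np] := eqVneq p 0.
  by apply: (case23 e5' e6 q cf) => //; rewrite h5 p0 scale0r add0r.
have [a12 [a13 [a23 [a14 [a24 [a34 [a15 [a25 [a35 [a45 h6]]]]]]]]]] := supp5 cf (dmx_anti g _) s6.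
have [/and4P[/eqP z1 /eqP z2 /eqP z3 /eqP z4]|n] :=
  boolP [&& a15 == 0, a25 == 0, a35 == 0 & a45 == 0]; last first.
  by right; apply: (Exc_maximal cf h1 h2 h3 h4 h5 h6 np n).
have s6' : supp [:: e1; e2; e3; e4] (d e6).
  by move=> x y /= v; zeros; rewrite h6 z1 z2 z3 z4; expand_ev2; zeros; ring.
have [k12 [k13 [k23 [k14 k]]]] := closed4 e6 e5' e6 cf s6'.
apply: (case23 (e6 - k12 *: e3 - k13 *: e4 - (k14 / p) *: e5') e5' (k23 - k14 / p * q)).
- by change_coframe cf.
- by rewrite !dmxE k h3 h4 h5; forms; field.
by move=> x y /= v; zeros; rewrite h5; expand_ev2; zeros; ring.
Qed.

(** A triangular coframe has at least two closed covectors.  Either the coefficients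
    of d e3 and d e4 provide a third one, or g starts with (0,0,12,13). *)
Theorem split_or_exceptional : nilpotent_lie g -> goal.
Proof.
move=> /triangular_coframe[e1 [e2 [e3 [e4 [e5 [e6 [a [b1 [b2 [b3 [c1 [c2 [c3 [c4 [c5 [c6]]]]]]]]]]]]]]]].
move=> [d1 [d2 [d3 [d4 [d5 [d6 [d7 [d8 [d9 [d0 [cf [h1 h2] h3 h4 [h5 h6]]]]]]]]]]]].
have s5 : supp [:: e1; e2; e3; e4] (d e5).
  by move=> x y /= v; zeros; rewrite h5; expand_ev2; zeros; ring.
have s6 : supp [:: e1; e2; e3; e4; e5] (d e6).
  by move=> x y /= v; zeros; rewrite h6; expand_ev2; zeros; ring.
have [a0|na] := eqVneq a 0.
  apply: (reduce_closed3 cf h1 h2) => //; first by rewrite h3 a0 scale0r.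
  by move=> x y /= v; zeros; rewrite h4; expand_ev2; zeros; ring.
have ia : a^-1 != 0 by rewrite invr_eq0.
have [/andP[/eqP z2 /eqP z3]|n] := boolP ((b2 == 0) && (b3 == 0)).
  apply: (@reduce_closed3 e1 e2 (e4 - (b1 / a) *: e3) e3 e5 e6) => //.
  - by change_coframe cf.
  - by rewrite !dmxE h4 h3 z2 z3; forms; field.
  - by move=> x y /= v; zeros; rewrite h3; expand_ev2; zeros; ring.
  - by change_supp s5.
  by change_supp s6.
rewrite negb_and in n; have [f2 [w2 k2 hf2]] := unimodular2 g e1 e2 n.
apply: (@reduce_12_13 (b2 *: e1 + b3 *: e2) f2 (a^-1 *: e3) (a^-1 *: (e4 - (b1 / a) *: e3)) e5 e6) => //.
- move=> X z1 z2; rewrite !dotE => *; zeros.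
  by have [? ?] := k2 X z1 z2; apply: cf.
- by rewrite !dmxE h1 h2 !scaler0 addr0.
- exact: hf2.
- by rewrite w2 !dmxE h3 scalerA mulVf // scale1r.
- by rewrite !dmxE h4 h3; forms; field.
- move=> x y /= [y1 [y2 v]]; apply: s5; have [? ?] := k2 x y1 y2.
  by move: v; rewrite !dotE => v; zeros; do ?split.
move=> x y /= [y1 [y2 v]]; apply: s6; have [? ?] := k2 x y1 y2.
by move: v; rewrite !dotE => v; zeros; do ?split.
Qed.

End ReductionB.

(** * Bases of the dual and Chevalley-Eilenberg differentials *)

Section Coframes.
Variables (R : realType) (g : lie_algebra R 6).
Local Notation V := 'rV[R]_6.
Local Notation d := (dmx g).

Lemma dual_sym (e1 e2 e3 e4 e5 e6 x1 x2 x3 x4 x5 x6 : V) :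
  mx6 [:: e1; e2; e3; e4; e5; e6] *m (mx6 [:: x1; x2; x3; x4; x5; x6])^T = 1%:M ->
  mx6 [:: x1; x2; x3; x4; x5; x6] *m (mx6 [:: e1; e2; e3; e4; e5; e6])^T = 1%:M.
Proof. by move=> /(congr1 trmx); rewrite trmx_mul trmxK trmx1. Qed.

Lemma coframe_free (e1 e2 e3 e4 e5 e6 : V) :
  coframe e1 e2 e3 e4 e5 e6 -> free [:: e1; e2; e3; e4; e5; e6].
Proof.
move=> /coframe_dual[x1 [x2 [x3 [x4 [x5 [x6 /dual_sym /mx6_dual dl]]]]]].
apply/(@freeP _ _ 6 [tuple e1; e2; e3; e4; e5; e6]) => k.
rewrite !big_ord_recl big_ord0 /= addr0 !addrA => E.
have [[h1 h2] h3] := (congr1 (dot x1) E, congr1 (dot x2) E, congr1 (dot x3) E).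
have [[h4 h5] h6] := (congr1 (dot x4) E, congr1 (dot x5) E, congr1 (dot x6) E).
rewrite (dual1 dl) dot0r in h1; rewrite (dual2 dl) dot0r in h2; rewrite (dual3 dl) dot0r in h3.
rewrite (dual4 dl) dot0r in h4; rewrite (dual5 dl) dot0r in h5; rewrite (dual6 dl) dot0r in h6.
case=> [[|[|[|[|[|[|//]]]]]] i6].
- by rewrite -[RHS]h1; congr k; apply: val_inj.
- by rewrite -[RHS]h2; congr k; apply: val_inj.
- by rewrite -[RHS]h3; congr k; apply: val_inj.
- by rewrite -[RHS]h4; congr k; apply: val_inj.
- by rewrite -[RHS]h5; congr k; apply: val_inj.
by rewrite -[RHS]h6; congr k; apply: val_inj.
Qed.

Lemma basis_coframe (e : 6.-tuple V) :
  basis_of fullv e -> coframe e`_0 e`_1 e`_2 e`_3 e`_4 e`_5.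
Proof.
move=> /span_basis eb X h0 h1 h2 h3 h4 h5.
apply: dot_eq => y; rewrite dot0l dotC.
have : y \in <<e>>%VS by rewrite eb memvf.
move=> /coord_span ->; rewrite dotC dot_sumr big1 // => i _.
rewrite dotZr dotC; suff -> : dot e`_i X = 0 by rewrite mulr0.
by case: i => [[|[|[|[|[|[|//]]]]]] i6].
Qed.

Lemma coframe_basis (e1 e2 e3 e4 e5 e6 : V) :
  coframe e1 e2 e3 e4 e5 e6 -> basis_of fullv [tuple e1; e2; e3; e4; e5; e6].
Proof.
by move=> /coframe_free f; rewrite basisEfree f subvf dimvf /= /dim /= mul1n.
Qed.

Lemma twoform_lin c (A B : 'M[R]_6) : twoform (c *: A + B) = c *: twoform A + twoform B.
Proof.
rewrite scaler_sumr -big_split /=; apply: eq_bigr => j _.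
rewrite scaler_sumr -big_split /=; apply: eq_bigr => k _.
by rewrite !mxE scalerDl scalerA.
Qed.

(** The coefficients of an alternating 2-form are recovered by interior products. *)
Lemma twoform_inj (A B : 'M[R]_6) :
  (forall x y, ev2 A y x = - ev2 A x y) -> (forall x y, ev2 B y x = - ev2 B x y) ->
  twoform A = twoform B -> A = B.
Proof.
move=> hA hB E; apply: ev2_ext => x y.
have cE (C : 'M[R]_6) : (forall x y, ev2 C y x = - ev2 C x y) ->
    contract y (contract x (twoform C)) = ev2 C x y *: monomial R finset.set0.
  move=> hC; have a j k : C k j = - C j k by rewrite -!ev2_delta hC.
  have a0 j : C j j = 0.
    by have /eqP := a j j; rewrite -addr_eq0 -mulr2n mulrn_eq0 /= => /eqP.
  rewrite contract_twoform // contract_oneform; congr (_ *: _).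
  by rewrite /ev2 /dot; congr ((_ *m _ *m _) 0 0); apply/matrixP => j k; rewrite mxE.
have := cE A hA; rewrite E (cE B hB) => /ffunP/(_ finset.set0).
by rewrite !ffunE eqxx /GRing.scale /= !mulr1.
Qed.

Lemma chevalley_dE eta : chevalley_d g eta = twoform (d eta).
Proof. by apply: eq_bigr => j _; apply: eq_bigr => k _; rewrite mxE. Qed.

Definition ij_mx (e : seq V) (z : int) : 'M[R]_6 :=
  (sgz z)%:~R *: wd e`_((`|z| %/ 10)%N.-1) e`_((`|z| %% 10)%N.-1).

Lemma sum_ij_form (e : seq V) l : \sum_(z <- l) ij_form e z = twoform (\sum_(z <- l) ij_mx e z).
Proof.
elim: l => [|z l IH]; last by rewrite !big_cons IH /ij_form wedge_oneform /ij_mx twoform_lin.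
rewrite !big_nil /twoform big1 // => j _; rewrite big1 // => k _.
by rewrite mxE scale0r.
Qed.

Lemma ij_mx_anti (e : seq V) l x y :
  ev2 (\sum_(z <- l) ij_mx e z) y x = - ev2 (\sum_(z <- l) ij_mx e z) x y.
Proof.
elim: l => [|z l IH]; first by rewrite !big_nil !ev20 oppr0.
by rewrite !big_cons !ev2D IH /ij_mx !ev2Z alt_wd opprD mulrN.
Qed.

Lemma chevalley_d_ij (e : seq V) l eta :
  chevalley_d g eta = \sum_(z <- l) ij_form e z <-> d eta = \sum_(z <- l) ij_mx e z.
Proof.
rewrite chevalley_dE sum_ij_form; split=> [|-> //].
apply: twoform_inj; [exact: dmx_anti|exact: ij_mx_anti].
Qed.

Lemma of_the_formP l : of_the_form g l <->
  exists e1 e2 e3 e4 e5 e6, let e := [:: e1; e2; e3; e4; e5; e6] in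
    coframe e1 e2 e3 e4 e5 e6 /\
    forall k, (k < size l)%N -> d e`_k = \sum_(z <- nth [::] l k) ij_mx e z.
Proof.
split=> [[e /basis_coframe cf h]|[e1 [e2 [e3 [e4 [e5 [e6 [cf h]]]]]]]]; last first.
  exists [tuple e1; e2; e3; e4; e5; e6]; first exact: coframe_basis.
  by move=> k kl; apply/chevalley_d_ij/h.
exists e`_0, e`_1, e`_2, e`_3, e`_4, e`_5; split=> //.
have -> : [:: e`_0; e`_1; e`_2; e`_3; e`_4; e`_5] = e.
  apply: (@eq_from_nth _ 0); first by rewrite (size_tuple e).
  by case=> [|[|[|[|[|[|//]]]]]].
by move=> k kl; apply/chevalley_d_ij/h.
Qed.

Lemma ij_mxE (e : seq V) :
  (ij_mx e 12 = wd e`_0 e`_1) * (ij_mx e 13 = wd e`_0 e`_2) * (ij_mx e 14 = wd e`_0 e`_3)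
  * (ij_mx e 23 = wd e`_1 e`_2) * (ij_mx e 24 = wd e`_1 e`_3) * (ij_mx e (-24) = - wd e`_1 e`_3)
  * (ij_mx e (-25) = - wd e`_1 e`_4).
Proof. by rewrite /ij_mx !(scale1r, scaleN1r). Qed.

Lemma form_12_14 : of_the_form g [:: [::]; [::]; [::]; [:: 12]; [:: 14]] <->
  exists e1 e2 e3 e4 e5 e6, [/\ coframe e1 e2 e3 e4 e5 e6, d e1 = 0 /\ d e2 = 0, d e3 = 0,
    d e4 = wd e1 e2 & d e5 = wd e1 e4].
Proof.
rewrite of_the_formP; split=> -[e1 [e2 [e3 [e4 [e5 [e6 /=]]]]]].
  case=> cf h; exists e1, e2, e3, e4, e5, e6.
  have := (h 0 isT, h 1 isT, h 2 isT, h 3 isT, h 4 isT).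
  by rewrite /= !big_seq1 !big_nil !ij_mxE /= => -[[[[? ?] ?] ?] ?].
case=> cf [h1 h2] h3 h4 h5; exists e1, e2, e3, e4, e5, e6; split=> // k.
by case: k => [|[|[|[|[|//]]]]] _ /=; rewrite ?big_seq1 ?big_nil ?ij_mxE.
Qed.

Lemma form_12_14_13_24 : of_the_form g [:: [::]; [::]; [::]; [:: 12]; [:: 14]; [:: 13; -24]] <->
  exists e1 e2 e3 e4 e5 e6, [/\ coframe e1 e2 e3 e4 e5 e6, d e1 = 0 /\ d e2 = 0, d e3 = 0,
    d e4 = wd e1 e2 & d e5 = wd e1 e4 /\ d e6 = wd e1 e3 - wd e2 e4].
Proof.
rewrite of_the_formP; split=> -[e1 [e2 [e3 [e4 [e5 [e6 /=]]]]]].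
  case=> cf h; exists e1, e2, e3, e4, e5, e6.
  have := (h 0 isT, h 1 isT, h 2 isT, h 3 isT, h 4 isT, h 5 isT).
  by rewrite /= !big_cons !big_nil !addr0 !ij_mxE /= => -[[[[[? ?] ?] ?] ?] ?].
case=> cf [h1 h2] h3 h4 [h5 h6]; exists e1, e2, e3, e4, e5, e6; split=> // k.
by case: k => [|[|[|[|[|[|//]]]]]] _ /=; rewrite ?big_cons ?big_nil ?addr0 ?ij_mxE.
Qed.

Lemma form_12_14_23_24 : of_the_form g [:: [::]; [::]; [::]; [:: 12]; [:: 14]; [:: 23; 24]] <->
  exists e1 e2 e3 e4 e5 e6, [/\ coframe e1 e2 e3 e4 e5 e6, d e1 = 0 /\ d e2 = 0, d e3 = 0,
    d e4 = wd e1 e2 & d e5 = wd e1 e4 /\ d e6 = wd e2 e3 + wd e2 e4].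
Proof.
rewrite of_the_formP; split=> -[e1 [e2 [e3 [e4 [e5 [e6 /=]]]]]].
  case=> cf h; exists e1, e2, e3, e4, e5, e6.
  have := (h 0 isT, h 1 isT, h 2 isT, h 3 isT, h 4 isT, h 5 isT).
  by rewrite /= !big_cons !big_nil !addr0 !ij_mxE /= => -[[[[[? ?] ?] ?] ?] ?].
case=> cf [h1 h2] h3 h4 [h5 h6]; exists e1, e2, e3, e4, e5, e6; split=> // k.
by case: k => [|[|[|[|[|[|//]]]]]] _ /=; rewrite ?big_cons ?big_nil ?addr0 ?ij_mxE.
Qed.

Lemma form_13_23_14 : of_the_form g [:: [::]; [::]; [:: 12]; [:: 13]; [:: 23]; [:: 14]] <->
  exists e1 e2 e3 e4 e5 e6, [/\ coframe e1 e2 e3 e4 e5 e6, d e1 = 0 /\ d e2 = 0, d e3 = wd e1 e2,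
    d e4 = wd e1 e3 & d e5 = wd e2 e3 /\ d e6 = wd e1 e4].
Proof.
rewrite of_the_formP; split=> -[e1 [e2 [e3 [e4 [e5 [e6 /=]]]]]].
  case=> cf h; exists e1, e2, e3, e4, e5, e6.
  have := (h 0 isT, h 1 isT, h 2 isT, h 3 isT, h 4 isT, h 5 isT).
  by rewrite /= !big_cons !big_nil !addr0 !ij_mxE /= => -[[[[[? ?] ?] ?] ?] ?].
case=> cf [h1 h2] h3 h4 [h5 h6]; exists e1, e2, e3, e4, e5, e6; split=> // k.
by case: k => [|[|[|[|[|[|//]]]]]] _ /=; rewrite ?big_cons ?big_nil ?addr0 ?ij_mxE.
Qed.

Lemma form_13_23_14_25 : of_the_form g [:: [::]; [::]; [:: 12]; [:: 13]; [:: 23]; [:: 14; -25]] <->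
  exists e1 e2 e3 e4 e5 e6, [/\ coframe e1 e2 e3 e4 e5 e6, d e1 = 0 /\ d e2 = 0, d e3 = wd e1 e2,
    d e4 = wd e1 e3 & d e5 = wd e2 e3 /\ d e6 = wd e1 e4 - wd e2 e5].
Proof.
rewrite of_the_formP; split=> -[e1 [e2 [e3 [e4 [e5 [e6 /=]]]]]].
  case=> cf h; exists e1, e2, e3, e4, e5, e6.
  have := (h 0 isT, h 1 isT, h 2 isT, h 3 isT, h 4 isT, h 5 isT).
  by rewrite /= !big_cons !big_nil !addr0 !ij_mxE /= => -[[[[[? ?] ?] ?] ?] ?].
case=> cf [h1 h2] h3 h4 [h5 h6]; exists e1, e2, e3, e4, e5, e6; split=> // k.
by case: k => [|[|[|[|[|[|//]]]]]] _ /=; rewrite ?big_cons ?big_nil ?addr0 ?ij_mxE.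
Qed.

End Coframes.

(** * The nilpotency conditions *)

Section Nilpotency.
Variables (R : realType) (g : lie_algebra R 6).
Local Notation V := 'rV[R]_6.
Local Notation d := (dmx g).
Local Notation ann k := (ann_lower_central g k%N).

(** The dual description of the lower central series: V_(k+1) contains the covectors
    whose differential is a 2-form in V_k. *)
Lemma ann_succ k s eta : supp s (d eta) -> (forall f, f \in s -> f \in ann k) -> eta \in ann k.+1.
Proof.
move=> h sk; apply/ann_lower_centralP; apply: (vanish_lower_central (A := s)).
  by move=> f /sk/ann_lower_centralP.
by move=> x y v; rewrite dot_br h ?oppr0 //; apply/vanishP.
Qed.

Lemma ann_closed eta : d eta = 0 -> eta \in ann 1.
Proof. by move=> h; apply: (@ann_succ 0%N [::]) => // x y _; rewrite h ev20. Qed.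

Lemma ann_le j k eta : (j <= k)%N -> eta \in ann j -> eta \in ann k.
Proof.
move=> jk /ann_lower_centralP h; apply/ann_lower_centralP => x xk; apply: h.
exact: (subvP (lower_central_le g jk)).
Qed.

Lemma ann_full k (e1 e2 e3 e4 e5 e6 : V) : coframe e1 e2 e3 e4 e5 e6 ->
  (forall f, f \in [:: e1; e2; e3; e4; e5; e6] -> f \in ann k) <-> lower_central g k = 0%VS.
Proof.
move=> cf; split=> [h|h f _]; last first.
  by apply/ann_lower_centralP => x; rewrite h memv0 => /eqP ->; rewrite dot0r.
apply/eqP; rewrite -subv0; apply/subvP => x xk; rewrite memv0; apply/eqP.
have z f : f \in [:: e1; e2; e3; e4; e5; e6] -> dot f x = 0.
  by move=> /h/ann_lower_centralP; apply.
by apply: cf; apply: z; rewrite !inE eqxx ?orbT.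
Qed.

Lemma free_dim (s t : seq V) k : free (s ++ t) -> (forall f, f \in s -> f \in ann k) ->
  (size s <= \dim (ann k))%N.
Proof.
move=> /catl_free; rewrite /free => /eqP <- h; apply: dimvS.
exact/span_subvP.
Qed.

Lemma dim_ann_le (t : seq V) k : (forall eta, eta \in ann k -> eta \in <<t>>%VS) ->
  (\dim (ann k) <= size t)%N.
Proof. by move=> h; apply: (leq_trans _ (dim_span t)); apply: dimvS; apply/subvP. Qed.

Lemma maximal_dim (gnil : nilpotent_lie g) : maximal_nilpotency gnil ->
  forall i, (0 < i <= 5)%N -> \dim (ann i) = i.+1.
Proof.
move=> [d1 dS]; move: dS; rewrite /nil_index; case: ex_minnP => n /eqP n0 _ dS.
have dn i : (0 < i <= n)%N -> \dim (ann i) = i.+1.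
  elim: i => [//|[_ _ //|i IH] hi].
  by rewrite (dS i.+2 hi) /= IH //= ltnW.
have full : \dim (ann n) = 6%N.
  suff -> : ann n = fullv by rewrite dimvf /dim /= mul1n.
  apply/eqP; rewrite eqEsubv subvf /=; apply/subvP => f _.
  by apply/ann_lower_centralP => x; rewrite n0 memv0 => /eqP ->; rewrite dot0r.
have n5 : n = 5%N.
  case: n n0 dS dn full => [|n] n0 dS dn full; last first.
    by move: (dn n.+1); rewrite full ltnS leqnn => /(_ isT) [] <-.
  have : (\dim (ann 0) <= \dim (ann 1))%N.
    by apply: dimvS; apply/subvP => f; apply: ann_le.
  by rewrite full d1.
by move: dn; rewrite n5.
Qed.

(** If d e_k did not involve e_(k-1), both covectors would lie in the same V_i, whose
    dimension would be too large. *)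
Lemma maximal_triangular (gnil : nilpotent_lie g) : maximal_nilpotency gnil ->
  exists e1 e2 e3 e4 e5 e6 a b1 b2 b3 c1 c2 c3 c4 c5 c6 d1 d2 d3 d4 d5 d6 d7 d8 d9 d0,
  [/\ coframe e1 e2 e3 e4 e5 e6, d e1 = 0 /\ d e2 = 0, d e3 = a *: wd e1 e2,
    d e4 = b1 *: wd e1 e2 + b2 *: wd e1 e3 + b3 *: wd e2 e3 &
    [/\ d e5 = c1 *: wd e1 e2 + c2 *: wd e1 e3 + c3 *: wd e2 e3 +
      c4 *: wd e1 e4 + c5 *: wd e2 e4 + c6 *: wd e3 e4,
    d e6 = d1 *: wd e1 e2 + d2 *: wd e1 e3 + d3 *: wd e2 e3 +
      d4 *: wd e1 e4 + d5 *: wd e2 e4 + d6 *: wd e3 e4 +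
      d7 *: wd e1 e5 + d8 *: wd e2 e5 + d9 *: wd e3 e5 + d0 *: wd e4 e5 &
    [/\ a != 0, (b2 != 0) || (b3 != 0), [|| c4 != 0, c5 != 0 | c6 != 0] &
        [|| d7 != 0, d8 != 0, d9 != 0 | d0 != 0]]]].
Proof.
move=> /maximal_dim dim_i.
have := triangular_coframe gnil.
move=> [e1 [e2 [e3 [e4 [e5 [e6 [a [b1 [b2 [b3 [c1 [c2 [c3 [c4 [c5 [c6]]]]]]]]]]]]]]]].
move=> [d1 [d2 [d3 [d4 [d5 [d6 [d7 [d8 [d9 [d0 [cf [h1 h2] h3 h4 [h5 h6]]]]]]]]]]]].
exists e1, e2, e3, e4, e5, e6, a, b1, b2, b3, c1, c2, c3, c4, c5, c6.
exists d1, d2, d3, d4, d5, d6, d7, d8, d9, d0; have cf' := coframe_free cf.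
have big (s t : seq V) k : free (s ++ t) -> (0 < k <= 5)%N -> (k.+1 < size s)%N ->
    ~ (forall f, f \in s -> f \in ann k).
  by move=> fr hk + /(free_dim fr); rewrite dim_i // ltnNge => /negP.
have a1 i : e1 \in ann i.+1 by apply: (@ann_le 1%N) => //; apply: ann_closed.
have a2 i : e2 \in ann i.+1 by apply: (@ann_le 1%N) => //; apply: ann_closed.
have a3 i : e3 \in ann i.+2.
  apply: (@ann_le 2%N) => //; apply: (@ann_succ 1%N [:: e1; e2]).
    by move=> x y /= v; zeros; rewrite h3; expand_ev2; zeros; ring.
  by move=> f; rewrite !inE => /orP[] /eqP ->.
have a4 i : e4 \in ann i.+3.
  apply: (@ann_le 3%N) => //; apply: (@ann_succ 2%N [:: e1; e2; e3]).
    by move=> x y /= v; zeros; rewrite h4; expand_ev2; zeros; ring.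
  by move=> f; rewrite !inE => /or3P[] /eqP ->.
have a5 i : e5 \in ann i.+4.
  apply: (@ann_le 4%N) => //; apply: (@ann_succ 3%N [:: e1; e2; e3; e4]).
    by move=> x y /= v; zeros; rewrite h5; expand_ev2; zeros; ring.
  by move=> f; rewrite !inE => /or4P[] /eqP ->.
do ?split=> //.
- apply/eqP => a0; apply: (big [:: e1; e2; e3] [:: e4; e5; e6] 1%N cf') => // f.
  by rewrite !inE => /or3P[] /eqP ->; apply: ann_closed => //; rewrite h3 a0 scale0r.
- rewrite -negb_and; apply/negP => /andP[/eqP z2 /eqP z3].
  apply: (big [:: e1; e2; e3; e4] [:: e5; e6] 2%N cf') => // f.
  rewrite !inE => /or4P[] /eqP -> //.
  apply: (@ann_succ 1%N [:: e1; e2]).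
    by move=> x y /= v; zeros; rewrite h4 z2 z3; expand_ev2; zeros; ring.
  by move=> f'; rewrite !inE => /orP[] /eqP ->.
- rewrite -!negb_and; apply/negP => /and3P[/eqP z4 /eqP z5 /eqP z6].
  apply: (big [:: e1; e2; e3; e4; e5] [:: e6] 3%N cf') => // f.
  rewrite !inE => /or4P[/eqP->|/eqP->|/eqP->|/orP[]/eqP->] //.
  apply: (@ann_succ 2%N [:: e1; e2; e3]).
    by move=> x y /= v; zeros; rewrite h5 z4 z5 z6; expand_ev2; zeros; ring.
  by move=> f'; rewrite !inE => /or3P[] /eqP ->.
rewrite -!negb_and; apply/negP => /and4P[/eqP z7 /eqP z8 /eqP z9 /eqP z0].
apply: (big [:: e1; e2; e3; e4; e5; e6] [::] 4%N cf') => // f.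
rewrite !inE => /or4P[/eqP->|/eqP->|/eqP->|/or3P[]/eqP->] //.
apply: (@ann_succ 3%N [:: e1; e2; e3; e4]).
  by move=> x y /= v; zeros; rewrite h6 z7 z8 z9 z0; expand_ev2; zeros; ring.
by move=> f'; rewrite !inE => /or4P[] /eqP ->.
Qed.

(** The k-th term of the lower central series contains a vector v_k on which
    e_1, .., e_(k+1) vanish and e_(k+2) does not.  These vectors bound the dimensions
    of the V_i from above, and the coframe bounds them from below. *)
Lemma exceptional_maximal (gnil : nilpotent_lie g) (e1 e2 e3 e4 e5 e6 : V)
    p q a12 a13 a23 a14 a24 a34 c1 c2 c3 c4 :
  coframe e1 e2 e3 e4 e5 e6 -> d e1 = 0 -> d e2 = 0 -> d e3 = wd e1 e2 -> d e4 = wd e1 e3 ->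
  d e5 = p *: wd e1 e4 + q *: wd e2 e3 ->
  d e6 = a12 *: wd e1 e2 + a13 *: wd e1 e3 + a23 *: wd e2 e3 + a14 *: wd e1 e4
    + a24 *: wd e2 e4 + a34 *: wd e3 e4 + c1 *: wd e1 e5 + c2 *: wd e2 e5
    + c3 *: wd e3 e5 + c4 *: wd e4 e5 ->
  p != 0 -> ~~ [&& c1 == 0, c2 == 0, c3 == 0 & c4 == 0] -> maximal_nilpotency gnil.
Proof.
move=> cf h1 h2 h3 h4 h5 h6 np nc; have cf' := coframe_free cf.
have [x1 [x2 [x3 [x4 [x5 [x6 dl']]]]]] := coframe_dual cf.
have dl := mx6_dual dl'; have dx := mx6_dual (dual_sym dl').
pose v1 := g x2 x1; pose v2 := g v1 x1; pose v3 := g v2 x1.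
have E1 : [/\ dot e1 v1 = 0, dot e2 v1 = 0, dot e3 v1 = 1, dot e4 v1 = 0 & dot e5 v1 = 0].
  by split; rewrite dot_br ?h1 ?h2 ?h3 ?h4 ?h5; expand_ev2; rewrite ?(dual_ev dl); ring.
have E2 : [/\ dot e1 v2 = 0, dot e2 v2 = 0, dot e3 v2 = 0, dot e4 v2 = 1 & dot e5 v2 = 0].
  case: E1 => k1 k2 k3 k4 k5.
  by split; rewrite dot_br ?h1 ?h2 ?h3 ?h4 ?h5; expand_ev2; rewrite ?(k1, k2, k3, k4, k5) ?(dual_ev dl); ring.
have E3 : [/\ dot e1 v3 = 0, dot e2 v3 = 0, dot e3 v3 = 0, dot e4 v3 = 0 & dot e5 v3 = p].
  case: E2 => k1 k2 k3 k4 k5.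
  by split; rewrite dot_br ?h1 ?h2 ?h3 ?h4 ?h5; expand_ev2; rewrite ?(k1, k2, k3, k4, k5) ?(dual_ev dl); ring.
have [y ny] : exists y, dot e6 (g v3 y) != 0.
  have E y : dot e6 (g v3 y) = p * (c1 * dot e1 y + c2 * dot e2 y + c3 * dot e3 y + c4 * dot e4 y).
    by case: E3 => k1 k2 k3 k4 k5; rewrite dot_br h6; expand_ev2; rewrite !(k1, k2, k3, k4, k5); ring.
  move: nc; rewrite !negb_and => /or4P[] n.
  - by exists x1; rewrite E !(dual_ev dl) !mulr0 !addr0 mulr1 mulf_neq0.
  - by exists x2; rewrite E !(dual_ev dl) !mulr0 !addr0 add0r mulr1 mulf_neq0.
  - by exists x3; rewrite E !(dual_ev dl) !mulr0 !addr0 !add0r mulr1 mulf_neq0.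
  by exists x4; rewrite E !(dual_ev dl) !mulr0 !add0r mulr1 mulf_neq0.
pose v4 := g v3 y.
have E4 : [/\ dot e1 v4 = 0, dot e2 v4 = 0, dot e3 v4 = 0, dot e4 v4 = 0 & dot e5 v4 = 0].
  case: E3 => k1 k2 k3 k4 k5.
  by split; rewrite dot_br ?h1 ?h2 ?h3 ?h4 ?h5; expand_ev2; rewrite ?(k1, k2, k3, k4, k5); ring.
have m1 : v1 \in lower_central g 1%N by apply: mem_lower_central; apply: memvf.
have m2 : v2 \in lower_central g 2%N by apply: mem_lower_central.
have m3 : v3 \in lower_central g 3%N by apply: mem_lower_central.
have m4 : v4 \in lower_central g 4%N by apply: mem_lower_central.
have kills i j eta v : eta \in ann i -> v \in lower_central g j -> (i <= j)%N ->
    dot eta x1 * dot e1 v + dot eta x2 * dot e2 v + dot eta x3 * dot e3 v + dot eta x4 * dot e4 v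
    + dot eta x5 * dot e5 v + dot eta x6 * dot e6 v = 0.
  move=> ei vj ij; have /ann_lower_centralP/(_ v vj) := ann_le ij ei.
  rewrite {1}(dual_vec dl v) !dotE => <-; ring.
have k6 i eta : (i <= 4)%N -> eta \in ann i -> dot eta x6 = 0.
  move=> i4 ei; have := kills i 4%N eta v4 ei m4 i4; case: E4 => -> -> -> -> ->.
  by rewrite !mulr0 !add0r mulrC => /(mulf_cancel0 ny).
have k5 i eta : (i <= 3)%N -> eta \in ann i -> dot eta x5 = 0.
  move=> i3 ei; have := kills i 3%N eta v3 ei m3 i3; case: E3 => -> -> -> -> ->.
  by rewrite (k6 i eta (leqW i3) ei) mul0r !mulr0 !add0r addr0 mulrC => /(mulf_cancel0 np).
have k4 i eta : (i <= 2)%N -> eta \in ann i -> dot eta x4 = 0.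
  move=> i2 ei; have := kills i 2%N eta v2 ei m2 i2; case: E2 => -> -> -> -> ->.
  by rewrite (k6 i eta (leqW (leqW i2)) ei) mul0r !mulr0 !add0r !addr0 mulr1.
have k3 i eta : (i <= 1)%N -> eta \in ann i -> dot eta x3 = 0.
  move=> i1 ei; have := kills i 1%N eta v1 ei m1 i1; case: E1 => -> -> -> -> ->.
  by rewrite (k6 i eta (leqW (leqW (leqW i1))) ei) mul0r !mulr0 !add0r !addr0 mulr1.
have etaE eta : eta = dot eta x1 *: e1 + dot eta x2 *: e2 + dot eta x3 *: e3 + dot eta x4 *: e4
    + dot eta x5 *: e5 + dot eta x6 *: e6.
  by rewrite {1}(dual_vec dx eta) !(dotC eta).
have a1 i : (0 < i)%N -> e1 \in ann i by move=> i1; apply: (ann_le i1); apply: ann_closed.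
have a2 i : (0 < i)%N -> e2 \in ann i by move=> i1; apply: (ann_le i1); apply: ann_closed.
have a3 i : (1 < i)%N -> e3 \in ann i.
  move=> i1; apply: (ann_le i1); apply: (@ann_succ 1%N [:: e1; e2]).
    by move=> x z /= v; zeros; rewrite h3; expand_ev2; zeros; ring.
  by move=> f; rewrite !inE => /orP[] /eqP ->; rewrite ?a1 ?a2.
have a4 i : (2 < i)%N -> e4 \in ann i.
  move=> i1; apply: (ann_le i1); apply: (@ann_succ 2%N [:: e1; e2; e3]).
    by move=> x z /= v; zeros; rewrite h4; expand_ev2; zeros; ring.
  by move=> f; rewrite !inE => /or3P[] /eqP ->; rewrite ?a1 ?a2 ?a3.
have a5 i : (3 < i)%N -> e5 \in ann i.
  move=> i1; apply: (ann_le i1); apply: (@ann_succ 3%N [:: e1; e2; e3; e4]).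
    by move=> x z /= v; zeros; rewrite h5; expand_ev2; zeros; ring.
  by move=> f; rewrite !inE => /or4P[] /eqP ->; rewrite ?a1 ?a2 ?a3 ?a4.
have a6 i : (4 < i)%N -> e6 \in ann i.
  move=> i1; apply: (ann_le i1); apply: (@ann_succ 4%N [:: e1; e2; e3; e4; e5]).
    by move=> x z /= v; zeros; rewrite h6; expand_ev2; zeros; ring.
  by move=> f; rewrite !inE => /or4P[/eqP->|/eqP->|/eqP->|/orP[]/eqP->]; rewrite ?a1 ?a2 ?a3 ?a4 ?a5.
have dimE (s t : seq V) i : free (s ++ t) -> (forall f, f \in s -> f \in ann i) ->
    (forall eta, eta \in ann i -> eta \in span s) -> \dim (ann i) = size s.
  by move=> fr le ge; apply/eqP; rewrite eqn_leq dim_ann_le // (free_dim fr).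
have D1 : \dim (ann 1) = 2%N.
  apply: (dimE [:: e1; e2] [:: e3; e4; e5; e6]) => //.
    by move=> f; rewrite !inE => /orP[] /eqP ->; rewrite ?a1 ?a2.
  move=> eta ei; rewrite (etaE eta) (k6 1%N) // (k5 1%N) // (k4 1%N) // (k3 1%N) // !scale0r !addr0.
  by rewrite rpredD ?rpredZ ?memv_span ?inE ?eqxx ?orbT.
have D2 : \dim (ann 2) = 3%N.
  apply: (dimE [:: e1; e2; e3] [:: e4; e5; e6]) => //.
    by move=> f; rewrite !inE => /or3P[] /eqP ->; rewrite ?a1 ?a2 ?a3.
  move=> eta ei; rewrite (etaE eta) (k6 2%N) // (k5 2%N) // (k4 2%N) // !scale0r !addr0.
  by rewrite !rpredD ?rpredZ ?memv_span ?inE ?eqxx ?orbT.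
have D3 : \dim (ann 3) = 4%N.
  apply: (dimE [:: e1; e2; e3; e4] [:: e5; e6]) => //.
    by move=> f; rewrite !inE => /or4P[] /eqP ->; rewrite ?a1 ?a2 ?a3 ?a4.
  move=> eta ei; rewrite (etaE eta) (k6 3%N) // (k5 3%N) // !scale0r !addr0.
  by rewrite !rpredD ?rpredZ ?memv_span ?inE ?eqxx ?orbT.
have D4 : \dim (ann 4) = 5%N.
  apply: (dimE [:: e1; e2; e3; e4; e5] [:: e6]) => //.
    by move=> f; rewrite !inE => /or4P[/eqP->|/eqP->|/eqP->|/orP[]/eqP->]; rewrite ?a1 ?a2 ?a3 ?a4 ?a5.
  move=> eta ei; rewrite (etaE eta) (k6 4%N) // !scale0r !addr0.
  by rewrite !rpredD ?rpredZ ?memv_span ?inE ?eqxx ?orbT.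
have all5 f : f \in [:: e1; e2; e3; e4; e5; e6] -> f \in ann 5.
  by rewrite !inE => /or4P[/eqP->|/eqP->|/eqP->|/or3P[]/eqP->]; rewrite ?a1 ?a2 ?a3 ?a4 ?a5 ?a6.
have D5 : \dim (ann 5) = 6%N.
  apply: (dimE [:: e1; e2; e3; e4; e5; e6] [::]) => //.
  move=> eta ei; rewrite (etaE eta).
  by rewrite !rpredD ?rpredZ ?memv_span ?inE ?eqxx ?orbT.
split=> // i; have n5 : (nil_index gnil <= 5)%N.
  by rewrite /nil_index; case: ex_minnP => n _; apply; apply/eqP/(ann_full _ cf).
case/andP=> i1 /leq_trans/(_ n5); move: i i1.
by case=> [|[|[|[|[|[|//]]]]]] //=; rewrite ?D1 ?D2 ?D3 ?D4 ?D5.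
Qed.

(** The third term of the lower central series contains [[[x2, x1], x1], x1], on
    which e6 takes the value l. *)
Lemma exceptional_nil_index (gnil : nilpotent_lie g) (e1 e2 e3 e4 e5 e6 : V) l a12 a13 a23 a14 a24 :
  coframe e1 e2 e3 e4 e5 e6 -> d e1 = 0 -> d e2 = 0 -> d e3 = 0 -> d e4 = wd e1 e2 ->
  d e5 = wd e1 e4 -> d e6 = l *: wd e1 e5 + a12 *: wd e1 e2 + a13 *: wd e1 e3 + a23 *: wd e2 e3
      + a14 *: wd e1 e4 + a24 *: wd e2 e4 -> l != 0 -> nil_index gnil = 4%N.
Proof.
move=> cf h1 h2 h3 h4 h5 h6 nl.
have [x1 [x2 [x3 [x4 [x5 [x6 /mx6_dual dl]]]]]] := coframe_dual cf.
have a1 i : (0 < i)%N -> e1 \in ann i by move=> i1; apply: (ann_le i1); apply: ann_closed.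
have a2 i : (0 < i)%N -> e2 \in ann i by move=> i1; apply: (ann_le i1); apply: ann_closed.
have a3 i : (0 < i)%N -> e3 \in ann i by move=> i1; apply: (ann_le i1); apply: ann_closed.
have a4 i : (1 < i)%N -> e4 \in ann i.
  move=> i1; apply: (ann_le i1); apply: (@ann_succ 1%N [:: e1; e2]).
    by move=> x z /= v; zeros; rewrite h4; expand_ev2; zeros; ring.
  by move=> f; rewrite !inE => /orP[] /eqP ->; rewrite ?a1 ?a2.
have a5 i : (2 < i)%N -> e5 \in ann i.
  move=> i1; apply: (ann_le i1); apply: (@ann_succ 2%N [:: e1; e4]).
    by move=> x z /= v; zeros; rewrite h5; expand_ev2; zeros; ring.
  by move=> f; rewrite !inE => /orP[] /eqP ->; rewrite ?a1 ?a4.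
have a6 i : (3 < i)%N -> e6 \in ann i.
  move=> i1; apply: (ann_le i1); apply: (@ann_succ 3%N [:: e1; e2; e3; e4; e5]).
    by move=> x z /= v; zeros; rewrite h6; expand_ev2; zeros; ring.
  by move=> f; rewrite !inE => /or4P[/eqP->|/eqP->|/eqP->|/orP[]/eqP->]; rewrite ?a1 ?a2 ?a3 ?a4 ?a5.
rewrite /nil_index; case: ex_minnP => n /eqP n0 nmin; apply/eqP; rewrite eqn_leq; apply/andP; split.
  apply: nmin; apply/eqP/(ann_full _ cf) => f.
  by rewrite !inE => /or4P[/eqP->|/eqP->|/eqP->|/or3P[]/eqP->]; rewrite ?a1 ?a2 ?a3 ?a4 ?a5 ?a6.
rewrite ltnNge; apply/negP => n3.
pose v1 := g x2 x1; pose v2 := g v1 x1; pose v3 := g v2 x1.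
have m3 : v3 \in lower_central g 3%N by do 3!apply: mem_lower_central; apply: memvf.
have E1 : [/\ dot e1 v1 = 0, dot e2 v1 = 0, dot e3 v1 = 0 & dot e4 v1 = 1].
  by split; rewrite dot_br ?h1 ?h2 ?h3 ?h4 ?h5; expand_ev2; rewrite ?(dual_ev dl); ring.
have E2 : [/\ dot e1 v2 = 0, dot e2 v2 = 0, dot e3 v2 = 0, dot e4 v2 = 0 & dot e5 v2 = 1].
  case: E1 => k1 k2 k3 k4.
  by split; rewrite dot_br ?h1 ?h2 ?h3 ?h4 ?h5; expand_ev2; rewrite ?(k1, k2, k3, k4) ?(dual_ev dl); ring.
have e6v : dot e6 v3 = l.
  case: E2 => k1 k2 k3 k4 k5.
  by rewrite dot_br h6; expand_ev2; rewrite ?(k1, k2, k3, k4, k5) ?(dual_ev dl); ring.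
have := subvP (lower_central_le g n3) _ m3; rewrite n0 memv0 => /eqP v0.
by move: nl; rewrite -e6v v0 dot0r eqxx.
Qed.

End Nilpotency.

(** * Adapted pairs of covectors and central pairings *)

Section AdaptedPair.
Variables (R : realType) (g : lie_algebra R 6).
Local Notation C := R[i].
Local Notation V := 'rV[R]_6.
Local Notation toC := (map_mx (real_complex R)).
Local Notation conj := (map_mx (@conjc R)).

(** The last term of the lower central series not contained in P provides a vector
    v outside of P all of whose brackets are in P. *)
Lemma top_central (P : V -> Prop) : nilpotent_lie g -> P 0 -> ~ (forall x, P x) ->
  exists k v, [/\ v \in lower_central g k, ~ P v & forall x, x \in lower_central g k.+1 -> P x].
Proof.
move=> [s /eqP s0] P0 nP.
have : ~ (forall x, x \in lower_central g 0 -> P x) by move=> h; apply: nP => x; apply/h/memvf.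
have : forall x, x \in lower_central g s -> P x by move=> x; rewrite s0 memv0 => /eqP ->.
elim: s {s0} => [h /(_ h) //|s IH hs h0].
have [h|/boolp.existsNP[v]] := boolp.pselect (forall x, x \in lower_central g s -> P x).
  exact: IH.
by move=> /boolp.not_implyP[vs Pv]; exists s, v.
Qed.

Lemma dot_bracketC t X Y : dot t (bracketC g X Y) =
  ev2 (\matrix_(j, k) dot t (toC (g (basis_vec R j) (basis_vec R k)))) X Y.
Proof.
rewrite ev2_sum /bracketC dot_sumr; apply: eq_bigr => j _; rewrite dot_sumr.
by apply: eq_bigr => k _; rewrite dotZr mxE.
Qed.

Lemma dot_real_eq0 t : (forall x : V, dot t (toC x) = 0) -> t = 0.
Proof.
move=> h; apply: dot_eq => X; rewrite dot0l [X]real_imaginary dotDr dotZr !h mulr0 addr0.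
by [].
Qed.

Lemma bracketC_top k v t : v \in lower_central g k ->
  (forall x, x \in lower_central g k.+1 -> dot t (toC x) = 0) ->
  forall X, dot t (bracketC g (toC v) X) = 0.
Proof.
move=> vk h X.
have r x : dot t (bracketC g (toC v) (toC x)) = 0 by rewrite bracketC_toC h // mem_lower_central.
move: r; rewrite [X]real_imaginary !dot_bracketC => r.
by rewrite ev2Dr ev2Zr -!dot_bracketC !bracketC_toC !h ?mulr0 ?addr0 // mem_lower_central.
Qed.

(** On ker s = (ker s /\ ker th) + C v, a functional t that kills [v, -] kills all
    brackets as soon as it kills those of ker s /\ ker th. *)
Lemma bracket_extend s th t v : dot s v = 0 -> dot th v != 0 ->
  (forall X Y, dot s X = 0 -> dot th X = 0 -> dot s Y = 0 -> dot th Y = 0 ->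
     dot t (bracketC g X Y) = 0) ->
  (forall X, dot t (bracketC g v X) = 0) ->
  forall X Y, dot s X = 0 -> dot s Y = 0 -> dot t (bracketC g X Y) = 0.
Proof.
move=> sv nv h hv X Y sX sY.
have hv' Z : dot t (bracketC g Z v) = 0 by rewrite bracketC_anti dotNr hv oppr0.
pose p Z := Z - (dot th Z / dot th v) *: v.
have sp Z : dot s Z = 0 -> dot s (p Z) = 0.
  by move=> sZ; rewrite /p dotDr dotNr dotZr sv sZ mulr0 subr0.
have tp Z : dot th (p Z) = 0 by rewrite /p dotDr dotNr dotZr divfK // subrr.
have := h _ _ (sp X sX) (tp X) (sp Y sY) (tp Y).
rewrite /p dot_bracketC !(ev2Dl, ev2Dr, ev2Nl, ev2Nr, ev2Zl, ev2Zr) -!dot_bracketC !hv !hv'.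
by rewrite !(mulr0, oppr0, subr0, addr0).
Qed.

(** The subspace spanned by t1 and t2 has a basis adapted to the structure of g: t1
    closed and t1 /\ d t2 = 0.  Indeed [top_central] gives a real v, not annihilated by
    t1 and t2, with [v, g] annihilated by both; take for t1 the combination
    vanishing at v.  By [bracket_extend] the kernel of t1 is a subalgebra,
    whose brackets are annihilated by t1 and t2.  A second use of [top_central], for
    t1 alone, shows that t1 vanishes on all brackets. *)
Theorem adapted_pair : nilpotent_lie g -> type2_data g -> exists (t1 t2 : 'rV[C]_6) (A : 'M[C]_6),
  [/\ forall X Y, ev2 A Y X = - ev2 A X Y,
      forall a b c d, a *: t1 + b *: t2 = c *: conj t1 + d *: conj t2 -> a = 0 /\ b = 0,
      (forall X Y, dot t1 (bracketC g X Y) = 0) /\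
      (forall X Y, dot t1 X = 0 -> dot t1 Y = 0 -> dot t2 (bracketC g X Y) = 0),
      closed_on g (ann2 t1 t2) A &
      forall p q : 'rV[R]_6, ann2 t1 t2 (toC p) -> ann2 t1 t2 (toC q) ->
        ev2 A (toC p) (toC q) = 0 ->
        forall a b : 'rV[R]_6, dot a p * dot b q = dot b p * dot a q].
Proof.
move=> gnil [t1 [t2 [A [hA N1 sub cl N4]]]].
have not_all : ~ (forall x, ann2 t1 t2 (toC x)).
  move=> h; have t10 : t1 = 0 by apply: dot_real_eq0 => x; case: (h x).
  have [|/eqP] := N1 1 0 0 0; last by rewrite oner_eq0.
  by rewrite t10 scaler0 !scale0r addr0.
have [|k [v [vk nv hv]]] := top_central gnil _ not_all.
  by rewrite /ann2 map_mx0 !dot0r.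
have hv1 := bracketC_top vk (fun x xk => (hv x xk).1).
have hv2 := bracketC_top vk (fun x xk => (hv x xk).2).
pose th1 := dot t2 (toC v) *: t1 - dot t1 (toC v) *: t2.
have th1v : dot th1 (toC v) = 0 by rewrite /th1 !dotE mulrC subrr.
have [th2 [al [be [E2 n2 th2v annE]]]] : exists th2 al be, [/\ th2 = al *: t1 + be *: t2,
    - (dot t2 (toC v) * be + dot t1 (toC v) * al) != 0,
    dot th2 (toC v) != 0 & forall X, ann2 th1 th2 X <-> ann2 t1 t2 X].
  have [t1v|t1v] := eqVneq (dot t1 (toC v)) 0; last first.
    exists t1, 1, 0; split; [| |exact: t1v|].
    - by rewrite scale1r scale0r addr0.
    - by rewrite mulr0 mulr1 add0r oppr_eq0.
    move=> X; rewrite /ann2 /th1 !dotE; split=> [[]|[] -> ->]; last by rewrite !mulr0 subrr.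
    move=> e e'; move: e; rewrite e' mulr0 sub0r => /eqP; rewrite oppr_eq0 mulf_eq0 (negPf t1v) /=.
    by move=> /eqP.
  have t2v : dot t2 (toC v) != 0 by apply/eqP => t2v; apply: nv.
  exists t2, 0, 1; split; [| |exact: t2v|].
  - by rewrite scale1r scale0r add0r.
  - by rewrite t1v mulr1 mul0r addr0 oppr_eq0.
  move=> X; rewrite /ann2 /th1 !dotE t1v; split=> [[]|[] -> ->]; last by rewrite !mulr0 subrr.
  move=> e e'; move: e; rewrite e' mul0r subr0 => /eqP; rewrite mulf_eq0 (negPf t2v) /=.
  by move=> /eqP ->.
have N1' a b c d : a *: th1 + b *: th2 = c *: conj th1 + d *: conj th2 -> a = 0 /\ b = 0.
  rewrite E2 /th1; move: n2; move: (dot t2 (toC v)) (dot t1 (toC v)) => u w n2.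
  rewrite !(map_mxD, map_mxN, map_mxZ) => E.
  have [] := N1 (a * u + b * al) (b * be - a * w) (c * conjc u + d * conjc al) (d * conjc be - c * conjc w).
    transitivity (a *: (u *: t1 - w *: t2) + b *: (al *: t1 + be *: t2)).
      by apply/rowP => j; rewrite !mxE; ring.
    by rewrite E; apply/rowP => j; rewrite !mxE; ring.
  move=> e1 e2; split; apply/eqP.
    have : a * - (u * be + w * al) = 0.
      transitivity (- be * (a * u + b * al) + al * (b * be - a * w)); first by ring.
      by rewrite e1 e2 !mulr0 addr0.
    by move=> /eqP; rewrite mulf_eq0 (negPf n2) orbF.
  have : b * - (u * be + w * al) = 0.
    transitivity (- w * (a * u + b * al) - u * (b * be - a * w)); first by ring.
    by rewrite e1 e2 !mulr0 subrr.
  by move=> /eqP; rewrite mulf_eq0 (negPf n2) orbF.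
have ker t : t = t1 \/ t = t2 -> forall X Y, dot th1 X = 0 -> dot th1 Y = 0 -> dot t (bracketC g X Y) = 0.
  move=> ht; apply: (bracket_extend th1v th2v).
    move=> X Y x1 x2 y1 y2; have aX : ann2 t1 t2 X by apply/annE; split; [exact: x1|exact: x2].
    have aY : ann2 t1 t2 Y by apply/annE; split; [exact: y1|exact: y2].
    have [] := sub X Y aX aY.
    by case: ht => ->.
  by case: ht => ->.
have k1 X Y : dot th1 X = 0 -> dot th1 Y = 0 -> dot th1 (bracketC g X Y) = 0.
  by move=> x y; rewrite /th1 !dotE (ker t1) ?(ker t2) ?mulr0 ?subrr //; [right|left].
have k2 X Y : dot th1 X = 0 -> dot th1 Y = 0 -> dot th2 (bracketC g X Y) = 0.
  by move=> x y; rewrite E2 !dotE (ker t1) ?(ker t2) ?mulr0 ?addr0 //; [right|left].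
have not_all1 : ~ (forall x, dot th1 (toC x) = 0).
  move=> /dot_real_eq0 t10.
  have [|/eqP] := N1' 1 0 0 0; last by rewrite oner_eq0.
  by rewrite t10 scaler0 !scale0r addr0.
have [|l [w [wl nw hw]]] := top_central gnil _ not_all1; first by rewrite map_mx0 dot0r.
exists th1, th2, A; split; [exact: hA|exact: N1'| | |].
- split; last exact: k2.
  have z (X : 'rV[C]_6) : dot 0 X = 0 by rewrite dot0l.
  have n : dot th1 (toC w) != 0 by apply/eqP.
  move=> X Y; apply: (bracket_extend (z _) n _ (bracketC_top wl hw) (z _) (z _)).
  by move=> X' Y' _ x _ y; apply: (k1 _ _ x y).
- by move=> X Y Z /annE x /annE y /annE z; apply: (cl _ _ _ x y z).
by move=> p q /annE hp /annE hq; apply: (N4 _ _ hp hq).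
Qed.

End AdaptedPair.

Section GenericFamilies.
Variables (K : numFieldType) (br : 'rV[K]_6 -> 'rV[K]_6 -> 'rV[K]_6).
Variables (E1 E2 E3 E4 E5 E6 Y1 Y2 Y3 Y4 Y5 Y6 t1 t2 : 'rV[K]_6) (A : 'M[K]_6).
Hypothesis dl : dual E1 E2 E3 E4 E5 E6 Y1 Y2 Y3 Y4 Y5 Y6.
Hypothesis hA : forall X Y, ev2 A Y X = - ev2 A X Y.
Hypothesis hcl : forall X Y Z, ann2 t1 t2 X -> ann2 t1 t2 Y -> ann2 t1 t2 Z ->
  ev2 A (br X Y) Z + ev2 A (br Y Z) X + ev2 A (br Z X) Y = 0.

Let sq X : ev2 A X X = 0.
Proof. by have /eqP := hA X X; rewrite -addr_eq0 -mulr2n mulrn_eq0 /= => /eqP. Qed.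

(** With u = a2 Y1 - a1 Y2 + u4 Y4 and v = b4 Y3 - b3 Y4 annihilated by t1 and t2,
    [u, v] = a2 b3 Y5 modulo Y6, which is central; so closedness on u, v, Y6 is
    a2 b3 A (Y5, Y6) = 0.  Here a_j and b_j are the values of t1 and t2 on Y_j. *)
Lemma central_pairing_14 :
  (forall X Y, dot E1 (br X Y) = 0) -> (forall X Y, dot E2 (br X Y) = 0) ->
  (forall X Y, dot E3 (br X Y) = 0) ->
  (forall X Y, dot E4 (br X Y) = - (dot E1 X * dot E2 Y - dot E2 X * dot E1 Y)) ->
  (forall X Y, dot E5 (br X Y) = - (dot E1 X * dot E4 Y - dot E4 X * dot E1 Y)) ->
  (forall X, dot E6 (br X Y6) = 0) -> (forall X, dot E6 (br Y6 X) = 0) ->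
  dot t1 Y3 = 0 -> dot t1 Y4 = 0 -> dot t1 Y5 = 0 -> dot t1 Y6 = 0 ->
  dot t2 Y5 = 0 -> dot t2 Y6 = 0 ->
  dot t1 Y2 != 0 -> dot t2 Y3 != 0 -> dot t2 Y4 != 0 -> ev2 A Y5 Y6 = 0.
Proof.
move=> k1 k2 k3 k4 k5 k6 k6' a3 a4 a5 a6 b5 b6 a2 b3 b4.
set u := dot t1 Y2 *: Y1 - dot t1 Y1 *: Y2
  - ((dot t2 Y1 * dot t1 Y2 - dot t2 Y2 * dot t1 Y1) / dot t2 Y4) *: Y4.
set v := dot t2 Y4 *: Y3 - dot t2 Y3 *: Y4.
have z0 W : ev2 A 0 W = 0 by rewrite -(scale0r 0) ev2Zl mul0r.
have bz X : br X Y6 = 0.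
  by rewrite (dual_vec dl (br X Y6)) k1 k2 k3 k4 k5 k6 !(dual_ev dl) !mulr0 !subrr oppr0 !scale0r !addr0.
have bz' X : br Y6 X = 0.
  by rewrite (dual_vec dl (br Y6 X)) k1 k2 k3 k4 k5 k6' !(dual_ev dl) !mul0r !subrr oppr0 !scale0r !addr0.
have au : ann2 t1 t2 u.
  by split; rewrite /u !dotE ?a4; [ring|field].
have av : ann2 t1 t2 v by split; rewrite /v !dotE ?a3 ?a4; ring.
have a66 : ann2 t1 t2 Y6 by split.
have := hcl au av a66; rewrite bz bz' !z0 !addr0 (dual_vec dl (br u v)) k1 k2 k3 k4 k5.
rewrite !ev2Dl !ev2Zl sq /u /v !dotE !(dual_ev dl) => h.
apply: (mulf_cancel0 (mulf_neq0 a2 b3)); rewrite -[RHS]h; ring.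
Qed.

(** Write a1, a2 for the values of t1 on Y1 and Y2, and u, v = a2 Y4 - a1 Y5,
    q = Y3 + q4 Y4 + q5 Y5 for vectors annihilated by t1 and t2.  As Y6 is central,
    [q, u] = v modulo Y6 and [v, q] = 0, and [u, v] = - (a2^2 - k a1^2) Y6.  Closedness
    on u, q, Y6 gives A (v, Y6) = 0, and then on u, v, q it gives A (Y6, q) = 0. *)
Lemma central_pairing_23 k q4 q5 :
  (forall X Y, dot E1 (br X Y) = 0) -> (forall X Y, dot E2 (br X Y) = 0) ->
  (forall X Y, dot E3 (br X Y) = - (dot E1 X * dot E2 Y - dot E2 X * dot E1 Y)) ->
  (forall X Y, dot E4 (br X Y) = - (dot E1 X * dot E3 Y - dot E3 X * dot E1 Y)) ->
  (forall X Y, dot E5 (br X Y) = - (dot E2 X * dot E3 Y - dot E3 X * dot E2 Y)) ->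
  (forall X Y, dot E6 (br X Y) = - (dot E1 X * dot E4 Y - dot E4 X * dot E1 Y
     - k * (dot E2 X * dot E5 Y - dot E5 X * dot E2 Y))) ->
  dot t1 Y3 = 0 -> dot t1 Y4 = 0 -> dot t1 Y5 = 0 -> dot t1 Y6 = 0 -> dot t2 Y6 = 0 ->
  dot t1 Y1 * dot t2 Y5 = dot t1 Y2 * dot t2 Y4 -> dot t2 Y4 != 0 ->
  dot t2 Y3 + q4 * dot t2 Y4 + q5 * dot t2 Y5 = 0 ->
  dot t1 Y2 ^+ 2 - k * dot t1 Y1 ^+ 2 != 0 ->
  ev2 A Y6 (Y3 + q4 *: Y4 + q5 *: Y5) = 0.
Proof.
move=> k1 k2 k3 k4 k5 k6 a3 a4 a5 a6 b6 ab b4 hq n0.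
set u := dot t1 Y2 *: Y1 - dot t1 Y1 *: Y2
  - ((dot t2 Y1 * dot t1 Y2 - dot t2 Y2 * dot t1 Y1) / dot t2 Y4) *: Y4.
set v := dot t1 Y2 *: Y4 - dot t1 Y1 *: Y5.
set q := Y3 + q4 *: Y4 + q5 *: Y5.
have z0 W : ev2 A 0 W = 0 by rewrite -(scale0r 0) ev2Zl mul0r.
have bz X : br X Y6 = 0.
  by rewrite (dual_vec dl (br X Y6)) k1 k2 k3 k4 k5 k6 !(dual_ev dl) !mulr0 !subrr ?mulr0 ?subrr !oppr0 !scale0r !addr0.
have bz' X : br Y6 X = 0.
  by rewrite (dual_vec dl (br Y6 X)) k1 k2 k3 k4 k5 k6 !(dual_ev dl) !mul0r !subrr ?mulr0 ?subrr !oppr0 !scale0r !addr0.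
have au : ann2 t1 t2 u by split; rewrite /u !dotE ?a4; [ring|field].
have av : ann2 t1 t2 v.
  split; rewrite /v !dotE ?a4 ?a5; first by ring.
  by rewrite ab subrr.
have aq : ann2 t1 t2 q.
  by split; rewrite /q !dotE ?a3 ?a4 ?a5; [ring|rewrite hq].
have a66 : ann2 t1 t2 Y6 by split.
have uq : br u q = - v + (- (q4 * dot t1 Y2 + k * q5 * dot t1 Y1)) *: Y6.
  rewrite (dual_vec dl (br u q)) k1 k2 k3 k4 k5 k6 /u /v /q !dotE !(dual_ev dl).
  by apply/rowP => j; rewrite !mxE; ring.
have qu : br q u = v + (q4 * dot t1 Y2 + k * q5 * dot t1 Y1) *: Y6.
  rewrite (dual_vec dl (br q u)) k1 k2 k3 k4 k5 k6 /u /v /q !dotE !(dual_ev dl).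
  by apply/rowP => j; rewrite !mxE; ring.
have uv : br u v = - (dot t1 Y2 ^+ 2 - k * dot t1 Y1 ^+ 2) *: Y6.
  rewrite (dual_vec dl (br u v)) k1 k2 k3 k4 k5 k6 /u /v !dotE !(dual_ev dl).
  by apply/rowP => j; rewrite !mxE; ring.
have vq : br v q = 0.
  rewrite (dual_vec dl (br v q)) k1 k2 k3 k4 k5 k6 /v /q !dotE !(dual_ev dl).
  by apply/rowP => j; rewrite !mxE; ring.
have v6 : ev2 A v Y6 = 0.
  have := hcl au aq a66; rewrite bz bz' uq !z0 !addr0 ev2Dl ev2Nl ev2Zl sq mulr0 addr0.
  by move=> /eqP; rewrite oppr_eq0 => /eqP.
have := hcl au av aq; rewrite uv vq qu z0 addr0 ev2Zl ev2Dl sq ev2Zl (hA v Y6) v6 oppr0 mulr0 addr0 addr0.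
by rewrite mulNr => /eqP; rewrite oppr_eq0 => /eqP /(mulf_cancel0 n0).
Qed.

(** The 2-form B is a multiple of t, hence t /\ B = 0. *)
Lemma wedge_eq0 (t : 'rV[K]_6) (B : 'M[K]_6) : (forall X Y, ev2 B Y X = - ev2 B X Y) ->
  (forall X Y, dot t X = 0 -> dot t Y = 0 -> ev2 B X Y = 0) ->
  forall P Q S, dot t P * ev2 B Q S + dot t Q * ev2 B S P + dot t S * ev2 B P Q = 0.
Proof.
move=> hB h.
have key P Q S : dot t P != 0 -> dot t P * ev2 B Q S + dot t Q * ev2 B S P + dot t S * ev2 B P Q = 0.
  move=> tP; have := h (dot t P *: Q - dot t Q *: P) (dot t P *: S - dot t S *: P).
  rewrite !dotE mulrC subrr [_ * dot t S]mulrC subrr => /(_ erefl erefl).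
  rewrite !(ev2Dl, ev2Dr, ev2Nl, ev2Nr, ev2Zl, ev2Zr) => e; apply: (mulf_cancel0 tP).
  have PP : ev2 B P P = 0 by have /eqP := hB P P; rewrite -addr_eq0 -mulr2n mulrn_eq0 /= => /eqP.
  by rewrite -[RHS]e PP (hB P S) (hB P Q); ring.
move=> P Q S; have [tP|tP] := eqVneq (dot t P) 0; last exact: key.
have [tQ|tQ] := eqVneq (dot t Q) 0; last by rewrite -addrA addrC; apply: key.
have [tS|tS] := eqVneq (dot t S) 0; last by rewrite addrC addrA; apply: key.
by rewrite tP tQ tS !mul0r !addr0.
Qed.

End GenericFamilies.

(** * Nonexistence on the exceptional Lie algebras *)

Section NoTypeTwo.
Variables (R : realType) (g : lie_algebra R 6).
Local Notation C := R[i].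
Local Notation V := 'rV[R]_6.
Local Notation toC := (map_mx (real_complex R)).
Local Notation conj := (map_mx (@conjc R)).
Local Notation d := (dmx g).

Lemma coframe_eq (e1 e2 e3 e4 e5 e6 u v : V) : coframe e1 e2 e3 e4 e5 e6 ->
  dot e1 u = dot e1 v -> dot e2 u = dot e2 v -> dot e3 u = dot e3 v ->
  dot e4 u = dot e4 v -> dot e5 u = dot e5 v -> dot e6 u = dot e6 v -> u = v.
Proof.
move=> cf h1 h2 h3 h4 h5 h6; apply/eqP; rewrite -subr_eq0; apply/eqP.
by apply: cf; rewrite dotDr dotNr ?h1 ?h2 ?h3 ?h4 ?h5 ?h6 subrr.
Qed.

End NoTypeTwo.

Ltac bracket_value cf dl H :=
  apply: (coframe_eq cf); rewrite dot_br ?H; expand_ev2; rewrite ?dotE ?(dual_ev dl); ring.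


Lemma combination_sub (K : fieldType) m (F : 'M[K]_(m, 6)) (u1 u2 u3 : 'rV[K]_6) c1 c2 c3 :
  (u1 <= F)%MS -> (u2 <= F)%MS -> (u3 <= F)%MS -> ((c1 *: u1 + c2 *: u2 + c3 *: u3)%R <= F)%MS.
Proof. by move=> h1 h2 h3; rewrite !addmx_sub ?scalemx_sub. Qed.

Lemma dependent4 (K : fieldType) (F : 'M[K]_(3, 6)) (u0 u1 u2 u3 : 'rV[K]_6) :
  (u0 <= F)%MS -> (u1 <= F)%MS -> (u2 <= F)%MS -> (u3 <= F)%MS ->
  exists c0 c1 c2 c3, c0 *: u0 + c1 *: u1 = c2 *: u2 + c3 *: u3 /\
    ~ [/\ c0 = 0, c1 = 0, c2 = 0 & c3 = 0].
Proof.
move=> h0 h1 h2 h3; pose P : 'M[K]_(4, 6) := \matrix_(i < 4) [:: u0; u1; u2; u3]`_i.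
have PF : (P <= F)%MS by apply/row_subP => -[[|[|[|[|//]]]] k]; rewrite rowK.
have : kermx P != 0.
  rewrite kermx_eq0 /row_free neq_ltn; apply/orP; left.
  by apply: (leq_ltn_trans (mxrankS PF)); apply: (leq_ltn_trans (rank_leq_row F)).
move=> /rowV0Pn[v /sub_kermxP vP /negP v0].
exists (v 0 (inord 0)), (v 0 (inord 1)), (- v 0 (inord 2)), (- v 0 (inord 3)); split.
  apply/eqP; rewrite -subr_eq0 !scaleNr opprD !opprK addrA; apply/eqP; rewrite -[RHS]vP.
  rewrite mulmx_sum_row !big_ord_recr big_ord0 /= add0r !rowK /=.
  by congr (v 0 _ *: _ + v 0 _ *: _ + v 0 _ *: _ + v 0 _ *: _); apply: val_inj; rewrite /= inordK.
case=> z0 z1 /eqP; rewrite oppr_eq0 => /eqP z2 /eqP; rewrite oppr_eq0 => /eqP z3.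
apply: v0; apply/eqP/rowP => -[[|[|[|[|//]]]] k]; rewrite [RHS]mxE.
- by rewrite -[RHS]z0; congr (v 0 _); apply: val_inj; rewrite /= inordK.
- by rewrite -[RHS]z1; congr (v 0 _); apply: val_inj; rewrite /= inordK.
- by rewrite -[RHS]z2; congr (v 0 _); apply: val_inj; rewrite /= inordK.
by rewrite -[RHS]z3; congr (v 0 _); apply: val_inj; rewrite /= inordK.
Qed.

Lemma ev2_map_wd (R K : fieldType) (phi : {rmorphism R -> K}) (a b c e : 'rV[R]_6) k X Y :
  ev2 (map_mx phi (wd a b - k *: wd c e)) X Y =
  dot (map_mx phi a) X * dot (map_mx phi b) Y - dot (map_mx phi b) X * dot (map_mx phi a) Y
  - phi k * (dot (map_mx phi c) X * dot (map_mx phi e) Y - dot (map_mx phi e) X * dot (map_mx phi c) Y).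
Proof.
have h u v : map_mx phi (wd u v) = wd (map_mx phi u) (map_mx phi v) :> 'M[K]_6.
  by rewrite /wd map_mxB !map_mxM !map_trmx.
by rewrite map_mxB map_mxZ !h ev2D ev2N ev2Z !ev2_wd.
Qed.

Section RealIndependence.
Variables (R : realType).
Local Notation C := R[i].
Local Notation V := 'rV[R]_6.
Local Notation toC := (map_mx (real_complex R)).
Local Notation conj := (map_mx (@conjc R)).
Variables (t1 t2 : 'rV[C]_6).
Hypothesis N1 : forall a b c d, a *: t1 + b *: t2 = c *: conj t1 + d *: conj t2 -> a = 0 /\ b = 0.

Lemma t1_neq0 : t1 <> 0.
Proof.
move=> t10; have [|/eqP] := N1 (a := 1) (b := 0) (c := 0) (d := 0); last by rewrite oner_eq0.
by rewrite t10 scaler0 !scale0r addr0.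
Qed.

Lemma not_real_multiple c (f : V) : t1 <> c *: toC f.
Proof.
move=> E; have [|/eqP + _] := N1 (a := conjc c) (b := 0) (c := c) (d := 0).
  by rewrite E map_mxZ conj_toC !scale0r !addr0 !scalerA mulrC.
rewrite conjc_eq0 => /eqP c0.
by apply: t1_neq0; rewrite E c0 scale0r.
Qed.

(** The covectors t1, t2 and their conjugates would be independent in a space of
    dimension 3. *)
Lemma not_in_dim3 (f1 f2 f3 : V) a1 a2 a3 b1 b2 b3 :
  t1 = a1 *: toC f1 + a2 *: toC f2 + a3 *: toC f3 ->
  t2 = b1 *: toC f1 + b2 *: toC f2 + b3 *: toC f3 -> False.
Proof.
move=> E1 E2.
pose F : 'M[C]_(3, 6) := \matrix_(i < 3) [:: toC f1; toC f2; toC f3]`_i.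
have inF c1 c2 c3 : ((c1 *: toC f1 + c2 *: toC f2 + c3 *: toC f3)%R <= F)%MS.
  have e k (hk : (k < 3)%N) : ([:: toC f1; toC f2; toC f3]`_k <= F)%MS.
    by have := row_sub (Ordinal hk) F; rewrite rowK.
  exact: (combination_sub _ _ _ (e 0%N isT) (e 1%N isT) (e 2%N isT)).
have [|||| v0 [v1 [v2 [v3 [rel nz]]]]] := @dependent4 _ F t1 t2 (conj t1) (conj t2).
- by rewrite E1; apply: inF.
- by rewrite E2; apply: inF.
- by rewrite E1 !map_mxD !map_mxZ !conj_toC; apply: inF.
- by rewrite E2 !map_mxD !map_mxZ !conj_toC; apply: inF.
have [z0 z1] := N1 rel.
have [|z2 z3] := N1 (a := conjc v2) (b := conjc v3) (c := 0) (d := 0).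
  move: rel; rewrite z0 z1 !scale0r addr0 => /(congr1 (fun u : 'rV[C]_6 => conj u)).
  rewrite map_mxD !map_mxZ map_mx0 -!map_mx_comp => rel; rewrite [RHS]rel.
  by congr (_ *: _ + _ *: _); apply/rowP => j; rewrite mxE /= conjcK.
move/eqP: z2; rewrite conjc_eq0 => /eqP z2; move/eqP: z3; rewrite conjc_eq0 => /eqP z3.
by apply: nz.
Qed.

Lemma real_ratio (e1 e2 : V) a1 a2 (l m : R) : t1 = a1 *: toC e1 + a2 *: toC e2 ->
  a1 * m%:C%C = a2 * l%:C%C -> l = 0 /\ m = 0.
Proof.
move=> E h.
have [l0|nl] := eqVneq l 0.
  split=> //; apply/eqP; apply/negPn/negP => nm; move: h; rewrite l0 mulr0 => /eqP.
  rewrite mulf_eq0 => /orP[/eqP a10|/eqP[m0]]; last by rewrite m0 eqxx in nm.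
  by apply: (@not_real_multiple a2 e2); rewrite E a10 scale0r add0r.
exfalso; have nlC : l%:C%C != 0 :> C by apply/eqP => -[l0]; rewrite l0 eqxx in nl.
apply: (@not_real_multiple (a1 / l%:C%C) (l *: e1 + m *: e2)).
rewrite E toC_D !toC_Z scalerDr !scalerA divfK //; congr (_ + _ *: _).
by apply: (mulIf nlC); rewrite -h mulrAC divfK.
Qed.

(** The complex numbers a1 and a2 are independent over the reals, as t1 would be a
    multiple of a real covector otherwise. *)
Lemma real_combination (e1 e2 : V) a1 a2 z : t1 = a1 *: toC e1 + a2 *: toC e2 ->
  exists r s : R, a1 * r%:C%C + a2 * s%:C%C = z.
Proof.
move=> E; case: a1 a2 z E => [a b] [c e] [z1 z2] E.
have D : a * e - b * c != 0.
  apply/eqP => D.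
  have [|a0 c0] := @real_ratio e1 e2 _ _ a c E.
    by apply/eqP; rewrite eq_complex /=; apply/andP; split; apply/eqP; [ring|lra].
  have [|b0 e0] := @real_ratio e1 e2 _ _ b e E.
    by apply/eqP; rewrite eq_complex /=; apply/andP; split; apply/eqP; [lra|ring].
  by apply: t1_neq0; rewrite E a0 b0 c0 e0 !scale0r addr0.
exists ((z1 * e - z2 * c) / (a * e - b * c)), ((a * z2 - b * z1) / (a * e - b * c)).
by apply/eqP; rewrite eq_complex /=; apply/andP; split; apply/eqP; field.
Qed.

End RealIndependence.

Section NoTypeTwo.
Variables (R : realType) (g : lie_algebra R 6).
Hypothesis gnil : nilpotent_lie g.
Local Notation C := R[i].
Local Notation V := 'rV[R]_6.
Local Notation toC := (map_mx (real_complex R)).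
Local Notation conj := (map_mx (@conjc R)).
Local Notation d := (dmx g).

Lemma covector_coordinates (e1 e2 e3 e4 e5 e6 x1 x2 x3 x4 x5 x6 : V) (t : 'rV[C]_6) :
  mx6 [:: e1; e2; e3; e4; e5; e6] *m (mx6 [:: x1; x2; x3; x4; x5; x6])^T = 1%:M ->
  t = dot t (toC x1) *: toC e1 + dot t (toC x2) *: toC e2 + dot t (toC x3) *: toC e3
    + dot t (toC x4) *: toC e4 + dot t (toC x5) *: toC e5 + dot t (toC x6) *: toC e6.
Proof. by move=> /dual_sym/toC_dual/mx6_dual dl; rewrite {1}(dual_vec dl t) !(dotC t). Qed.

(** The conditions d t1 = 0 and t1 /\ d t2 = 0 on real vectors. *)
Lemma adapted_pair_real (t1 t2 : 'rV[C]_6) :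
  (forall X Y, dot t1 (bracketC g X Y) = 0) ->
  (forall X Y, dot t1 X = 0 -> dot t1 Y = 0 -> dot t2 (bracketC g X Y) = 0) ->
  (forall x y, dot t1 (toC (g x y)) = 0) /\
  (forall x y z, dot t1 (toC x) * dot t2 (toC (g y z)) + dot t1 (toC y) * dot t2 (toC (g z x))
     + dot t1 (toC z) * dot t2 (toC (g x y)) = 0).
Proof.
move=> h1 h2; split=> [x y|x y z]; first by rewrite -bracketC_toC h1.
rewrite -!bracketC_toC !dot_bracketC; apply: wedge_eq0.
  by move=> X Y; rewrite -!dot_bracketC bracketC_anti dotNr.
by move=> X Y tX tY; rewrite -dot_bracketC; apply: h2 tX tY.
Qed.

Lemma dot_toC_anti (t : 'rV[C]_6) x y : dot t (toC (g y x)) = - dot t (toC (g x y)).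
Proof. by rewrite br_anti toC_N dotNr. Qed.

Lemma dot_toC_sub0 (t : 'rV[C]_6) (u v : V) (c : R) : dot t (toC v) = 0 ->
  dot t (toC (u - c *: v)) = dot t (toC u).
Proof. by move=> z; rewrite toC_D toC_N toC_Z dotDr dotNr dotZr z mulr0 subr0. Qed.

Lemma dot_toC_oppZ (t : 'rV[C]_6) (v : V) (c : R) :
  dot t (toC (- (c *: v))) = - (c%:C%C * dot t (toC v)).
Proof. by rewrite toC_N toC_Z dotNr dotZr. Qed.

Lemma dot_toC_opp (t : 'rV[C]_6) (v : V) : dot t (toC (- v)) = - dot t (toC v).
Proof. by rewrite toC_N dotNr. Qed.

Lemma dot_bracketC_central eta (x : V) : (forall y, ev2 (d eta) y x = 0) ->
  forall X, dot (toC eta) (bracketC g X (toC x)) = 0 /\ dot (toC eta) (bracketC g (toC x) X) = 0.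
Proof.
move=> h X; have z : dot (toC eta) (bracketC g X (toC x)) = 0.
  by rewrite dot_brC [X]real_imaginary ev2Dl ev2Zl !ev2_toC !h mulr0 addr0 oppr0.
by split=> //; rewrite bracketC_anti dotNr z oppr0.
Qed.

Lemma opp_real_mul_eq0 (r : R) (z : C) : - (r%:C%C * z) = 0 -> r != 0 -> z = 0.
Proof.
move=> /eqP; rewrite oppr_eq0 mulf_eq0 => /orP[/eqP[->]|/eqP //].
by rewrite eqxx.
Qed.

Lemma real_mul_eq0 (r : R) (z : C) : r%:C%C * z = 0 -> z != 0 -> r = 0.
Proof. by move=> /eqP; rewrite mulf_eq0 => /orP[/eqP[->]|->]. Qed.

Lemma mul_oppr_eq (K : pzRingType) (a b c e : K) : a * - b + c * e = 0 -> a * b = c * e.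
Proof. by rewrite mulrN addrC => /eqP; rewrite subr_eq0 => /eqP. Qed.

Lemma proportional_combination (K : fieldType) (a1 a2 b3 b4 b5 r s : K) : a1 != 0 -> b4 != 0 ->
  a1 * b5 = a2 * b4 -> a1 * r + a2 * s = - (b3 * a1) / b4 -> b3 + r * b4 + s * b5 = 0.
Proof.
move=> n1 n4 ab h; apply: (mulfI n1); rewrite mulr0.
transitivity (a1 * b3 + b4 * (a1 * r + a2 * s) + s * (a1 * b5 - a2 * b4)); first by ring.
by rewrite h ab; field.
Qed.

Lemma square_difference (K : fieldType) (a b : K) : b ^+ 2 - a ^+ 2 = 0 -> a = b \/ a = - b.
Proof.
move=> /eqP; rewrite subr_sqr mulf_eq0 subr_eq0 addr_eq0 => /orP[/eqP|/eqP] ->; first by left.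
by right; rewrite opprK.
Qed.

(** What it means for the coefficients of t1 that it is not proportional to a real
    covector. *)
Lemma plane_facts (t1 t2 : 'rV[C]_6) (e1 e2 : V) a1 a2 :
  (forall a b c d, a *: t1 + b *: t2 = c *: conj t1 + d *: conj t2 -> a = 0 /\ b = 0) ->
  t1 = a1 *: toC e1 + a2 *: toC e2 ->
  [/\ a1 != 0, a2 != 0 &
    forall (p q : R) b, b != 0 -> a1 * (q%:C%C * b) = a2 * (p%:C%C * b) -> p = 0 /\ q = 0].
Proof.
move=> N1 E; split.
- apply/eqP => z; apply: (not_real_multiple N1 (c := a2) (f := e2)).
  by rewrite E z scale0r add0r.
- apply/eqP => z; apply: (not_real_multiple N1 (c := a1) (f := e1)).
  by rewrite E z scale0r addr0.
move=> p q b nb h; apply: (real_ratio N1 E).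
by apply: (mulIf nb); rewrite -!mulrA.
Qed.

(** As t1 is closed it is a combination of e1 and e2.  Then t1 /\ d t2 = 0 shows that t2
    successively vanishes at x6, x5 and x4: otherwise t1 would be proportional to the
    real covector that multiplies e5 in d e6, e4 in d e5 or e3 in d e4.  So t1 and t2 lie in the span of e1, e2, e3. *)
Lemma no_type2_maximal (e1 e2 e3 e4 e5 e6 : V) a b1 b2 b3 c1 c2 c3 c4 c5 c6
    d1 d2 d3 d4 d5 d6 d7 d8 d9 d0 :
  coframe e1 e2 e3 e4 e5 e6 -> d e1 = 0 -> d e2 = 0 -> d e3 = a *: wd e1 e2 ->
  d e4 = b1 *: wd e1 e2 + b2 *: wd e1 e3 + b3 *: wd e2 e3 ->
  d e5 = c1 *: wd e1 e2 + c2 *: wd e1 e3 + c3 *: wd e2 e3 +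
      c4 *: wd e1 e4 + c5 *: wd e2 e4 + c6 *: wd e3 e4 ->
  d e6 = d1 *: wd e1 e2 + d2 *: wd e1 e3 + d3 *: wd e2 e3 +
      d4 *: wd e1 e4 + d5 *: wd e2 e4 + d6 *: wd e3 e4 +
      d7 *: wd e1 e5 + d8 *: wd e2 e5 + d9 *: wd e3 e5 + d0 *: wd e4 e5 ->
  a != 0 -> (b2 != 0) || (b3 != 0) -> [|| c4 != 0, c5 != 0 | c6 != 0] ->
  [|| d7 != 0, d8 != 0, d9 != 0 | d0 != 0] -> ~ type2_data g.
Proof.
move=> cf h1 h2 h3 h4 h5 h6 na nb nc nd /(adapted_pair gnil)[t1 [t2 [A [_ N1 [k1 k2] _ _]]]].
have [x1 [x2 [x3 [x4 [x5 [x6 dl']]]]]] := coframe_dual cf; have dl := mx6_dual dl'.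
have [cl wedge0] := adapted_pair_real k1 k2.
have t1E := covector_coordinates t1 dl'; have t2E := covector_coordinates t2 dl'.
have g15 : g x1 x5 = - (d7 *: x6) by bracket_value cf dl (h1, h2, h3, h4, h5, h6).
have g25 : g x2 x5 = - (d8 *: x6) by bracket_value cf dl (h1, h2, h3, h4, h5, h6).
have g35 : g x3 x5 = - (d9 *: x6) by bracket_value cf dl (h1, h2, h3, h4, h5, h6).
have g45 : g x4 x5 = - (d0 *: x6) by bracket_value cf dl (h1, h2, h3, h4, h5, h6).
have g14 : g x1 x4 = - (c4 *: x5) - d4 *: x6 by bracket_value cf dl (h1, h2, h3, h4, h5, h6).
have g24 : g x2 x4 = - (c5 *: x5) - d5 *: x6 by bracket_value cf dl (h1, h2, h3, h4, h5, h6).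
have g34 : g x3 x4 = - (c6 *: x5) - d6 *: x6 by bracket_value cf dl (h1, h2, h3, h4, h5, h6).
have g13 : g x1 x3 = - (b2 *: x4) - c2 *: x5 - d2 *: x6 by bracket_value cf dl (h1, h2, h3, h4, h5, h6).
have g23 : g x2 x3 = - (b3 *: x4) - c3 *: x5 - d3 *: x6 by bracket_value cf dl (h1, h2, h3, h4, h5, h6).
have g12 : g x1 x2 = - (a *: x3) - b1 *: x4 - c1 *: x5 - d1 *: x6.
  by bracket_value cf dl (h1, h2, h3, h4, h5, h6).
have q15 t : dot t (toC (g x1 x5)) = - (d7%:C%C * dot t (toC x6)) by rewrite g15 dot_toC_oppZ.
have q25 t : dot t (toC (g x2 x5)) = - (d8%:C%C * dot t (toC x6)) by rewrite g25 dot_toC_oppZ.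
have q35 t : dot t (toC (g x3 x5)) = - (d9%:C%C * dot t (toC x6)) by rewrite g35 dot_toC_oppZ.
have q45 t : dot t (toC (g x4 x5)) = - (d0%:C%C * dot t (toC x6)) by rewrite g45 dot_toC_oppZ.
have z16 : dot t1 (toC x6) = 0.
  case/or4P: nd => n.
  - by apply: (opp_real_mul_eq0 _ n); rewrite -q15.
  - by apply: (opp_real_mul_eq0 _ n); rewrite -q25.
  - by apply: (opp_real_mul_eq0 _ n); rewrite -q35.
  by apply: (opp_real_mul_eq0 _ n); rewrite -q45.
have q14 t : dot t (toC x6) = 0 -> dot t (toC (g x1 x4)) = - (c4%:C%C * dot t (toC x5)).
  by move=> z; rewrite g14 dot_toC_sub0 // dot_toC_oppZ.
have q24 t : dot t (toC x6) = 0 -> dot t (toC (g x2 x4)) = - (c5%:C%C * dot t (toC x5)).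
  by move=> z; rewrite g24 dot_toC_sub0 // dot_toC_oppZ.
have q34 t : dot t (toC x6) = 0 -> dot t (toC (g x3 x4)) = - (c6%:C%C * dot t (toC x5)).
  by move=> z; rewrite g34 dot_toC_sub0 // dot_toC_oppZ.
have z15 : dot t1 (toC x5) = 0.
  case/or3P: nc => n.
  - by apply: (opp_real_mul_eq0 _ n); rewrite -q14.
  - by apply: (opp_real_mul_eq0 _ n); rewrite -q24.
  by apply: (opp_real_mul_eq0 _ n); rewrite -q34.
have q13 t : dot t (toC x6) = 0 -> dot t (toC x5) = 0 ->
    dot t (toC (g x1 x3)) = - (b2%:C%C * dot t (toC x4)).
  by move=> z z'; rewrite g13 !dot_toC_sub0 // dot_toC_oppZ.
have q23 t : dot t (toC x6) = 0 -> dot t (toC x5) = 0 ->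
    dot t (toC (g x2 x3)) = - (b3%:C%C * dot t (toC x4)).
  by move=> z z'; rewrite g23 !dot_toC_sub0 // dot_toC_oppZ.
have z14 : dot t1 (toC x4) = 0.
  case/orP: nb => n.
  - by apply: (opp_real_mul_eq0 _ n); rewrite -q13.
  by apply: (opp_real_mul_eq0 _ n); rewrite -q23.
have z13 : dot t1 (toC x3) = 0.
  apply: (opp_real_mul_eq0 _ na); rewrite -[RHS](cl x1 x2) g12.
  by rewrite !dot_toC_sub0 // dot_toC_oppZ.
rewrite z13 z14 z15 z16 !scale0r !addr0 in t1E.
have [n1 n2 ratio] := plane_facts N1 t1E.
have wedge12 u w (p q : R) : dot t1 (toC u) = 0 -> w != 0 ->
    dot t2 (toC (g x1 u)) = - (p%:C%C * w) -> dot t2 (toC (g x2 u)) = - (q%:C%C * w) -> p = 0 /\ q = 0.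
  move=> tu nw e1u e2u; apply: (ratio _ _ w nw); have := wedge0 x1 x2 u.
  rewrite tu mul0r addr0 (dot_toC_anti t2 x1 u) e1u e2u opprK mulrN => /eqP.
  by rewrite addrC subr_eq0 => /eqP.
have wedge1 u v w (p : R) : dot t1 (toC u) = 0 -> dot t1 (toC v) = 0 -> w != 0 ->
    dot t2 (toC (g u v)) = - (p%:C%C * w) -> p = 0.
  move=> tu tv nw euv; have := wedge0 x1 u v; rewrite tu tv !mul0r !addr0 euv mulrN => /eqP.
  rewrite oppr_eq0 => /eqP /(mulf_cancel0 n1) h; exact: real_mul_eq0 h nw.
have z26 : dot t2 (toC x6) = 0.
  apply/eqP/negPn/negP => nz.
  have [p q] := wedge12 x5 _ _ _ z15 nz (q15 t2) (q25 t2).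
  have p' := wedge1 _ _ _ _ z13 z15 nz (q35 t2); have q' := wedge1 _ _ _ _ z14 z15 nz (q45 t2).
  by move: nd; rewrite p q p' q' eqxx.
have z25 : dot t2 (toC x5) = 0.
  apply/eqP/negPn/negP => nz.
  have [p q] := wedge12 x4 _ _ _ z14 nz (q14 t2 z26) (q24 t2 z26).
  have p' := wedge1 _ _ _ _ z13 z14 nz (q34 t2 z26).
  by move: nc; rewrite p q p' eqxx.
have z24 : dot t2 (toC x4) = 0.
  apply/eqP/negPn/negP => nz.
  have [p q] := wedge12 x3 _ _ _ z13 nz (q13 t2 z26 z25) (q23 t2 z26 z25).
  by move: nb; rewrite p q eqxx.
rewrite z24 z25 z26 !scale0r !addr0 in t2E.
apply: (not_in_dim3 N1 (a1 := dot t1 (toC x1)) (a2 := dot t1 (toC x2)) (a3 := 0) _ t2E).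
by rewrite scale0r addr0; exact: t1E.
Qed.

(** As before t1 is a combination of e1, e2, e3 and t2 vanishes at x6 and x5, which span the
    real plane annihilated by t1 and t2.  Then t1 is a combination of e1 and e2, and the
    values of t2 at x3 and x4 are not 0, which is the situation of
    [central_pairing_14]. *)
Lemma no_type2_12_14 (e1 e2 e3 e4 e5 e6 : V) l a12 a13 a23 a14 a24 :
  coframe e1 e2 e3 e4 e5 e6 -> d e1 = 0 -> d e2 = 0 -> d e3 = 0 -> d e4 = wd e1 e2 ->
  d e5 = wd e1 e4 -> d e6 = l *: wd e1 e5 + a12 *: wd e1 e2 + a13 *: wd e1 e3 + a23 *: wd e2 e3
      + a14 *: wd e1 e4 + a24 *: wd e2 e4 ->
  l != 0 \/ a24 != 0 /\ ((a13 != 0) || (a23 != 0)) -> ~ type2_data g.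
Proof.
move=> cf h1 h2 h3 h4 h5 h6 cond /(adapted_pair gnil)[t1 [t2 [A [hA N1 [k1 k2] clA N4]]]].
have [x1 [x2 [x3 [x4 [x5 [x6 dl']]]]]] := coframe_dual cf; have dl := mx6_dual dl'.
have [cl wedge0] := adapted_pair_real k1 k2.
have t1E := covector_coordinates t1 dl'; have t2E := covector_coordinates t2 dl'.
have g15 : g x1 x5 = - (l *: x6) by bracket_value cf dl (h1, h2, h3, h4, h5, h6).
have g25 : g x2 x5 = 0 by bracket_value cf dl (h1, h2, h3, h4, h5, h6).
have g35 : g x3 x5 = 0 by bracket_value cf dl (h1, h2, h3, h4, h5, h6).
have g14 : g x1 x4 = - x5 - a14 *: x6 by bracket_value cf dl (h1, h2, h3, h4, h5, h6).
have g24 : g x2 x4 = - (a24 *: x6) by bracket_value cf dl (h1, h2, h3, h4, h5, h6).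
have g34 : g x3 x4 = 0 by bracket_value cf dl (h1, h2, h3, h4, h5, h6).
have g13 : g x1 x3 = - (a13 *: x6) by bracket_value cf dl (h1, h2, h3, h4, h5, h6).
have g23 : g x2 x3 = - (a23 *: x6) by bracket_value cf dl (h1, h2, h3, h4, h5, h6).
have g12 : g x1 x2 = - x4 - a12 *: x6 by bracket_value cf dl (h1, h2, h3, h4, h5, h6).
have q15 t : dot t (toC (g x1 x5)) = - (l%:C%C * dot t (toC x6)) by rewrite g15 dot_toC_oppZ.
have q24 t : dot t (toC (g x2 x4)) = - (a24%:C%C * dot t (toC x6)) by rewrite g24 dot_toC_oppZ.
have z16 : dot t1 (toC x6) = 0.
  case: cond => [n|[n _]]; first by apply: (opp_real_mul_eq0 _ n); rewrite -q15.
  by apply: (opp_real_mul_eq0 _ n); rewrite -q24.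
have z15 : dot t1 (toC x5) = 0.
  have := cl x1 x4; rewrite g14 dot_toC_sub0 // dot_toC_opp => /eqP.
  by rewrite oppr_eq0 => /eqP.
have z14 : dot t1 (toC x4) = 0.
  have := cl x1 x2; rewrite g12 dot_toC_sub0 // dot_toC_opp => /eqP.
  by rewrite oppr_eq0 => /eqP.
rewrite z14 z15 z16 !scale0r !addr0 in t1E.
have q23 t : dot t (toC (g x2 x3)) = - (a23%:C%C * dot t (toC x6)) by rewrite g23 dot_toC_oppZ.
have q13 t : dot t (toC (g x1 x3)) = - (a13%:C%C * dot t (toC x6)) by rewrite g13 dot_toC_oppZ.
have q14 t : dot t (toC x6) = 0 -> dot t (toC (g x1 x4)) = - dot t (toC x5).
  by move=> z; rewrite g14 dot_toC_sub0 // dot_toC_opp.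
have q12 t : dot t (toC x6) = 0 -> dot t (toC (g x1 x2)) = - dot t (toC x4).
  by move=> z; rewrite g12 dot_toC_sub0 // dot_toC_opp.
have qz t : dot t (toC 0) = 0 by rewrite map_mx0 dot0r.
(* t1 is not a multiple of e1 *)
have not_e1 : dot t1 (toC x2) = 0 -> dot t1 (toC x3) = 0 -> False.
  move=> y2 y3; apply: (not_real_multiple N1 (c := dot t1 (toC x1)) (f := e1)).
  by rewrite {1}t1E y2 y3 !scale0r !addr0.
have z26 : dot t2 (toC x6) = 0.
  apply/eqP/negPn/negP => nz; case: cond => [n|[n n']].
    have nl : l%:C%C * dot t2 (toC x6) != 0.
      by rewrite mulf_neq0 //; apply/eqP => -[l0]; rewrite l0 eqxx in n.
    apply: not_e1; apply: (mulIf nl); rewrite mul0r.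
      have := wedge0 x1 x2 x5; rewrite g25 qz z15 (dot_toC_anti t2 x1 x5) q15 opprK.
      by rewrite mulr0 mul0r add0r addr0.
    have := wedge0 x1 x3 x5; rewrite g35 qz z15 (dot_toC_anti t2 x1 x5) q15 opprK.
    by rewrite mulr0 mul0r add0r addr0.
  have nl : a24%:C%C * dot t2 (toC x6) != 0.
    by rewrite mulf_neq0 //; apply/eqP => -[l0]; rewrite l0 eqxx in n.
  have y3 : dot t1 (toC x3) = 0.
    apply: (mulIf nl); rewrite mul0r; have := wedge0 x2 x3 x4.
    by rewrite g34 qz z14 (dot_toC_anti t2 x2 x4) q24 opprK mulr0 mul0r add0r addr0.
  rewrite y3 scale0r addr0 in t1E; have [n1 n2 ratio] := plane_facts N1 t1E.
  have [p q] : a13 = 0 /\ a23 = 0.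
    apply: (ratio _ _ _ nz); have := wedge0 x1 x2 x3.
    rewrite y3 mul0r addr0 (dot_toC_anti t2 x1 x3) q13 q23 opprK mulrN => /eqP.
    by rewrite addrC subr_eq0 => /eqP.
  by move: n'; rewrite p q eqxx.
have z25 : dot t2 (toC x5) = 0.
  apply/eqP/negPn/negP => nz; apply: not_e1; apply: (mulIf nz); rewrite mul0r.
    have := wedge0 x1 x2 x4; rewrite q24 z26 z14 (dot_toC_anti t2 x1 x4) (q14 t2 z26) opprK.
    by rewrite mulr0 oppr0 mulr0 mul0r add0r addr0.
  have := wedge0 x1 x3 x4; rewrite g34 qz z14 (dot_toC_anti t2 x1 x4) (q14 t2 z26) opprK.
  by rewrite mulr0 mul0r add0r addr0.
rewrite z25 z26 !scale0r !addr0 in t2E.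
have n4 : dot t2 (toC x4) != 0.
  apply/eqP => z24; rewrite z24 scale0r addr0 in t2E.
  exact: (not_in_dim3 N1 t1E t2E).
have z13 : dot t1 (toC x3) = 0.
  apply: (mulIf n4); rewrite mul0r; have := wedge0 x1 x2 x3.
  rewrite q23 (dot_toC_anti t2 x1 x3) q13 (q12 t2 z26) z26 !mulr0 !oppr0 !mulr0 !add0r mulrN.
  by move=> /eqP; rewrite oppr_eq0 => /eqP.
rewrite z13 scale0r addr0 in t1E; have [n1 n2 _] := plane_facts N1 t1E.
have n3 : dot t2 (toC x3) != 0.
  apply/eqP => z23; rewrite z23 scale0r addr0 in t2E.
  apply: (not_in_dim3 N1 (a1 := dot t1 (toC x1)) (a2 := dot t1 (toC x2)) (a3 := 0) _ t2E).
  by rewrite scale0r addr0; exact: t1E.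
have central6 y : ev2 (d e6) y x6 = 0.
  by rewrite h6; expand_ev2; rewrite !(dual_ev dl); ring.
have E1 X Y : dot (toC e1) (bracketC g X Y) = 0 by rewrite dot_brC h1 map_mx0 ev20 oppr0.
have E2 X Y : dot (toC e2) (bracketC g X Y) = 0 by rewrite dot_brC h2 map_mx0 ev20 oppr0.
have E3 X Y : dot (toC e3) (bracketC g X Y) = 0 by rewrite dot_brC h3 map_mx0 ev20 oppr0.
have E4 X Y : dot (toC e4) (bracketC g X Y) =
    - (dot (toC e1) X * dot (toC e2) Y - dot (toC e2) X * dot (toC e1) Y).
  by rewrite dot_brC h4 toC_wd ev2_wd.
have E5 X Y : dot (toC e5) (bracketC g X Y) =
    - (dot (toC e1) X * dot (toC e4) Y - dot (toC e4) X * dot (toC e1) Y).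
  by rewrite dot_brC h5 toC_wd ev2_wd.
have E6 X := (dot_bracketC_central central6 X).1.
have E6' X := (dot_bracketC_central central6 X).2.
have ev0 := central_pairing_14 (mx6_dual (toC_dual dl')) hA clA E1 E2 E3 E4 E5 E6 E6'
  z13 z14 z15 z16 z25 z26 n2 n3 n4.
have := N4 x5 x6 (Logic.conj z15 z25) (Logic.conj z16 z26) ev0 e5 e6; rewrite !(dual_ev dl) mulr1 mulr0 => /eqP.
by rewrite oner_eq0.
Qed.

(** Here the real plane is spanned by x6 and q = x3 + q4 x4 + q5 x5.  The coefficient
    a2^2 - k a1^2 of [central_pairing_23] is not 0 since the ratio of a1 and a2 is not
    real; with the opposite sign, a2^2 + a1^2 vanishes when a2 = i a1. *)
Lemma no_type2_13_23 (e1 e2 e3 e4 e5 e6 : V) (k : R) :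
  coframe e1 e2 e3 e4 e5 e6 -> d e1 = 0 -> d e2 = 0 -> d e3 = wd e1 e2 -> d e4 = wd e1 e3 ->
  d e5 = wd e2 e3 -> d e6 = wd e1 e4 - k *: wd e2 e5 -> k = 0 \/ k = 1 -> ~ type2_data g.
Proof.
move=> cf h1 h2 h3 h4 h5 h6 k01 /(adapted_pair gnil)[t1 [t2 [A [hA N1 [k1 k2] clA N4]]]].
have [x1 [x2 [x3 [x4 [x5 [x6 dl']]]]]] := coframe_dual cf; have dl := mx6_dual dl'.
have [cl wedge0] := adapted_pair_real k1 k2.
have t1E := covector_coordinates t1 dl'; have t2E := covector_coordinates t2 dl'.
have g12 : g x1 x2 = - x3 by bracket_value cf dl (h1, h2, h3, h4, h5, h6).
have g13 : g x1 x3 = - x4 by bracket_value cf dl (h1, h2, h3, h4, h5, h6).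
have g23 : g x2 x3 = - x5 by bracket_value cf dl (h1, h2, h3, h4, h5, h6).
have g14 : g x1 x4 = - x6 by bracket_value cf dl (h1, h2, h3, h4, h5, h6).
have g24 : g x2 x4 = 0 by bracket_value cf dl (h1, h2, h3, h4, h5, h6).
have cl0 v : dot t1 (toC (- v)) = 0 -> dot t1 (toC v) = 0.
  by rewrite dot_toC_opp => /eqP; rewrite oppr_eq0 => /eqP.
have z13 : dot t1 (toC x3) = 0 by apply: cl0; rewrite -g12; apply: cl.
have z14 : dot t1 (toC x4) = 0 by apply: cl0; rewrite -g13; apply: cl.
have z15 : dot t1 (toC x5) = 0 by apply: cl0; rewrite -g23; apply: cl.
have z16 : dot t1 (toC x6) = 0 by apply: cl0; rewrite -g14; apply: cl.
rewrite z13 z14 z15 z16 !scale0r !addr0 in t1E; have [n1 n2 _] := plane_facts N1 t1E.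
have qz t : dot t (toC 0) = 0 by rewrite map_mx0 dot0r.
have z26 : dot t2 (toC x6) = 0.
  apply: (mulfI n2); rewrite mulr0; have := wedge0 x1 x2 x4.
  by rewrite g24 (dot_toC_anti t2 x1 x4) g14 dot_toC_opp opprK qz z14 mulr0 mul0r add0r addr0.
have ab : dot t1 (toC x1) * dot t2 (toC x5) = dot t1 (toC x2) * dot t2 (toC x4).
  have := wedge0 x1 x2 x3; rewrite z13 mul0r addr0 (dot_toC_anti t2 x1 x3) g13 g23 !dot_toC_opp.
  by rewrite opprK; apply: mul_oppr_eq.
have n4 : dot t2 (toC x4) != 0.
  apply/eqP => z24; have z25 : dot t2 (toC x5) = 0.
    by apply: (mulfI n1); rewrite ab z24 !mulr0.
  rewrite z24 z25 z26 !scale0r !addr0 in t2E.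
  apply: (not_in_dim3 N1 (a1 := dot t1 (toC x1)) (a2 := dot t1 (toC x2)) (a3 := 0) _ t2E).
  by rewrite scale0r addr0; exact: t1E.
(* real q4, q5 such that t2 vanishes on q = x3 + q4 x4 + q5 x5 *)
have [q4 [q5 hq]] := real_combination N1 (- (dot t2 (toC x3) * dot t1 (toC x1)) / dot t2 (toC x4)) t1E.
have hq' : dot t2 (toC x3) + q4%:C%C * dot t2 (toC x4) + q5%:C%C * dot t2 (toC x5) = 0.
  exact: (proportional_combination n1 n4 ab hq).
have E1 X Y : dot (toC e1) (bracketC g X Y) = 0 by rewrite dot_brC h1 map_mx0 ev20 oppr0.
have E2 X Y : dot (toC e2) (bracketC g X Y) = 0 by rewrite dot_brC h2 map_mx0 ev20 oppr0.
have E3 X Y : dot (toC e3) (bracketC g X Y) =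
    - (dot (toC e1) X * dot (toC e2) Y - dot (toC e2) X * dot (toC e1) Y).
  by rewrite dot_brC h3 toC_wd ev2_wd.
have E4 X Y : dot (toC e4) (bracketC g X Y) =
    - (dot (toC e1) X * dot (toC e3) Y - dot (toC e3) X * dot (toC e1) Y).
  by rewrite dot_brC h4 toC_wd ev2_wd.
have E5 X Y : dot (toC e5) (bracketC g X Y) =
    - (dot (toC e2) X * dot (toC e3) Y - dot (toC e3) X * dot (toC e2) Y).
  by rewrite dot_brC h5 toC_wd ev2_wd.
have E6 X Y : dot (toC e6) (bracketC g X Y) =
    - (dot (toC e1) X * dot (toC e4) Y - dot (toC e4) X * dot (toC e1) Y
       - k%:C%C * (dot (toC e2) X * dot (toC e5) Y - dot (toC e5) X * dot (toC e2) Y)).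
  by rewrite dot_brC h6; congr (- _); apply: ev2_map_wd.
have n0 : dot t1 (toC x2) ^+ 2 - k%:C%C * dot t1 (toC x1) ^+ 2 != 0.
  apply/eqP; case: k01 => ->; first by rewrite mul0r subr0 => /eqP; rewrite expf_eq0 /= (negPf n2).
  rewrite mul1r => /square_difference[] e12.
    have [|/eqP] := @real_ratio _ _ _ N1 _ _ _ _ 1 1 t1E; last by rewrite oner_eq0.
    by rewrite e12.
  have [|/eqP] := @real_ratio _ _ _ N1 _ _ _ _ (-1) 1 t1E; last by rewrite oppr_eq0 oner_eq0.
  by rewrite e12 mulr1 rmorphN1 mulrN1.
have ev0 := central_pairing_23 (mx6_dual (toC_dual dl')) hA clA E1 E2 E3 E4 E5 E6
  z13 z14 z15 z16 z26 ab n4 hq' n0.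
have qE : toC (x3 + q4 *: x4 + q5 *: x5) = toC x3 + q4%:C%C *: toC x4 + q5%:C%C *: toC x5.
  by rewrite !toC_D !toC_Z.
have aq : ann2 t1 t2 (toC (x3 + q4 *: x4 + q5 *: x5)).
  rewrite qE; split; rewrite !dotDr !dotZr ?z13 ?z14 ?z15; last exact: hq'.
  by rewrite !mulr0 !addr0.
rewrite -qE in ev0.
have := N4 x6 _ (Logic.conj z16 z26) aq ev0 e6 e3.
rewrite !dotE !(dual_ev dl) !mulr0 !addr0 mulr1 mul0r => /eqP.
by rewrite oner_eq0.
Qed.

End NoTypeTwo.

(** * The classification *)

Section Index4.
Variables (R : realType) (g : lie_algebra R 6).
Local Notation V := 'rV[R]_6.
Local Notation d := (dmx g).
Local Notation ann k := (ann_lower_central g k%N).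

(** If d e1, .., d e5 only involve e1, .., e5, the line dual to e6 is an ideal,
    which is central when the algebra is nilpotent. *)
Lemma supp_last (e1 e2 e3 e4 e5 e6 : V) : nilpotent_lie g -> coframe e1 e2 e3 e4 e5 e6 ->
  (forall e, e \in [:: e1; e2; e3; e4; e5] -> supp [:: e1; e2; e3; e4; e5] (d e)) ->
  supp [:: e1; e2; e3; e4; e5] (d e6).
Proof.
move=> gnil cf s x y v; rewrite ev2_dmx; apply/eqP; rewrite oppr_eq0.
have v0 := (vanishP _ _).1 v.
have ideal z : exists c, g x z = c *: x.
  have [x0|x0] := eqVneq (dot e6 x) 0.
    exists 0; rewrite scale0r (_ : x = 0) ?br0l //.
    by case: v => ? [? [? [? [? _]]]]; apply: cf.
  exists (dot e6 (g x z) / dot e6 x).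
  have k e : e \in [:: e1; e2; e3; e4; e5] -> dot e (g x z) = dot e (dot e6 (g x z) / dot e6 x *: x).
    by move=> es; rewrite dot_br (s e es) // oppr0 dotZr (v0 e es) mulr0.
  apply: (coframe_eq cf); [apply: k; rewrite !inE eqxx ?orbT //..|].
  by rewrite dotZr divfK.
have [c xy] := ideal y; rewrite xy dotZr.
have [->|c0] := eqVneq c 0; first by rewrite mul0r.
suff -> : x = 0 by rewrite dot0r mulr0.
have U0 : <[x]>%VS = 0%VS.
  apply: (nilpotent_not_self gnil).
  rewrite -memvE -{1}(scalerK c0 x) -xy memvZ //; exact/mem_bracket_span/memv_line.
by apply/eqP; rewrite -memv0 -U0 memv_line.
Qed.

Lemma index4_normal_form (gnil : nilpotent_lie g) :
  of_the_form g [:: [::]; [::]; [::]; [:: 12]; [:: 14]] -> nil_index gnil = 4%N ->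
  exists e1 e2 e3 e4 e5 e6 l a12 a13 a23 a14 a24,
  [/\ coframe e1 e2 e3 e4 e5 e6, d e1 = 0 /\ d e2 = 0, d e3 = 0, d e4 = wd e1 e2 &
    [/\ d e5 = wd e1 e4, d e6 = l *: wd e1 e5 + a12 *: wd e1 e2 + a13 *: wd e1 e3
      + a23 *: wd e2 e3 + a14 *: wd e1 e4 + a24 *: wd e2 e4 & l != 0]].
Proof.
move=> /form_12_14[e1 [e2 [e3 [e4 [e5 [e6 [cf [h1 h2] h3 h4 h5]]]]]]] n4.
have s6 : supp [:: e1; e2; e3; e4; e5] (d e6).
  apply: (supp_last gnil cf) => e.
  rewrite !inE => /or4P[/eqP->|/eqP->|/eqP->|/orP[]/eqP->] x y /= v; zeros;
    by rewrite ?h1 ?h2 ?h3 ?h4 ?h5; expand_ev2; zeros; ring.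
have h5' : d e5 = wd e1 e4 + 0 *: wd e2 e3 by rewrite h5 scale0r addr0.
have [l [a12 [a13 [a23 [a14 [a24 h6]]]]]] := differential_12_14 cf h1 h2 h3 h4 h5' s6.
have {}h6 : d e6 = l *: wd e1 e5 + a12 *: wd e1 e2 + a13 *: wd e1 e3
      + a23 *: wd e2 e3 + a14 *: wd e1 e4 + a24 *: wd e2 e4.
  by rewrite h6; forms; ring.
exists e1, e2, e3, e4, e5, e6, l, a12, a13, a23, a14, a24.
split; [exact: cf|split; [exact: h1|exact: h2]|exact: h3|exact: h4|split; [exact: h5|exact: h6|]].
apply/eqP => l0; move: n4; rewrite /nil_index; case: ex_minnP => n _ nmin n4.
suff : (n <= 3)%N by rewrite n4.
apply: nmin; apply/eqP/(ann_full _ _ cf).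
have a1 i : (0 < i)%N -> e1 \in ann i by move=> i1; apply: (ann_le i1); apply: ann_closed.
have a2 i : (0 < i)%N -> e2 \in ann i by move=> i1; apply: (ann_le i1); apply: ann_closed.
have a3 i : (0 < i)%N -> e3 \in ann i by move=> i1; apply: (ann_le i1); apply: ann_closed.
have a4 i : (1 < i)%N -> e4 \in ann i.
  move=> i1; apply: (ann_le i1); apply: (@ann_succ _ _ 1%N [:: e1; e2]).
    by move=> x z /= v; zeros; rewrite h4; expand_ev2; zeros; ring.
  by move=> f; rewrite !inE => /orP[] /eqP ->; rewrite ?a1 ?a2.
have step e : supp [:: e1; e2; e3; e4] (d e) -> e \in ann 3.
  move=> se; apply: (ann_succ (k := 2%N) se) => f.
  by rewrite !inE => /or4P[] /eqP ->; rewrite ?a1 ?a2 ?a3 ?a4.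
move=> f; rewrite !inE => /or4P[/eqP->|/eqP->|/eqP->|/or3P[]/eqP->]; rewrite ?a1 ?a2 ?a3 ?a4 //.
  by apply: step => x y /= v; zeros; rewrite h5; expand_ev2; zeros; ring.
by apply: step => x y /= v; zeros; rewrite h6 l0; expand_ev2; zeros; ring.
Qed.

End Index4.

Theorem theorem3p4 (R : realType) (M : nilmanifold R 6) :
  ~ (exists J : 'rV[R]_6 -> 'M[R]_(6 + 6),
       [/\ generalized_complex M J, left_invariant M J & of_type J 2])
  <->
  [\/ maximal_nilpotency (nil_algebraP M),
      of_the_form M [:: [::]; [::]; [::]; [:: 12]; [:: 14]]
      /\ nil_index (nil_algebraP M) = 4%N,
      of_the_form M [:: [::]; [::]; [::]; [:: 12]; [:: 14]; [:: 13; -24]]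
      \/ of_the_form M [:: [::]; [::]; [::]; [:: 12]; [:: 14]; [:: 23; 24]]
    | of_the_form M [:: [::]; [::]; [:: 12]; [:: 13]; [:: 23]; [:: 14]]
      \/ of_the_form M [:: [::]; [::]; [:: 12]; [:: 13]; [:: 23]; [:: 14; -25]]].
Proof.
have gnil := nil_algebraP M; split=> [noJ|cases [J [gc li ty]]].
  case: (split_or_exceptional gnil) => [ok|exc].
    by case: noJ; apply: split_type2_exists.
  case: exc.
  - move=> e1 e2 e3 e4 e5 e6 p q a12 a13 a23 a14 a24 a34 c1 c2 c3 c4 cf h1 h2 h3 h4 h5 h6 np nc.
    by constructor 1; apply: (exceptional_maximal _ cf h1 h2 h3 h4 h5 h6 np nc).
  - move=> e1 e2 e3 e4 e5 e6 l a12 a13 a23 a14 a24 cf h1 h2 h3 h4 h5 h6 nl; constructor 2; split.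
      by apply/form_12_14; exists e1, e2, e3, e4, e5, e6.
    exact: (exceptional_nil_index _ cf h1 h2 h3 h4 h5 h6 nl).
  - move=> e1 e2 e3 e4 e5 e6 cf h1 h2 h3 h4 h5 h6; constructor 3; left.
    by apply/form_12_14_13_24; exists e1, e2, e3, e4, e5, e6.
  - move=> e1 e2 e3 e4 e5 e6 cf h1 h2 h3 h4 h5 h6; constructor 3; right.
    by apply/form_12_14_23_24; exists e1, e2, e3, e4, e5, e6.
  - move=> e1 e2 e3 e4 e5 e6 cf h1 h2 h3 h4 h5 h6; constructor 4; left.
    by apply/form_13_23_14; exists e1, e2, e3, e4, e5, e6.
  move=> e1 e2 e3 e4 e5 e6 cf h1 h2 h3 h4 h5 h6; constructor 4; right.
  by apply/form_13_23_14_25; exists e1, e2, e3, e4, e5, e6.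
have := type2_necessary gc li ty.
case: cases => [/maximal_triangular|[f n4]|[|]|[|]].
- move=> [e1 [e2 [e3 [e4 [e5 [e6 [a [b1 [b2 [b3 [c1 [c2 [c3 [c4 [c5 [c6]]]]]]]]]]]]]]]].
  move=> [d1 [d2 [d3 [d4 [d5 [d6 [d7 [d8 [d9 [d0 [cf [h1 h2] h3 h4 [h5 h6 [na nb nc nd]]]]]]]]]]]]].
  exact: (no_type2_maximal gnil cf h1 h2 h3 h4 h5 h6 na nb nc nd).
- have [e1 [e2 [e3 [e4 [e5 [e6 H]]]]]] := index4_normal_form f n4.
  have [l [a12 [a13 [a23 [a14 [a24 [cf [h1 h2] h3 h4 [h5 h6 nl]]]]]]]] := H.
  by apply: (no_type2_12_14 gnil cf h1 h2 h3 h4 h5 h6); left.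
- move=> /form_12_14_13_24[e1 [e2 [e3 [e4 [e5 [e6 [cf [h1 h2] h3 h4 [h5 h6]]]]]]]].
  apply: (@no_type2_12_14 _ _ gnil e1 e2 e3 e4 e5 e6 0 0 1 0 0 (-1) cf h1 h2 h3 h4 h5).
    by rewrite h6; forms; ring.
  by right; rewrite oppr_eq0 oner_eq0.
- move=> /form_12_14_23_24[e1 [e2 [e3 [e4 [e5 [e6 [cf [h1 h2] h3 h4 [h5 h6]]]]]]]].
  apply: (@no_type2_12_14 _ _ gnil e1 e2 e3 e4 e5 e6 0 0 0 1 0 1 cf h1 h2 h3 h4 h5).
    by rewrite h6; forms; ring.
  by right; rewrite oner_eq0 orbT.
- move=> /form_13_23_14[e1 [e2 [e3 [e4 [e5 [e6 [cf [h1 h2] h3 h4 [h5 h6]]]]]]]].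
  apply: (@no_type2_13_23 _ _ gnil e1 e2 e3 e4 e5 e6 0 cf h1 h2 h3 h4 h5); last by left.
  by rewrite h6 scale0r subr0.
move=> /form_13_23_14_25[e1 [e2 [e3 [e4 [e5 [e6 [cf [h1 h2] h3 h4 [h5 h6]]]]]]]].
apply: (@no_type2_13_23 _ _ gnil e1 e2 e3 e4 e5 e6 1 cf h1 h2 h3 h4 h5); last by right.
by rewrite h6 scale1r.
Qed.
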